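(* Let $D_1,D_2\subset\mathbb{C}$ be domains. Then: (1) If at least one of $D_1$, $D_2$ is simply connected, then $h_{D_1\times D_2}\equiv\kappa_{D_1\times D_2}$. (2) If at least one of $D_1$, $D_2$ is biholomorphic to $\mathbb{C}_*:=\mathbb{C}\setminus\{0\}$, then $h_{D_1\times D_2}\equiv\kappa_{D_1\times D_2}$. (3) If neither $D_1$ nor $D_2$ is simply connected and neither is biholomorphic to $\mathbb{C}_*$, then $h_{D_1\times D_2}\not\equiv\kappa_{D_1\times D_2}$. In particular, $h_{D_1\times D_2}\equiv\kappa_{D_1\times D_2}$ if and only if at least one of $D_1,D_2$ is simply connected or biholomorphic to $\mathbb{C}_*$.
   Context: $E$ denotes the open unit disc in $\mathbb{C}$, and $\mathcal{O}(E,D)$ the set of holomorphic maps $E\to D$. For a domain $D\subset\mathbb{C}^n$, $z\in D$, $X\in\mathbb{C}^n$, the Kobayashi–Royden pseudometric is $\kappa_D(z;X):=\inf\{|\alpha| : \exists f\in\mathcal{O}(E,D),\ f(0)=z,\ \alpha f'(0)=X\}$ and the Hahn pseudometric is $h_D(z;X):=\inf\{|\alpha| : \exists f\in\mathcal{O}(E,D) \text{ injective},\ f(0)=z,\ \alpha f'(0)=X\}$. The notation $h_D\equiv\kappa_D$ means equality for all $(z,X)\in D\times\mathbb{C}^n$. *)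

(* Defs.v *)
From Stdlib Require Import Reals.
From Coquelicot Require Import Coquelicot.
Open Scope R_scope.

Definition cdiff (f : C -> C) (z : C) : Prop :=
  @ex_derive C_AbsRing C_NormedModule f z.

Definition holo_on (U : C -> Prop) (f : C -> C) : Prop :=
  forall z, U z -> cdiff f z.

Definition open_C (U : C -> Prop) : Prop :=
  forall z, U z -> exists eps, 0 < eps /\ forall w, Cmod (w - z) < eps -> U w.

Definition connected_C (D : C -> Prop) : Prop :=
  forall U V : C -> Prop, open_C U -> open_C V ->
    (forall z, D z -> U z \/ V z) ->
    (forall z, D z -> U z -> V z -> False) ->
    (forall z, D z -> U z) \/ (forall z, D z -> V z).

Definition cdomain (D : C -> Prop) : Prop :=
  open_C D /\ connected_C D /\ exists z, D z.

Definition I01 (t : R) : Prop := 0 <= t <= 1.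

Definition path_in (D : C -> Prop) (g : R -> C) : Prop :=
  (forall t, I01 t -> filterlim g (within I01 (locally t)) (locally (g t))) /\
  (forall t, I01 t -> D (g t)).

Definition square (p : R * R) : Prop := I01 (fst p) /\ I01 (snd p).

Definition simply_connected (D : C -> Prop) : Prop :=
  cdomain D /\
  forall g : R -> C, path_in D g -> g 0 = g 1 ->
    exists (H : R * R -> C) (c : C),
      (forall p, square p -> filterlim H (within square (locally p)) (locally (H p))) /\
      (forall p, square p -> D (H p)) /\
      (forall t, I01 t -> H (0, t) = g t) /\
      (forall t, I01 t -> H (1, t) = c) /\
      (forall s, I01 s -> H (s, 0) = H (s, 1)).

Definition biholomorphic (D G : C -> Prop) : Prop :=
  exists phi psi : C -> C,
    holo_on D phi /\ holo_on G psi /\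
    (forall z, D z -> G (phi z)) /\ (forall w, G w -> D (psi w)) /\
    (forall z, D z -> psi (phi z) = z) /\ (forall w, G w -> phi (psi w) = w).

Definition Cstar (z : C) : Prop := z <> 0%C.

Definition Edisc (z : C) : Prop := Cmod z < 1.

Definition prodD (D1 D2 : C -> Prop) (z : C * C) : Prop := D1 (fst z) /\ D2 (snd z).

Definition disc_vals (inj : bool) (D : C * C -> Prop) (z X : C * C) (r : R) : Prop :=
  exists (f1 f2 : C -> C) (a : C),
    holo_on Edisc f1 /\ holo_on Edisc f2 /\
    (forall w, Edisc w -> D (f1 w, f2 w)) /\
    (if inj then forall w1 w2, Edisc w1 -> Edisc w2 ->
                   (f1 w1, f2 w1) = (f1 w2, f2 w2) -> w1 = w2 else True) /\
    f1 0%C = fst z /\ f2 0%C = snd z /\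
    (a * C_derive f1 0%C)%C = fst X /\ (a * C_derive f2 0%C)%C = snd X /\
    r = Cmod a.

Definition kobayashi (D : C * C -> Prop) (z X : C * C) : Rbar :=
  Glb_Rbar (disc_vals false D z X).
Definition hahn (D : C * C -> Prop) (z X : C * C) : Rbar :=
  Glb_Rbar (disc_vals true D z X).

Definition hahn_eq_kob (D : C * C -> Prop) : Prop :=
  forall z X, D z -> hahn D z X = kobayashi D z X.

(* Main.v *)
(** A planar domain whose complement has at least two points is covered holomorphically by the
    disc [E], in the sense that every holomorphic disc in it lifts. For bounded domains this is
    Koebe's square-root algorithm; in general the domain is first pulled back by
    [m |-> a + (b - a) exp (2 pi i cos m)] to a domain that contains no large disc, whose bounded
    pieces have coverings that converge by Bloch's theorem.

    If [D1] is simply connected, this covering is injective and the Schwarz lemma compares any disc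
    with it; if the first component has zero derivative, adding to its coordinate a multiple of the
    second component makes the disc injective. If [D1] is the punctured plane, the same device is
    used in the exponent.

    Otherwise both coverings [f1], [f2] have nontrivial deck transformations, which are elements of
    SU(1,1) without fixed points. Recentring and rotating the coverings one may assume that
    [gamma1 0 = gamma2 0] while [gamma1' 0 <> gamma2' 0]. In the direction [(f1' 0, f2' 0)] at
    [(f1 0, f2 0)] the Kobayashi metric is at most 1, and a competitor with value close to 1 lifts
    to self-maps of [E] close to a common rotation, so the transversal double point of [(f1, f2)]
    persists and the competitor is not injective. *)
Require Import Defs.
From Stdlib Require Import Reals Lra Lia Psatz Classical ClassicalEpsilon.
From Coquelicot Require Import Coquelicot.
Open Scope R_scope.

(** Coverings are required to lift holomorphic discs only. This suffices to compare the metrics and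
    passes through compositions and limits, while sections over balls, path uniqueness and homotopy
    lifting are recovered from it afterwards. The cosine in the pull-back makes the preimages of [b]
    the solutions of [cos m = integer]. They meet every closed disc of radius 6, as Bloch's theorem
    needs, and discs are pulled back by a logarithm, a square root and a second logarithm.

    The requirements on the deck transformations are read off matrix entries. For [gamma z = (s z +
    t) / (conj t z + conj s)] of determinant 1 one has [gamma 0 = t / conj s] and
    [gamma' 0 = 1 / (conj s)^2]. Conjugation keeps [Re s] and can enlarge [|Im s|], so both [s] get
    the same modulus, and a rotation of one covering then equalizes [gamma 0]. The derivatives agree
    only if [s1 = s2] or [s1 = - s2]. The sign of [Im s] is free, because inverses are allowed, so
    this is avoided once [Re s <> 0]. Here the absence of fixed points enters: [Re s = 0] would give
    an elliptic involution. *)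

Lemma Cmod_sub_sym (z w : C) : Cmod (z - w) = Cmod (w - z).
Proof. rewrite <- Cmod_opp. f_equal. ring. Qed.

Lemma Cmod_sub_tri (x y z : C) : Cmod (x - z) <= Cmod (x - y) + Cmod (y - z).
Proof.
  replace (x - z)%C with ((x - y) + (y - z))%C by ring. apply Cmod_triangle.
Qed.

Lemma Cmod_le_sub (x y : C) : Cmod x <= Cmod y + Cmod (x - y).
Proof.
  replace x with (y + (x - y))%C at 1 by ring. apply Cmod_triangle.
Qed.

Lemma Cmod_self_sub (z : C) : Cmod (z - z) = 0.
Proof. replace (z - z)%C with (RtoC 0) by ring. apply Cmod_0. Qed.

Lemma Cmod_pos_neq (z : C) : z <> 0%C <-> 0 < Cmod z.
Proof.
  split; intros H; [apply Cmod_gt_0; auto|].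
  intros ->. rewrite Cmod_0 in H. lra.
Qed.

Lemma Cmod_eq0 (z : C) : Cmod z <= 0 -> z = 0%C.
Proof. intros H. apply Cmod_eq_0. pose proof (Cmod_ge_0 z). lra. Qed.

Lemma Csub_neq (z w : C) : z <> w -> (z - w)%C <> 0%C.
Proof. intros H E. apply H. apply Ceq_minus; auto. Qed.

Lemma Csub_eq (z w : C) : (z - w)%C = 0%C -> z = w.
Proof. intros. apply Ceq_minus; auto. Qed.

Lemma C_eq_of_small (z w : C) : (forall eps, 0 < eps -> Cmod (z - w) <= eps) -> z = w.
Proof.
  intros H. apply Csub_eq, Cmod_eq0. apply Rnot_lt_le; intros h.
  specialize (H (Cmod (z - w) / 2)). lra.
Qed.

(** * Continuity and complex derivatives in epsilon-delta form *)

Definition ccont (f : C -> C) (z : C) : Prop :=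
  forall eps, 0 < eps -> exists d, 0 < d /\ forall w, Cmod (w - z) < d -> Cmod (f w - f z) < eps.

(** A linear bound without a quotient, so that [w = z] needs no exclusion; [cder_is_derive]
    identifies it with the derivative of Coquelicot. *)
Definition cder (f : C -> C) (z l : C) : Prop :=
  forall eps, 0 < eps -> exists d, 0 < d /\ forall w, Cmod (w - z) < d ->
    Cmod (f w - f z - l * (w - z)) <= eps * Cmod (w - z).

Lemma locally_Cmod (z : C) (P : C -> Prop) :
  @locally C_UniformSpace z P <-> exists d, 0 < d /\ forall w, Cmod (w - z) < d -> P w.
Proof.
  split.
  - intros H.
    assert (H' : @locally_norm C_AbsRing C_NormedModule z P).
    { apply (@locally_norm_le_locally C_AbsRing C_NormedModule). exact H. }
    destruct H' as [d Hd]. exists d. split; [apply cond_pos|].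
    intros w Hw. apply Hd. exact Hw.
  - intros [d [Hd H]]. apply (@locally_le_locally_norm C_AbsRing C_NormedModule).
    exists (mkposreal d Hd). intros w Hw. apply H. exact Hw.
Qed.

Lemma locally_CAbs (z : C) (P : C -> Prop) :
  @locally (AbsRing_UniformSpace C_AbsRing) z P <->
  exists d, 0 < d /\ forall w, Cmod (w - z) < d -> P w.
Proof.
  split.
  - intros [d Hd]. exists d. split; [apply cond_pos|]. intros w Hw. apply Hd. exact Hw.
  - intros [d [Hd H]]. exists (mkposreal d Hd). intros w Hw. apply H. exact Hw.
Qed.

Lemma cder_is_derive (f : C -> C) (z l : C) :
  cder f z l <-> @is_derive C_AbsRing C_NormedModule f z l.
Proof.
  split.
  - intros H. split; [apply (@is_linear_scal_l C_AbsRing C_NormedModule)|].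
    intros x Hx. apply (@is_filter_lim_locally_unique C_AbsRing (AbsRing_NormedModule C_AbsRing)) in Hx. subst x.
    intros eps. apply locally_CAbs. destruct (H eps (cond_pos eps)) as [d [Hd K]].
    exists d; split; auto. intros w Hw. specialize (K w Hw).
    unfold norm, minus, plus, opp, scal; simpl. unfold mult; simpl.
    replace (f w + - f z + - ((w + - z) * l))%C with (f w - f z - l * (w - z))%C by ring.
    exact K.
  - intros [_ H]. specialize (H z (fun P HP => HP)).
    intros eps He. specialize (H (mkposreal eps He)). apply locally_CAbs in H.
    destruct H as [d [Hd K]]. exists d; split; auto. intros w Hw. specialize (K w Hw).
    unfold norm, minus, plus, opp, scal in K; simpl in K. unfold mult in K; simpl in K.
    replace (f w + - f z + - ((w + - z) * l))%C with (f w - f z - l * (w - z))%C in K by ring.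
    exact K.
Qed.

(** Here the target is [C] as a normed module over itself, the form demanded by the product rule and
    by the inner function of the chain rule. The neighbourhoods are the same. *)
Lemma cder_is_derive_abs (f : C -> C) (z l : C) :
  cder f z l <-> @is_derive C_AbsRing (AbsRing_NormedModule C_AbsRing) f z l.
Proof.
  split.
  - intros H. split; [apply (@is_linear_scal_l C_AbsRing (AbsRing_NormedModule C_AbsRing))|].
    intros x Hx. apply (@is_filter_lim_locally_unique C_AbsRing (AbsRing_NormedModule C_AbsRing)) in Hx. subst x.
    intros eps. apply locally_CAbs. destruct (H eps (cond_pos eps)) as [d [Hd K]].
    exists d; split; auto. intros w Hw. specialize (K w Hw).
    unfold norm, minus, plus, opp, scal; simpl. unfold mult; simpl.
    replace (f w + - f z + - ((w + - z) * l))%C with (f w - f z - l * (w - z))%C by ring.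
    exact K.
  - intros [_ H]. specialize (H z (fun P HP => HP)).
    intros eps He. specialize (H (mkposreal eps He)). apply locally_CAbs in H.
    destruct H as [d [Hd K]]. exists d; split; auto. intros w Hw. specialize (K w Hw).
    unfold norm, minus, plus, opp, scal in K; simpl in K. unfold mult in K; simpl in K.
    replace (f w + - f z + - ((w + - z) * l))%C with (f w - f z - l * (w - z))%C in K by ring.
    exact K.
Qed.

Lemma cdiff_cder (f : C -> C) (z : C) : cdiff f z <-> exists l, cder f z l.
Proof.
  split; intros [l H]; exists l; apply cder_is_derive; auto.
Qed.

Lemma cder_C_derive (f : C -> C) (z l : C) : cder f z l -> C_derive f z = l.
Proof. intros H. apply is_C_derive_unique, cder_is_derive, H. Qed.

Lemma cdiff_C_derive (f : C -> C) (z : C) : cdiff f z -> cder f z (C_derive f z).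
Proof. intros [l H]. apply cder_is_derive in H. rewrite (cder_C_derive _ _ _ H). exact H. Qed.

Lemma cder_cdiff (f : C -> C) (z l : C) : cder f z l -> cdiff f z.
Proof. intros H. apply cdiff_cder; eauto. Qed.

Lemma cder_unique (f : C -> C) (z l l' : C) : cder f z l -> cder f z l' -> l = l'.
Proof. intros H H'. apply cder_C_derive in H. apply cder_C_derive in H'. congruence. Qed.

Lemma cder_cont (f : C -> C) (z l : C) : cder f z l -> ccont f z.
Proof.
  intros H eps He. destruct (H 1 Rlt_0_1) as [d [Hd K]].
  pose proof (Cmod_ge_0 l).
  assert (Hp : 0 < eps / (2 + Cmod l)) by (apply Rdiv_lt_0_compat; lra).
  exists (Rmin d (eps / (2 + Cmod l))). split; [apply Rmin_pos; auto|].
  intros w Hw. assert (h1 := Rmin_l d (eps / (2 + Cmod l))). assert (h2 := Rmin_r d (eps / (2 + Cmod l))).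
  specialize (K w ltac:(lra)).
  pose proof (Cmod_le_sub (f w - f z) (l * (w - z))) as T. rewrite Cmod_mult in T.
  pose proof (Cmod_ge_0 (w - z)).
  assert (Cmod (w - z) * (2 + Cmod l) < eps).
  { apply (Rmult_lt_reg_r (/ (2 + Cmod l))); [apply Rinv_0_lt_compat; lra|].
    rewrite Rmult_assoc, Rinv_r; [|lra]. unfold Rdiv in *. lra. }
  nra.
Qed.

Lemma cdiff_cont (f : C -> C) (z : C) : cdiff f z -> ccont f z.
Proof. intros H. apply cdiff_C_derive in H. eapply cder_cont; eauto. Qed.

Lemma cder_ext (f g : C -> C) (z l : C) :
  (exists d, 0 < d /\ forall w, Cmod (w - z) < d -> f w = g w) -> cder f z l -> cder g z l.
Proof.
  intros [d [Hd E]] H eps He. destruct (H eps He) as [d' [Hd' K]].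
  exists (Rmin d d'). split; [apply Rmin_pos; auto|]. intros w Hw.
  pose proof (Rmin_l d d'). pose proof (Rmin_r d d').
  rewrite <- !E; [apply K; lra| |lra]. rewrite Cmod_self_sub; lra.
Qed.

Lemma ccont_ext (f g : C -> C) (z : C) :
  (exists d, 0 < d /\ forall w, Cmod (w - z) < d -> f w = g w) -> ccont f z -> ccont g z.
Proof.
  intros [d [Hd E]] H eps He. destruct (H eps He) as [d' [Hd' K]].
  exists (Rmin d d'). split; [apply Rmin_pos; auto|]. intros w Hw.
  pose proof (Rmin_l d d'). pose proof (Rmin_r d d').
  rewrite <- !E; [apply K; lra| |lra]. rewrite Cmod_self_sub; lra.
Qed.

Lemma cder_const (c z : C) : cder (fun _ => c) z 0%C.
Proof.
  intros eps He. exists 1; split; [lra|]. intros w _.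
  replace (c - c - 0 * (w - z))%C with (RtoC 0) by ring. rewrite Cmod_0.
  pose proof (Cmod_ge_0 (w - z)); nra.
Qed.

Lemma cder_id (z : C) : cder (fun w => w) z 1%C.
Proof.
  intros eps He. exists 1; split; [lra|]. intros w _.
  replace (w - z - 1 * (w - z))%C with (RtoC 0) by ring. rewrite Cmod_0.
  pose proof (Cmod_ge_0 (w - z)); nra.
Qed.

Lemma cder_plus (f g : C -> C) (z l m : C) :
  cder f z l -> cder g z m -> cder (fun w => f w + g w)%C z (l + m)%C.
Proof.
  intros Hf Hg. apply cder_is_derive in Hf. apply cder_is_derive in Hg. apply cder_is_derive.
  exact (is_derive_plus _ _ _ _ _ Hf Hg).
Qed.

Lemma cder_opp (f : C -> C) (z l : C) : cder f z l -> cder (fun w => - f w)%C z (- l)%C.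
Proof.
  intros Hf. apply cder_is_derive in Hf. apply cder_is_derive. exact (is_derive_opp _ _ _ Hf).
Qed.

Lemma cder_minus (f g : C -> C) (z l m : C) :
  cder f z l -> cder g z m -> cder (fun w => f w - g w)%C z (l - m)%C.
Proof. intros Hf Hg. apply cder_plus; auto. apply cder_opp; auto. Qed.

Lemma cder_mult (f g : C -> C) (z l m : C) :
  cder f z l -> cder g z m -> cder (fun w => f w * g w)%C z (l * g z + f z * m)%C.
Proof.
  intros Hf Hg. apply cder_is_derive_abs in Hf. apply cder_is_derive_abs in Hg. apply cder_is_derive_abs.
  exact (is_derive_mult f g z l m Hf Hg Cmult_comm).
Qed.

Lemma cder_comp (f g : C -> C) (z l m : C) :
  cder f (g z) l -> cder g z m -> cder (fun w => f (g w)) z (l * m)%C.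
Proof.
  intros Hf Hg. apply cder_is_derive in Hf. apply cder_is_derive_abs in Hg. apply cder_is_derive.
  rewrite Cmult_comm. exact (is_derive_comp f g z l m Hf Hg).
Qed.

Lemma cder_inv_id (z : C) : z <> 0%C -> cder (fun w => / w)%C z (- / (z * z))%C.
Proof.
  intros Hz eps He. apply Cmod_pos_neq in Hz as Hz'. set (a := Cmod z) in *.
  assert (Ha : 0 < a * a * a) by (repeat apply Rmult_lt_0_compat; auto).
  exists (Rmin (a / 2) (eps * (a * a * a) / 2)). split.
  { apply Rmin_pos; [lra|]. apply Rdiv_lt_0_compat; [nra|lra]. }
  intros w Hw. pose proof (Rmin_l (a / 2) (eps * (a * a * a) / 2)).
  pose proof (Rmin_r (a / 2) (eps * (a * a * a) / 2)).
  pose proof (Cmod_le_sub z w). rewrite Cmod_sub_sym in H1. fold a in H1.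
  assert (Hw0 : w <> 0%C) by (apply Cmod_pos_neq; lra).
  replace (/ w - / z - - / (z * z) * (w - z))%C with ((w - z) * (w - z) / (w * (z * z)))%C
    by (field; auto).
  rewrite Cmod_div, !Cmod_mult; [|repeat apply Cmult_neq_0; auto]. fold a.
  pose proof (Cmod_ge_0 (w - z)). set (h := Cmod (w - z)) in *. set (b := Cmod w) in *.
  apply (Rmult_le_reg_r (b * (a * a))); [apply Rmult_lt_0_compat; [lra|nra]|].
  unfold Rdiv. rewrite Rmult_assoc, Rinv_l; [|apply Rgt_not_eq; apply Rmult_lt_0_compat; [lra|nra]].
  rewrite Rmult_1_r.
  assert (h <= eps * (b * (a * a))) by (assert (a * a * a / 2 <= b * (a * a)) by nra; nra). nra.
Qed.

Lemma cder_inv (f : C -> C) (z l : C) : f z <> 0%C ->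
  cder f z l -> cder (fun w => / f w)%C z (- l / (f z * f z))%C.
Proof.
  intros Hz Hf. replace (- l / (f z * f z))%C with (- / (f z * f z) * l)%C by (field; auto).
  apply (cder_comp (fun w => / w)%C f); auto. apply cder_inv_id; auto.
Qed.

Lemma cder_div (f g : C -> C) (z l m : C) : g z <> 0%C ->
  cder f z l -> cder g z m ->
  cder (fun w => f w / g w)%C z ((l * g z - f z * m) / (g z * g z))%C.
Proof.
  intros Hz Hf Hg.
  replace ((l * g z - f z * m) / (g z * g z))%C with (l * / g z + f z * (- m / (g z * g z)))%C
    by (field; auto).
  apply (cder_mult f (fun w => / g w)%C); auto. apply (cder_inv g); auto.
Qed.

Lemma cdiff_const (c z : C) : cdiff (fun _ => c) z.
Proof. eapply cder_cdiff, cder_const. Qed.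
Lemma cdiff_id (z : C) : cdiff (fun w => w) z.
Proof. eapply cder_cdiff, cder_id. Qed.
Lemma cdiff_plus (f g : C -> C) z : cdiff f z -> cdiff g z -> cdiff (fun w => f w + g w)%C z.
Proof. intros Hf Hg. eapply cder_cdiff, cder_plus; apply cdiff_C_derive; auto. Qed.
Lemma cdiff_opp (f : C -> C) z : cdiff f z -> cdiff (fun w => - f w)%C z.
Proof. intros Hf. eapply cder_cdiff, cder_opp; apply cdiff_C_derive; auto. Qed.
Lemma cdiff_minus (f g : C -> C) z : cdiff f z -> cdiff g z -> cdiff (fun w => f w - g w)%C z.
Proof. intros Hf Hg. eapply cder_cdiff, cder_minus; apply cdiff_C_derive; auto. Qed.
Lemma cdiff_mult (f g : C -> C) z : cdiff f z -> cdiff g z -> cdiff (fun w => f w * g w)%C z.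
Proof. intros Hf Hg. eapply cder_cdiff, cder_mult; apply cdiff_C_derive; auto. Qed.
Lemma cdiff_inv (f : C -> C) z : f z <> 0%C -> cdiff f z -> cdiff (fun w => / f w)%C z.
Proof. intros Hz Hf. eapply cder_cdiff, cder_inv; auto; apply cdiff_C_derive; auto. Qed.
Lemma cdiff_div (f g : C -> C) z : g z <> 0%C -> cdiff f z -> cdiff g z -> cdiff (fun w => f w / g w)%C z.
Proof. intros Hz Hf Hg. eapply cder_cdiff, cder_div; auto; apply cdiff_C_derive; auto. Qed.
Lemma cdiff_comp (f g : C -> C) z : cdiff f (g z) -> cdiff g z -> cdiff (fun w => f (g w)) z.
Proof. intros Hf Hg. eapply cder_cdiff, (cder_comp f g); apply cdiff_C_derive; auto. Qed.

Lemma ccont_plus (f g : C -> C) z : ccont f z -> ccont g z -> ccont (fun w => f w + g w)%C z.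
Proof.
  intros Hf Hg eps He. destruct (Hf (eps / 2)) as [d [Hd K]]; [lra|].
  destruct (Hg (eps / 2)) as [d' [Hd' K']]; [lra|].
  exists (Rmin d d'). split; [apply Rmin_pos; auto|]. intros w Hw.
  pose proof (Rmin_l d d'). pose proof (Rmin_r d d').
  specialize (K w ltac:(lra)). specialize (K' w ltac:(lra)).
  replace (f w + g w - (f z + g z))%C with ((f w - f z) + (g w - g z))%C by ring.
  pose proof (Cmod_triangle (f w - f z) (g w - g z)). lra.
Qed.

Lemma ccont_const (c z : C) : ccont (fun _ => c) z.
Proof. apply cdiff_cont, cdiff_const. Qed.

Lemma ccont_comp (f g : C -> C) z : ccont f (g z) -> ccont g z -> ccont (fun w => f (g w)) z.
Proof.
  intros Hf Hg eps He. destruct (Hf eps He) as [d [Hd K]].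
  destruct (Hg d Hd) as [d' [Hd' K']]. exists d'; split; auto.
Qed.

Lemma ccont_mult (f g : C -> C) z : ccont f z -> ccont g z -> ccont (fun w => f w * g w)%C z.
Proof.
  intros Hf Hg eps He.
  pose proof (Cmod_ge_0 (f z)). pose proof (Cmod_ge_0 (g z)).
  set (M := 1 + Cmod (f z) + Cmod (g z)). assert (HM : 1 <= M) by (unfold M; lra).
  assert (He1 : 0 < Rmin 1 (eps / (2 * M))).
  { apply Rmin_pos; [lra|]. apply Rdiv_lt_0_compat; lra. }
  destruct (Hf _ He1) as [d [Hd K]]. destruct (Hg _ He1) as [d' [Hd' K']].
  exists (Rmin d d'). split; [apply Rmin_pos; auto|]. intros w Hw.
  pose proof (Rmin_l d d'). pose proof (Rmin_r d d').
  specialize (K w ltac:(lra)). specialize (K' w ltac:(lra)).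
  pose proof (Rmin_l 1 (eps / (2 * M))). pose proof (Rmin_r 1 (eps / (2 * M))).
  replace (f w * g w - f z * g z)%C with ((f w - f z) * (g w - g z) + ((f w - f z) * g z + f z * (g w - g z)))%C by ring.
  pose proof (Cmod_triangle ((f w - f z) * (g w - g z)) ((f w - f z) * g z + f z * (g w - g z))).
  pose proof (Cmod_triangle ((f w - f z) * g z) (f z * (g w - g z))).
  rewrite !Cmod_mult in *.
  set (a := Cmod (f w - f z)) in *. set (b := Cmod (g w - g z)) in *.
  assert (0 <= a) by apply Cmod_ge_0. assert (0 <= b) by apply Cmod_ge_0.
  set (e := eps / (2 * M)) in *. assert (e * (2 * M) = eps) by (unfold e; field; lra).
  assert (a * b <= 1 * e) by (apply Rmult_le_compat; lra).
  assert (a * Cmod (g z) <= e * Cmod (g z)) by (apply Rmult_le_compat_r; lra).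
  assert (Cmod (f z) * b <= Cmod (f z) * e) by (apply Rmult_le_compat_l; lra).
  assert (0 < e) by (unfold e; apply Rdiv_lt_0_compat; lra).
  unfold M in *. nra.
Qed.

Lemma ccont_inv_id (z : C) : z <> 0%C -> ccont (fun w => / w)%C z.
Proof. intros. eapply cder_cont, cder_inv_id; auto. Qed.

Definition cball (z0 : C) (R : R) (z : C) : Prop := Cmod (z - z0) < R.

Lemma open_cball z0 R : open_C (cball z0 R).
Proof.
  intros z Hz. exists (R - Cmod (z - z0)). split; [unfold cball in Hz; lra|].
  intros w Hw. unfold cball. pose proof (Cmod_sub_tri w z z0). lra.
Qed.

Lemma Edisc_cball z : Edisc z <-> cball 0 1 z.
Proof. unfold Edisc, cball. replace (z - 0)%C with z by ring. tauto. Qed.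

Lemma E_ball z : Edisc z -> cball 0 1 z.
Proof. apply Edisc_cball. Qed.

Lemma ball_E z : cball 0 1 z -> Edisc z.
Proof. apply Edisc_cball. Qed.

Lemma open_Edisc : open_C Edisc.
Proof.
  intros z Hz. apply Edisc_cball in Hz. destruct (open_cball 0 1 z Hz) as [d [Hd K]].
  exists d; split; auto. intros w Hw; apply Edisc_cball; auto.
Qed.

Lemma cder_eq (f : C -> C) (z l l' : C) : cder f z l -> l = l' -> cder f z l'.
Proof. intros H <-; exact H. Qed.

(** Differentiates by structure, stops at unknown heads and leaves nonvanishing denominators as
    goals. The derivative it produces is unsimplified, hence the usual [cder_eq] in front of it. *)
Ltac cdr :=
  match goal with
  | |- cder (fun w => w) _ _ => apply cder_id
  | |- cder (fun w => ?c) _ _ => apply (cder_const c)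
  | |- cder (fun w => Cplus (@?f w) (@?g w)) _ _ => apply (cder_plus f g); cdr
  | |- cder (fun w => Cminus (@?f w) (@?g w)) _ _ => apply (cder_minus f g); cdr
  | |- cder (fun w => Copp (@?f w)) _ _ => apply (cder_opp f); cdr
  | |- cder (fun w => Cmult (@?f w) (@?g w)) _ _ => apply (cder_mult f g); cdr
  | |- cder (fun w => Cdiv (@?f w) (@?g w)) _ _ => apply (cder_div f g); [|cdr|cdr]
  | |- cder (fun w => Cinv (@?f w)) _ _ => apply (cder_inv f); [|cdr]
  | |- _ => idtac
  end.

Ltac cdf :=
  match goal with
  | |- cdiff (fun w => w) _ => apply cdiff_id
  | |- cdiff (fun w => ?c) _ => apply (cdiff_const c)
  | |- cdiff (fun w => Cplus (@?f w) (@?g w)) _ => apply (cdiff_plus f g); cdf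
  | |- cdiff (fun w => Cminus (@?f w) (@?g w)) _ => apply (cdiff_minus f g); cdf
  | |- cdiff (fun w => Copp (@?f w)) _ => apply (cdiff_opp f); cdf
  | |- cdiff (fun w => Cmult (@?f w) (@?g w)) _ => apply (cdiff_mult f g); cdf
  | |- cdiff (fun w => Cdiv (@?f w) (@?g w)) _ => apply (cdiff_div f g); [|cdf|cdf]
  | |- cdiff (fun w => Cinv (@?f w)) _ => apply (cdiff_inv f); [|cdf]
  | |- _ => idtac
  end.

(** * Integration of complex-valued functions *)

Definition rcont (g : R -> C) (t : R) : Prop :=
  forall eps, 0 < eps -> exists d, 0 < d /\ forall s, Rabs (s - t) < d -> Cmod (g s - g t) < eps.

Definition rder (g : R -> C) (t : R) (l : C) : Prop :=
  forall eps, 0 < eps -> exists d, 0 < d /\ forall s, Rabs (s - t) < d ->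
    Cmod (g s - g t - l * (s - t)) <= eps * Rabs (s - t).

Definition CI (f : R -> C) (a b : R) : C := @RInt C_R_CompleteNormedModule f a b.

Lemma locally_Rabs (t : R) (P : R -> Prop) :
  locally t P <-> exists d, 0 < d /\ forall s, Rabs (s - t) < d -> P s.
Proof.
  split.
  - intros [d Hd]. exists d. split; [apply cond_pos|]. intros w Hw. apply Hd. exact Hw.
  - intros [d [Hd H]]. exists (mkposreal d Hd). intros w Hw. apply H. exact Hw.
Qed.

Lemma rcont_continuous (g : R -> C) (t : R) :
  rcont g t <-> @continuous R_UniformSpace C_R_NormedModule g t.
Proof.
  split.
  - intros H P HP. apply locally_Cmod in HP. destruct HP as [e [He K]].
    destruct (H e He) as [d [Hd K']]. apply locally_Rabs. exists d; split; auto.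
  - intros H e He.
    assert (HP : @locally C_UniformSpace (g t) (fun w => Cmod (w - g t) < e)).
    { apply locally_Cmod. exists e; auto. }
    apply H in HP. apply locally_Rabs in HP. exact HP.
Qed.

Lemma scal_CR (x : R) (z : C) : @scal R_AbsRing C_R_NormedModule x z = (x * z)%C.
Proof.
  destruct z as [a b].
  change (@scal R_AbsRing C_R_NormedModule x (a, b)) with ((x * a)%R, (x * b)%R).
  unfold Cmult, RtoC; simpl. apply injective_projections; simpl; ring.
Qed.

Lemma norm_CR (z : C) : @norm R_AbsRing C_R_NormedModule z = Cmod z.
Proof.
  destruct z as [a b]. change (sqrt (Rabs a ^ 2 + Rabs b ^ 2) = sqrt (a ^ 2 + b ^ 2)).
  rewrite !pow2_abs. reflexivity.
Qed.

Lemma rder_is_derive (g : R -> C) (t : R) (l : C) :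
  rder g t l -> @is_derive R_AbsRing C_R_NormedModule g t l.
Proof.
  intros H. split; [apply (@is_linear_scal_l R_AbsRing C_R_NormedModule)|].
  intros x Hx. apply (@is_filter_lim_locally_unique R_AbsRing (AbsRing_NormedModule R_AbsRing)) in Hx. subst x.
  intros eps. apply locally_Rabs. destruct (H eps (cond_pos eps)) as [d [Hd K]].
  exists d; split; auto. intros w Hw. specialize (K w Hw).
  rewrite scal_CR, norm_CR.
  change (Cmod (g w + - g t + - (RtoC (w + - t) * l))%C <= eps * Rabs (w - t)).
  replace (g w + - g t + - (RtoC (w + - t) * l))%C with (g w - g t - l * (w - t))%C; [exact K|].
  rewrite RtoC_plus, RtoC_opp. ring.
Qed.

Lemma rder_cont (f : R -> C) (z : R) (l : C) : rder f z l -> rcont f z.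
Proof.
  intros H eps He. destruct (H 1 Rlt_0_1) as [d [Hd K]].
  pose proof (Cmod_ge_0 l).
  assert (Hp : 0 < eps / (2 + Cmod l)) by (apply Rdiv_lt_0_compat; lra).
  exists (Rmin d (eps / (2 + Cmod l))). split; [apply Rmin_pos; auto|].
  intros w Hw. assert (h1 := Rmin_l d (eps / (2 + Cmod l))). assert (h2 := Rmin_r d (eps / (2 + Cmod l))).
  specialize (K w ltac:(lra)).
  pose proof (Cmod_le_sub (f w - f z) (l * (w - z))) as T. rewrite Cmod_mult, <- RtoC_minus, Cmod_R in T.
  rewrite <- RtoC_minus in K. pose proof (Rabs_pos (w - z)).
  assert (Rabs (w - z) * (2 + Cmod l) < eps).
  { apply (Rmult_lt_reg_r (/ (2 + Cmod l))); [apply Rinv_0_lt_compat; lra|].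
    rewrite Rmult_assoc, Rinv_r; [|lra]. unfold Rdiv in *. lra. }
  nra.
Qed.

Lemma rcont_comp (f : C -> C) (g : R -> C) (t : R) :
  ccont f (g t) -> rcont g t -> rcont (fun s => f (g s)) t.
Proof.
  intros Hf Hg e He. destruct (Hf e He) as [d [Hd K]]. destruct (Hg d Hd) as [d' [Hd' K']].
  exists d'; split; auto.
Qed.

Lemma rder_comp (f : C -> C) (g : R -> C) (t : R) (l m : C) :
  cder f (g t) l -> rder g t m -> rder (fun s => f (g s)) t (l * m)%C.
Proof.
  intros Hf Hg e He. pose proof (Cmod_ge_0 l). pose proof (Cmod_ge_0 m).
  set (e1 := Rmin 1 (e / (2 + Cmod l + Cmod m))).
  assert (He1 : 0 < e1) by (unfold e1; apply Rmin_pos; [lra|apply Rdiv_lt_0_compat; lra]).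
  assert (Hb : e1 * (2 + Cmod l + Cmod m) <= e).
  { assert (e1 <= e / (2 + Cmod l + Cmod m)) by apply Rmin_r.
    apply (Rmult_le_compat_r (2 + Cmod l + Cmod m)) in H1; [|lra].
    replace (e / (2 + Cmod l + Cmod m) * (2 + Cmod l + Cmod m)) with e in H1 by (field; lra). auto. }
  assert (e1 <= 1) by apply Rmin_l.
  destruct (Hf e1 He1) as [d [Hd K]]. destruct (Hg e1 He1) as [d' [Hd' K']].
  destruct (rder_cont _ _ _ Hg d Hd) as [d'' [Hd'' K'']].
  exists (Rmin d' d''). split; [apply Rmin_pos; auto|]. intros s Hs.
  pose proof (Rmin_l d' d''). pose proof (Rmin_r d' d'').
  specialize (K' s ltac:(lra)). specialize (K _ (K'' s ltac:(lra))).
  replace (f (g s) - f (g t) - l * m * (s - t))%C with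
    ((f (g s) - f (g t) - l * (g s - g t)) + l * (g s - g t - m * (s - t)))%C by ring.
  pose proof (Cmod_triangle (f (g s) - f (g t) - l * (g s - g t)) (l * (g s - g t - m * (s - t)))).
  rewrite Cmod_mult in H4.
  pose proof (Cmod_le_sub (g s - g t) (m * (s - t))). rewrite Cmod_mult, <- RtoC_minus, Cmod_R in H5.
  rewrite <- RtoC_minus in *. set (h := Rabs (s - t)) in *. assert (0 <= h) by apply Rabs_pos.
  set (a := Cmod (g s - g t)) in *.
  assert (a <= (Cmod m + 1) * h) by nra.
  assert (e1 * a <= e1 * ((Cmod m + 1) * h)) by (apply Rmult_le_compat_l; lra).
  assert (Cmod l * Cmod (g s - g t - m * (s - t)%R) <= Cmod l * (e1 * h)) by (apply Rmult_le_compat_l; lra).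
  nra.
Qed.

Lemma rder_affine (c v : C) (t : R) : rder (fun s => c + v * s)%C t v.
Proof.
  intros e He. exists 1; split; [lra|]. intros s _.
  replace (c + v * s - (c + v * t) - v * (s - t))%C with (RtoC 0) by ring.
  rewrite Cmod_0. pose proof (Rabs_pos (s - t)); nra.
Qed.

Lemma rcont_affine (c v : C) (t : R) : rcont (fun s => c + v * s)%C t.
Proof. eapply rder_cont, rder_affine. Qed.

Lemma rcont_const (c : C) (t : R) : rcont (fun _ => c) t.
Proof. intros e He. exists 1; split; [lra|]. intros. rewrite Cmod_self_sub; auto. Qed.

Lemma CI_is (f : R -> C) a b : (forall t, Rmin a b <= t <= Rmax a b -> rcont f t) ->
  @is_RInt C_R_NormedModule f a b (CI f a b).
Proof.
  intros H. apply (@RInt_correct C_R_CompleteNormedModule). apply ex_RInt_continuous.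
  intros t Ht. apply rcont_continuous; auto.
Qed.

Lemma CI_unique (f : R -> C) a b (l : C) : @is_RInt C_R_NormedModule f a b l -> CI f a b = l.
Proof. intros H. apply (@is_RInt_unique C_R_CompleteNormedModule). exact H. Qed.

Lemma CI_ext (f g : R -> C) a b :
  (forall t, Rmin a b < t < Rmax a b -> f t = g t) -> CI f a b = CI g a b.
Proof. intros H. apply (@RInt_ext C_R_CompleteNormedModule); auto. Qed.

Lemma CI_point f a : CI f a a = 0%C.
Proof. apply (@RInt_point C_R_CompleteNormedModule). Qed.

Lemma CI_swap (f : R -> C) a b : (forall t, Rmin a b <= t <= Rmax a b -> rcont f t) ->
  CI f b a = (- CI f a b)%C.
Proof.
  intros H. apply CI_unique. apply (@is_RInt_swap C_R_NormedModule). apply CI_is; auto.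
Qed.

Lemma CI_Chasles (f : R -> C) a b c : (forall t, Rmin a c <= t <= Rmax a c -> rcont f t) ->
  a <= b <= c -> CI f a c = (CI f a b + CI f b c)%C.
Proof.
  intros H Hb. apply CI_unique. rewrite Rmin_left, Rmax_right in H by lra.
  apply (@is_RInt_Chasles C_R_NormedModule) with b; apply CI_is; intros t Ht; apply H.
  - rewrite Rmin_left, Rmax_right in Ht; lra.
  - rewrite Rmin_left, Rmax_right in Ht; lra.
Qed.

Lemma CI_minus (f g : R -> C) a b :
  (forall t, Rmin a b <= t <= Rmax a b -> rcont f t) -> (forall t, Rmin a b <= t <= Rmax a b -> rcont g t) ->
  CI (fun t => f t - g t)%C a b = (CI f a b - CI g a b)%C.
Proof.
  intros Hf Hg. apply CI_unique. apply (@is_RInt_minus C_R_NormedModule); apply CI_is; auto.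
Qed.

(** A complex factor mixes the two real components, so each component is integrated as a real linear
    combination. *)
Lemma CI_cmul (c : C) (f : R -> C) a b : (forall t, Rmin a b <= t <= Rmax a b -> rcont f t) ->
  CI (fun t => c * f t)%C a b = (c * CI f a b)%C.
Proof.
  intros Hf. apply CI_unique. pose proof (CI_is f a b Hf) as H.
  set (l := CI f a b) in *. clearbody l.
  assert (H1 : is_RInt (fun t => fst (f t)) a b (fst l)).
  { exact (is_RInt_fct_extend_fst f a b l H). }
  assert (H2 : is_RInt (fun t => snd (f t)) a b (snd l)).
  { exact (is_RInt_fct_extend_snd f a b l H). }
  destruct c as [c1 c2]. unfold Cmult; simpl.
  apply (@is_RInt_fct_extend_pair R_NormedModule R_NormedModule).
  - apply (is_RInt_ext (fun t => minus (scal c1 (fst (f t))) (scal c2 (snd (f t))))).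
    { intros; reflexivity. }
    apply (@is_RInt_minus R_NormedModule); apply (@is_RInt_scal R_NormedModule); auto.
  - apply (is_RInt_ext (fun t => plus (scal c1 (snd (f t))) (scal c2 (fst (f t))))).
    { intros; reflexivity. }
    apply (@is_RInt_plus R_NormedModule); apply (@is_RInt_scal R_NormedModule); auto.
Qed.

Lemma CI_bound (f : R -> C) a b M : (forall t, Rmin a b <= t <= Rmax a b -> rcont f t) ->
  (forall t, Rmin a b <= t <= Rmax a b -> Cmod (f t) <= M) -> Cmod (CI f a b) <= M * Rabs (b - a).
Proof.
  assert (G : forall a b, a <= b -> (forall t, Rmin a b <= t <= Rmax a b -> rcont f t) ->
    (forall t, Rmin a b <= t <= Rmax a b -> Cmod (f t) <= M) -> Cmod (CI f a b) <= M * Rabs (b - a)).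
  { clear a b. intros a b Hab Hc HM.
    pose proof (@norm_RInt_le_const C_R_NormedModule f a b (CI f a b) M Hab) as H.
    rewrite Rmin_left, Rmax_right in HM by auto.
    rewrite norm_CR in H. rewrite Rabs_pos_eq by lra. rewrite Rmult_comm. apply H; [|apply CI_is; auto].
    intros x Hx. rewrite norm_CR. auto. }
  intros Hc HM. destruct (Rle_dec a b) as [h|h].
  - apply G; auto.
  - rewrite (CI_swap f b a).
    + rewrite Cmod_opp, Rabs_minus_sym. apply G; [lra| |]; intros t Ht; [apply Hc|apply HM];
      rewrite Rmin_comm, Rmax_comm; auto.
    + intros t Ht; apply Hc. rewrite Rmin_comm, Rmax_comm; auto.
Qed.

Lemma CI_FTC (F f : R -> C) a b :
  (forall t, Rmin a b <= t <= Rmax a b -> rder F t (f t)) ->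
  (forall t, Rmin a b <= t <= Rmax a b -> rcont f t) -> CI f a b = (F b - F a)%C.
Proof.
  intros H Hc. apply CI_unique. apply (@is_RInt_derive C_R_CompleteNormedModule F f).
  - intros x Hx. apply rder_is_derive; auto.
  - intros x Hx. apply rcont_continuous; auto.
Qed.

Lemma CI_const (c : C) a b : CI (fun _ => c) a b = (c * (b - a))%C.
Proof.
  rewrite (CI_FTC (fun s => 0 + c * s)%C (fun _ => c)).
  - ring.
  - intros. apply rder_affine.
  - intros. apply rcont_const.
Qed.

(** Subtracting the constant leaves an integrand of size [M]. With [c] the value at the base point
    this differentiates primitives. *)
Lemma CI_dep (f : R -> C) a b (c : C) M :
  (forall t, Rmin a b <= t <= Rmax a b -> rcont f t) ->
  (forall t, Rmin a b <= t <= Rmax a b -> Cmod (f t - c) <= M) ->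
  Cmod (CI f a b - c * (b - a)) <= M * Rabs (b - a).
Proof.
  intros Hc HM. rewrite <- CI_const, <- CI_minus; auto.
  - apply CI_bound; auto. intros t Ht e He. destruct (Hc t Ht e He) as [d [Hd K]].
    exists d; split; auto. intros s Hs. specialize (K s Hs).
    replace (f s - c - (f t - c))%C with (f s - f t)%C by ring. auto.
  - intros; apply rcont_const.
Qed.

(** * Goursat's theorem *)

Definition inrect (a b c d : R) (z : C) : Prop := a <= fst z <= b /\ c <= snd z <= d.

(** Compactness by quadrisection: if [P] failed, some quarter would fail at every stage, and the
    nested rectangles would shrink to a point at which the local hypothesis applies. It serves
    Goursat's theorem and, on the unit square, the existence of Lebesgue numbers. *)
Lemma rect_cousin (P : R -> R -> R -> R -> Prop) (a b c d : R) :
  a <= b -> c <= d ->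
  (forall a b c d, a <= b -> c <= d ->
    P a ((a + b) / 2) c ((c + d) / 2) -> P ((a + b) / 2) b c ((c + d) / 2) ->
    P a ((a + b) / 2) ((c + d) / 2) d -> P ((a + b) / 2) b ((c + d) / 2) d -> P a b c d) ->
  (forall z, inrect a b c d z -> exists e, 0 < e /\
     forall a' b' c' d', a <= a' -> b' <= b -> c <= c' -> d' <= d ->
       inrect a' b' c' d' z -> b' - a' < e -> d' - c' < e -> P a' b' c' d') ->
  P a b c d.
Proof.
  intros Hab Hcd Hq Hl. apply NNPP; intros HN.
  (* Only three quarters are tested: if [P] holds on them, it must fail on the fourth, or else it
     would hold on the rectangle. *)
  set (step := fun r : (R * R) * (R * R) =>
    let '((a, b), (c, d)) := r in let m := (a + b) / 2 in let k := (c + d) / 2 in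
    if excluded_middle_informative (P a m c k) then
    if excluded_middle_informative (P m b c k) then
    if excluded_middle_informative (P a m k d) then ((m, b), (k, d)) else ((a, m), (k, d))
    else ((m, b), (c, k)) else ((a, m), (c, k))).
  set (r := fun n => Nat.iter n step ((a, b), (c, d))).
  assert (Hr : forall n, let '((a', b'), (c', d')) := r n in
     ~ P a' b' c' d' /\ a' <= b' /\ c' <= d' /\ a <= a' /\ b' <= b /\ c <= c' /\ d' <= d /\
     b' - a' = (b - a) / 2 ^ n /\ d' - c' = (d - c) / 2 ^ n).
  { induction n as [|n IH].
    - simpl. repeat split; auto; try lra.
    - unfold r in *. simpl. destruct (Nat.iter n step (a, b, (c, d))) as [[a' b'] [c' d']].
      destruct IH as (h1 & h2 & h3 & h4 & h5 & h6 & h7 & h8 & h9). simpl.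
      assert (e1 : (b - a) / (2 * 2 ^ n) = (b' - a') / 2)
        by (rewrite h8; field; apply pow_nonzero; lra).
      assert (e2 : (d - c) / (2 * 2 ^ n) = (d' - c') / 2)
        by (rewrite h9; field; apply pow_nonzero; lra).
      rewrite e1, e2. clear e1 e2.
      repeat (destruct excluded_middle_informative); repeat split; auto; lra. }
  set (an := fun n => fst (fst (r n))). set (bn := fun n => snd (fst (r n))).
  set (cn := fun n => fst (snd (r n))). set (dn := fun n => snd (snd (r n))).
  assert (Hs : forall n, an n <= an (S n) /\ bn (S n) <= bn n /\ cn n <= cn (S n) /\ dn (S n) <= dn n).
  { intros n. unfold an, bn, cn, dn, r. simpl. specialize (Hr n). unfold r in Hr.
    destruct (Nat.iter n step (a, b, (c, d))) as [[a' b'] [c' d']]. simpl.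
    destruct Hr as (h1 & h2 & h3 & _).
    repeat (destruct excluded_middle_informative); simpl; lra. }
  assert (Hr' : forall n, ~ P (an n) (bn n) (cn n) (dn n) /\ an n <= bn n /\ cn n <= dn n /\
     a <= an n /\ bn n <= b /\ c <= cn n /\ dn n <= d /\
     bn n - an n = (b - a) / 2 ^ n /\ dn n - cn n = (d - c) / 2 ^ n).
  { intros n. specialize (Hr n). unfold an, bn, cn, dn. destruct (r n) as [[a' b'] [c' d']]. exact Hr. }
  clearbody an bn cn dn. clear Hr r step.
  assert (Hm : forall u v : nat -> R, (forall n, u n <= u (S n)) -> (forall n, v (S n) <= v n) ->
     (forall n, u n <= v n) -> exists l, forall n, u n <= l <= v n).
  { intros u v Hu Hv Huv.
    assert (Hu' : forall n m, (n <= m)%nat -> u n <= u m).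
    { intros n m Hnm; induction Hnm; [lra|]. specialize (Hu m). lra. }
    assert (Hv' : forall n m, (n <= m)%nat -> v m <= v n).
    { intros n m Hnm; induction Hnm; [lra|]. specialize (Hv m). lra. }
    assert (Hx : forall n m, u n <= v m).
    { intros n m. pose proof (Hu' n (Nat.max n m) (Nat.le_max_l _ _)).
      pose proof (Hv' m (Nat.max n m) (Nat.le_max_r _ _)). specialize (Huv (Nat.max n m)). lra. }
    destruct (completeness (fun x => exists n, x = u n)) as [l [Hl1 Hl2]].
    - exists (v O). intros x [n ->]. apply Hx.
    - exists (u O); eauto.
    - exists l. intros n. split; [apply Hl1; eauto|]. apply Hl2. intros x [m ->]. apply Hx. }
  destruct (Hm an bn) as [x Hx]; try (intros n; apply Hs); try (intros n; apply Hr').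
  destruct (Hm cn dn) as [y Hy]; try (intros n; apply Hs); try (intros n; apply Hr').
  destruct (Hl (x, y)) as [e [He K]].
  { specialize (Hr' O). specialize (Hx O). specialize (Hy O). unfold inrect; simpl. lra. }
  (* The summand 1 keeps the denominator positive for degenerate rectangles; both sides of the
     [N]-th rectangle are then shorter than [e]. *)
  destruct (pow_lt_1_zero (/ 2) ltac:(rewrite Rabs_pos_eq; lra) (e / (1 + (b - a) + (d - c))))
    as [N HN']; [apply Rdiv_lt_0_compat; lra|].
  specialize (HN' N (le_n _)). rewrite Rabs_pos_eq in HN' by (apply pow_le; lra).
  rewrite pow_inv in HN'. set (k := / 2 ^ N) in *.
  assert (0 < k) by (apply Rinv_0_lt_compat, pow_lt; lra).
  assert (k * (1 + (b - a) + (d - c)) < e).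
  { apply (Rmult_lt_compat_r (1 + (b - a) + (d - c))) in HN'; [|lra].
    unfold Rdiv in HN'. rewrite Rmult_assoc, Rinv_l in HN'; lra. }
  specialize (Hr' N). destruct Hr' as (h1 & h2 & h3 & h4 & h5 & h6 & h7 & h8 & h9).
  apply h1. unfold Rdiv in h8, h9. fold k in h8, h9.
  apply K; auto; try nra. unfold inrect; simpl. split; auto.
Qed.

Definition Hseg (f : C -> C) (y a b : R) : C := CI (fun t => f (t, y)) a b.
Definition Vseg (f : C -> C) (x c d : R) : C := CI (fun t => f (x, t)) c d.
(** The contour integral over the boundary, counterclockwise from the lower side; [Ci] is the
    direction of the vertical sides. *)
Definition rectI (f : C -> C) (a b c d : R) : C :=
  (Hseg f c a b + Ci * Vseg f b c d - Hseg f d a b - Ci * Vseg f a c d)%C.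

Lemma rcont_h (y t : R) : rcont (fun s => (s, y) : C) t.
Proof.
  intros e He. exists e; split; auto. intros s Hs.
  replace (((s, y) : C) - (t, y))%C with (RtoC (s - t)).
  - rewrite Cmod_R; auto.
  - unfold RtoC, Cminus, Cplus, Copp; simpl. f_equal; ring.
Qed.

Lemma rcont_v (x t : R) : rcont (fun s => (x, s) : C) t.
Proof.
  intros e He. exists e; split; auto. intros s Hs.
  replace (((x, s) : C) - (x, t))%C with (Ci * RtoC (s - t))%C.
  - rewrite Cmod_mult, Cmod_Ci, Rmult_1_l, Cmod_R; auto.
  - unfold Ci, RtoC, Cminus, Cplus, Copp, Cmult; simpl. f_equal; ring.
Qed.

Lemma rder_h (y t : R) : rder (fun s => (s, y) : C) t 1%C.
Proof.
  intros e He. exists e; split; auto. intros s Hs.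
  replace (((s, y) : C) - (t, y) - 1 * (s - t))%C with (RtoC 0).
  - rewrite Cmod_0. pose proof (Rabs_pos (s - t)); nra.
  - unfold RtoC, Cminus, Cplus, Copp, Cmult; simpl. f_equal; ring.
Qed.

Lemma rder_v (x t : R) : rder (fun s => (x, s) : C) t Ci.
Proof.
  intros e He. exists e; split; auto. intros s Hs.
  replace (((x, s) : C) - (x, t) - Ci * (s - t))%C with (RtoC 0).
  - rewrite Cmod_0. pose proof (Rabs_pos (s - t)); nra.
  - unfold Ci, RtoC, Cminus, Cplus, Copp, Cmult; simpl. f_equal; ring.
Qed.

Lemma rcont_fh (f : C -> C) (y t : R) : ccont f (t, y) -> rcont (fun s => f (s, y)) t.
Proof. intros H. apply (rcont_comp f (fun s => (s, y) : C)); auto. apply rcont_h. Qed.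

Lemma rcont_fv (f : C -> C) (x t : R) : ccont f (x, t) -> rcont (fun s => f (x, s)) t.
Proof. intros H. apply (rcont_comp f (fun s => (x, s) : C)); auto. apply rcont_v. Qed.

Definition rcontin (f : C -> C) (a b c d : R) : Prop := forall z, inrect a b c d z -> ccont f z.

Lemma rcontin_sub (f : C -> C) a b c d a' b' c' d' :
  rcontin f a b c d -> a <= a' -> b' <= b -> c <= c' -> d' <= d -> rcontin f a' b' c' d'.
Proof. intros H h1 h2 h3 h4 z Hz. apply H. unfold inrect in *. lra. Qed.

Ltac side_rect H := intros; rewrite ?Rmin_left, ?Rmax_right in * by lra;
   (apply rcont_fh || apply rcont_fv); apply H; unfold inrect; simpl; lra.

Lemma rectI_split_h (f : C -> C) a m b c d : a <= m <= b -> c <= d -> rcontin f a b c d ->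
  rectI f a b c d = (rectI f a m c d + rectI f m b c d)%C.
Proof.
  intros Hm Hcd H. unfold rectI, Hseg.
  rewrite (CI_Chasles (fun t => f (t, c)) a m b), (CI_Chasles (fun t => f (t, d)) a m b); auto;
    try side_rect H. ring.
Qed.

Lemma rectI_split_v (f : C -> C) a b c m d : a <= b -> c <= m <= d -> rcontin f a b c d ->
  rectI f a b c d = (rectI f a b c m + rectI f a b m d)%C.
Proof.
  intros Hm Hcd H. unfold rectI, Vseg.
  rewrite (CI_Chasles (fun t => f (a, t)) c m d), (CI_Chasles (fun t => f (b, t)) c m d); auto;
    try side_rect H. ring.
Qed.

Lemma rectI_minus (f g : C -> C) a b c d : a <= b -> c <= d -> rcontin f a b c d -> rcontin g a b c d ->
  rectI (fun z => f z - g z)%C a b c d = (rectI f a b c d - rectI g a b c d)%C.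
Proof.
  intros Hab Hcd Hf Hg. unfold rectI, Hseg, Vseg.
  rewrite !CI_minus; try side_rect Hf; try side_rect Hg. ring.
Qed.

Lemma rectI_bound (f : C -> C) a b c d M : a <= b -> c <= d -> rcontin f a b c d ->
  (forall z, inrect a b c d z -> Cmod (f z) <= M) ->
  Cmod (rectI f a b c d) <= M * (2 * ((b - a) + (d - c))).
Proof.
  intros Hab Hcd Hf HM. unfold rectI.
  assert (B1 : forall y, c <= y <= d -> Cmod (Hseg f y a b) <= M * (b - a)).
  { intros y Hy. rewrite <- (Rabs_pos_eq (b - a)) by lra. apply CI_bound; [side_rect Hf|].
    intros t Ht. rewrite Rmin_left, Rmax_right in Ht by lra. apply HM; unfold inrect; simpl; lra. }
  assert (B2 : forall x, a <= x <= b -> Cmod (Ci * Vseg f x c d) <= M * (d - c)).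
  { intros x Hx. rewrite Cmod_mult, Cmod_Ci, Rmult_1_l.
    rewrite <- (Rabs_pos_eq (d - c)) by lra. apply CI_bound; [side_rect Hf|].
    intros t Ht. rewrite Rmin_left, Rmax_right in Ht by lra. apply HM; unfold inrect; simpl; lra. }
  unfold Cminus.
  pose proof (Cmod_triangle (Hseg f c a b + Ci * Vseg f b c d + - Hseg f d a b) (- (Ci * Vseg f a c d))).
  pose proof (Cmod_triangle (Hseg f c a b + Ci * Vseg f b c d) (- Hseg f d a b)).
  pose proof (Cmod_triangle (Hseg f c a b) (Ci * Vseg f b c d)).
  rewrite Cmod_opp in *.
  pose proof (B1 c ltac:(lra)). pose proof (B1 d ltac:(lra)).
  pose proof (B2 a ltac:(lra)). pose proof (B2 b ltac:(lra)). lra.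
Qed.

Lemma rectI_primitive (F f : C -> C) a b c d : a <= b -> c <= d -> rcontin f a b c d ->
  (forall z, inrect a b c d z -> cder F z (f z)) -> rectI f a b c d = 0%C.
Proof.
  intros Hab Hcd Hf HF. unfold rectI, Hseg, Vseg.
  assert (Eh : forall y, c <= y <= d -> CI (fun t => f (t, y)) a b = (F (b, y) - F (a, y))%C).
  { intros y Hy. apply (CI_FTC (fun t => F (t, y))).
    - intros t Ht. rewrite Rmin_left, Rmax_right in Ht by lra.
      replace (f (t, y)) with (f (t, y) * 1)%C by ring.
      apply (rder_comp F (fun t => (t, y) : C)); [|apply rder_h].
      apply HF; unfold inrect; simpl; lra.
    - side_rect Hf. }
  assert (Ev : forall x, a <= x <= b -> (Ci * CI (fun t => f (x, t)) c d = F (x, d) - F (x, c))%C).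
  { intros x Hx. rewrite <- CI_cmul; [|side_rect Hf].
    apply (CI_FTC (fun t => F (x, t))).
    - intros t Ht. rewrite Rmin_left, Rmax_right in Ht by lra.
      rewrite Cmult_comm.
      apply (rder_comp F (fun t => (x, t) : C)); [|apply rder_v].
      apply HF; unfold inrect; simpl; lra.
    - intros t Ht. apply (rcont_comp (fun z => Ci * z)%C (fun t => f (x, t))).
      + apply ccont_mult; [apply ccont_const|]. apply cdiff_cont, cdiff_id.
      + revert t Ht. side_rect Hf. }
  rewrite !Eh, !Ev by lra. ring.
Qed.

Lemma rectI_affine (k l z0 : C) a b c d : a <= b -> c <= d ->
  rectI (fun z => k + l * (z - z0))%C a b c d = 0%C.
Proof.
  intros Hab Hcd. apply (rectI_primitive (fun z => k * z + l * ((z - z0) * (z - z0)) / 2)%C); auto.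
  - intros z _. apply cdiff_cont. cdf.
  - intros z _.
    eapply cder_eq; [cdr; intros E; apply RtoC_inj in E; lra|].
    field; intros E; apply RtoC_inj in E; lra.
Qed.

Lemma Cmod_rect_diam a b c d (z w : C) : inrect a b c d z -> inrect a b c d w ->
  Cmod (w - z) <= (b - a) + (d - c).
Proof.
  destruct z as [x y], w as [x' y']. unfold inrect; simpl. intros Hz Hw.
  replace (((x', y') : C) - (x, y))%C with (RtoC (x' - x) + Ci * RtoC (y' - y))%C.
  - eapply Rle_trans; [apply Cmod_triangle|]. rewrite Cmod_mult, Cmod_Ci, !Cmod_R.
    unfold Rabs. destruct Rcase_abs, Rcase_abs; lra.
  - unfold Ci, RtoC, Cminus, Cplus, Copp, Cmult; simpl. f_equal; ring.
Qed.

(** With [S] the half perimeter, the bound [2 e S^2] survives quadrisection because each quarter has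
    half perimeter [S / 2]. It holds on small rectangles, since [f] differs there by at most [e S]
    from an affine function, whose integral vanishes. *)
Lemma goursat_rect (f : C -> C) a b c d : a <= b -> c <= d ->
  (forall z, inrect a b c d z -> cdiff f z) -> rectI f a b c d = 0%C.
Proof.
  intros Hab Hcd H.
  assert (Hc : rcontin f a b c d) by (intros z Hz; apply cdiff_cont; auto).
  apply Cmod_eq0. apply Rnot_lt_le; intros Hpos.
  set (A := (b - a) + (d - c)). assert (HA : 0 <= A) by (unfold A; lra).
  (* Makes [2 e A^2] smaller than the modulus of the integral, which contradicts the bound proved
     next. *)
  set (e := Cmod (rectI f a b c d) / (2 * (1 + A * A) * 2)).
  assert (He : 0 < e) by (unfold e; apply Rdiv_lt_0_compat; nra).
  assert (K : a <= a -> b <= b -> c <= c -> d <= d ->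
     Cmod (rectI f a b c d) <= 2 * e * (((b - a) + (d - c)) * ((b - a) + (d - c)))).
  2:{ specialize (K ltac:(lra) ltac:(lra) ltac:(lra) ltac:(lra)). fold A in K.
      assert (e * (2 * (1 + A * A) * 2) = Cmod (rectI f a b c d)) by (unfold e; field; nra). nra. }
  refine (rect_cousin (fun a' b' c' d' => a <= a' -> b' <= b -> c <= c' -> d' <= d ->
     Cmod (rectI f a' b' c' d') <= 2 * e * (((b' - a') + (d' - c')) * ((b' - a') + (d' - c')))) a b c d Hab Hcd _ _).
  - intros a' b' c' d' h1 h2 K1 K2 K3 K4 h3 h4 h5 h6.
    assert (Hc' : rcontin f a' b' c' d') by (eapply rcontin_sub; eauto).
    rewrite (rectI_split_h f a' ((a' + b') / 2) b'), (rectI_split_v f a' _ c' ((c' + d') / 2) d'),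
      (rectI_split_v f _ b' c' ((c' + d') / 2) d'); try lra; try (eapply rcontin_sub; eauto; lra).
    specialize (K1 ltac:(lra) ltac:(lra) ltac:(lra) ltac:(lra)).
    specialize (K2 ltac:(lra) ltac:(lra) ltac:(lra) ltac:(lra)).
    specialize (K3 ltac:(lra) ltac:(lra) ltac:(lra) ltac:(lra)).
    specialize (K4 ltac:(lra) ltac:(lra) ltac:(lra) ltac:(lra)).
    set (m := (a' + b') / 2) in *. set (k := (c' + d') / 2) in *.
    pose proof (Cmod_triangle (rectI f a' m c' k + rectI f a' m k d') (rectI f m b' c' k + rectI f m b' k d')).
    pose proof (Cmod_triangle (rectI f a' m c' k) (rectI f a' m k d')).
    pose proof (Cmod_triangle (rectI f m b' c' k) (rectI f m b' k d')).
    assert (Em : m - a' = (b' - a') / 2) by (unfold m; lra).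
    assert (Em' : b' - m = (b' - a') / 2) by (unfold m; lra).
    assert (Ek : k - c' = (d' - c') / 2) by (unfold k; lra).
    assert (Ek' : d' - k = (d' - c') / 2) by (unfold k; lra).
    rewrite Em, Ek in K1. rewrite Em', Ek in K2. rewrite Em, Ek' in K3. rewrite Em', Ek' in K4. lra.
  - intros z Hz. pose proof (cdiff_C_derive f z (H z Hz)) as Hd. set (l := C_derive f z) in *.
    destruct (Hd e He) as [dl [Hdl Kd]].
    exists (dl / 2). split; [lra|]. intros a' b' c' d' h1 h2 h3 h4 Hin h5 h6 _ _ _ _.
    assert (Hle : a' <= b' /\ c' <= d') by (unfold inrect in Hin; lra). destruct Hle as [Hab' Hcd'].
    assert (Hc' : rcontin f a' b' c' d') by (eapply rcontin_sub; eauto).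
    assert (Hc2 : rcontin (fun w => f z + l * (w - z))%C a' b' c' d').
    { intros w _. apply cdiff_cont. cdf. }
    replace (rectI f a' b' c' d') with
      (rectI (fun w => f w - (f z + l * (w - z)))%C a' b' c' d').
    2:{ rewrite rectI_minus; auto. rewrite rectI_affine; auto. ring. }
    replace (2 * e * ((b' - a' + (d' - c')) * (b' - a' + (d' - c')))) with
      (e * (b' - a' + (d' - c')) * (2 * ((b' - a') + (d' - c')))) by ring.
    apply rectI_bound; auto.
    + intros w Hw. apply (ccont_plus f (fun w => - (f z + l * (w - z)))%C); [apply Hc'; auto|].
      apply cdiff_cont. cdf.
    + intros w Hw. pose proof (Cmod_rect_diam _ _ _ _ z w Hin Hw).
      specialize (Kd w ltac:(lra)).
      replace (f w - (f z + l * (w - z)))%C with (f w - f z - l * (w - z))%C by ring. nra.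
Qed.

Lemma rectI_degenerate_h f a c d : rectI f a a c d = 0%C.
Proof. unfold rectI, Hseg. rewrite !CI_point. ring. Qed.

Lemma rectI_degenerate_v f a b c : rectI f a b c c = 0%C.
Proof. unfold rectI, Vseg. rewrite !CI_point. ring. Qed.

(* The exceptional point is enclosed in a square of side [2 e], where the integral is at most
   a bound of [f] times the perimeter. *)
Lemma goursat_rect_exc (f : C -> C) (p : C) a b c d : a <= b -> c <= d ->
  rcontin f a b c d -> (forall z, inrect a b c d z -> z <> p -> cdiff f z) -> rectI f a b c d = 0%C.
Proof.
  intros Hab Hcd Hc H.
  destruct (classic (inrect a b c d p)) as [Hp|Hp].
  2:{ apply goursat_rect; auto. intros z Hz. apply H; auto. intros ->; auto. }
  destruct p as [px py]. unfold inrect in Hp; simpl in Hp.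
  assert (Hs : forall e, 0 < e -> rectI f a b c d =
     rectI f (Rmax a (px - e)) (Rmin b (px + e)) (Rmax c (py - e)) (Rmin d (py + e))).
  { intros e He. set (a' := Rmax a (px - e)). set (b' := Rmin b (px + e)).
    set (c' := Rmax c (py - e)). set (d' := Rmin d (py + e)).
    assert (Ha : a <= a' /\ a' <= px /\ (a' = a \/ a' < px)) by (unfold a', Rmax; destruct Rle_dec; lra).
    assert (Hb : b' <= b /\ px <= b' /\ (b' = b \/ px < b')) by (unfold b', Rmin; destruct Rle_dec; lra).
    assert (Hc1 : c <= c' /\ c' <= py /\ (c' = c \/ c' < py)) by (unfold c', Rmax; destruct Rle_dec; lra).
    assert (Hd : d' <= d /\ py <= d' /\ (d' = d \/ py < d')) by (unfold d', Rmin; destruct Rle_dec; lra).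
    clearbody a' b' c' d'.
    rewrite (rectI_split_h f a a' b), (rectI_split_h f a' b' b); try lra; auto;
      try (eapply rcontin_sub; eauto; lra).
    assert (Z1 : rectI f a a' c d = 0%C).
    { destruct (Req_dec a' a) as [->|]; [apply rectI_degenerate_h|].
      apply goursat_rect; try lra. intros z Hz. apply H; [unfold inrect in *; lra|].
      intros ->. unfold inrect in Hz; simpl in Hz; lra. }
    assert (Z2 : rectI f b' b c d = 0%C).
    { destruct (Req_dec b' b) as [->|]; [apply rectI_degenerate_h|].
      apply goursat_rect; try lra. intros z Hz. apply H; [unfold inrect in *; lra|].
      intros ->. unfold inrect in Hz; simpl in Hz; lra. }
    rewrite Z1, Z2.
    rewrite (rectI_split_v f a' b' c c' d), (rectI_split_v f a' b' c' d' d); try lra; auto;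
      try (eapply rcontin_sub; eauto; lra).
    assert (Z3 : rectI f a' b' c c' = 0%C).
    { destruct (Req_dec c' c) as [->|]; [apply rectI_degenerate_v|].
      apply goursat_rect; try lra. intros z Hz. apply H; [unfold inrect in *; lra|].
      intros ->. unfold inrect in Hz; simpl in Hz; lra. }
    assert (Z4 : rectI f a' b' d' d = 0%C).
    { destruct (Req_dec d' d) as [->|]; [apply rectI_degenerate_v|].
      apply goursat_rect; try lra. intros z Hz. apply H; [unfold inrect in *; lra|].
      intros ->. unfold inrect in Hz; simpl in Hz; lra. }
    rewrite Z3, Z4. ring. }
  assert (Hcp : ccont f (px, py)) by (apply Hc; unfold inrect; simpl; auto).
  destruct (Hcp 1 Rlt_0_1) as [dl [Hdl K]].
  set (M := Cmod (f (px, py)) + 1). assert (HM : 0 < M) by (unfold M; pose proof (Cmod_ge_0 (f (px, py))); lra).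
  apply Cmod_eq0. apply Rnot_lt_le; intros Hpos.
  set (eta := Cmod (rectI f a b c d)) in *.
  set (e := Rmin (dl / 8) (eta / (16 * M))).
  assert (He : 0 < e) by (unfold e; apply Rmin_pos; [lra|apply Rdiv_lt_0_compat; lra]).
  assert (He1 : e <= dl / 8) by apply Rmin_l.
  assert (He2 : e * (16 * M) <= eta).
  { assert (Hh : e <= eta / (16 * M)) by apply Rmin_r. apply (Rmult_le_compat_r (16 * M)) in Hh; [|lra].
    replace (eta / (16 * M) * (16 * M)) with eta in Hh by (field; lra). auto. }
  unfold eta in He2, Hpos. rewrite (Hs e He) in He2.
  set (a' := Rmax a (px - e)) in *. set (b' := Rmin b (px + e)) in *.
  set (c' := Rmax c (py - e)) in *. set (d' := Rmin d (py + e)) in *.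
  assert (Ha : a <= a' /\ a' <= px /\ px - e <= a') by (unfold a', Rmax; destruct Rle_dec; lra).
  assert (Hb : b' <= b /\ px <= b' /\ b' <= px + e) by (unfold b', Rmin; destruct Rle_dec; lra).
  assert (Hc1 : c <= c' /\ c' <= py /\ py - e <= c') by (unfold c', Rmax; destruct Rle_dec; lra).
  assert (Hd : d' <= d /\ py <= d' /\ d' <= py + e) by (unfold d', Rmin; destruct Rle_dec; lra).
  clearbody a' b' c' d'.
  pose proof (rectI_bound f a' b' c' d' M ltac:(lra) ltac:(lra)) as B.
  assert (B' : Cmod (rectI f a' b' c' d') <= M * (2 * (b' - a' + (d' - c')))).
  { apply B; [eapply rcontin_sub; eauto; lra|]. intros z Hz.
    assert (Hpr : inrect a' b' c' d' (px, py)) by (unfold inrect; simpl; lra).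
    pose proof (Cmod_rect_diam _ _ _ _ _ _ Hpr Hz).
    specialize (K z ltac:(lra)). pose proof (Cmod_le_sub (f z) (f (px, py))). unfold M; lra. }
  assert (b' - a' + (d' - c') <= 4 * e) by lra.
  nra.
Qed.

Lemma CI_Chasles_gen (f : R -> C) a b c :
  (forall t, Rmin a b <= t <= Rmax a b -> rcont f t) ->
  (forall t, Rmin b c <= t <= Rmax b c -> rcont f t) ->
  CI f a c = (CI f a b + CI f b c)%C.
Proof.
  intros H1 H2. apply CI_unique.
  apply (@is_RInt_Chasles C_R_NormedModule) with b; apply CI_is; auto.
Qed.

Lemma Cmod_mono (a b a' b' : R) : Rabs a <= Rabs a' -> Rabs b <= Rabs b' ->
  Cmod (a, b) <= Cmod (a', b').
Proof.
  intros Ha Hb. unfold Cmod; simpl. apply sqrt_le_1_alt.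
  rewrite !Rmult_1_r. pose proof (Rsqr_le_abs_1 _ _ Ha). pose proof (Rsqr_le_abs_1 _ _ Hb).
  unfold Rsqr in *. lra.
Qed.

Lemma rectI_swap_h f a b c d : rcontin f (Rmin a b) (Rmax a b) (Rmin c d) (Rmax c d) ->
  rectI f b a c d = (- rectI f a b c d)%C.
Proof.
  intros H. unfold rectI, Hseg. pose proof (Rmin_l c d). pose proof (Rmin_r c d).
  pose proof (Rmax_l c d). pose proof (Rmax_r c d).
  rewrite (CI_swap (fun t => f (t, c)) a b), (CI_swap (fun t => f (t, d)) a b).
  - ring.
  - intros t Ht. apply rcont_fh. apply H. unfold inrect; simpl; lra.
  - intros t Ht. apply rcont_fh. apply H. unfold inrect; simpl; lra.
Qed.

Lemma rectI_swap_v f a b c d : rcontin f (Rmin a b) (Rmax a b) (Rmin c d) (Rmax c d) ->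
  rectI f a b d c = (- rectI f a b c d)%C.
Proof.
  intros H. unfold rectI, Vseg. pose proof (Rmin_l a b). pose proof (Rmin_r a b).
  pose proof (Rmax_l a b). pose proof (Rmax_r a b).
  rewrite (CI_swap (fun t => f (a, t)) c d), (CI_swap (fun t => f (b, t)) c d).
  - ring.
  - intros t Ht. apply rcont_fv. apply H. unfold inrect; simpl; lra.
  - intros t Ht. apply rcont_fv. apply H. unfold inrect; simpl; lra.
Qed.

(** The primitive is built from rectangles whose corners come in any order; exchanging the two ends
    of a coordinate range only changes the sign. *)
Lemma goursat_rect_unordered (f : C -> C) (p : C) a b c d :
  rcontin f (Rmin a b) (Rmax a b) (Rmin c d) (Rmax c d) ->
  (forall z, inrect (Rmin a b) (Rmax a b) (Rmin c d) (Rmax c d) z -> z <> p -> cdiff f z) ->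
  rectI f a b c d = 0%C.
Proof.
  intros Hc Hd.
  assert (G : rectI f (Rmin a b) (Rmax a b) (Rmin c d) (Rmax c d) = 0%C).
  { apply (goursat_rect_exc f p); auto; apply Rminmax. }
  assert (E1 : rectI f a b (Rmin c d) (Rmax c d) = 0%C).
  { unfold Rmin at 1, Rmax at 1 in G. destruct (Rle_dec a b); auto.
    rewrite rectI_swap_h, G; [ring|].
    rewrite (Rmin_comm b a), (Rmax_comm b a), (Rmin_left (Rmin c d) (Rmax c d)), (Rmax_right (Rmin c d) (Rmax c d)) by apply Rminmax. auto. }
  unfold Rmin at 1, Rmax at 1 in E1. destruct (Rle_dec c d); auto.
  rewrite rectI_swap_v, E1; [ring|]. rewrite (Rmin_comm d c), (Rmax_comm d c). auto.
Qed.

Lemma Rabs_between x x' t x0 : Rmin x x' <= t <= Rmax x x' ->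
  Rabs (t - x0) <= Rabs (x - x0) \/ Rabs (t - x0) <= Rabs (x' - x0).
Proof.
  intros H. unfold Rmin, Rmax in H. destruct (Rle_dec x x'); unfold Rabs; repeat destruct Rcase_abs; lra.
Qed.

Lemma im_le_Cmod (z : C) : Rabs (Im z) <= Cmod z.
Proof.
  replace (Im z) with (- Re (z * Ci)) by (rewrite re_mult_Ci; ring). rewrite Rabs_Ropp.
  eapply Rle_trans; [apply re_le_Cmod|]. rewrite Cmod_mult, Cmod_Ci. lra.
Qed.

(** The primitive is the integral from the centre along a horizontal and then a vertical segment.
    Goursat on one rectangle moves the vertical leg to another abscissa, so that an increment
    becomes an integral over two short segments near [z]. One point [p] of mere continuity is
    allowed with a view to divided differences. *)
Lemma primitive_ball (f : C -> C) (p z0 : C) (R : R) :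
  (forall z, cball z0 R z -> ccont f z) -> (forall z, cball z0 R z -> z <> p -> cdiff f z) ->
  exists F, forall z, cball z0 R z -> cder F z (f z).
Proof.
  intros Hc Hd. destruct z0 as [x0 y0].
  exists (fun z => CI (fun t => f (t, y0)) x0 (fst z) + Ci * CI (fun t => f (fst z, t)) y0 (snd z))%C.
  intros [x y] Hz e He.
  destruct (Hc _ Hz (e / 2)) as [d1 [Hd1 K1]]; [lra|].
  destruct (open_cball _ _ _ Hz) as [d2 [Hd2 K2]].
  exists (Rmin d1 d2). split; [apply Rmin_pos; auto|]. intros [x' y'] Hw.
  pose proof (Rmin_l d1 d2). pose proof (Rmin_r d1 d2).
  set (h := Cmod ((x', y') - (x, y))) in *.
  assert (Hhx : Rabs (x' - x) <= h) by exact (re_le_Cmod (((x', y') : C) - (x, y))%C).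
  assert (Hhy : Rabs (y' - y) <= h) by exact (im_le_Cmod (((x', y') : C) - (x, y))%C).
  assert (Hnear : forall t s, Rmin x x' <= t <= Rmax x x' -> Rmin y y' <= s <= Rmax y y' ->
            Cmod ((t, s) - (x, y)) <= h).
  { intros t s Ht Hs. apply Cmod_mono; simpl.
    - change (Rabs (t - x) <= Rabs (x' - x)).
      destruct (Rabs_between x x' t x Ht) as [hh|hh]; auto.
      replace (x - x) with 0 in hh by ring. rewrite Rabs_R0 in hh. pose proof (Rabs_pos (x' - x)); lra.
    - change (Rabs (s - y) <= Rabs (y' - y)).
      destruct (Rabs_between y y' s y Hs) as [hh|hh]; auto.
      replace (y - y) with 0 in hh by ring. rewrite Rabs_R0 in hh. pose proof (Rabs_pos (y' - y)); lra. }
  assert (Hin : forall t s, Rmin x x' <= t <= Rmax x x' -> Rmin y0 y <= s <= Rmax y0 y ->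
            cball (x0, y0) R (t, s)).
  { intros t s Ht Hs.
    assert (Hs' : Rabs (s - y0) <= Rabs (y - y0)).
    { destruct (Rabs_between y0 y s y0 Hs) as [hh|hh]; auto.
      replace (y0 - y0) with 0 in hh by ring. rewrite Rabs_R0 in hh. pose proof (Rabs_pos (y - y0)); lra. }
    destruct (Rabs_between x x' t x0 Ht) as [hh|hh].
    - eapply Rle_lt_trans; [|apply Hz]. apply Cmod_mono; auto.
    - assert (Hz' : cball (x0, y0) R (x', y)).
      { apply K2. eapply Rle_lt_trans; [apply Hnear|]; [| |lra].
        - split; [apply Rmin_r|apply Rmax_r].
        - split; [apply Rmin_l|apply Rmax_l]. }
      eapply Rle_lt_trans; [|apply Hz']. apply Cmod_mono; auto. }
  assert (Hax : forall u v, cball (x0, y0) R (u, v) -> forall t, Rmin x0 u <= t <= Rmax x0 u -> cball (x0, y0) R (t, y0)).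
  { intros u v Huv t Ht. eapply Rle_lt_trans; [|apply Huv]. apply Cmod_mono; simpl.
    - destruct (Rabs_between x0 u t x0 Ht) as [hh|hh]; auto.
      replace (x0 - x0) with 0 in hh by ring. rewrite Rabs_R0 in hh.
      pose proof (Rabs_pos (u - x0)). unfold Rminus in *; lra.
    - replace (y0 + - y0) with 0 by ring. rewrite Rabs_R0. apply Rabs_pos. }
  assert (Hx : Rmin x x' <= x <= Rmax x x') by (split; [apply Rmin_l|apply Rmax_l]).
  assert (Hx' : Rmin x x' <= x' <= Rmax x x') by (split; [apply Rmin_r|apply Rmax_r]).
  assert (Hy : Rmin y0 y <= y <= Rmax y0 y) by (split; [apply Rmin_r|apply Rmax_r]).
  assert (Hy0 : Rmin y0 y <= y0 <= Rmax y0 y) by (split; [apply Rmin_l|apply Rmax_l]).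
  (* This rectangle trades the vertical leg at [x'] for the one at [x]. It lies in the ball, as each
     of its points is at most as far from the centre as [(x, y)] or [(x', y)]. *)
  assert (HJ : rectI f x x' y0 y = 0%C).
  { apply (goursat_rect_unordered f p).
    - intros [t s] [h1 h2]. simpl in h1, h2. apply Hc, Hin; auto.
    - intros [t s] [h1 h2]. simpl in h1, h2. apply Hd, Hin; auto. }
  assert (E1 : CI (fun t => f (t, y0)) x0 x' = (CI (fun t => f (t, y0)) x0 x + CI (fun t => f (t, y0)) x x')%C).
  { apply CI_Chasles_gen; intros t Ht; apply rcont_fh, Hc; [eapply Hax; eauto|apply Hin; auto]. }
  assert (E2 : CI (fun t => f (x', t)) y0 y' = (CI (fun t => f (x', t)) y0 y + CI (fun t => f (x', t)) y y')%C).
  { apply CI_Chasles_gen; intros t Ht; apply rcont_fv, Hc; [apply Hin; auto|].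
    apply K2. eapply Rle_lt_trans; [apply Hnear; auto|lra]. }
  cbn [fst snd]. rewrite E1, E2. unfold rectI, Hseg, Vseg in HJ.
  set (A := CI (fun t => f (t, y0)) x0 x) in *. set (B := CI (fun t => f (t, y0)) x x') in *.
  set (D := CI (fun t => f (x', t)) y0 y) in *. set (G := CI (fun t => f (x, t)) y0 y) in *.
  pose proof (CI_dep (fun t => f (t, y)) x x' (f (x, y)) (e / 2)) as B1.
  pose proof (CI_dep (fun t => f (x', t)) y y' (f (x, y)) (e / 2)) as B2.
  set (I1 := CI (fun t => f (t, y)) x x') in *. set (I2 := CI (fun t => f (x', t)) y y') in *.
  replace (A + B + Ci * (D + I2) - (A + Ci * G) - f (x, y) * ((x', y') - (x, y)))%C with
    ((B + Ci * D - I1 - Ci * G) + ((I1 - f (x, y) * (x' - x)) + Ci * (I2 - f (x, y) * (y' - y))))%C.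
  2:{ replace (((x', y') : C) - (x, y))%C with ((x' - x) + Ci * (y' - y))%C.
      - ring.
      - unfold Ci, RtoC, Cminus, Cplus, Copp, Cmult; simpl. f_equal; ring. }
  rewrite HJ, Cplus_0_l. eapply Rle_trans; [apply Cmod_triangle|].
  rewrite Cmod_mult, Cmod_Ci, Rmult_1_l.
  assert (B1' : Cmod (I1 - f (x, y) * (x' - x)) <= e / 2 * Rabs (x' - x)).
  { apply B1.
    - intros t Ht. apply rcont_fh, Hc, Hin; auto.
    - intros t Ht. apply Rlt_le, K1. eapply Rle_lt_trans; [apply Hnear; auto|lra].
      split; [apply Rmin_l|apply Rmax_l]. }
  assert (B2' : Cmod (I2 - f (x, y) * (y' - y)) <= e / 2 * Rabs (y' - y)).
  { apply B2.
    - intros t Ht. apply rcont_fv, Hc, K2. eapply Rle_lt_trans; [apply Hnear; auto|lra].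
    - intros t Ht. apply Rlt_le, K1. eapply Rle_lt_trans; [apply Hnear; auto|lra]. }
  assert (e / 2 * Rabs (x' - x) <= e / 2 * h) by (apply Rmult_le_compat_l; lra).
  assert (e / 2 * Rabs (y' - y) <= e / 2 * h) by (apply Rmult_le_compat_l; lra).
  lra.
Qed.

(** * Integrals over circles and their dependence on a parameter *)

Definition cis (t : R) : C := (cos t, sin t).

Lemma Cmod_cis t : Cmod (cis t) = 1.
Proof.
  unfold Cmod, cis; simpl. pose proof (sin2_cos2 t). unfold Rsqr in H.
  replace (cos t * (cos t * 1) + sin t * (sin t * 1)) with 1 by lra. apply sqrt_1.
Qed.

Lemma Cmod_le_parts (z : C) : Cmod z <= Rabs (fst z) + Rabs (snd z).
Proof.
  destruct z as [a b]; simpl. replace ((a, b) : C) with (RtoC a + Ci * RtoC b)%C.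
  - eapply Rle_trans; [apply Cmod_triangle|]. rewrite Cmod_mult, Cmod_Ci, !Cmod_R. lra.
  - unfold Ci, RtoC, Cplus, Cmult; simpl. f_equal; ring.
Qed.

Lemma derivable_small (f : R -> R) (x l : R) : derivable_pt_lim f x l -> forall e, 0 < e ->
  exists d, 0 < d /\ forall s, Rabs (s - x) < d -> Rabs (f s - f x - l * (s - x)) <= e * Rabs (s - x).
Proof.
  intros H e He. destruct (H e He) as [d K]. exists d; split; [apply cond_pos|].
  intros s Hs. destruct (Req_dec s x) as [->|Hn].
  - replace (f x - f x - l * (x - x)) with 0 by ring. rewrite Rabs_R0. pose proof (Rabs_pos (x - x)); nra.
  - specialize (K (s - x) ltac:(lra) Hs). replace (x + (s - x)) with s in K by ring.
    replace (f s - f x - l * (s - x)) with (((f s - f x) / (s - x) - l) * (s - x)) by (field; lra).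
    rewrite Rabs_mult. apply Rmult_le_compat_r; [apply Rabs_pos|lra].
Qed.

Lemma rder_pair (f g : R -> R) (t a b : R) : derivable_pt_lim f t a -> derivable_pt_lim g t b ->
  rder (fun s => (f s, g s) : C) t (a, b).
Proof.
  intros Hf Hg e He. destruct (derivable_small _ _ _ Hf (e / 2)) as [d [Hd K]]; [lra|].
  destruct (derivable_small _ _ _ Hg (e / 2)) as [d' [Hd' K']]; [lra|].
  exists (Rmin d d'). split; [apply Rmin_pos; auto|]. intros s Hs.
  pose proof (Rmin_l d d'). pose proof (Rmin_r d d').
  specialize (K s ltac:(lra)). specialize (K' s ltac:(lra)).
  eapply Rle_trans; [apply Cmod_le_parts|]. simpl.
  replace (f s + - f t + - (a * (s + - t) - b * (0 + - 0))) with (f s - f t - a * (s - t)) by ring.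
  replace (g s + - g t + - (a * (0 + - 0) + b * (s + - t))) with (g s - g t - b * (s - t)) by ring.
  lra.
Qed.

Lemma rder_cis t : rder cis t (Ci * cis t)%C.
Proof.
  replace (Ci * cis t)%C with ((- sin t, cos t) : C).
  - apply (rder_pair cos sin); [apply derivable_pt_lim_cos|apply derivable_pt_lim_sin].
  - unfold Ci, cis, Cmult; simpl. f_equal; ring.
Qed.

Definition circ (z0 : C) (r : R) (t : R) : C := (z0 + r * cis t)%C.

Lemma rder_circ z0 r t : rder (circ z0 r) t (Ci * (r * cis t))%C.
Proof.
  replace (Ci * (r * cis t))%C with ((0 + (0 * cis t + r * 1)) * (Ci * cis t))%C by ring.
  unfold circ. apply (rder_comp (fun w => z0 + r * w)%C cis); [|apply rder_cis].
  cdr.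
Qed.

Lemma rcont_cis t : rcont cis t.
Proof. eapply rder_cont, rder_cis. Qed.

Lemma rcont_circ z0 r t : rcont (circ z0 r) t.
Proof. eapply rder_cont, rder_circ. Qed.

Lemma continuous_R_eps (f : R -> R) t : continuous f t -> forall e, 0 < e ->
  exists d, 0 < d /\ forall s, Rabs (s - t) < d -> Rabs (f s - f t) < e.
Proof.
  intros H e He. apply locally_Rabs. apply (H (fun y => Rabs (y - f t) < e)).
  apply locally_Rabs. exists e; auto.
Qed.

Lemma rcont_mult (f g : R -> C) t : rcont f t -> rcont g t -> rcont (fun s => f s * g s)%C t.
Proof.
  intros Hf Hg. apply rcont_continuous in Hf. apply rcont_continuous in Hg.
  assert (Hf1 : continuous (fun s => fst (f s)) t).
  { apply (continuous_comp f fst); [exact Hf|]. apply continuous_fst. }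
  assert (Hf2 : continuous (fun s => snd (f s)) t).
  { apply (continuous_comp f snd); [exact Hf|]. apply continuous_snd. }
  assert (Hg1 : continuous (fun s => fst (g s)) t).
  { apply (continuous_comp g fst); [exact Hg|]. apply continuous_fst. }
  assert (Hg2 : continuous (fun s => snd (g s)) t).
  { apply (continuous_comp g snd); [exact Hg|]. apply continuous_snd. }
  clear Hf Hg. intros e He.
  assert (C1 : continuous (fun s => fst (f s) * fst (g s) - snd (f s) * snd (g s)) t).
  { apply (continuous_minus (fun s => fst (f s) * fst (g s)) (fun s => snd (f s) * snd (g s)));
    apply (@continuous_mult R_UniformSpace R_AbsRing); auto. }
  assert (C2 : continuous (fun s => fst (f s) * snd (g s) + snd (f s) * fst (g s)) t).
  { apply (continuous_plus (fun s => fst (f s) * snd (g s)) (fun s => snd (f s) * fst (g s)));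
    apply (@continuous_mult R_UniformSpace R_AbsRing); auto. }
  destruct (continuous_R_eps _ _ C1 (e / 2)) as [d [Hd K]]; [lra|].
  destruct (continuous_R_eps _ _ C2 (e / 2)) as [d' [Hd' K']]; [lra|].
  exists (Rmin d d'). split; [apply Rmin_pos; auto|]. intros s Hs.
  pose proof (Rmin_l d d'). pose proof (Rmin_r d d').
  specialize (K s ltac:(lra)). specialize (K' s ltac:(lra)).
  eapply Rle_lt_trans; [apply Cmod_le_parts|]. simpl. unfold Rminus in *. lra.
Qed.

Lemma circI_primitive (G g : C -> C) z0 r :
  (forall t, cder G (circ z0 r t) (g (circ z0 r t))) -> (forall t, ccont g (circ z0 r t)) ->
  CI (fun t => g (circ z0 r t) * (r * cis t))%C 0 (2 * PI) = 0%C.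
Proof.
  intros HG Hg.
  assert (Hc : forall t, rcont (fun t => g (circ z0 r t) * (r * cis t))%C t).
  { intros t. apply rcont_mult; [apply (rcont_comp g); auto; apply rcont_circ|].
    apply (rcont_mult (fun _ => RtoC r) cis); [apply rcont_const|apply rcont_cis]. }
  assert (E : (Ci * CI (fun t => g (circ z0 r t) * (r * cis t)) 0 (2 * PI) = 0)%C).
  { rewrite <- CI_cmul by auto.
    rewrite (CI_FTC (fun t => G (circ z0 r t))).
    - unfold circ, cis. rewrite cos_2PI, sin_2PI, cos_0, sin_0. ring.
    - intros t _. replace (Ci * (g (circ z0 r t) * (r * cis t)))%C with (g (circ z0 r t) * (Ci * (r * cis t)))%C by ring.
      apply (rder_comp G); auto. apply rder_circ.
    - intros t _. apply (rcont_mult (fun _ => Ci)); auto. apply rcont_const. }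
  destruct (Ceq_dec (CI (fun t => g (circ z0 r t) * (r * cis t))%C 0 (2 * PI)) 0) as [e|n]; auto.
  exfalso. apply (Cmult_neq_0 Ci _ Ci_nz n). exact E.
Qed.

(** A quadratic remainder that is uniform in [t] integrates to a quadratic remainder, which is more
    than differentiability asks. *)
Lemma CI_param (k : C -> R -> C) (k' : R -> C) (a b C0 rho : R) (w : C) : 0 < rho ->
  (forall h t, Cmod h < rho -> rcont (k (w + h)%C) t) -> (forall t, rcont k' t) ->
  (forall h t, Cmod h < rho -> Cmod (k (w + h)%C t - k w t - h * k' t) <= C0 * (Cmod h * Cmod h)) ->
  cder (fun w => CI (k w) a b) w (CI k' a b).
Proof.
  intros Hr Hk Hk' HB e He.
  assert (HC0 : 0 <= Rabs C0) by apply Rabs_pos.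
  set (L := Rabs (b - a)). assert (HL : 0 <= L) by apply Rabs_pos.
  exists (Rmin rho (e / (1 + Rabs C0 * L))).
  assert (H1 : 0 < 1 + Rabs C0 * L) by nra.
  split; [apply Rmin_pos; [auto|apply Rdiv_lt_0_compat; lra]|].
  intros v Hv. set (h := (v - w)%C) in *.
  pose proof (Rmin_l rho (e / (1 + Rabs C0 * L))). pose proof (Rmin_r rho (e / (1 + Rabs C0 * L))).
  assert (Hh : Cmod h < rho) by lra.
  assert (Hkw : forall t, rcont (k w) t).
  { intros t. replace w with (w + 0)%C by ring. apply Hk. rewrite Cmod_0; auto. }
  assert (Hkv : forall t, rcont (k v) t).
  { intros t. replace v with (w + h)%C by (unfold h; ring). apply Hk; auto. }
  assert (Ehk : forall t, rcont (fun t => h * k' t)%C t).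
  { intros t. apply (rcont_mult (fun _ => h)); auto. apply rcont_const. }
  assert (Hm : forall f g, (forall t, rcont f t) -> (forall t, rcont g t) -> forall t, rcont (fun s => f s - g s)%C t).
  { intros f g Hf Hg t e' He'. destruct (Hf t (e' / 2)) as [d [Hd K]]; [lra|].
    destruct (Hg t (e' / 2)) as [d' [Hd' K']]; [lra|].
    exists (Rmin d d'). split; [apply Rmin_pos; auto|]. intros s Hs.
    pose proof (Rmin_l d d'). pose proof (Rmin_r d d').
    specialize (K s ltac:(lra)). specialize (K' s ltac:(lra)).
    replace (f s - g s - (f t - g t))%C with ((f s - f t) + - (g s - g t))%C by ring.
    pose proof (Cmod_triangle (f s - f t) (- (g s - g t))) as HT. rewrite Cmod_opp in HT. lra. }
  rewrite Cmult_comm, <- CI_cmul, <- !CI_minus; auto.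
  eapply Rle_trans. apply (CI_bound _ a b (Rabs C0 * (Cmod h * Cmod h))).
  - intros t _. apply (Hm (fun t => k v t - k w t)%C); auto.
  - intros t _. replace v with (w + h)%C by (unfold h; ring). eapply Rle_trans; [apply HB; auto|].
    apply Rmult_le_compat_r; [|apply Rle_abs]. pose proof (Cmod_ge_0 h); nra.
  - fold L. pose proof (Cmod_ge_0 h).
    assert (Cmod h * (1 + Rabs C0 * L) <= e).
    { assert (Hx : Cmod h <= e / (1 + Rabs C0 * L)) by lra.
      apply (Rmult_le_compat_r (1 + Rabs C0 * L)) in Hx; [|lra].
      replace (e / (1 + Rabs C0 * L) * (1 + Rabs C0 * L)) with e in Hx by (field; lra). auto. }
    assert (Rabs C0 * L * Cmod h <= e) by lra. nra.
Qed.

Lemma circ_dist z0 r w t : Cmod (w - z0) < r -> r - Cmod (w - z0) <= Cmod (circ z0 r t - w).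
Proof.
  intros H. pose proof (Cmod_ge_0 (w - z0)).
  pose proof (Cmod_sub_tri (circ z0 r t) w z0).
  assert (E : Cmod (circ z0 r t - z0) = r).
  { unfold circ. replace (z0 + r * cis t - z0)%C with (r * cis t)%C by ring.
    rewrite Cmod_mult, Cmod_cis, Cmod_R, Rabs_pos_eq; lra. }
  lra.
Qed.

Lemma rcont_div (u v : R -> C) t : v t <> 0%C -> rcont u t -> rcont v t -> rcont (fun s => u s / v s)%C t.
Proof.
  intros Hn Hu Hv. apply rcont_mult; auto. apply (rcont_comp (fun z => / z)%C v); auto.
  apply ccont_inv_id; auto.
Qed.

Lemma rcont_sub_const (v : R -> C) (w : C) t : rcont v t -> rcont (fun s => v s - w)%C t.
Proof.
  intros Hv. apply (rcont_comp (fun z => z - w)%C v); auto. apply cdiff_cont. cdf.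
Qed.

(** Since [dz = i r cis t dt], the choice [u t = f (circ z0 r t) * (r * cis t)] makes this the
    Cauchy integral divided by [i]; hence the constant [2 PI] instead of [2 PI i] in the formulas
    below. *)
Definition cauchyI (n : nat) (u : R -> C) (z0 : C) (r : R) (w : C) : C :=
  CI (fun t => u t / (circ z0 r t - w) ^ n)%C 0 (2 * PI).

Lemma rcont_bounded_period (u : R -> C) : (forall t, rcont u t) ->
  exists M, 0 < M /\ forall t, 0 <= t <= 2 * PI -> Cmod (u t) <= M.
Proof.
  intros Hu.
  assert (Hc : forall t, 0 <= t <= 2 * PI -> continuity_pt (fun t => Cmod (u t)) t).
  { intros t _ e He. destruct (Hu t e He) as [d [Hd K]]. exists d; split; auto.
    intros s [_ Hs]. simpl in *. unfold R_dist in *.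
    specialize (K s Hs). pose proof (Cmod_le_sub (u s) (u t)). pose proof (Cmod_le_sub (u t) (u s)).
    rewrite Cmod_sub_sym in H0. apply Rabs_def1; lra. }
  destruct (continuity_ab_maj (fun t => Cmod (u t)) 0 (2 * PI)) as [m [Hm _]]; auto.
  { pose proof PI_RGT_0; lra. }
  exists (1 + Cmod (u m)). split; [pose proof (Cmod_ge_0 (u m)); lra|]. intros t Ht. specialize (Hm t Ht). simpl in Hm. lra.
Qed.

Lemma CI_param_circle (k : C -> R -> C) (k' : R -> C) (C0 rho : R) (w : C) (u : R -> C) : 0 < rho ->
  (forall t, rcont u t) ->
  (forall h t, Cmod h < rho -> rcont (k (w + h)%C) t) -> (forall t, rcont k' t) ->
  (forall h t, Cmod h < rho -> Cmod (k (w + h)%C t - k w t - h * k' t) <= C0 * (Cmod h * Cmod h)) ->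
  cder (fun w => CI (fun t => u t * k w t)%C 0 (2 * PI)) w (CI (fun t => u t * k' t)%C 0 (2 * PI)).
Proof.
  intros Hr Hu Hk Hk' HB.
  destruct (rcont_bounded_period u Hu) as [M [HM HuM]].
  (* The parameter is clamped to one period, because [CI_param] wants bounds for every real [t],
     while [u] is only known to be bounded there. *)
  set (cl := fun t => Rmax 0 (Rmin t (2 * PI))).
  assert (HPI := PI_RGT_0).
  assert (Hcl : forall t, 0 <= cl t <= 2 * PI).
  { intros t. unfold cl, Rmax, Rmin. repeat destruct Rle_dec; lra. }
  assert (Hclid : forall t, 0 < t < 2 * PI -> cl t = t).
  { intros t Ht. unfold cl, Rmax, Rmin. repeat destruct Rle_dec; lra. }
  assert (Hclc : forall (f : R -> C), (forall t, rcont f t) -> forall t, rcont (fun t => f (cl t)) t).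
  { intros f Hf t e He. destruct (Hf (cl t) e He) as [d [Hd K]]. exists d; split; auto.
    intros s Hs. apply K. eapply Rle_lt_trans; [|apply Hs].
    unfold cl, Rmax, Rmin. repeat destruct Rle_dec; unfold Rabs; repeat destruct Rcase_abs; lra. }
  assert (E : forall f : R -> C, CI f 0 (2 * PI) = CI (fun t => f (cl t)) 0 (2 * PI)).
  { intros f. apply CI_ext. intros t Ht. rewrite Rmin_left, Rmax_right in Ht by lra. rewrite Hclid; auto. }
  rewrite (E (fun t => u t * k' t)%C).
  apply cder_ext with (fun w => CI (fun t => u (cl t) * k w (cl t))%C 0 (2 * PI)).
  { exists 1; split; [lra|]. intros v _. rewrite (E (fun t => u t * k v t)%C). reflexivity. }
  apply (CI_param (fun w t => u (cl t) * k w (cl t))%C (fun t => u (cl t) * k' (cl t))%C _ _ (M * Rabs C0) rho w Hr).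
  - intros h t Hh. apply (Hclc (fun t => u t * k (w + h) t)%C). intros. apply rcont_mult; auto.
  - intros t. apply (Hclc (fun t => u t * k' t)%C). intros. apply rcont_mult; auto.
  - intros h t Hh.
    replace (u (cl t) * k (w + h) (cl t) - u (cl t) * k w (cl t) - h * (u (cl t) * k' (cl t)))%C
      with (u (cl t) * (k (w + h) (cl t) - k w (cl t) - h * k' (cl t)))%C by ring.
    rewrite Cmod_mult, Rmult_assoc. apply Rmult_le_compat; try apply Cmod_ge_0; auto.
    eapply Rle_trans; [apply HB; auto|]. apply Rmult_le_compat_r; [|apply Rle_abs].
    pose proof (Cmod_ge_0 h); nra.
Qed.

Lemma Cmod_div_le (a b : C) (m d : R) : 0 < d -> d <= Cmod b -> Cmod a <= m -> Cmod (a / b) <= m / d.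
Proof.
  intros Hd Hb Ha. pose proof (Cmod_ge_0 a).
  rewrite Cmod_div; [|apply Cmod_pos_neq; lra].
  unfold Rdiv. apply Rmult_le_compat; auto; [apply Rlt_le, Rinv_0_lt_compat; lra|].
  apply Rinv_le_contravar; auto.
Qed.

Lemma cauchyI_1_der u z0 r w : (forall t, rcont u t) -> Cmod (w - z0) < r ->
  cder (cauchyI 1 u z0 r) w (cauchyI 2 u z0 r w).
Proof.
  intros Hu Hw. set (d := (r - Cmod (w - z0)) / 2). assert (Hd : 0 < d) by (unfold d; lra).
  assert (Hz : forall h t, Cmod h < d -> d <= Cmod (circ z0 r t - (w + h))).
  { intros h t Hh. pose proof (Cmod_triangle (w - z0) h).
    replace (w - z0 + h)%C with (w + h - z0)%C in H by ring.
    pose proof (circ_dist z0 r (w + h) t ltac:(unfold d in *; lra)). unfold d in *; lra. }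
  assert (Hz0 : forall t, d <= Cmod (circ z0 r t - w)).
  { intros t. pose proof (circ_dist z0 r w t Hw). unfold d in *. lra. }
  apply cder_ext with (fun w => CI (fun t => u t * / (circ z0 r t - w))%C 0 (2 * PI)).
  { exists 1; split; [lra|]. intros v _. unfold cauchyI. apply CI_ext. intros. simpl. rewrite Cmult_1_r. reflexivity. }
  unfold cauchyI.
  apply (CI_param_circle (fun w t => / (circ z0 r t - w))%C (fun t => / (circ z0 r t - w) ^ 2)%C (/ (d * d * d)) d); auto.
  - intros h t Hh. apply (rcont_comp (fun z => / z)%C).
    + apply ccont_inv_id, Cmod_pos_neq. specialize (Hz h t Hh). lra.
    + apply rcont_sub_const, rcont_circ.
  - intros t. apply (rcont_comp (fun z => / (z - w) ^ 2)%C (circ z0 r)); [|apply rcont_circ].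
    apply cdiff_cont. simpl. specialize (Hz0 t).
    assert (circ z0 r t - w <> 0)%C by (apply Cmod_pos_neq; lra).
    cdf. repeat apply Cmult_neq_0; auto. apply C1_nz.
  - intros h t Hh. specialize (Hz h t Hh). specialize (Hz0 t).
    set (A := (circ z0 r t - w)%C) in *. set (B := (circ z0 r t - (w + h))%C) in *.
    assert (A <> 0%C) by (apply Cmod_pos_neq; lra). assert (B <> 0%C) by (apply Cmod_pos_neq; lra).
    replace (/ B - / A - h * / A ^ 2)%C with (h * h / (B * (A * A)))%C.
    2:{ replace h with (A - B)%C by (unfold A, B; ring). field. split; auto. }
    replace (/ (d * d * d) * (Cmod h * Cmod h)) with (Cmod h * Cmod h / (d * (d * d))) by (field; lra).
    assert (0 < d * d) by nra. assert (d * d <= Cmod A * Cmod A) by nra.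
    apply Cmod_div_le; rewrite ?Cmod_mult; [nra| |lra]. apply Rmult_le_compat; lra.
Qed.

Lemma cauchyI_2_der u z0 r w : (forall t, rcont u t) -> Cmod (w - z0) < r ->
  cder (cauchyI 2 u z0 r) w (2 * cauchyI 3 u z0 r w)%C.
Proof.
  intros Hu Hw. set (d := (r - Cmod (w - z0)) / 2). assert (Hd : 0 < d) by (unfold d; lra).
  assert (Hz : forall h t, Cmod h < d -> d <= Cmod (circ z0 r t - (w + h))).
  { intros h t Hh. pose proof (Cmod_triangle (w - z0) h).
    replace (w - z0 + h)%C with (w + h - z0)%C in H by ring.
    pose proof (circ_dist z0 r (w + h) t ltac:(unfold d in *; lra)). unfold d in *; lra. }
  assert (Hz0 : forall t, d <= Cmod (circ z0 r t - w)).
  { intros t. pose proof (circ_dist z0 r w t Hw). unfold d in *. lra. }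
  assert (Hc3 : forall t, rcont (fun t => / (circ z0 r t - w) ^ 3)%C t).
  { intros t. apply (rcont_comp (fun z => / (z - w) ^ 3)%C (circ z0 r)); [|apply rcont_circ].
    apply cdiff_cont. simpl. specialize (Hz0 t).
    assert (circ z0 r t - w <> 0)%C by (apply Cmod_pos_neq; lra).
    cdf. repeat apply Cmult_neq_0; auto. apply C1_nz. }
  unfold cauchyI. rewrite <- CI_cmul.
  2:{ intros t _. apply rcont_mult; auto. }
  replace (CI (fun t => 2 * (u t / (circ z0 r t - w) ^ 3))%C 0 (2 * PI)) with
    (CI (fun t => u t * (2 * / (circ z0 r t - w) ^ 3))%C 0 (2 * PI)).
  2:{ apply CI_ext. intros. unfold Cdiv. ring. }
  apply (CI_param_circle (fun w t => / (circ z0 r t - w) ^ 2)%C (fun t => 2 * / (circ z0 r t - w) ^ 3)%C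
     (4 * / (d * d * d * d)) d); auto.
  - intros h t Hh. apply (rcont_comp (fun z => / (z - (w + h)) ^ 2)%C (circ z0 r)); [|apply rcont_circ].
    apply cdiff_cont. simpl. specialize (Hz h t Hh).
    assert (circ z0 r t - (w + h) <> 0)%C by (apply Cmod_pos_neq; lra).
    cdf. repeat apply Cmult_neq_0; auto. apply C1_nz.
  - intros t. apply (rcont_mult (fun _ => RtoC 2)); auto. apply rcont_const.
  - intros h t Hh. specialize (Hz h t Hh). specialize (Hz0 t).
    set (A := (circ z0 r t - w)%C) in *. set (B := (circ z0 r t - (w + h))%C) in *.
    assert (A <> 0%C) by (apply Cmod_pos_neq; lra). assert (B <> 0%C) by (apply Cmod_pos_neq; lra).
    (* with [A = B + h]: [A^3 - A B^2 - 2 h B^2 = h^2 (3 B + h)], and [3 B + h = 2 B + A] *)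
    replace (/ B ^ 2 - / A ^ 2 - h * (2 * / A ^ 3))%C with (h * h * (2 / (A * A * (A * B)) + 1 / (A * A * (B * B))))%C.
    2:{ replace h with (A - B)%C by (unfold A, B; ring). field. split; auto. }
    rewrite !Cmod_mult.
    replace (4 * / (d * d * d * d) * (Cmod h * Cmod h)) with (Cmod h * Cmod h * (2 / (d * d * (d * d)) + 2 / (d * d * (d * d)))) by (field; lra).
    pose proof (Cmod_ge_0 h).
    apply Rmult_le_compat_l; [nra|]. eapply Rle_trans; [apply Cmod_triangle|].
    assert (0 < d * d) by nra. assert (d * d <= Cmod A * Cmod A) by nra.
    assert (d * d <= Cmod B * Cmod B) by nra. assert (d * d <= Cmod A * Cmod B) by nra.
    apply Rplus_le_compat; apply Cmod_div_le; rewrite ?Cmod_mult.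
    + nra.
    + apply Rmult_le_compat; lra.
    + rewrite Cmod_R, Rabs_pos_eq; lra.
    + nra.
    + apply Rmult_le_compat; lra.
    + rewrite Cmod_R, Rabs_pos_eq; lra.
Qed.

(** * Cauchy's formula and its consequences *)

Lemma seg_FTC (F f : C -> C) (w z : C) :
  (forall t, 0 <= t <= 1 -> cder F (w + (z - w) * t)%C (f (w + (z - w) * t)%C)) ->
  (forall t, 0 <= t <= 1 -> ccont f (w + (z - w) * t)%C) ->
  (F z - F w = CI (fun t => f (w + (z - w) * t) * (z - w)) 0 1)%C.
Proof.
  intros HF Hf. symmetry. rewrite (CI_FTC (fun t => F (w + (z - w) * t)%C)).
  - f_equal; f_equal; f_equal; ring.
  - intros t Ht. rewrite Rmin_left, Rmax_right in Ht by lra.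
    apply (rder_comp F (fun t => w + (z - w) * t)%C); auto. apply rder_affine.
  - intros t Ht. rewrite Rmin_left, Rmax_right in Ht by lra.
    apply (rcont_mult (fun t => f (w + (z - w) * t)%C) (fun _ => (z - w)%C)); [|apply rcont_const].
    apply (rcont_comp f (fun t => w + (z - w) * t)%C); auto. apply rcont_affine.
Qed.

Lemma mvi (F f : C -> C) (w z : C) (M : R) :
  (forall t, 0 <= t <= 1 -> cder F (w + (z - w) * t)%C (f (w + (z - w) * t)%C)) ->
  (forall t, 0 <= t <= 1 -> ccont f (w + (z - w) * t)%C) ->
  (forall t, 0 <= t <= 1 -> Cmod (f (w + (z - w) * t)%C) <= M) ->
  Cmod (F z - F w) <= M * Cmod (z - w).
Proof.
  intros HF Hf HM. rewrite (seg_FTC F f); auto.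
  eapply Rle_trans; [apply (CI_bound _ 0 1 (M * Cmod (z - w)))|].
  - intros t Ht. rewrite Rmin_left, Rmax_right in Ht by lra.
    apply (rcont_mult (fun t => f (w + (z - w) * t)%C) (fun _ => (z - w)%C)); [|apply rcont_const].
    apply (rcont_comp f (fun t => w + (z - w) * t)%C); auto. apply rcont_affine.
  - intros t Ht. rewrite Rmin_left, Rmax_right in Ht by lra. rewrite Cmod_mult.
    apply Rmult_le_compat_r; auto. apply Cmod_ge_0.
  - replace (1 - 0) with 1 by ring. rewrite Rabs_R1. lra.
Qed.

Lemma seg_in_ball (z0 w z : C) (R t : R) : 0 <= t <= 1 -> Cmod (w - z0) < R -> Cmod (z - z0) < R ->
  Cmod (w + (z - w) * t - z0) < R.
Proof.
  intros Ht Hw Hz.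
  replace (w + (z - w) * t - z0)%C with (RtoC (1 - t) * (w - z0) + RtoC t * (z - z0))%C
    by (rewrite RtoC_minus; ring).
  eapply Rle_lt_trans; [apply Cmod_triangle|]. rewrite !Cmod_mult, !Cmod_R, !Rabs_pos_eq by lra.
  pose proof (Cmod_ge_0 (w - z0)). destruct (Req_dec t 0) as [->|]; [lra|]. nra.
Qed.

Lemma seg_in_cball_le (z0 w z : C) (R t : R) : 0 <= t <= 1 -> Cmod (w - z0) <= R -> Cmod (z - z0) <= R ->
  Cmod (w + (z - w) * t - z0) <= R.
Proof.
  intros Ht Hw Hz.
  replace (w + (z - w) * t - z0)%C with (RtoC (1 - t) * (w - z0) + RtoC t * (z - z0))%C
    by (rewrite RtoC_minus; ring).
  eapply Rle_trans; [apply Cmod_triangle|]. rewrite !Cmod_mult, !Cmod_R, !Rabs_pos_eq by lra. nra.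
Qed.

Lemma const_of_der0 (F : C -> C) (z0 : C) (R : R) : (forall z, cball z0 R z -> cder F z 0%C) ->
  forall w z, cball z0 R w -> cball z0 R z -> F z = F w.
Proof.
  intros H w z Hw Hz. apply Csub_eq, Cmod_eq0.
  eapply Rle_trans; [apply (mvi F (fun _ => 0%C) w z 0)|lra].
  - intros t Ht. apply H. apply seg_in_ball; auto.
  - intros. apply ccont_const.
  - intros. rewrite Cmod_0; lra.
Qed.

Lemma rcont_rcis (r t : R) : rcont (fun t => r * cis t)%C t.
Proof. apply (rcont_mult (fun _ => RtoC r)); [apply rcont_const|apply rcont_cis]. Qed.

Lemma Cmod_circ z0 r t : 0 <= r -> Cmod (circ z0 r t - z0) = r.
Proof.
  intros H. unfold circ. replace (z0 + r * cis t - z0)%C with (r * cis t)%C by ring.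
  rewrite Cmod_mult, Cmod_cis, Cmod_R, Rabs_pos_eq; lra.
Qed.

(** The derivative in [w] is the integral of [1 / (z - w)^2], which has a primitive along the
    circle. So the value is that at the centre, where the integrand is 1. *)
Lemma winding z0 r w : 0 < r -> Cmod (w - z0) < r ->
  cauchyI 1 (fun t => r * cis t)%C z0 r w = RtoC (2 * PI).
Proof.
  intros Hr Hw.
  assert (H0 : Cmod (z0 - z0) < r) by (rewrite Cmod_self_sub; auto).
  rewrite (const_of_der0 (cauchyI 1 (fun t => r * cis t)%C z0 r) z0 r) with (w := z0); auto.
  - unfold cauchyI. rewrite (CI_ext _ (fun _ => RtoC 1)).
    + rewrite CI_const. ring.
    + intros t _. unfold circ. simpl. field.
      replace (z0 + r * cis t - z0)%C with (r * cis t)%C by ring.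
      apply Cmod_pos_neq. rewrite Cmod_mult, Cmod_cis, Cmod_R, Rabs_pos_eq; lra.
  - clear w Hw. intros w Hw. eapply cder_eq.
    + apply cauchyI_1_der; auto. intros; apply rcont_rcis.
    + unfold cauchyI.
      rewrite (CI_ext _ (fun t => (fun z => / ((z - w) * (z - w)))%C (circ z0 r t) * (r * cis t))%C).
      2:{ intros t _. simpl. rewrite Cmult_1_r. unfold Cdiv. ring. }
      assert (Hn : forall t, (circ z0 r t - w)%C <> 0%C).
      { intros t. apply Cmod_pos_neq. pose proof (circ_dist z0 r w t Hw). unfold cball in Hw. lra. }
      apply (circI_primitive (fun z => - / (z - w))%C (fun z => / ((z - w) * (z - w)))%C).
      * intros t. eapply cder_eq; [cdr; auto|]. field. auto.
      * intros t. apply cdiff_cont. cdf. apply Cmult_neq_0; auto.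
Qed.

Lemma divdiff_cont (f : C -> C) (w l : C) : cder f w l ->
  ccont (fun z => if Ceq_dec z w then l else (f z - f w) / (z - w))%C w.
Proof.
  intros H e He. destruct (H (e / 2)) as [d [Hd K]]; [lra|]. exists d; split; auto.
  intros z Hz. destruct (Ceq_dec w w) as [_|n]; [|congruence].
  destruct (Ceq_dec z w) as [->|n]; [rewrite Cmod_self_sub; auto|].
  specialize (K z Hz). apply Csub_neq in n.
  replace ((f z - f w) / (z - w) - l)%C with ((f z - f w - l * (z - w)) / (z - w))%C by (field; auto).
  rewrite Cmod_div by auto. apply Cmod_pos_neq in n.
  apply (Rmult_lt_reg_r (Cmod (z - w))); auto. unfold Rdiv. rewrite Rmult_assoc, Rinv_l by lra. nra.
Qed.

Lemma divdiff_cdiff (f : C -> C) (w l z : C) : z <> w -> cdiff f z ->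
  cdiff (fun z => if Ceq_dec z w then l else (f z - f w) / (z - w))%C z.
Proof.
  intros Hn Hf. apply cder_cdiff with (C_derive (fun z => (f z - f w) / (z - w))%C z).
  apply cder_ext with (fun z => (f z - f w) / (z - w))%C.
  - exists (Cmod (z - w)). split; [apply Cmod_pos_neq, Csub_neq; auto|].
    intros v Hv. destruct (Ceq_dec v w) as [->|]; auto. rewrite Cmod_sub_sym in Hv. lra.
  - apply cdiff_C_derive. cdf; auto. apply Csub_neq; auto.
Qed.

(** The divided difference at [w], completed by the derivative, is continuous at [w] and holomorphic
    elsewhere. So it has a primitive and integrates to 0; the winding integral does the rest. *)
Lemma cauchy_formula (f : C -> C) z0 R r w : holo_on (cball z0 R) f -> 0 < r < R -> Cmod (w - z0) < r ->
  cauchyI 1 (fun t => f (circ z0 r t) * (r * cis t))%C z0 r w = (2 * PI * f w)%C.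
Proof.
  intros Hf Hr Hw.
  set (g := fun z => if Ceq_dec z w then C_derive f w else ((f z - f w) / (z - w))%C).
  assert (Hwb : cball z0 R w) by (unfold cball; lra).
  assert (Hg1 : forall z, cball z0 R z -> z <> w -> cdiff g z).
  { intros z Hz Hn. apply divdiff_cdiff; auto. }
  assert (Hg2 : forall z, cball z0 R z -> ccont g z).
  { intros z Hz. destruct (Ceq_dec z w) as [->|n].
    - apply divdiff_cont, cdiff_C_derive; auto.
    - apply cdiff_cont; auto. }
  destruct (primitive_ball g w z0 R Hg2 Hg1) as [G HG].
  assert (Hcb : forall t, cball z0 R (circ z0 r t)).
  { intros t. unfold cball. rewrite Cmod_circ; lra. }
  assert (E : CI (fun t => g (circ z0 r t) * (r * cis t))%C 0 (2 * PI) = 0%C).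
  { apply (circI_primitive G g); auto. }
  assert (Hn : forall t, (circ z0 r t - w)%C <> 0%C).
  { intros t. apply Cmod_pos_neq. pose proof (circ_dist z0 r w t Hw). lra. }
  assert (Hcw : forall t, rcont (fun t => (circ z0 r t - w) ^ 1)%C t).
  { intros t. apply (rcont_comp (fun z => z ^ 1)%C (fun t => circ z0 r t - w)%C).
    - apply cdiff_cont. simpl. cdf.
    - apply rcont_sub_const, rcont_circ. }
  assert (Hn1 : forall t, ((circ z0 r t - w) ^ 1)%C <> 0%C) by (intros; apply Cpow_nz; auto).
  assert (c1 : forall t, rcont (fun t => f (circ z0 r t) * (r * cis t) / (circ z0 r t - w) ^ 1)%C t).
  { intros t. apply (rcont_div (fun t => f (circ z0 r t) * (r * cis t))%C (fun t => (circ z0 r t - w) ^ 1)%C); auto.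
    apply rcont_mult; [|apply rcont_rcis]. apply (rcont_comp f); [apply cdiff_cont; auto|apply rcont_circ]. }
  assert (c2 : forall t, rcont (fun t => (r * cis t) / (circ z0 r t - w) ^ 1)%C t).
  { intros t. apply (rcont_div (fun t => (r * cis t))%C (fun t => (circ z0 r t - w) ^ 1)%C); auto.
    apply rcont_rcis. }
  assert (c3 : forall t, rcont (fun t => f w * ((r * cis t) / (circ z0 r t - w) ^ 1))%C t).
  { intros t. apply (rcont_mult (fun _ => f w)); auto. apply rcont_const. }
  rewrite (CI_ext _ (fun t => (f (circ z0 r t) * (r * cis t) / (circ z0 r t - w) ^ 1)
                   - f w * ((r * cis t) / (circ z0 r t - w) ^ 1))%C) in E.
  2:{ intros t _. unfold g. destruct (Ceq_dec (circ z0 r t) w) as [e|n].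
      - exfalso. apply (Hn t). rewrite e. ring.
      - simpl. field. auto. }
  rewrite CI_minus, CI_cmul in E; auto.
  pose proof (winding z0 r w ltac:(lra) Hw) as W. unfold cauchyI in W. rewrite W in E.
  apply Csub_eq in E. unfold cauchyI. rewrite E, RtoC_mult. ring.
Qed.

Lemma C2PI_nz : (2 * PI)%C <> 0%C.
Proof.
  rewrite <- RtoC_mult. intros E. apply RtoC_inj in E. pose proof PI_RGT_0. lra.
Qed.

Lemma C2PI_cancel (x : C) : (2 * PI * x / (2 * PI))%C = x.
Proof.
  unfold Cdiv. rewrite (Cmult_comm (2 * PI) x), <- Cmult_assoc, Cinv_r by apply C2PI_nz. ring.
Qed.

Lemma rcont_fcirc (f : C -> C) z0 R r t : holo_on (cball z0 R) f -> 0 < r < R ->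
  rcont (fun t => f (circ z0 r t) * (r * cis t))%C t.
Proof.
  intros Hf Hr. apply rcont_mult; [|apply rcont_rcis].
  apply (rcont_comp f); [|apply rcont_circ]. apply cdiff_cont, Hf. unfold cball. rewrite Cmod_circ; lra.
Qed.

Lemma cauchy_formula_der (f : C -> C) z0 R r w : holo_on (cball z0 R) f -> 0 < r < R -> Cmod (w - z0) < r ->
  cder f w (cauchyI 2 (fun t => f (circ z0 r t) * (r * cis t))%C z0 r w / (2 * PI))%C.
Proof.
  intros Hf Hr Hw. set (u := (fun t => f (circ z0 r t) * (r * cis t))%C).
  apply cder_ext with (fun v => cauchyI 1 u z0 r v / (2 * PI))%C.
  - exists (r - Cmod (w - z0)). split; [lra|]. intros v Hv. unfold u. rewrite (cauchy_formula f z0 R); auto.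
    + apply C2PI_cancel.
    + pose proof (Cmod_sub_tri v w z0). lra.
  - eapply cder_eq; [apply (cder_mult (cauchyI 1 u z0 r) (fun _ => / (2 * PI))%C); [|apply cder_const]|].
    + apply cauchyI_1_der; auto. intros; apply rcont_fcirc with R; auto.
    + unfold Cdiv. ring.
Qed.

Lemma holo_C_derive_ball (f : C -> C) z0 R : holo_on (cball z0 R) f -> holo_on (cball z0 R) (C_derive f).
Proof.
  intros Hf w Hw. unfold cball in Hw. set (r := (Cmod (w - z0) + R) / 2).
  pose proof (Cmod_ge_0 (w - z0)).
  assert (Hr : 0 < r < R) by (unfold r; lra). assert (Hwr : Cmod (w - z0) < r) by (unfold r; lra).
  set (u := (fun t => f (circ z0 r t) * (r * cis t))%C).
  eapply cder_cdiff. apply cder_ext with (fun v => cauchyI 2 u z0 r v / (2 * PI))%C.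
  - exists (r - Cmod (w - z0)). split; [lra|]. intros v Hv. symmetry. apply cder_C_derive.
    apply cauchy_formula_der with R; auto. pose proof (Cmod_sub_tri v w z0). lra.
  - apply (cder_mult (cauchyI 2 u z0 r) (fun _ => / (2 * PI))%C); [|apply cder_const].
    apply cauchyI_2_der; auto. intros; apply rcont_fcirc with R; auto.
Qed.

Lemma holo_C_derive (U : C -> Prop) f : open_C U -> holo_on U f -> holo_on U (C_derive f).
Proof.
  intros HU Hf z Hz. destruct (HU z Hz) as [e [He K]].
  apply (holo_C_derive_ball f z e); [|unfold cball; rewrite Cmod_self_sub; auto].
  intros w Hw. apply Hf, K, Hw.
Qed.

Lemma cauchy_estimate (f : C -> C) z0 R r M : holo_on (cball z0 R) f -> 0 < r < R ->
  (forall z, Cmod (z - z0) = r -> Cmod (f z) <= M) -> Cmod (C_derive f z0) <= M / r.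
Proof.
  intros Hf Hr HM.
  assert (Hz : Cmod (z0 - z0) < r) by (rewrite Cmod_self_sub; lra).
  rewrite (cder_C_derive f z0 _ (cauchy_formula_der f z0 R r z0 Hf Hr Hz)).
  rewrite Cmod_div by apply C2PI_nz. pose proof PI_RGT_0.
  replace (Cmod (2 * PI)) with (2 * PI).
  2:{ rewrite <- RtoC_mult, Cmod_R, Rabs_pos_eq; lra. }
  assert (B : Cmod (cauchyI 2 (fun t => f (circ z0 r t) * (r * cis t))%C z0 r z0) <= M / r * Rabs (2 * PI - 0)).
  { apply CI_bound.
    - intros t _. apply (rcont_div (fun t => f (circ z0 r t) * (r * cis t))%C (fun t => (circ z0 r t - z0) ^ 2)%C).
      + apply Cpow_nz, Cmod_pos_neq. rewrite Cmod_circ; lra.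
      + apply rcont_fcirc with R; auto.
      + apply (rcont_comp (fun z => (z - z0) ^ 2)%C); [|apply rcont_circ]. apply cdiff_cont; simpl; cdf.
    - intros t _. rewrite Cmod_div, Cmod_pow, !Cmod_mult, Cmod_cis, Cmod_R, Rabs_pos_eq, Cmod_circ; try lra.
      + replace (Cmod (f (circ z0 r t)) * (r * 1) / r ^ 2) with (Cmod (f (circ z0 r t)) / r) by (field; lra).
        apply Rmult_le_compat_r; [apply Rlt_le, Rinv_0_lt_compat; lra|]. apply HM. rewrite Cmod_circ; lra.
      + apply Cpow_nz, Cmod_pos_neq. rewrite Cmod_circ; lra. }
  rewrite Rminus_0_r, Rabs_pos_eq in B by lra.
  apply (Rmult_le_reg_r (2 * PI)); [lra|]. unfold Rdiv at 1. rewrite Rmult_assoc, Rinv_l; lra.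
Qed.

Lemma max_modulus_const (f : C -> C) z0 R r M w : holo_on (cball z0 R) f -> 0 < r < R ->
  (forall z, Cmod (z - z0) = r -> Cmod (f z) <= M) -> Cmod (w - z0) < r ->
  Cmod (f w) <= M * (r / (r - Cmod (w - z0))).
Proof.
  intros Hf Hr HM Hw. pose proof PI_RGT_0.
  assert (B : Cmod (cauchyI 1 (fun t => f (circ z0 r t) * (r * cis t))%C z0 r w)
     <= M * (r / (r - Cmod (w - z0))) * Rabs (2 * PI - 0)).
  { apply CI_bound.
    - intros t _. apply (rcont_div (fun t => f (circ z0 r t) * (r * cis t))%C (fun t => (circ z0 r t - w) ^ 1)%C).
      + apply Cpow_nz, Cmod_pos_neq. pose proof (circ_dist z0 r w t Hw). lra.
      + apply rcont_fcirc with R; auto.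
      + apply (rcont_comp (fun z => (z - w) ^ 1)%C); [|apply rcont_circ]. apply cdiff_cont; simpl; cdf.
    - intros t _. replace (M * (r / (r - Cmod (w - z0)))) with (M * r / (r - Cmod (w - z0))) by (field; lra).
      pose proof (circ_dist z0 r w t Hw).
      apply Cmod_div_le; try lra.
      + rewrite Cmod_pow. lra.
      + rewrite !Cmod_mult, Cmod_cis, Cmod_R, Rabs_pos_eq by lra. rewrite Rmult_1_r.
        apply Rmult_le_compat_r; [lra|]. apply HM. rewrite Cmod_circ; lra. }
  rewrite (cauchy_formula f z0 R) in B; auto. rewrite Cmod_mult in B.
  replace (Cmod (2 * PI)) with (2 * PI) in B.
  2:{ rewrite <- RtoC_mult, Cmod_R, Rabs_pos_eq; lra. }
  rewrite Rminus_0_r, Rabs_pos_eq in B by lra. nra.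
Qed.

(* Applying the crude bound to [f^n] and taking n-th roots removes the constant. *)
Lemma max_modulus (f : C -> C) z0 R r M w : holo_on (cball z0 R) f -> 0 < r < R ->
  (forall z, Cmod (z - z0) = r -> Cmod (f z) <= M) -> Cmod (w - z0) < r -> Cmod (f w) <= M.
Proof.
  intros Hf Hr HM Hw. apply Rnot_lt_le; intros Hlt.
  assert (HM0 : 0 <= M).
  { eapply Rle_trans; [apply Cmod_ge_0|apply (HM (circ z0 r 0))]. apply Cmod_circ; lra. }
  (* The mean [b] is positive even when [M = 0], and [(a / b)^n <= K] for all [n] contradicts
     Bernoulli's inequality. *)
  set (a := Cmod (f w)) in *. set (b := (a + M) / 2).
  set (K := r / (r - Cmod (w - z0))).
  assert (Hn : forall n, a ^ n <= M ^ n * K).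
  { intros n. unfold a, K. rewrite <- Cmod_pow.
    apply (max_modulus_const (fun z => f z ^ n)%C z0 R r (M ^ n) w); auto.
    - intros z Hz. clear Hlt. induction n; simpl; cdf; auto.
    - intros z Hz. rewrite Cmod_pow. apply pow_incr. split; [apply Cmod_ge_0|auto]. }
  assert (Hb : 0 < b) by (unfold b; lra).
  assert (Hb2 : forall n, (a / b) ^ n <= K).
  { intros n. specialize (Hn n).
    assert (M ^ n <= b ^ n) by (apply pow_incr; unfold b; lra).
    assert (0 < K) by (unfold K; apply Rdiv_lt_0_compat; lra).
    unfold Rdiv. rewrite Rpow_mult_distr, pow_inv.
    assert (0 < b ^ n) by (apply pow_lt; auto).
    apply (Rmult_le_reg_r (b ^ n)); auto. rewrite Rmult_assoc, Rinv_l by lra.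
    rewrite Rmult_1_r. nra. }
  set (x := a / b - 1).
  assert (Hx : 0 < x).
  { unfold x. assert (1 < a / b); [|lra]. apply (Rmult_lt_reg_r b); auto.
    unfold Rdiv. rewrite Rmult_assoc, Rinv_l by lra. unfold b; lra. }
  destruct (INR_unbounded (K / x)) as [N HN]. apply Rgt_lt in HN.
  pose proof (poly N x Hx) as HP. specialize (Hb2 N). replace (a / b) with (1 + x) in Hb2 by (unfold x; ring).
  assert (K < INR N * x); [|lra].
  apply (Rmult_lt_compat_r x) in HN; auto. unfold Rdiv in HN. rewrite Rmult_assoc, Rinv_l in HN; lra.
Qed.

(** The maximum principle for [1 / f]. It takes the place of Rouche's theorem and of the open
    mapping theorem wherever a zero has to be found. *)
Lemma min_modulus (f : C -> C) z0 R r m w : holo_on (cball z0 R) f -> 0 < r < R ->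
  (forall z, Cmod (z - z0) = r -> m <= Cmod (f z)) -> Cmod (w - z0) < r -> Cmod (f w) < m ->
  exists z, cball z0 R z /\ f z = 0%C.
Proof.
  intros Hf Hr HM Hw Hfw. apply NNPP; intros HN.
  assert (Hnz : forall z, cball z0 R z -> f z <> 0%C) by (intros z Hz E; apply HN; eauto).
  pose proof (Cmod_ge_0 (f w)).
  assert (B : Cmod (/ f w) <= / m).
  { apply (max_modulus (fun z => / f z)%C z0 R r); auto.
    - intros z Hz. cdf; auto.
    - intros z Hz. assert (cball z0 R z) by (unfold cball; lra).
      rewrite Cmod_inv by auto. apply Rinv_le_contravar; [lra|auto]. }
  assert (Hn : f w <> 0%C) by (apply Hnz; unfold cball; lra).
  rewrite Cmod_inv in B by auto. apply Cmod_pos_neq in Hn.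
  apply Rinv_lt_contravar in Hfw; [lra|]. nra.
Qed.

(** * Locally uniform limits and removable singularities *)

Definition uconv (z0 : C) (R : R) (f : nat -> C -> C) (g : C -> C) : Prop :=
  forall r e, 0 < r < R -> 0 < e -> exists N, forall n z, (N <= n)%nat -> Cmod (z - z0) <= r ->
    Cmod (f n z - g z) <= e.

(** Cauchy's formula passes to the uniform limit, and an integral of Cauchy type is differentiable
    in its parameter as soon as its density is continuous. *)
Lemma weierstrass (z0 : C) (rho : R) (f : nat -> C -> C) (g : C -> C) :
  (forall n, holo_on (cball z0 rho) (f n)) -> uconv z0 rho f g -> holo_on (cball z0 rho) g.
Proof.
  intros Hf Hu w Hw. unfold cball in Hw. pose proof (Cmod_ge_0 (w - z0)).
  set (r := (Cmod (w - z0) + rho) / 2).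
  assert (Hr : 0 < r < rho) by (unfold r; lra). assert (Hwr : Cmod (w - z0) < r) by (unfold r; lra).
  assert (Hgc : forall z, Cmod (z - z0) < rho -> ccont g z).
  { intros z Hz e He. set (r1 := (Cmod (z - z0) + rho) / 2). pose proof (Cmod_ge_0 (z - z0)).
    destruct (Hu r1 (e / 4) ltac:(unfold r1; lra) ltac:(lra)) as [N KN].
    destruct (cdiff_cont _ _ (Hf N z Hz) (e / 4) ltac:(lra)) as [d [Hd K]].
    exists (Rmin d (r1 - Cmod (z - z0))). split; [apply Rmin_pos; unfold r1; lra|].
    intros v Hv. pose proof (Rmin_l d (r1 - Cmod (z - z0))). pose proof (Rmin_r d (r1 - Cmod (z - z0))).
    specialize (K v ltac:(lra)). pose proof (Cmod_sub_tri v z z0).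
    pose proof (KN N v (le_n _) ltac:(lra)). pose proof (KN N z (le_n _) ltac:(unfold r1; lra)).
    pose proof (Cmod_sub_tri (g v) (f N v) (g z)). pose proof (Cmod_sub_tri (f N v) (f N z) (g z)).
    rewrite (Cmod_sub_sym (g v) (f N v)) in *. lra. }
  assert (Hgu : forall t, rcont (fun t => g (circ z0 r t) * (r * cis t))%C t).
  { intros t. apply rcont_mult; [|apply rcont_rcis]. apply (rcont_comp g); [|apply rcont_circ].
    apply Hgc. rewrite Cmod_circ; lra. }
  assert (HF : forall v, Cmod (v - z0) < r -> cauchyI 1 (fun t => g (circ z0 r t) * (r * cis t))%C z0 r v = (2 * PI * g v)%C).
  { intros v Hv. apply C_eq_of_small. intros e He.
    set (d := r - Cmod (v - z0)). assert (Hd : 0 < d) by (unfold d; lra). pose proof PI_RGT_0.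
    set (e1 := e / (2 * PI * (1 + r / d))).
    assert (Hrd : 0 < r / d) by (apply Rdiv_lt_0_compat; lra).
    assert (He1 : 0 < e1) by (unfold e1; apply Rdiv_lt_0_compat; nra).
    destruct (Hu r e1 Hr He1) as [N KN].
    pose proof (cauchy_formula (f N) z0 rho r v (Hf N) Hr Hv) as CF.
    assert (Hcd : forall u : R -> C, (forall t, rcont u t) -> forall t, rcont (fun t => u t / (circ z0 r t - v) ^ 1)%C t).
    { intros u Huc t. apply (rcont_div u (fun t => (circ z0 r t - v) ^ 1)%C); auto.
      - apply Cpow_nz, Cmod_pos_neq. pose proof (circ_dist z0 r v t Hv). lra.
      - apply (rcont_comp (fun z => (z - v) ^ 1)%C); [|apply rcont_circ]. apply cdiff_cont; simpl; cdf. }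
    assert (Hfu : forall t, rcont (fun t => f N (circ z0 r t) * (r * cis t))%C t).
    { intros; apply rcont_fcirc with rho; auto. }
    assert (B : Cmod (cauchyI 1 (fun t => g (circ z0 r t) * (r * cis t))%C z0 r v
                  - cauchyI 1 (fun t => f N (circ z0 r t) * (r * cis t))%C z0 r v) <= e1 * r / d * Rabs (2 * PI - 0)).
    { unfold cauchyI. rewrite <- CI_minus by (intros; apply Hcd; auto).
      apply CI_bound.
      - intros t _. apply rcont_continuous.
        apply (@continuous_minus R_UniformSpace R_AbsRing C_R_NormedModule
          (fun t => g (circ z0 r t) * (r * cis t) / (circ z0 r t - v) ^ 1)%C
          (fun t => f N (circ z0 r t) * (r * cis t) / (circ z0 r t - v) ^ 1)%C); apply rcont_continuous;
        [apply (Hcd (fun t => g (circ z0 r t) * (r * cis t))%C); auto|apply (Hcd (fun t => f N (circ z0 r t) * (r * cis t))%C); auto].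
      - intros t _.
        pose proof (circ_dist z0 r v t Hv).
        assert (Hn : ((circ z0 r t - v) ^ 1)%C <> 0%C) by (apply Cpow_nz, Cmod_pos_neq; lra).
        replace (g (circ z0 r t) * (r * cis t) / (circ z0 r t - v) ^ 1 - f N (circ z0 r t) * (r * cis t) / (circ z0 r t - v) ^ 1)%C
          with ((g (circ z0 r t) - f N (circ z0 r t)) * (r * cis t) / (circ z0 r t - v) ^ 1)%C by (field; simpl in Hn; rewrite Cmult_1_r in Hn; auto).
        apply Cmod_div_le; auto.
        + rewrite Cmod_pow. unfold d. lra.
        + rewrite !Cmod_mult, Cmod_cis, Cmod_R, Rabs_pos_eq, Cmod_sub_sym by lra. rewrite Rmult_1_r.
          apply Rmult_le_compat_r; [lra|]. apply KN; auto. rewrite Cmod_circ; lra. }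
    rewrite CF in B. rewrite Rminus_0_r, Rabs_pos_eq in B by lra.
    pose proof (KN N v (le_n _) ltac:(lra)) as B2.
    replace (cauchyI 1 (fun t => g (circ z0 r t) * (r * cis t))%C z0 r v - 2 * PI * g v)%C with
      ((cauchyI 1 (fun t => g (circ z0 r t) * (r * cis t))%C z0 r v - 2 * PI * f N v) + 2 * PI * (f N v - g v))%C by ring.
    eapply Rle_trans; [apply Cmod_triangle|].
    rewrite (Cmod_mult (2 * PI)). replace (Cmod (2 * PI)) with (2 * PI) by (rewrite <- RtoC_mult, Cmod_R, Rabs_pos_eq; lra).
    assert (E : e1 * r / d * (2 * PI) + 2 * PI * e1 = e) by (unfold e1; field; lra).
    assert (2 * PI * Cmod (f N v - g v) <= 2 * PI * e1) by (apply Rmult_le_compat_l; lra). lra. }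
  eapply cder_cdiff.
  apply cder_ext with (fun v => cauchyI 1 (fun t => g (circ z0 r t) * (r * cis t))%C z0 r v / (2 * PI))%C.
  - exists (r - Cmod (w - z0)). split; [lra|]. intros v Hv. rewrite HF.
    + apply C2PI_cancel.
    + pose proof (Cmod_sub_tri v w z0). lra.
  - apply (cder_mult (cauchyI 1 _ z0 r) (fun _ => / (2 * PI))%C); [|apply cder_const].
    apply cauchyI_1_der; auto.
Qed.

(** The completed divided difference has a primitive, and derivatives of holomorphic functions are
    holomorphic: this removes the singularity. *)
Lemma divdiff_holo (f : C -> C) z0 R : 0 < R -> holo_on (cball z0 R) f ->
  exists g, holo_on (cball z0 R) g /\ g z0 = C_derive f z0 /\
    forall z, (f z - f z0 = g z * (z - z0))%C.
Proof.
  intros HR Hf. set (g := fun z => if Ceq_dec z z0 then C_derive f z0 else ((f z - f z0) / (z - z0))%C).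
  assert (Hwb : cball z0 R z0) by (unfold cball; rewrite Cmod_self_sub; auto).
  assert (Hg1 : forall z, cball z0 R z -> z <> z0 -> cdiff g z).
  { intros z Hz Hn. apply divdiff_cdiff; auto. }
  assert (Hg2 : forall z, cball z0 R z -> ccont g z).
  { intros z Hz. destruct (Ceq_dec z z0) as [->|n].
    - apply divdiff_cont, cdiff_C_derive; auto.
    - apply cdiff_cont; auto. }
  destruct (primitive_ball g z0 z0 R Hg2 Hg1) as [G HG].
  exists g. split; [|split].
  - intros z Hz. eapply cder_cdiff. apply cder_ext with (C_derive G).
    + destruct (open_cball z0 R z Hz) as [d [Hd K]]. exists d; split; auto.
      intros v Hv. apply cder_C_derive; auto.
    + apply cdiff_C_derive. apply (holo_C_derive_ball G z0 R); auto.
      intros v Hv. eapply cder_cdiff; eauto.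
  - unfold g. destruct (Ceq_dec z0 z0); congruence.
  - intros z. unfold g. destruct (Ceq_dec z z0) as [->|n]; [ring|]. field. apply Csub_neq; auto.
Qed.

(** * Schwarz lemma, exponential and roots *)

Lemma holo_E_ball f : holo_on Edisc f <-> holo_on (cball 0 1) f.
Proof. split; intros H z Hz; apply H; auto using ball_E, E_ball. Qed.

Lemma Csub_0_r (z : C) : (z - 0)%C = z. Proof. ring. Qed.

Lemma E0 : Edisc 0%C.
Proof. unfold Edisc. rewrite Cmod_0; lra. Qed.

Lemma max_modulus_E (f : C -> C) r M w : holo_on Edisc f -> 0 < r < 1 ->
  (forall z, Cmod z = r -> Cmod (f z) <= M) -> Cmod w < r -> Cmod (f w) <= M.
Proof.
  intros Hf Hr HM Hw. apply (max_modulus f 0 1 r M w); auto.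
  - apply holo_E_ball; auto.
  - intros z Hz. rewrite Csub_0_r in Hz; auto.
  - rewrite Csub_0_r; auto.
Qed.

Lemma Cmod_sqr (z : C) : Cmod z * Cmod z = fst z * fst z + snd z * snd z.
Proof.
  unfold Cmod. rewrite sqrt_sqrt; [ring|]. pose proof (pow2_ge_0 (fst z)). pose proof (pow2_ge_0 (snd z)). lra.
Qed.

Lemma Cmod_le_sqr (z w : C) : Cmod z * Cmod z <= Cmod w * Cmod w -> Cmod z <= Cmod w.
Proof. intros H. pose proof (Cmod_ge_0 z). pose proof (Cmod_ge_0 w). nra. Qed.

Lemma pick_identity (a b : C) :
  Cmod (1 - Cconj b * a) * Cmod (1 - Cconj b * a) - Cmod (a - b) * Cmod (a - b) =
  (1 - Cmod a * Cmod a) * (1 - Cmod b * Cmod b).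
Proof. rewrite !Cmod_sqr. destruct a, b; simpl. ring. Qed.

(** The quotient [g] is returned along with the inequality, because the near-equality case below
    applies Schwarz-Pick to [g]. *)
Lemma schwarz (phi : C -> C) : holo_on Edisc phi -> (forall z, Edisc z -> Cmod (phi z) <= 1) ->
  phi 0%C = 0%C ->
  exists g, holo_on Edisc g /\ g 0%C = C_derive phi 0%C /\ (forall z, phi z = g z * z)%C /\
    forall z, Edisc z -> Cmod (g z) <= 1.
Proof.
  intros Hp HB H0. destruct (divdiff_holo phi 0 1 Rlt_0_1 (proj1 (holo_E_ball phi) Hp)) as (g & Hg & Hg0 & HE).
  apply holo_E_ball in Hg.
  assert (HE' : forall z, (phi z = g z * z)%C).
  { intros z. specialize (HE z). rewrite H0, !Csub_0_r in HE. auto. }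
  exists g. repeat split; auto.
  intros w Hw. unfold Edisc in Hw. apply Rnot_lt_le; intros Hlt.
  set (a := Cmod (g w)) in *. pose proof (Cmod_ge_0 w).
  assert (Ha : 0 < / a < 1).
  { split; [apply Rinv_0_lt_compat; lra|]. rewrite <- Rinv_1. apply Rinv_lt_contravar; lra. }
  (* If [a = |g w|] exceeds 1, a circle whose radius [r] lies beyond both [|w|] and [1 / a] bounds
     [|g w|] by [1 / r < a]. *)
  set (r := (Rmax (Cmod w) (/ a) + 1) / 2).
  assert (Hr : Cmod w < r /\ / a < r /\ r < 1).
  { unfold r, Rmax. destruct Rle_dec; lra. }
  assert (B : a <= / r).
  { apply (max_modulus_E g r (/ r) w); auto; try lra. intros z Hz.
    assert (Hzn : z <> 0%C) by (apply Cmod_pos_neq; lra).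
    replace (g z) with (phi z / z)%C by (rewrite HE'; field; auto).
    rewrite Cmod_div, Hz by auto. unfold Rdiv. rewrite <- (Rmult_1_l (/ r)) at 2.
    apply Rmult_le_compat_r; [apply Rlt_le, Rinv_0_lt_compat; lra|]. apply HB. unfold Edisc; lra. }
  assert (/ r < a).
  { rewrite <- (Rinv_inv a). apply Rinv_lt_contravar; [|lra]. apply Rmult_lt_0_compat; lra. }
  lra.
Qed.

Lemma schwarz_le (phi : C -> C) z : holo_on Edisc phi -> (forall z, Edisc z -> Cmod (phi z) <= 1) ->
  phi 0%C = 0%C -> Edisc z -> Cmod (phi z) <= Cmod z.
Proof.
  intros Hp HB H0 Hz. destruct (schwarz phi Hp HB H0) as (g & Hg & _ & HE & HG).
  rewrite HE, Cmod_mult. specialize (HG z Hz). pose proof (Cmod_ge_0 z). nra.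
Qed.

Lemma schwarz_der (phi : C -> C) : holo_on Edisc phi -> (forall z, Edisc z -> Cmod (phi z) <= 1) ->
  phi 0%C = 0%C -> Cmod (C_derive phi 0%C) <= 1.
Proof.
  intros Hp HB H0. destruct (schwarz phi Hp HB H0) as (g & Hg & <- & HE & HG). apply HG, E0.
Qed.

Lemma Cmod_cconj_mul_lt (a b : C) : Cmod a < 1 -> Cmod b <= 1 -> (1 - Cconj b * a)%C <> 0%C.
Proof.
  intros Ha Hb E. assert (H : Cmod (Cconj b * a) = 1).
  { replace (Cconj b * a)%C with (RtoC 1); [apply Cmod_1|]. symmetry. apply Csub_eq. rewrite <- Copp_minus_distr.
    rewrite E. ring. }
  rewrite Cmod_mult, Cmod_conj in H. pose proof (Cmod_ge_0 a). pose proof (Cmod_ge_0 b). nra.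
Qed.

Lemma schwarz_pick0 (h : C -> C) z : holo_on Edisc h -> (forall z, Edisc z -> Cmod (h z) < 1) ->
  Edisc z -> Cmod (h z - h 0%C) <= Cmod z * Cmod (1 - Cconj (h 0%C) * h z).
Proof.
  intros Hh HB Hz. set (c := h 0%C).
  assert (Hc : Cmod c < 1) by (apply HB, E0).
  assert (Hn : forall z, Edisc z -> (1 - Cconj c * h z)%C <> 0%C).
  { intros v Hv. apply Cmod_cconj_mul_lt; auto. lra. }
  pose proof (schwarz_le (fun z => (h z - c) / (1 - Cconj c * h z))%C z) as S.
  assert (S' : Cmod ((h z - c) / (1 - Cconj c * h z)) <= Cmod z).
  { apply S; auto.
    - intros v Hv. cdf; auto.
    - intros v Hv. rewrite Cmod_div by auto. specialize (Hn v Hv). apply Cmod_pos_neq in Hn.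
      apply (Rmult_le_reg_r (Cmod (1 - Cconj c * h v))); auto.
      unfold Rdiv. rewrite Rmult_assoc, Rinv_l, Rmult_1_l, Rmult_1_r by lra.
      apply Cmod_le_sqr. pose proof (pick_identity (h v) c). specialize (HB v Hv).
      pose proof (Cmod_ge_0 c). pose proof (Cmod_ge_0 (h v)).
      assert (0 <= (1 - Cmod (h v) * Cmod (h v)) * (1 - Cmod c * Cmod c)) by (apply Rmult_le_pos; nra). lra.
    - unfold c. unfold Cdiv, Cminus. rewrite Cplus_opp_r. ring. }
  rewrite Cmod_div in S' by auto. specialize (Hn z Hz). apply Cmod_pos_neq in Hn.
  apply (Rmult_le_compat_r (Cmod (1 - Cconj c * h z))) in S'; [|lra].
  unfold Rdiv in S'. rewrite Rmult_assoc, Rinv_l, Rmult_1_r in S' by lra. exact S'.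
Qed.

(** Depends on [h] only through [|h 0|], so it keeps a whole sequence of discs in a compact part of
    [E] as long as their centres stay away from the unit circle. *)
Lemma schwarz_pick_bound (h : C -> C) z : holo_on Edisc h -> (forall z, Edisc z -> Cmod (h z) < 1) ->
  Edisc z -> Cmod (h z) * Cmod (h z) <= 1 - (1 - Cmod (h 0%C)) * (1 - Cmod (h 0%C)) * (1 - Cmod z * Cmod z).
Proof.
  intros Hh HB Hz. pose proof (schwarz_pick0 h z Hh HB Hz) as S. unfold Edisc in Hz.
  pose proof (pick_identity (h z) (h 0%C)) as PI'. set (c := h 0%C) in *.
  set (A := Cmod (h z - c)) in *. set (B := Cmod (1 - Cconj c * h z)) in *.
  assert (Hc : Cmod c < 1) by (apply HB, E0). specialize (HB z Hz).
  pose proof (Cmod_ge_0 c). pose proof (Cmod_ge_0 (h z)). pose proof (Cmod_ge_0 z).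
  assert (0 <= A) by apply Cmod_ge_0. assert (0 <= B) by apply Cmod_ge_0.
  assert (B1 : 1 - Cmod c <= B).
  { pose proof (Cmod_le_sub 1 (1 - Cconj c * h z)). rewrite Cmod_1 in H4. fold B in H4.
    replace (1 - (1 - Cconj c * h z))%C with (Cconj c * h z)%C in H4 by ring.
    rewrite Cmod_mult, Cmod_conj in H4. nra. }
  set (a := Cmod c) in *. set (y := Cmod (h z)) in *. set (r := Cmod z) in *.
  assert (A * A <= r * r * (B * B)).
  { replace (r * r * (B * B)) with ((r * B) * (r * B)) by ring. apply Rmult_le_compat; lra. }
  assert (H5 : (1 - a) * (1 - a) * (1 - r * r) <= B * B * (1 - r * r)).
  { apply Rmult_le_compat_r; [nra|]. apply Rmult_le_compat; lra. }
  assert (0 <= 1 - y * y) by nra.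
  assert ((1 - y * y) * (1 - a * a) <= (1 - y * y)) by nra.
  nra.
Qed.

(** Only [|g| <= 1] is known, so [g] may be a unimodular constant. Schwarz-Pick is applied to [t g]
    with [t < 1], and then [t] tends to 1. *)
Lemma schwarz_pick_const (g : C -> C) z : holo_on Edisc g -> (forall z, Edisc z -> Cmod (g z) <= 1) ->
  Edisc z -> Cmod (g z - g 0%C) * (1 - Cmod z) <= Cmod z * (1 - Cmod (g 0%C) * Cmod (g 0%C)).
Proof.
  intros Hg HB Hz. set (c := g 0%C).
  assert (Hc : Cmod c <= 1) by (apply HB, E0). pose proof (Cmod_ge_0 c).
  set (r := Cmod z). assert (Hr : 0 <= r < 1) by (split; [apply Cmod_ge_0|exact Hz]).
  set (A := Cmod (g z - c)). assert (HA : 0 <= A) by apply Cmod_ge_0.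
  assert (K : forall t, 0 < t < 1 -> t * A * (1 - r) <= r * (1 - t * t * (Cmod c * Cmod c))).
  { intros t Ht. pose proof (schwarz_pick0 (fun z => t * g z)%C z) as S. simpl in S. fold c r in S.
    assert (S' : Cmod (t * g z - t * c) <= r * Cmod (1 - Cconj (t * c) * (t * g z))).
    { apply S; auto.
      - intros v Hv. cdf; auto.
      - intros v Hv. rewrite Cmod_mult, Cmod_R, Rabs_pos_eq by lra. specialize (HB v Hv).
        pose proof (Cmod_ge_0 (g v)). nra. }
    replace (t * g z - t * c)%C with (t * (g z - c))%C in S' by ring.
    rewrite Cmod_mult, Cmod_R, Rabs_pos_eq in S' by lra. fold A in S'.
    set (D := Cmod (1 - Cconj (t * c) * (t * g z))) in *.
    assert (HD : D <= (1 - t * t * (Cmod c * Cmod c)) + t * A).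
    { unfold D.
      replace (1 - Cconj (t * c) * (t * g z))%C with
        (RtoC (1 - t * t * (Cmod c * Cmod c)) + - (Cconj (t * c) * (t * (g z - c))))%C.
      - eapply Rle_trans; [apply Cmod_triangle|].
        rewrite Cmod_opp, !Cmod_mult, Cmod_conj, Cmod_mult, !Cmod_R. fold A.
        assert (0 <= t * t <= 1) by nra. assert (0 <= Cmod c * Cmod c <= 1) by nra.
        assert (t * t * (Cmod c * Cmod c) <= 1) by nra.
        rewrite !Rabs_pos_eq by lra. assert (t * Cmod c * (t * A) <= 1 * (t * A)); [|lra].
        apply Rmult_le_compat_r; nra.
      - rewrite !Cmod_sqr. rewrite Cmult_conj. unfold Cconj, RtoC, Cminus, Cplus, Copp, Cmult.
        destruct c, (g z); simpl. apply injective_projections; simpl; ring. }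
    assert (r * D <= r * ((1 - t * t * (Cmod c * Cmod c)) + t * A)) by (apply Rmult_le_compat_l; lra).
    lra. }
  apply Rnot_lt_le; intros Hlt.
  set (X := A * (1 - r)) in *. set (m := Cmod c * Cmod c) in *. set (Y := r * (1 - m)) in *.
  assert (Hm : 0 <= m <= 1) by (unfold m; nra).
  assert (HX : 0 <= X) by (unfold X; nra).
  (* At [t = 1 - s] the estimate gives [X - Y <= s (X + 2)], whereas [s (X + 3)] is only half of
     [X - Y]. *)
  set (s := (X - Y) / (2 * (X + 3))).
  assert (HY : 0 <= Y) by (unfold Y; nra).
  assert (Hs : 0 < s < 1).
  { unfold s. split; [apply Rdiv_lt_0_compat; lra|]. apply (Rmult_lt_reg_r (2 * (X + 3))); [lra|].
    unfold Rdiv. rewrite Rmult_assoc, Rinv_l; lra. }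
  assert (Es : s * (2 * (X + 3)) = X - Y) by (unfold s; field; lra).
  specialize (K (1 - s) ltac:(lra)). replace ((1 - s) * A * (1 - r)) with ((1 - s) * X) in K by (unfold X; ring).
  replace (r * (1 - (1 - s) * (1 - s) * m)) with (Y + r * m * (2 * s - s * s)) in K by (unfold Y; ring).
  assert (0 <= r * m <= 1) by nra.
  assert (r * m * (2 * s - s * s) <= 1 * (2 * s)) by (apply Rmult_le_compat; nra).
  nra.
Qed.

(* The quantitative equality case of the Schwarz lemma. *)
Lemma schwarz_near (phi : C -> C) z : holo_on Edisc phi -> (forall z, Edisc z -> Cmod (phi z) <= 1) ->
  phi 0%C = 0%C -> Edisc z ->
  Cmod (phi z - C_derive phi 0 * z) * (1 - Cmod z) <=
    Cmod z * Cmod z * (1 - Cmod (C_derive phi 0%C) * Cmod (C_derive phi 0%C)).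
Proof.
  intros Hp HB H0 Hz. destruct (schwarz phi Hp HB H0) as (g & Hg & <- & HE & HG).
  pose proof (schwarz_pick_const g z Hg HG Hz) as S.
  replace (phi z - g 0 * z)%C with (z * (g z - g 0%C))%C by (rewrite HE; ring).
  rewrite Cmod_mult. pose proof (Cmod_ge_0 z). nra.
Qed.

(** * Moebius automorphisms of the disc *)

Definition mob (a z : C) : C := ((z + a) / (1 + Cconj a * z))%C.

Lemma mob_den (a z : C) : Edisc a -> Cmod z <= 1 -> (1 + Cconj a * z)%C <> 0%C.
Proof.
  unfold Edisc. intros Ha Hz E. assert (H : Cmod (Cconj a * z) = 1).
  { replace (Cconj a * z)%C with (- RtoC 1)%C.
    - rewrite Cmod_opp. apply Cmod_1.
    - symmetry. apply Csub_eq. rewrite <- E. ring. }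
  rewrite Cmod_mult, Cmod_conj in H. pose proof (Cmod_ge_0 a). pose proof (Cmod_ge_0 z). nra.
Qed.

Lemma mob_den_E (a z : C) : Edisc a -> Edisc z -> (1 + Cconj a * z)%C <> 0%C.
Proof. intros Ha Hz. apply mob_den; auto. apply Rlt_le, Hz. Qed.

Lemma mob_E (a z : C) : Edisc a -> Edisc z -> Edisc (mob a z).
Proof.
  intros Ha Hz. pose proof (mob_den_E a z Ha Hz) as Hn. unfold Edisc in *. unfold mob.
  rewrite Cmod_div by auto. apply Cmod_pos_neq in Hn.
  apply (Rmult_lt_reg_r (Cmod (1 + Cconj a * z))); auto.
  unfold Rdiv. rewrite Rmult_assoc, Rinv_l, Rmult_1_l, Rmult_1_r by lra.
  pose proof (pick_identity z (- a)%C) as P. rewrite Cmod_opp, Copp_conj in P.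
  replace (1 - - Cconj a * z)%C with (1 + Cconj a * z)%C in P by ring.
  replace (z - - a)%C with (z + a)%C in P by ring.
  pose proof (Cmod_ge_0 a). pose proof (Cmod_ge_0 z). pose proof (Cmod_ge_0 (z + a)).
  assert (0 < (1 - Cmod z * Cmod z) * (1 - Cmod a * Cmod a)) by (apply Rmult_lt_0_compat; nra).
  nra.
Qed.

Lemma mob_0 a : mob a 0 = a.
Proof. unfold mob. field. Qed.

Lemma Cconj_mult_self (z : C) : (Cconj z * z)%C = RtoC (Cmod z * Cmod z).
Proof. rewrite Cmod_sqr. destruct z; unfold Cconj, Cmult, RtoC; simpl. f_equal; ring. Qed.

Lemma Edisc_opp a : Edisc a -> Edisc (- a)%C.
Proof. unfold Edisc. rewrite Cmod_opp; auto. Qed.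

Lemma Edisc_ncc a : Edisc a -> (1 - Cconj a * a)%C <> 0%C.
Proof.
  intros Ha. unfold Edisc in Ha. rewrite Cconj_mult_self, <- RtoC_minus. intros E. apply RtoC_inj in E.
  pose proof (Cmod_ge_0 a). nra.
Qed.

Lemma mob_inv a z : Edisc a -> Edisc z -> mob (- a) (mob a z) = z.
Proof.
  intros Ha Hz. pose proof (mob_den_E a z Ha Hz) as Hn. unfold mob. rewrite Copp_conj.
  pose proof (Edisc_ncc a Ha). 
  field. repeat split; auto; intros HH; apply H; rewrite <- HH; ring.
Qed.

Lemma mob_inv' a z : Edisc a -> Edisc z -> mob a (mob (- a) z) = z.
Proof.
  intros Ha Hz. replace a with (- - a)%C at 1 by ring. apply mob_inv; auto. apply Edisc_opp; auto.
Qed.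

Lemma cder_mob a z : Edisc a -> Edisc z ->
  cder (mob a) z (RtoC (1 - Cmod a * Cmod a) / ((1 + Cconj a * z) * (1 + Cconj a * z)))%C.
Proof.
  intros Ha Hz. pose proof (mob_den_E a z Ha Hz) as Hn. unfold mob.
  eapply cder_eq; [cdr; auto|]. rewrite RtoC_minus, <- Cconj_mult_self. field; auto.
Qed.

Lemma holo_mob a : Edisc a -> holo_on Edisc (mob a).
Proof. intros Ha z Hz. eapply cder_cdiff, cder_mob; auto. Qed.

Lemma holo_comp (U V : C -> Prop) (f g : C -> C) : holo_on V f -> holo_on U g ->
  (forall z, U z -> V (g z)) -> holo_on U (fun z => f (g z)).
Proof. intros Hf Hg HU z Hz. apply cdiff_comp; auto. Qed.

(** * Exponential, logarithms and square roots *)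

Definition cexp (z : C) : C := (exp (fst z) * cos (snd z), exp (fst z) * sin (snd z)).

Lemma cexp_plus z w : cexp (z + w) = (cexp z * cexp w)%C.
Proof.
  destruct z as [a b], w as [c d]. unfold cexp, Cplus, Cmult; simpl.
  rewrite exp_plus, cos_plus, sin_plus. f_equal; ring.
Qed.

Lemma cexp_0 : cexp 0 = 1%C.
Proof. unfold cexp; simpl. rewrite exp_0, cos_0, sin_0. unfold RtoC. f_equal; ring. Qed.

Lemma Cmod_cexp z : Cmod (cexp z) = exp (fst z).
Proof.
  assert (H : cexp z = (RtoC (exp (fst z)) * cis (snd z))%C).
  { unfold cexp, cis, RtoC, Cmult; simpl. f_equal; ring. }
  rewrite H, Cmod_mult, Cmod_cis, Cmod_R, Rabs_pos_eq; [ring|]. left; apply exp_pos.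
Qed.

Lemma cexp_nz z : cexp z <> 0%C.
Proof. apply Cmod_pos_neq. rewrite Cmod_cexp. apply exp_pos. Qed.

Lemma cexp_opp z : cexp (- z) = (/ cexp z)%C.
Proof.
  assert (H : (cexp z * cexp (- z) = 1)%C).
  { rewrite <- cexp_plus. replace (z + - z)%C with (RtoC 0) by ring. apply cexp_0. }
  pose proof (cexp_nz z). replace (cexp (- z)) with (/ cexp z * (cexp z * cexp (- z)))%C by (field; auto).
  rewrite H. ring.
Qed.

Lemma cexp_der_0 : cder cexp 0 1%C.
Proof.
  intros e He.
  (* The error terms below add up to at most [9 e1] times the modulus of the argument. *)
  set (e1 := Rmin 1 (e / 20)). assert (He1 : 0 < e1) by (unfold e1; apply Rmin_pos; lra).
  assert (H1 : e1 <= 1) by apply Rmin_l. assert (H2 : e1 <= e / 20) by apply Rmin_r.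
  pose proof (derivable_pt_lim_exp 0) as D1. rewrite exp_0 in D1.
  pose proof (derivable_pt_lim_cos 0) as D2. rewrite sin_0 in D2.
  pose proof (derivable_pt_lim_sin 0) as D3. rewrite cos_0 in D3.
  destruct (derivable_small _ _ _ D1 e1 He1) as [d1 [Hd1 K1]].
  destruct (derivable_small _ _ _ D2 e1 He1) as [d2 [Hd2 K2]].
  destruct (derivable_small _ _ _ D3 e1 He1) as [d3 [Hd3 K3]].
  set (d := Rmin (Rmin d1 d2) (Rmin d3 e1)).
  assert (Hd : 0 < d) by (unfold d; repeat apply Rmin_pos; auto; lra).
  assert (Hdd : d <= d1 /\ d <= d2 /\ d <= d3 /\ d <= e1).
  { unfold d. pose proof (Rmin_l (Rmin d1 d2) (Rmin d3 e1)). pose proof (Rmin_r (Rmin d1 d2) (Rmin d3 e1)).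
    pose proof (Rmin_l d1 d2). pose proof (Rmin_r d1 d2). pose proof (Rmin_l d3 e1). pose proof (Rmin_r d3 e1). lra. }
  exists d; split; auto. intros [x y] Hw. rewrite Csub_0_r in *.
  assert (Hx : Rabs x <= Cmod (x, y)) by exact (re_le_Cmod (x, y)).
  assert (Hy : Rabs y <= Cmod (x, y)) by exact (im_le_Cmod (x, y)).
  set (h := Cmod (x, y)) in *.
  specialize (K1 x). specialize (K2 y). specialize (K3 y).
  rewrite Rminus_0_r in K1, K2, K3. specialize (K1 ltac:(lra)). specialize (K2 ltac:(lra)). specialize (K3 ltac:(lra)).
  rewrite exp_0 in K1. rewrite cos_0 in K2. rewrite sin_0 in K3.
  rewrite cexp_0. eapply Rle_trans; [apply Cmod_le_parts|]. simpl.
  set (E := exp x) in *. set (c := cos y) in *. set (s := sin y) in *.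
  assert (HE : Rabs (E - 1) <= 2 * h).
  { replace (E - 1) with ((E - 1 - 1 * x) + x) by ring. eapply Rle_trans; [apply Rabs_triang|].
    pose proof (Rabs_pos x). nra. }
  assert (HE3 : Rabs E <= 3).
  { replace E with ((E - 1) + 1) by ring. eapply Rle_trans; [apply Rabs_triang|]. rewrite Rabs_R1. lra. }
  replace (E * c + - (1) + - (1 * x - 0 * y)) with ((E - 1 - 1 * x) + E * (c - 1 - - 0 * y)) by ring.
  replace (E * s + - 0 + - (1 * y + 0 * x)) with (E * (s - 0 - 1 * y) + (E - 1) * y) by ring.
  pose proof (Rabs_triang (E - 1 - 1 * x) (E * (c - 1 - - 0 * y))).
  pose proof (Rabs_triang (E * (s - 0 - 1 * y)) ((E - 1) * y)).
  rewrite !Rabs_mult in *.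
  pose proof (Rabs_pos x). pose proof (Rabs_pos y). pose proof (Rabs_pos E). pose proof (Rabs_pos (E - 1)).
  assert (Hh : 0 <= h) by lra.
  assert (B1 : e1 * Rabs x <= e1 * h) by (apply Rmult_le_compat_l; lra).
  assert (B2 : Rabs E * Rabs (c - 1 - - 0 * y) <= 3 * (e1 * h)).
  { apply Rmult_le_compat; auto; try apply Rabs_pos. eapply Rle_trans; [apply K2|]. apply Rmult_le_compat_l; lra. }
  assert (B3 : Rabs E * Rabs (s - 0 - 1 * y) <= 3 * (e1 * h)).
  { apply Rmult_le_compat; auto; try apply Rabs_pos. eapply Rle_trans; [apply K3|]. apply Rmult_le_compat_l; lra. }
  assert (B4 : Rabs (E - 1) * Rabs y <= 2 * h * h) by (apply Rmult_le_compat; auto).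
  assert (h * h <= e1 * h) by (apply Rmult_le_compat_r; lra).
  assert (e1 * h <= e / 20 * h) by (apply Rmult_le_compat_r; lra).
  assert (0 <= e * h) by nra.
  nra.
Qed.

Lemma cder_cexp z : cder cexp z (cexp z).
Proof.
  apply cder_ext with (fun w => cexp z * cexp (w - z))%C.
  - exists 1; split; [lra|]. intros w _. rewrite <- cexp_plus. f_equal. ring.
  - eapply cder_eq.
    + apply (cder_mult (fun _ => cexp z) (fun w => cexp (w - z))); [apply cder_const|].
      apply (cder_comp cexp (fun w => w - z)%C); [|cdr].
      replace (z - z)%C with (RtoC 0) by ring. apply cexp_der_0.
    + ring.
Qed.

Lemma cdiff_cexp (f : C -> C) z : cdiff f z -> cdiff (fun w => cexp (f w)) z.
Proof. intros H. apply (cdiff_comp cexp f); auto. eapply cder_cdiff, cder_cexp. Qed.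

Lemma cis_surj (u : C) : Cmod u = 1 -> exists t, cis t = u.
Proof.
  intros H. pose proof (Cmod_sqr u) as S. rewrite H in S. destruct u as [a b]; simpl in S.
  assert (Ha : -1 <= a <= 1) by nra.
  assert (Hs : sin (acos a) = Rabs b).
  { rewrite sin_acos by auto. rewrite <- (sqrt_Rsqr_abs b). f_equal. unfold Rsqr. lra. }
  destruct (Rle_dec 0 b) as [h|h].
  - exists (acos a). unfold cis. rewrite cos_acos, Hs, Rabs_pos_eq; auto.
  - exists (- acos a). unfold cis. rewrite cos_neg, sin_neg, cos_acos, Hs by auto.
    rewrite Rabs_left by lra. f_equal. ring.
Qed.

Lemma cexp_surj (w : C) : w <> 0%C -> exists z, cexp z = w.
Proof.
  intros Hw. apply Cmod_pos_neq in Hw as Hp.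
  destruct (cis_surj (w / Cmod w)%C) as [t Ht].
  { rewrite Cmod_div, Cmod_R, Rabs_pos_eq; try lra.
    - field. lra.
    - intros E. apply RtoC_inj in E. lra. }
  exists (ln (Cmod w), t).
  assert (E : cexp (ln (Cmod w), t) = (RtoC (Cmod w) * cis t)%C).
  { unfold cexp, cis, RtoC, Cmult; simpl. rewrite exp_ln by auto. f_equal; ring. }
  rewrite E, Ht. field. intros E'. apply RtoC_inj in E'. lra.
Qed.

(** [L] is a primitive of [h' / h], normalized at 0; then [h exp (- L)] has derivative 0. *)
Lemma log_E (h : C -> C) (c : C) : holo_on Edisc h -> (forall z, Edisc z -> h z <> 0%C) -> cexp c = h 0%C ->
  exists L, holo_on Edisc L /\ L 0%C = c /\ forall z, Edisc z -> cexp (L z) = h z.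
Proof.
  intros Hh Hn Hc.
  assert (Hd : holo_on Edisc (fun z => C_derive h z / h z)%C).
  { intros z Hz. cdf; auto. apply (holo_C_derive Edisc h); auto. apply open_Edisc. }
  destruct (primitive_ball (fun z => C_derive h z / h z)%C 0 0 1) as [F HF].
  { intros z Hz. apply cdiff_cont, Hd, ball_E; auto. }
  { intros z Hz _. apply Hd, ball_E; auto. }
  set (L := fun z => (F z - F 0 + c)%C).
  assert (HL : forall z, Edisc z -> cder L z (C_derive h z / h z)%C).
  { intros z Hz. unfold L. eapply cder_eq; [cdr; apply HF, E_ball; auto|]. ring. }
  exists L. split; [|split].
  - intros z Hz. eapply cder_cdiff; eauto.
  - unfold L. ring.
  - intros z Hz.
    assert (E : (h z * cexp (- L z) = h 0 * cexp (- L 0%C))%C).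
    { apply (const_of_der0 (fun z => h z * cexp (- L z))%C 0 1).
      - clear z Hz. intros z Hz. apply ball_E in Hz. eapply cder_eq.
        + apply (cder_mult h (fun z => cexp (- L z))).
          * apply cdiff_C_derive; auto.
          * apply (cder_comp cexp (fun z => - L z)%C); [apply cder_cexp|]. apply cder_opp; eauto.
        + field. auto.
      - apply E_ball, E0.
      - apply E_ball; auto. }
    replace (L 0%C) with c in E by (unfold L; ring).
    rewrite !cexp_opp, Hc in E. pose proof (Hn 0%C E0). pose proof (cexp_nz (L z)).
    rewrite Cinv_r in E by auto.
    replace (h z) with (h z * / cexp (L z) * cexp (L z))%C by (field; auto). rewrite E. ring.
Qed.

Lemma C2_nz : RtoC 2 <> 0%C.
Proof. intros E. apply RtoC_inj in E. lra. Qed.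

Lemma sqrt_E (h : C -> C) (s0 : C) : holo_on Edisc h -> (forall z, Edisc z -> h z <> 0%C) -> (s0 * s0)%C = h 0%C ->
  exists s, holo_on Edisc s /\ s 0%C = s0 /\ forall z, Edisc z -> (s z * s z)%C = h z.
Proof.
  intros Hh Hn Hs.
  assert (Hs0 : s0 <> 0%C).
  { intros E. apply (Hn 0%C E0). rewrite <- Hs, E. ring. }
  destruct (cexp_surj s0 Hs0) as [c Hc].
  destruct (log_E h (c + c)%C Hh Hn) as (L & HL & HL0 & HE).
  { rewrite cexp_plus, Hc. auto. }
  exists (fun z => cexp (L z / 2)). split; [|split].
  - intros z Hz. apply cdiff_cexp. cdf; auto. apply C2_nz.
  - rewrite HL0. rewrite <- Hc. f_equal. field.
  - intros z Hz. rewrite <- cexp_plus, <- HE by auto. f_equal. field.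
Qed.

Lemma cis_sqrt (u : C) : Cmod u = 1 -> exists v, (v * v)%C = u /\ Cmod v = 1.
Proof.
  intros H. destruct (cis_surj u H) as [t Ht]. exists (cis (t / 2)). split; [|apply Cmod_cis].
  rewrite <- Ht. set (x := t / 2). replace t with (x + x) by (unfold x; field).
  unfold cis, Cmult; simpl. rewrite cos_plus, sin_plus. f_equal; ring.
Qed.

Lemma Csqrt_ex (w : C) : exists v, (v * v)%C = w.
Proof.
  destruct (Ceq_dec w 0) as [->|n]; [exists 0%C; ring|].
  destruct (cexp_surj w n) as [c Hc]. exists (cexp (c / 2)). rewrite <- cexp_plus, <- Hc. f_equal. field.
Qed.

(** * Lifting of discs and Koebe's algorithm *)

(** Lifts have a prescribed value at 0. For [U] the disc, sections over balls and, over connected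
    open sets, surjectivity are derived later. The source is left general because Koebe's step
    covers [D] by a part of [E]. *)
Definition cov (U : C -> Prop) (f : C -> C) (D : C -> Prop) : Prop :=
  holo_on U f /\ (forall z, U z -> D (f z)) /\
  forall h l, holo_on Edisc h -> (forall z, Edisc z -> D (h z)) -> U l -> h 0%C = f l ->
    exists phi, holo_on Edisc phi /\ (forall z, Edisc z -> U (phi z)) /\ phi 0%C = l /\
      forall z, Edisc z -> f (phi z) = h z.

Lemma cov_comp U f V g D : cov U f V -> cov V g D -> cov U (fun z => g (f z)) D.
Proof.
  intros (Hf & HfV & Lf) (Hg & HgD & Lg). split; [|split].
  - apply (holo_comp U V g f); auto.
  - auto.
  - intros h l Hh HhD Hl Hh0. destruct (Lg h (f l) Hh HhD (HfV l Hl) Hh0) as (k & Hk & HkV & Hk0 & HE).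
    destruct (Lf k l Hk HkV Hl Hk0) as (phi & Hp & HpU & Hp0 & HE').
    exists phi. repeat split; auto. intros z Hz. rewrite HE', HE; auto.
Qed.

Lemma cov_iso U V f g : holo_on U f -> holo_on V g -> (forall z, U z -> V (f z)) ->
  (forall z, V z -> U (g z)) -> (forall z, U z -> g (f z) = z) -> (forall z, V z -> f (g z) = z) -> cov U f V.
Proof.
  intros Hf Hg HfV HgU Hgf Hfg. split; [|split]; auto.
  intros h l Hh HhV Hl H0. exists (fun z => g (h z)). repeat split; auto.
  - apply (holo_comp Edisc V g h); auto.
  - rewrite H0. auto.
Qed.

Lemma cov_mob a : Edisc a -> cov Edisc (mob a) Edisc.
Proof.
  intros Ha. pose proof (Edisc_opp a Ha). apply (cov_iso _ _ _ (mob (- a))).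
  - apply holo_mob; auto.
  - apply holo_mob; auto.
  - intros; apply mob_E; auto.
  - intros; apply mob_E; auto.
  - intros; apply mob_inv; auto.
  - intros; apply mob_inv'; auto.
Qed.

Lemma cov_rot u : Cmod u = 1 -> cov Edisc (fun z => u * z)%C Edisc.
Proof.
  intros Hu. assert (u <> 0%C) by (apply Cmod_pos_neq; lra).
  apply (cov_iso _ _ _ (fun z => / u * z)%C).
  - intros z Hz; cdf.
  - intros z Hz. apply (cdiff_mult (fun _ => / u)%C (fun z => z)); cdf; auto.
  - unfold Edisc. intros z Hz. rewrite Cmod_mult, Hu. lra.
  - unfold Edisc. intros z Hz. rewrite Cmod_mult, Cmod_inv, Hu by auto. lra.
  - intros z _. field; auto.
  - intros z _. field; auto.
Qed.

(** The supremum of [1 - |p|] need not be attained, but half of it is always exceeded; this costs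
    the factor 2. *)
Lemma sup_choice (P : C -> Prop) : (forall p, P p -> Edisc p) -> (exists p, P p) ->
  exists p0, P p0 /\ forall p, P p -> 1 - Cmod p <= 2 * (1 - Cmod p0).
Proof.
  intros HP [p1 Hp1].
  destruct (completeness (fun x => exists p, P p /\ x = 1 - Cmod p)) as [m [Hm1 Hm2]].
  - exists 1. intros x [p [_ ->]]. pose proof (Cmod_ge_0 p). lra.
  - exists (1 - Cmod p1), p1; auto.
  - assert (Hpos : 0 < m).
    { assert (1 - Cmod p1 <= m) by (apply Hm1; eauto). specialize (HP p1 Hp1). unfold Edisc in HP. lra. }
    apply NNPP; intros HN. assert (m <= m / 2); [|lra].
    apply Hm2. intros x [p [Hp ->]]. apply Rnot_lt_le; intros Hlt. apply HN. exists p; split; auto.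
    intros p' Hp'. assert (1 - Cmod p' <= m) by (apply Hm1; eauto). lra.
Qed.

(* The degree-2 Blaschke product [B o (square) o mob (- v)] with critical value [p = v^2],
   where [B x = (p - x) / (1 - conj p x) = mob p (- x)] is an involution exchanging 0 and p. *)
Lemma koebe_blaschke (D : C -> Prop) (p : C) : (forall z, D z -> Edisc z) -> D 0%C -> Edisc p -> ~ D p ->
  exists q a, 0 < a <= 1 /\ holo_on Edisc q /\ (forall z, Edisc z -> Edisc (q z)) /\ q 0%C = 0%C /\
    C_derive q 0%C = RtoC a /\ cov (fun w => Edisc w /\ D (q w)) q D /\
    (1 - Cmod p) * (1 - Cmod p) <= 8 * (1 - a).
Proof.
  intros HD H0 Hp HDp.
  destruct (Csqrt_ex p) as [v Hv].
  assert (Hvp : Cmod v * Cmod v = Cmod p) by (rewrite <- Cmod_mult, Hv; auto).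
  assert (Hpn : p <> 0%C) by (intros ->; auto).
  assert (Hvn : v <> 0%C) by (intros E; apply Hpn; rewrite <- Hv, E; ring).
  apply Cmod_pos_neq in Hvn as Hvpos.
  set (rho := Cmod v) in *.
  assert (HvE : Edisc v) by (unfold Edisc in *; fold rho; nra).
  assert (Hrho : 0 < rho < 1) by (unfold Edisc in HvE; fold rho in HvE; lra).
  (* A rotation that makes the derivative at 0 positive. *)
  set (u := (Cconj v / rho)%C).
  assert (Hrn : RtoC rho <> 0%C) by (intros E; apply RtoC_inj in E; lra).
  assert (Hu : Cmod u = 1).
  { unfold u. rewrite Cmod_div, Cmod_conj, Cmod_R, Rabs_pos_eq by (auto; lra). fold rho. field. lra. }
  assert (HEo : Edisc (- v)%C) by (apply Edisc_opp; auto).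
  set (B := fun x => mob p (- x)).
  set (m := mob (- v)).
  set (q := fun w => B (m (u * w)%C * m (u * w)%C)%C).
  assert (Huw : forall w, Edisc w -> Edisc (u * w)%C).
  { unfold Edisc. intros w Hw. rewrite Cmod_mult, Hu. lra. }
  assert (Hsq : forall w, Edisc w -> Edisc (w * w)%C).
  { unfold Edisc. intros w Hw. rewrite Cmod_mult. pose proof (Cmod_ge_0 w). nra. }
  assert (HBE : forall x, Edisc x -> Edisc (B x)).
  { intros x Hx. apply mob_E; auto. apply Edisc_opp; auto. }
  assert (HBB : forall x, Edisc x -> B (B x) = x).
  { intros x Hx. unfold B, mob.
    pose proof (mob_den_E p (- x)%C Hp (Edisc_opp _ Hx)) as Hd.
    pose proof (Edisc_ncc p Hp) as Hd2.
    field. repeat split; auto; intros HH; apply Hd2; rewrite <- HH; ring. }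
  assert (HBd : forall x, Edisc x -> cdiff B x).
  { intros x Hx. apply (cdiff_comp (mob p) (fun x => - x)%C); [|cdf]. apply holo_mob; auto. apply Edisc_opp; auto. }
  assert (Hmd : forall w, Edisc w -> cdiff (fun w => m (u * w)%C) w).
  { intros w Hw. apply (cdiff_comp m (fun w => u * w)%C); [|cdf]. apply holo_mob; auto. }
  assert (HmE : forall w, Edisc w -> Edisc (m (u * w)%C)) by (intros; apply mob_E; auto).
  assert (Hqd : holo_on Edisc q).
  { intros w Hw. apply (cdiff_comp B (fun w => m (u * w) * m (u * w))%C); [apply HBd; auto|].
    apply (cdiff_mult (fun w => m (u * w)%C) (fun w => m (u * w)%C)); auto. }
  (* The derivatives of [m], of the square and of [B] have moduli [1 - rho^2], [2 rho] and
     [1 / (1 - rho^4)]; this is their product. *)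
  exists q, (2 * rho / (1 + rho * rho)).
  assert (Hden : 0 < 1 + rho * rho) by nra.
  split; [|split; [|split; [|split; [|split; [|split]]]]].
  - split; [apply Rdiv_lt_0_compat; lra|]. apply (Rmult_le_reg_r (1 + rho * rho)); auto.
    unfold Rdiv. rewrite Rmult_assoc, Rinv_l by lra. nra.
  - auto.
  - intros z Hz. apply HBE; auto.
  - unfold q. replace (u * 0)%C with (RtoC 0) by ring. unfold m. rewrite mob_0.
    replace (- v * - v)%C with p by (rewrite <- Hv; ring). unfold B, mob.
    pose proof (Edisc_ncc p Hp). field. intros HH; apply H; rewrite <- HH; ring.
  - apply cder_C_derive. unfold q.
    assert (E00 : m (u * 0)%C = (- v)%C) by (unfold m; replace (u * 0)%C with (RtoC 0) by ring; apply mob_0).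
    assert (Dm : cder (fun w => m (u * w)%C) 0 (RtoC (1 - rho * rho) * u)%C).
    { eapply cder_eq; [apply (cder_comp m (fun w => u * w)%C); [|cdr]|].
      - replace (u * 0)%C with (RtoC 0) by ring. apply cder_mob; [auto|apply E0].
      - rewrite Cmod_opp. fold rho. field. }
    assert (DB : cder B p (- / (RtoC (1 - Cmod p * Cmod p)))%C).
    { unfold B. eapply cder_eq; [apply (cder_comp (mob p) (fun x => - x)%C); [apply cder_mob; auto; apply Edisc_opp; auto|cdr]|].
      pose proof (Edisc_ncc p Hp) as Hd2. rewrite RtoC_minus, <- Cconj_mult_self.
      field. repeat split; auto; intros HH; apply Hd2; rewrite <- HH; ring. }
    eapply cder_eq.
    + apply (cder_comp B (fun w => m (u * w) * m (u * w))%C).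
      * replace (m (u * 0) * m (u * 0))%C with p by (rewrite E00, <- Hv; ring). apply DB.
      * apply (cder_mult (fun w => m (u * w)%C) (fun w => m (u * w)%C)); apply Dm.
    + rewrite E00. unfold u. rewrite <- Hvp.
      assert (Hvv : (Cconj v * v)%C = (rho * rho)%C) by (rewrite Cconj_mult_self; fold rho; rewrite RtoC_mult; ring).
      replace (- / RtoC (1 - rho * rho * (rho * rho)) * (RtoC (1 - rho * rho) * (Cconj v / rho) * - v + - v * (RtoC (1 - rho * rho) * (Cconj v / rho))))%C
        with (/ RtoC (1 - rho * rho * (rho * rho)) * (2 * RtoC (1 - rho * rho) * (Cconj v * v) / rho))%C
        by (unfold Cdiv; ring).
      rewrite Hvv. rewrite RtoC_div by lra. rewrite RtoC_plus, RtoC_mult, !RtoC_minus, !RtoC_mult.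
      assert (K1 : (1 - rho * rho * (rho * rho))%C <> 0%C).
      { rewrite <- !RtoC_mult, <- RtoC_minus. intros E. apply RtoC_inj in E.
        assert (0 < rho * rho < 1) by nra. nra. }
      assert (K2 : (1 + rho * rho)%C <> 0%C).
      { rewrite <- !RtoC_mult, <- RtoC_plus. intros E. apply RtoC_inj in E. nra. }
      field. repeat split; auto.
  - split; [|split].
    + intros w [Hw _]. auto.
    + intros w [_ Hw]. auto.
    + intros h l Hh HhD [HlE HlD] Hh0.
      assert (HhE : forall z, Edisc z -> Edisc (h z)) by auto.
      (* [h] omits [p], hence [B o h] omits 0 and has a square root on the disc. Undoing [mob (- v)]
         and the rotation turns the root into the lift. *)
      destruct (sqrt_E (fun z => B (h z)) (m (u * l)%C)) as (s & Hs & Hs0 & Hss).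
      * apply (holo_comp Edisc Edisc B h); auto.
      * intros z Hz E. apply HDp. replace p with (h z); auto.
        rewrite <- (HBB (h z)) by auto. rewrite E. unfold B. replace (- 0)%C with (RtoC 0) by ring. apply mob_0.
      * rewrite Hh0. unfold q. rewrite HBB; auto.
      * assert (HsE : forall z, Edisc z -> Edisc (s z)).
        { intros z Hz. assert (Hz' := HBE _ (HhE z Hz)). rewrite <- (Hss z Hz) in Hz'. unfold Edisc in *.
          rewrite Cmod_mult in Hz'. pose proof (Cmod_ge_0 (s z)). nra. }
        assert (Hun : u <> 0%C) by (apply Cmod_pos_neq; lra).
        exists (fun z => / u * mob v (s z))%C.
        assert (Hq : forall z, Edisc z -> q (/ u * mob v (s z))%C = h z).
        { intros z Hz. unfold q. replace (u * (/ u * mob v (s z)))%C with (mob v (s z)) by (field; auto).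
          unfold m. rewrite mob_inv by auto. rewrite Hss, HBB; auto. }
        assert (HE : forall z, Edisc z -> Edisc (/ u * mob v (s z))%C).
        { intros z Hz. unfold Edisc. rewrite Cmod_mult, Cmod_inv, Hu by auto.
          pose proof (mob_E v (s z) HvE (HsE z Hz)) as HH. unfold Edisc in HH. lra. }
        repeat split; auto.
        -- intros z Hz. apply (cdiff_mult (fun _ => / u)%C (fun z => mob v (s z))); [cdf|].
           apply (cdiff_comp (mob v) s); auto. apply holo_mob; auto.
        -- rewrite Hq; auto.
        -- rewrite Hs0. unfold m. rewrite mob_inv' by auto. field; auto.
  (* Here [1 - a = (1 - rho)^2 / (1 + rho^2)] and [1 - |p| = (1 - rho) (1 + rho)]; the 8 bounds
     [(1 + rho)^2 (1 + rho^2)]. *)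
  - rewrite <- Hvp.
    replace (1 - 2 * rho / (1 + rho * rho)) with ((1 - rho) * (1 - rho) / (1 + rho * rho)) by (field; lra).
    apply (Rmult_le_reg_r (1 + rho * rho)); auto.
    replace (8 * ((1 - rho) * (1 - rho) / (1 + rho * rho)) * (1 + rho * rho)) with (8 * ((1 - rho) * (1 - rho))) by (field; lra).
    replace ((1 - rho * rho) * (1 - rho * rho) * (1 + rho * rho)) with
      ((1 - rho) * (1 - rho) * ((1 + rho) * (1 + rho) * (1 + rho * rho))) by ring.
    rewrite Rmult_comm. apply Rmult_le_compat_r; [nra|].
    replace 8 with (4 * 2) by ring. apply Rmult_le_compat; nra.
Qed.

(** The point handed to the Blaschke product is nearly the closest omitted one to 0, so a single
    step controls all omitted points; [32 = 8 * 2^2] pays for the factor 2 in the choice. If nothing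
    is omitted, the identity with [a = 1] does. *)
Lemma koebe_step (D : C -> Prop) : (forall z, D z -> Edisc z) -> D 0%C ->
  exists q a, 0 < a <= 1 /\ holo_on Edisc q /\ (forall z, Edisc z -> Edisc (q z)) /\ q 0%C = 0%C /\
    C_derive q 0%C = RtoC a /\ cov (fun w => Edisc w /\ D (q w)) q D /\
    forall p, Edisc p -> ~ D p -> (1 - Cmod p) * (1 - Cmod p) <= 32 * (1 - a).
Proof.
  intros HD H0. destruct (classic (exists p, Edisc p /\ ~ D p)) as [Hex|Hex].
  - destruct (sup_choice (fun p => Edisc p /\ ~ D p)) as (p0 & [Hp0 HDp0] & Hmax); [tauto|auto|].
    destruct (koebe_blaschke D p0 HD H0 Hp0 HDp0) as (q & a & Ha & H1 & H2 & H3 & H4 & H5 & H6).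
    exists q, a. repeat (split; auto). intros p Hp HDp. specialize (Hmax p (conj Hp HDp)).
    unfold Edisc in *. assert (0 <= 1 - Cmod p) by lra.
    assert ((1 - Cmod p) * (1 - Cmod p) <= (2 * (1 - Cmod p0)) * (2 * (1 - Cmod p0))) by (apply Rmult_le_compat; auto).
    lra.
  - assert (HDE : forall z, Edisc z -> D z) by (intros z Hz; apply NNPP; intros HN; apply Hex; eauto).
    exists (fun z => z), 1. split; [lra|]. split; [intros z _; cdf|]. split; [auto|]. split; [auto|].
    split; [apply cder_C_derive, cder_id|]. split.
    + split; [intros z _; cdf|]. split; [tauto|].
      intros h l Hh HhD Hl H0'. exists h. repeat split; auto.
    + intros p Hp HDp. exfalso; auto.
Qed.

(** * Convergence of Koebe's iteration *)

Definition clim (u : nat -> C) (l : C) : Prop :=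
  forall e, 0 < e -> exists N, forall n, (N <= n)%nat -> Cmod (u n - l) <= e.

Lemma C_cauchy (u : nat -> C) :
  (forall e, 0 < e -> exists N, forall n m, (N <= n)%nat -> (N <= m)%nat -> Cmod (u n - u m) <= e) ->
  exists l, clim u l.
Proof.
  intros H.
  destruct (Rcomplete.R_complete (fun n => fst (u n))) as [x Hx].
  { intros e He. destruct (H (e / 2)) as [N K]; [lra|]. exists N. intros n m Hn Hm.
    specialize (K n m Hn Hm). unfold R_dist.
    pose proof (re_le_Cmod (u n - u m)) as B. unfold Re in B; simpl in B. unfold Rminus. lra. }
  destruct (Rcomplete.R_complete (fun n => snd (u n))) as [y Hy].
  { intros e He. destruct (H (e / 2)) as [N K]; [lra|]. exists N. intros n m Hn Hm.
    specialize (K n m Hn Hm). unfold R_dist.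
    pose proof (im_le_Cmod (u n - u m)) as B. unfold Im in B; simpl in B. unfold Rminus. lra. }
  exists (x, y). intros e He. destruct (Hx (e / 2)) as [N1 K1]; [lra|]. destruct (Hy (e / 2)) as [N2 K2]; [lra|].
  exists (N1 + N2)%nat. intros n Hn. specialize (K1 n ltac:(lia)). specialize (K2 n ltac:(lia)).
  unfold R_dist in *. eapply Rle_trans; [apply Cmod_le_parts|]. simpl. unfold Rminus in *. lra.
Qed.

Lemma clim_unique u l l' : clim u l -> clim u l' -> l = l'.
Proof.
  intros H H'. apply C_eq_of_small. intros e He.
  destruct (H (e / 2)) as [N K]; [lra|]. destruct (H' (e / 2)) as [N' K']; [lra|].
  specialize (K (N + N')%nat ltac:(lia)). specialize (K' (N + N')%nat ltac:(lia)).
  pose proof (Cmod_sub_tri l (u (N + N')%nat) l'). rewrite (Cmod_sub_sym l (u (N + N')%nat)) in H0. lra.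
Qed.

Lemma clim_shift u l k : clim u l -> clim (fun n => u (k + n)%nat) l.
Proof. intros H e He. destruct (H e He) as [N K]. exists N. intros n Hn. apply K. lia. Qed.

Lemma clim_ccont (f : C -> C) u l : ccont f l -> clim u l -> clim (fun n => f (u n)) (f l).
Proof.
  intros Hf Hu e He. destruct (Hf e He) as [d [Hd K]]. destruct (Hu (d / 2)) as [N KN]; [lra|].
  exists N. intros n Hn. apply Rlt_le, K. specialize (KN n Hn). lra.
Qed.

Lemma clim_Cmod_le u l M : clim u l -> (forall n, Cmod (u n) <= M) -> Cmod l <= M.
Proof.
  intros H HM. apply Rnot_lt_le; intros Hlt. destruct (H ((Cmod l - M) / 2)) as [N K]; [lra|].
  specialize (K N (le_n _)). specialize (HM N). pose proof (Cmod_le_sub l (u N)).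
  rewrite Cmod_sub_sym in H0. lra.
Qed.

Lemma unif_cauchy (F : nat -> C -> C) :
  (forall r e, 0 < r < 1 -> 0 < e -> exists N, forall n m z, (N <= n)%nat -> (N <= m)%nat -> Cmod z <= r ->
     Cmod (F n z - F m z) <= e) ->
  exists f, uconv 0 1 F f /\ forall z, Edisc z -> clim (fun n => F n z) (f z).
Proof.
  intros H.
  assert (Hp : forall z, exists l, Edisc z -> clim (fun n => F n z) l).
  { intros z. destruct (classic (Edisc z)) as [Hz|Hz]; [|exists 0%C; tauto].
    destruct (C_cauchy (fun n => F n z)) as [l Hl]; [|eauto].
    intros e He. unfold Edisc in Hz. pose proof (Cmod_ge_0 z).
    destruct (H ((1 + Cmod z) / 2) e ltac:(lra) He) as [N K]. exists N. intros n m Hn Hm. apply K; auto; lra. }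
  set (f := fun z => proj1_sig (constructive_indefinite_description _ (Hp z))).
  assert (Hf : forall z, Edisc z -> clim (fun n => F n z) (f z)).
  { intros z. unfold f. destruct constructive_indefinite_description; auto. }
  exists f. split; auto. intros r e Hr He. destruct (H r (e / 2) Hr ltac:(lra)) as [N K].
  exists N. intros n z Hn Hz. rewrite Csub_0_r in Hz.
  destruct (Hf z ltac:(unfold Edisc; lra) (e / 2) ltac:(lra)) as [N' K'].
  specialize (K n (N + N')%nat z Hn ltac:(lia) Hz). specialize (K' (N + N')%nat ltac:(lia)).
  pose proof (Cmod_sub_tri (F n z) (F (N + N')%nat z) (f z)). lra.
Qed.

Lemma weierstrass_E (F : nat -> C -> C) f : (forall n, holo_on Edisc (F n)) -> uconv 0 1 F f -> holo_on Edisc f.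
Proof.
  intros HF Hu. apply holo_E_ball. apply (weierstrass 0 1 F f); auto. intros n. apply holo_E_ball; auto.
Qed.

Lemma der_bound_E (g : C -> C) M r v : holo_on Edisc g -> (forall z, Edisc z -> Cmod (g z) <= M) ->
  0 <= r < 1 -> Cmod v <= r -> Cmod (C_derive g v) <= 2 * M / (1 - r).
Proof.
  intros Hg HB Hr Hv.
  assert (Hin : forall z, cball v (1 - r) z -> Edisc z).
  { intros z Hz. unfold cball in Hz. unfold Edisc. pose proof (Cmod_le_sub z v). lra. }
  replace (2 * M / (1 - r)) with (M / ((1 - r) / 2)) by (field; lra).
  apply (cauchy_estimate g v (1 - r)); [|lra|].
  - intros z Hz. auto.
  - intros z Hz. apply HB, Hin. unfold cball. lra.
Qed.

Lemma lip_E (g : C -> C) L r z w : holo_on Edisc g -> 0 <= r < 1 ->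
  (forall v, Cmod v <= r -> Cmod (C_derive g v) <= L) ->
  Cmod z <= r -> Cmod w <= r -> Cmod (g z - g w) <= L * Cmod (z - w).
Proof.
  intros Hg Hr HL Hz Hw.
  assert (Hs : forall t, 0 <= t <= 1 -> Cmod (w + (z - w) * t) <= r).
  { intros t Ht. rewrite <- (Csub_0_r (w + (z - w) * t)). apply seg_in_cball_le; rewrite ?Csub_0_r; auto. }
  apply (mvi g (C_derive g)).
  - intros t Ht. apply cdiff_C_derive, Hg. unfold Edisc. specialize (Hs t Ht). lra.
  - intros t Ht. apply cdiff_cont, (holo_C_derive Edisc g open_Edisc Hg). unfold Edisc. specialize (Hs t Ht). lra.
  - intros t Ht. apply HL. auto.
Qed.

Lemma lip_bounded_E (g : C -> C) M r z w : holo_on Edisc g -> (forall z, Edisc z -> Cmod (g z) <= M) ->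
  0 <= r < 1 -> Cmod z <= r -> Cmod w <= r -> Cmod (g z - g w) <= 2 * M / (1 - r) * Cmod (z - w).
Proof.
  intros Hg HB Hr Hz Hw. apply (lip_E g _ r); auto. intros v Hv. apply der_bound_E; auto.
Qed.

(** [schwarz_near] bounds [q w - a w] by [2 (1 - a) / (1 - r)], and [(1 - a) |w|] is the rest. *)
Lemma near_id (q : C -> C) a r w : holo_on Edisc q -> (forall z, Edisc z -> Edisc (q z)) -> q 0%C = 0%C ->
  C_derive q 0%C = RtoC a -> 0 < a <= 1 -> 0 <= r < 1 -> Cmod w <= r ->
  Cmod (q w - w) <= 3 * (1 - a) / (1 - r).
Proof.
  intros Hq HE H0 Hd Ha Hr Hw.
  assert (Hw' : Edisc w) by (unfold Edisc; lra).
  pose proof (schwarz_near q w Hq (fun z Hz => Rlt_le _ _ (HE z Hz)) H0 Hw') as S.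
  rewrite Hd, Cmod_R, Rabs_pos_eq in S by lra.
  pose proof (Cmod_ge_0 w).
  replace (q w - w)%C with ((q w - a * w) + - (RtoC (1 - a) * w))%C by (rewrite RtoC_minus; ring).
  eapply Rle_trans; [apply Cmod_triangle|]. rewrite Cmod_opp, Cmod_mult, Cmod_R, Rabs_pos_eq by lra.
  apply (Rmult_le_reg_r (1 - r)); [lra|].
  replace (3 * (1 - a) / (1 - r) * (1 - r)) with (3 * (1 - a)) by (field; lra).
  set (A := Cmod (q w - a * w)) in *. assert (0 <= A) by apply Cmod_ge_0.
  set (x := Cmod w) in *.
  assert (A * (1 - r) <= A * (1 - x)) by (apply Rmult_le_compat_l; lra).
  assert (x * x * (1 - a * a) <= 1 * (2 * (1 - a))) by (apply Rmult_le_compat; nra).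
  assert ((1 - a) * x <= 1 - a) by nra.
  assert ((1 - a) * x * (1 - r) <= (1 - a) * 1) by (apply Rmult_le_compat; nra).
  lra.
Qed.

Lemma dep_choice (A : Type) (P : nat -> A -> Prop) (Q : nat -> A -> A -> Prop) (x0 : A) :
  P O x0 -> (forall n x, P n x -> exists y, P (S n) y /\ Q n x y) ->
  exists u : nat -> A, u O = x0 /\ (forall n, P n (u n)) /\ forall n, Q n (u n) (u (S n)).
Proof.
  intros H0 HS.
  assert (HS' : forall n (x : {x | P n x}), exists y : {y | P (S n) y}, Q n (proj1_sig x) (proj1_sig y)).
  { intros n [x Hx]. destruct (HS n x Hx) as [y [Hy HQ]]. exists (exist _ y Hy). exact HQ. }
  set (next := fun n x => proj1_sig (constructive_indefinite_description _ (HS' n x))).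
  set (u := fix u n : {x | P n x} := match n with O => exist _ x0 H0 | S n => next n (u n) end).
  exists (fun n => proj1_sig (u n)). split; [reflexivity|]. split.
  - intros n. apply (proj2_sig (u n)).
  - intros n. simpl. unfold next. destruct constructive_indefinite_description; auto.
Qed.

Definition koebe_tower (D : nat -> C -> Prop) (q : nat -> C -> C) (a : nat -> R) : Prop :=
  forall n, (forall z, D n z -> Edisc z) /\ 0 < a n <= 1 /\ holo_on Edisc (q n) /\
    (forall z, Edisc z -> Edisc (q n z)) /\ q n 0%C = 0%C /\ C_derive (q n) 0%C = RtoC (a n) /\
    (forall z, D (S n) z <-> Edisc z /\ D n (q n z)) /\ cov (D (S n)) (q n) (D n) /\
    (forall p, Edisc p -> ~ D n p -> (1 - Cmod p) * (1 - Cmod p) <= 32 * (1 - a n)).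

(** The composite [q_n o q_(n+1) o ... o q_(n+m-1)], extended on the inside so that the target stays
    at level [n]. *)
Fixpoint tcomp (q : nat -> C -> C) (n m : nat) (z : C) : C :=
  match m with O => z | S m' => tcomp q n m' (q (n + m')%nat z) end.

Lemma tcomp_add q n m k z : tcomp q n (m + k) z = tcomp q n m (tcomp q (n + m) k z).
Proof.
  revert z. induction k as [|k IH]; intros z.
  - rewrite Nat.add_0_r. reflexivity.
  - rewrite Nat.add_succ_r. simpl. rewrite IH. rewrite Nat.add_assoc. reflexivity.
Qed.

Lemma koebe_tower_ex (D0 : C -> Prop) : (forall z, D0 z -> Edisc z) -> D0 0%C ->
  exists D q a, koebe_tower D q a /\ forall z, D O z <-> D0 z.
Proof.
  intros HD H0.
  set (St := ((C -> Prop) * (C -> C) * R)%type).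
  set (P := fun (_ : nat) (s : St) => let '(D, q, a) := s in
    (forall z, D z -> Edisc z) /\ D 0%C /\ 0 < a <= 1 /\ holo_on Edisc q /\
    (forall z, Edisc z -> Edisc (q z)) /\ q 0%C = 0%C /\ C_derive q 0%C = RtoC a /\
    cov (fun w => Edisc w /\ D (q w)) q D /\
    (forall p, Edisc p -> ~ D p -> (1 - Cmod p) * (1 - Cmod p) <= 32 * (1 - a))).
  set (Q := fun (_ : nat) (s s' : St) => fst (fst s') = (fun w => Edisc w /\ fst (fst s) (snd (fst s) w))).
  destruct (koebe_step D0 HD H0) as (q0 & a0 & Ha0 & Hq0).
  destruct (dep_choice St P Q (D0, q0, a0)) as (u & Hu0 & HP & HQ).
  - simpl. tauto.
  - intros n [[D q] a] HPs. simpl in HPs. destruct HPs as (h1 & h2 & h3 & h4 & h5 & h6 & h7 & h8 & h9).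
    set (D' := fun w => Edisc w /\ D (q w)).
    destruct (koebe_step D') as (q' & a' & Hq').
    + intros z [Hz _]; auto.
    + split; [apply E0|]. rewrite h6; auto.
    + exists (D', q', a'). split; [|reflexivity]. simpl.
      split; [intros z [Hz _]; auto|]. split; [split; [apply E0|rewrite h6; auto]|]. tauto.
  - exists (fun n => fst (fst (u n))), (fun n => snd (fst (u n))), (fun n => snd (u n)).
    split; [|rewrite Hu0; simpl; tauto].
    intros n. specialize (HP n). specialize (HQ n). unfold Q in HQ. rewrite HQ.
    unfold P in HP. destruct (u n) as [[D q] a]. simpl in *.
    destruct HP as (h1 & h2 & h3 & h4 & h5 & h6 & h7 & h8 & h9).
    repeat (split; [tauto|]). auto.
Qed.

Lemma tcomp_facts D q a : koebe_tower D q a -> forall n m,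
  holo_on Edisc (tcomp q n m) /\ (forall z, Edisc z -> Edisc (tcomp q n m z)) /\ tcomp q n m 0%C = 0%C /\
  cov (D (n + m)%nat) (tcomp q n m) (D n).
Proof.
  intros T n m. induction m as [|m (IH1 & IH2 & IH3 & IH4)].
  - simpl. rewrite Nat.add_0_r. repeat split; auto.
    + intros z _; cdf.
    + intros z _; cdf.
    + intros h l Hh HhD Hl H0. exists h. repeat split; auto.
  - destruct (T (n + m)%nat) as (h1 & h2 & h3 & h4 & h5 & h6 & h7 & h8 & h9).
    rewrite Nat.add_succ_r. simpl. split; [|split; [|split]].
    + apply (holo_comp Edisc Edisc (tcomp q n m) (q (n + m)%nat)); auto.
    + auto.
    + rewrite h5; auto.
    + apply (cov_comp _ (q (n + m)%nat) (D (n + m)%nat) (tcomp q n m)); auto.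
Qed.

(** The products [P m] of the [a n] are the derivatives at 0 of the composites. They stay above the
    radius [r0] of a disc in [D 0]: the disc [r0 z] lifts through each composite, and the Schwarz
    lemma applies to the lift. So [P] converges, and [s n = (P n - lim P) / r0] telescopes. *)
Lemma tower_summable D q a : koebe_tower D q a -> open_C (D O) -> D O 0%C ->
  exists s : nat -> R, (forall n, 0 <= s n) /\ (forall n, 1 - a n <= s n - s (S n)) /\
    forall e, 0 < e -> exists N, forall n, (N <= n)%nat -> s n <= e.
Proof.
  intros T Ho HO.
  set (P := fix P n := match n with O => 1 | S n => P n * a n end).
  assert (HPd : forall m, C_derive (tcomp q 0 m) 0%C = RtoC (P m)).
  { induction m as [|m IH].
    - apply cder_C_derive, cder_id.
    - destruct (T m) as (h1 & h2 & h3 & h4 & h5 & h6 & h7 & h8 & h9).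
      destruct (tcomp_facts D q a T O m) as (k1 & k2 & k3 & k4).
      apply cder_C_derive. change (P (S m)) with (P m * a m). rewrite RtoC_mult.
      apply (cder_comp (tcomp q 0 m) (q m)).
      + rewrite h5, <- IH. apply cdiff_C_derive, k1, E0.
      + rewrite <- h6. apply cdiff_C_derive, h3, E0. }
  destruct (Ho 0%C HO) as (r0 & Hr0 & Kr0).
  assert (HPlow : forall m, r0 <= P m).
  { intros m. destruct (tcomp_facts D q a T O m) as (k1 & k2 & k3 & k4). destruct k4 as (_ & _ & Lk).
    assert (HPpos : 0 <= P m).
    { clear -T. induction m; simpl; [lra|]. destruct (T m) as (_ & h2 & _). nra. }
    destruct (Lk (fun z => RtoC r0 * z)%C 0%C) as (phi & Hp & HpD & Hp0 & HE).
    - intros z _; cdf.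
    - intros z Hz. apply Kr0. rewrite Csub_0_r, Cmod_mult, Cmod_R, Rabs_pos_eq by lra. unfold Edisc in Hz. nra.
    - clear -T HO. induction m; auto. simpl. destruct (T m) as (_ & _ & _ & _ & h5 & _ & h7 & _).
      apply h7. rewrite h5. split; [apply E0|auto].
    - rewrite k3. ring.
    - assert (HpE : forall z, Edisc z -> Cmod (phi z) <= 1).
      { intros z Hz. apply Rlt_le. assert (Hh : Edisc (phi z)); [|exact Hh].
        apply (proj1 (T (0 + m)%nat)). apply HpD; auto. }
      pose proof (schwarz_der phi Hp HpE Hp0) as S.
      assert (ED : (RtoC r0 = RtoC (P m) * C_derive phi 0)%C).
      { apply (cder_unique (fun z => RtoC r0 * z)%C 0%C).
        - eapply cder_eq; [cdr|ring].
        - apply cder_ext with (fun z => tcomp q 0 m (phi z)).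
          + exists 1. split; [lra|]. intros w Hw. rewrite Csub_0_r in Hw. rewrite HE; auto.
          + apply (cder_comp (tcomp q 0 m) phi); [|apply cdiff_C_derive, Hp, E0].
            rewrite Hp0, <- HPd. apply cdiff_C_derive, k1, E0. }
      apply (f_equal Cmod) in ED. rewrite Cmod_mult, !Cmod_R, !Rabs_pos_eq in ED by lra.
      pose proof (Cmod_ge_0 (C_derive phi 0%C)). nra. }
  assert (HPdec : forall m, P (S m) <= P m).
  { intros m. change (P (S m)) with (P m * a m). destruct (T m) as (_ & h2 & _). specialize (HPlow m). nra. }
  assert (HPdec' : forall n m, (n <= m)%nat -> P m <= P n).
  { intros n m Hnm. induction Hnm; [lra|]. specialize (HPdec m). lra. }
  (* [l] is minus the limit of the decreasing sequence [P]. *)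
  destruct (completeness (fun x => exists n, x = - P n)) as [l [Hl1 Hl2]].
  { exists 0. intros x [n ->]. specialize (HPlow n). lra. }
  { exists (- P O); eauto. }
  exists (fun n => (P n + l) / r0). split; [|split].
  - intros n. assert (- P n <= l) by (apply Hl1; eauto).
    apply Rmult_le_pos; [lra|]. left; apply Rinv_0_lt_compat; auto.
  - intros n. change (P (S n)) with (P n * a n).
    replace ((P n + l) / r0 - (P n * a n + l) / r0) with (P n / r0 * (1 - a n)) by (field; lra).
    destruct (T n) as (_ & h2 & _).
    assert (1 <= P n / r0). { apply (Rmult_le_reg_r r0); auto. unfold Rdiv. rewrite Rmult_assoc, Rinv_l by lra. specialize (HPlow n). lra. }
    nra.
  - intros e He. apply NNPP; intros HN.
    assert (l <= l - e * r0); [|nra]. apply Hl2. intros x [n ->]. apply Rnot_lt_le; intros Hlt.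
    apply HN. exists n. intros m Hm. specialize (HPdec' n m Hm).
    apply (Rmult_le_reg_r r0); auto. unfold Rdiv. rewrite Rmult_assoc, Rinv_l by lra. lra.
Qed.

(** The factor is the Lipschitz constant [2 / (1 - r)] of a composite times the 3 and [1 / (1 - r)]
    of [near_id] for one further map; the differences of [s] add up the steps. *)
Lemma tower_near D q a s : koebe_tower D q a -> (forall n, 1 - a n <= s n - s (S n)) ->
  forall n m k r z, 0 <= r < 1 -> Cmod z <= r ->
    Cmod (tcomp q n (m + k) z - tcomp q n m z) <= 6 / ((1 - r) * (1 - r)) * (s (n + m)%nat - s (n + m + k)%nat).
Proof.
  intros T Hs n m k r z Hr Hz. induction k as [|k IH].
  - rewrite !Nat.add_0_r, Cmod_self_sub. lra.
  - rewrite !Nat.add_succ_r. simpl.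
    destruct (tcomp_facts D q a T n (m + k)) as (k1 & k2 & k3 & k4).
    destruct (T (n + (m + k))%nat) as (h1 & h2 & h3 & h4 & h5 & h6 & h7 & h8 & h9).
    rewrite Nat.add_assoc in *. set (j := (n + m + k)%nat) in *.
    pose proof (near_id (q j) (a j) r z h3 h4 h5 h6 h2 Hr Hz) as B1.
    assert (Hqz : Cmod (q j z) <= r).
    { eapply Rle_trans; [apply (schwarz_le (q j)); auto|auto].
      - intros w Hw. apply Rlt_le. apply (h4 w Hw).
      - unfold Edisc; lra. }
    pose proof (lip_bounded_E (tcomp q n (m + k)) 1 r (q j z) z k1 (fun w Hw => Rlt_le _ _ (k2 w Hw)) Hr Hqz Hz) as B2.
    pose proof (Cmod_sub_tri (tcomp q n (m + k) (q j z)) (tcomp q n (m + k) z) (tcomp q n m z)) as B3.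
    specialize (Hs j).
    assert (B4 : 2 * 1 / (1 - r) * Cmod (q j z - z) <= 2 * 1 / (1 - r) * (3 * (1 - a j) / (1 - r))).
    { apply Rmult_le_compat_l; auto. apply Rmult_le_pos; [lra|]. left; apply Rinv_0_lt_compat; lra. }
    replace (2 * 1 / (1 - r) * (3 * (1 - a j) / (1 - r))) with (6 / ((1 - r) * (1 - r)) * (1 - a j)) in B4 by (field; lra).
    assert (0 < 6 / ((1 - r) * (1 - r))) by (apply Rdiv_lt_0_compat; nra).
    assert (6 / ((1 - r) * (1 - r)) * (1 - a j) <= 6 / ((1 - r) * (1 - r)) * (s j - s (S j))) by (apply Rmult_le_compat_l; lra).
    lra.
Qed.

Lemma s_decreasing (a s : nat -> R) : (forall n, a n <= 1) -> (forall n, 1 - a n <= s n - s (S n)) ->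
  forall n m, (n <= m)%nat -> s m <= s n.
Proof.
  intros Ha Hs n m Hnm. induction Hnm; [lra|]. specialize (Ha m). specialize (Hs m). lra.
Qed.

(** [f n] is the limit of the composites from level [n] on. Its values lie in [D n], as they come
    from points of modulus at most [|z|] at a level so high that every omitted point is closer to
    the unit circle. *)
Lemma tower_limit D q a s : koebe_tower D q a -> (forall n, 0 <= s n) ->
  (forall n, 1 - a n <= s n - s (S n)) ->
  (forall e, 0 < e -> exists N, forall n, (N <= n)%nat -> s n <= e) ->
  exists f : nat -> C -> C, forall n, holo_on Edisc (f n) /\ (forall z, Edisc z -> Cmod (f n z) <= Cmod z) /\
    (forall z, Edisc z -> D n (f n z)) /\
    (forall m z, Edisc z -> f n z = tcomp q n m (f (n + m)%nat z)) /\
    (forall r z, 0 <= r < 1 -> Cmod z <= r -> Cmod (f n z - z) <= 6 / ((1 - r) * (1 - r)) * s n).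
Proof.
  intros T Hs0 Hs Hlim.
  assert (Ha : forall n, a n <= 1) by (intros n; destruct (T n) as (_ & h2 & _); lra).
  pose proof (s_decreasing a s Ha Hs) as Hdec.
  assert (Hc : forall n, exists f, uconv 0 1 (tcomp q n) f /\ forall z, Edisc z -> clim (fun m => tcomp q n m z) (f z)).
  { intros n. apply unif_cauchy. intros r e Hr He.
    set (K := 6 / ((1 - r) * (1 - r))). assert (HK : 0 < K) by (apply Rdiv_lt_0_compat; nra).
    destruct (Hlim (e / (2 * K))) as [N HN]; [apply Rdiv_lt_0_compat; lra|].
    assert (G : forall m z, (N <= m)%nat -> Cmod z <= r -> Cmod (tcomp q n m z - tcomp q n N z) <= e / 2).
    { intros m z Hm Hz. replace m with (N + (m - N))%nat by lia.
      eapply Rle_trans; [apply (tower_near D q a s T Hs n N (m - N) r z ltac:(lra) Hz)|]. fold K.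
      specialize (HN (n + N)%nat ltac:(lia)). pose proof (Hs0 (n + N + (m - N))%nat).
      replace (e / 2) with (K * (e / (2 * K))) by (field; lra). apply Rmult_le_compat_l; lra. }
    exists N. intros m m' z Hm Hm' Hz. pose proof (G m z Hm Hz). pose proof (G m' z Hm' Hz).
    pose proof (Cmod_sub_tri (tcomp q n m z) (tcomp q n N z) (tcomp q n m' z)).
    rewrite (Cmod_sub_sym (tcomp q n N z) (tcomp q n m' z)) in H1. lra. }
  set (f := fun n => proj1_sig (constructive_indefinite_description _ (Hc n))).
  assert (Hf : forall n, uconv 0 1 (tcomp q n) (f n) /\ forall z, Edisc z -> clim (fun m => tcomp q n m z) (f n z)).
  { intros n. unfold f. destruct constructive_indefinite_description; auto. }
  clearbody f. exists f.
  assert (Hle : forall n z, Edisc z -> Cmod (f n z) <= Cmod z).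
  { intros n z Hz. apply (clim_Cmod_le (fun m => tcomp q n m z)); [apply Hf; auto|]. intros m.
    destruct (tcomp_facts D q a T n m) as (k1 & k2 & k3 & k4).
    apply schwarz_le; auto. intros w Hw. apply Rlt_le. apply (k2 w Hw). }
  assert (Hcomp : forall n m z, Edisc z -> f n z = tcomp q n m (f (n + m)%nat z)).
  { intros n m z Hz. apply (clim_unique (fun k => tcomp q n (m + k) z)).
    - apply (clim_shift (fun k => tcomp q n k z)). apply Hf; auto.
    - intros e He.
      destruct (tcomp_facts D q a T n m) as (k1 & k2 & k3 & k4).
      assert (Hin : Edisc (f (n + m)%nat z)) by (unfold Edisc in *; specialize (Hle (n + m)%nat z Hz); lra).
      destruct (clim_ccont (tcomp q n m) (fun k => tcomp q (n + m) k z) (f (n + m)%nat z)) with (e := e) as [N K]; auto.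
      + apply cdiff_cont; auto.
      + apply Hf; auto.
      + exists N. intros k Hk. rewrite tcomp_add. auto. }
  intros n. split; [|split; [|split; [|split]]]; auto.
  - apply (weierstrass_E (tcomp q n)); [|apply Hf]. intros m. apply (tcomp_facts D q a T n m).
  - intros z Hz. unfold Edisc in Hz. pose proof (Cmod_ge_0 z).
    set (x := 1 - Cmod z). assert (Hx : 0 < x) by (unfold x; lra).
    (* An omitted point of modulus at most [|z|] would give [x^2 <= 32 (1 - a) <= x^2 / 2]. *)
    destruct (Hlim (x * x / 64)) as [N HN]; [nra|].
    rewrite (Hcomp n N z Hz). destruct (tcomp_facts D q a T n N) as (k1 & k2 & k3 & k4).
    apply k4. destruct (T (n + N)%nat) as (h1 & h2 & h3 & h4 & h5 & h6 & h7 & h8 & h9).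
    apply NNPP; intros Hnot. specialize (Hle (n + N)%nat z Hz).
    specialize (h9 (f (n + N)%nat z) ltac:(unfold Edisc; lra) Hnot).
    specialize (Hs (n + N)%nat). specialize (HN (n + N)%nat ltac:(lia)). pose proof (Hs0 (S (n + N))).
    assert (x * x <= (1 - Cmod (f (n + N)%nat z)) * (1 - Cmod (f (n + N)%nat z))) by (unfold x in *; apply Rmult_le_compat; lra).
    nra.
  - intros r z Hr Hz. assert (Hz' : Edisc z) by (unfold Edisc; lra).
    apply (clim_Cmod_le (fun m => tcomp q n m z - z)%C).
    + intros e He. destruct (proj2 (Hf n) z Hz' e He) as [N K]. exists N. intros m Hm. specialize (K m Hm).
      replace (tcomp q n m z - z - (f n z - z))%C with (tcomp q n m z - f n z)%C by ring. auto.
    + intros m. pose proof (tower_near D q a s T Hs n 0 m r z Hr Hz) as B. simpl in B.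
      eapply Rle_trans; [exact B|]. rewrite Nat.add_0_r. pose proof (Hs0 (n + m)%nat).
      apply Rmult_le_compat_l; [|lra]. left; apply Rdiv_lt_0_compat; nra.
Qed.

(** A disc [h] is lifted level by level to [u n]. By [near_id] the lifts form a Cauchy sequence once
    they are kept in a compact part of [E]. The limit lifts [h], since [f 0] is the composite of the
    first [n] maps with [f n], and [f n] tends to the identity. *)
Lemma tower_cov (D0 : C -> Prop) : (forall z, D0 z -> Edisc z) -> D0 0%C -> open_C D0 ->
  exists f, cov Edisc f D0 /\ f 0%C = 0%C.
Proof.
  intros HD0 H00 Ho0. destruct (koebe_tower_ex D0 HD0 H00) as (D & q & a & T & HDD).
  assert (Ho : open_C (D O)).
  { intros z Hz. apply HDD in Hz. destruct (Ho0 z Hz) as (e & He & K). exists e; split; auto.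
    intros w Hw. apply HDD; auto. }
  assert (HO : D O 0%C) by (apply HDD; auto).
  destruct (tower_summable D q a T Ho HO) as (s & Hs0 & Hs & Hlim).
  destruct (tower_limit D q a s T Hs0 Hs Hlim) as (f & Hf).
  assert (Hf0 : forall n, f n 0%C = 0%C).
  { intros n. apply Cmod_eq0. destruct (Hf n) as (_ & h & _). specialize (h 0%C E0). rewrite Cmod_0 in h. auto. }
  exists (f O). split; [|auto]. split; [apply Hf|]. split; [intros z Hz; apply HDD, Hf; auto|].
  intros h l Hh HhD Hl Hh0.
  (* The value at 0 is consistent, as [q n] takes [f (n + 1) l] to [f n l], and it tends to [l]. *)
  set (P := fun n (g : C -> C) => holo_on Edisc g /\ (forall z, Edisc z -> D n (g z)) /\ g 0%C = f n l).
  set (Q := fun n (g g' : C -> C) => forall z, Edisc z -> q n (g' z) = g z).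
  destruct (dep_choice (C -> C) P Q h) as (u & Hu0 & HP & HQ).
  { split; [auto|]. split; auto. intros z Hz; apply HDD; auto. }
  { intros n g (g1 & g2 & g3). destruct (T n) as (h1 & h2 & h3 & h4 & h5 & h6 & h7 & (c1 & c2 & c3) & h9).
    destruct (c3 g (f (S n) l) g1 g2) as (phi & p1 & p2 & p3 & p4).
    - apply Hf; auto.
    - rewrite g3. destruct (Hf n) as (_ & _ & _ & K & _). specialize (K 1%nat l Hl). simpl in K.
      rewrite Nat.add_0_r, Nat.add_1_r in K. auto.
    - exists phi. split; [split; auto|exact p4]. }
  assert (HuE : forall n z, Edisc z -> Edisc (u n z)).
  { intros n z Hz. destruct (T n) as (h1 & _). apply h1. apply HP; auto. }
  set (x := 1 - Cmod l). assert (Hx : 0 < x <= 1) by (unfold x; unfold Edisc in Hl; pose proof (Cmod_ge_0 l); lra).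
  (* uniform bound [|u n z| <= R1 < 1] on [|z| <= r], from Schwarz-Pick and [|u n 0| <= |l|] *)
  assert (Hbd : forall r, 0 < r < 1 -> exists R1, 0 <= R1 < 1 /\ forall n z, Cmod z <= r -> Cmod (u n z) <= R1).
  { intros r Hr. set (y := x * x * (1 - r * r)).
    assert (Hy : 0 < y <= 1).
    { assert (0 < x * x <= 1) by nra. assert (0 < 1 - r * r <= 1) by nra. unfold y. split; [nra|].
      apply Rle_trans with (1 * 1); [apply Rmult_le_compat; lra|lra]. }
    exists (sqrt (1 - y)). split.
    - split; [apply sqrt_pos|]. apply Rlt_le_trans with (sqrt 1); [apply sqrt_lt_1; lra|rewrite sqrt_1; lra].
    - intros n z Hz. pose proof (Cmod_ge_0 z). assert (Hz' : Edisc z) by (unfold Edisc; lra).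
      pose proof (schwarz_pick_bound (u n) z (proj1 (HP n)) (fun w Hw => HuE n w Hw) Hz') as B.
      destruct (HP n) as (_ & _ & E). rewrite E in B.
      assert (Hfl : Cmod (f n l) <= Cmod l) by (apply Hf; auto).
      pose proof (Cmod_ge_0 (u n z)). rewrite <- (sqrt_Rsqr (Cmod (u n z))) by auto.
      apply sqrt_le_1_alt. unfold Rsqr. eapply Rle_trans; [exact B|].
      assert (x * x <= (1 - Cmod (f n l)) * (1 - Cmod (f n l))) by (unfold x in *; apply Rmult_le_compat; lra).
      assert (1 - r * r <= 1 - Cmod z * Cmod z) by nra.
      assert (y <= (1 - Cmod (f n l)) * (1 - Cmod (f n l)) * (1 - Cmod z * Cmod z)).
      { unfold y. apply Rmult_le_compat; nra. }
      lra. }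
  assert (Hstep : forall r R1, 0 <= R1 < 1 -> (forall n z, Cmod z <= r -> Cmod (u n z) <= R1) ->
     forall n k z, Cmod z <= r -> Edisc z -> Cmod (u (n + k)%nat z - u n z) <= 3 / (1 - R1) * (s n - s (n + k)%nat)).
  { intros r R1 HR1 HB n k z Hz Hz'. induction k as [|k IH].
    - rewrite Nat.add_0_r, Cmod_self_sub. lra.
    - rewrite Nat.add_succ_r. set (j := (n + k)%nat) in *.
      destruct (T j) as (h1 & h2 & h3 & h4 & h5 & h6 & h7 & h8 & h9).
      pose proof (near_id (q j) (a j) R1 (u (S j) z) h3 h4 h5 h6 h2 HR1 (HB (S j) z Hz)) as B.
      rewrite (HQ j z Hz') in B. rewrite Cmod_sub_sym in B.
      pose proof (Cmod_sub_tri (u (S j) z) (u j z) (u n z)). specialize (Hs j).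
      assert (0 < 3 / (1 - R1)) by (apply Rdiv_lt_0_compat; lra).
      replace (3 * (1 - a j) / (1 - R1)) with (3 / (1 - R1) * (1 - a j)) in B by (field; lra).
      assert (3 / (1 - R1) * (1 - a j) <= 3 / (1 - R1) * (s j - s (S j))) by (apply Rmult_le_compat_l; lra).
      lra. }
  destruct (unif_cauchy u) as (phi & Hphi & Hpt).
  { intros r e Hr He. destruct (Hbd r Hr) as (R1 & HR1 & HB).
    set (K := 3 / (1 - R1)). assert (HK : 0 < K) by (apply Rdiv_lt_0_compat; lra).
    destruct (Hlim (e / (2 * K))) as [N HN]; [apply Rdiv_lt_0_compat; lra|].
    assert (G : forall m z, (N <= m)%nat -> Cmod z <= r -> Cmod (u m z - u N z) <= e / 2).
    { intros m z Hm Hz. replace m with (N + (m - N))%nat by lia.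
      eapply Rle_trans; [apply (Hstep r R1 HR1 HB N (m - N)%nat z Hz ltac:(unfold Edisc; lra))|]. fold K.
      specialize (HN N (le_n _)). pose proof (Hs0 (N + (m - N))%nat).
      replace (e / 2) with (K * (e / (2 * K))) by (field; lra). apply Rmult_le_compat_l; lra. }
    exists N. intros m m' z Hm Hm' Hz. pose proof (G m z Hm Hz). pose proof (G m' z Hm' Hz).
    pose proof (Cmod_sub_tri (u m z) (u N z) (u m' z)).
    rewrite (Cmod_sub_sym (u N z) (u m' z)) in H1. lra. }
  assert (HphiB : forall r R1, (forall n z, Cmod z <= r -> Cmod (u n z) <= R1) -> forall z, Cmod z <= r -> Edisc z -> Cmod (phi z) <= R1).
  { intros r R1 HB z Hz Hz'. apply (clim_Cmod_le (fun n => u n z)); auto. }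
  assert (HphiE : forall z, Edisc z -> Edisc (phi z)).
  { intros z Hz. unfold Edisc in Hz. pose proof (Cmod_ge_0 z).
    destruct (Hbd ((1 + Cmod z) / 2) ltac:(lra)) as (R1 & HR1 & HB).
    assert (Cmod (phi z) <= R1) by (apply (HphiB ((1 + Cmod z) / 2)); auto; lra). unfold Edisc; lra. }
  exists phi. split; [|split; [|split]]; auto.
  - apply (weierstrass_E u); auto. intros n; apply HP.
  - apply (clim_unique (fun n => u n 0%C)); [apply Hpt, E0|].
    intros e He. assert (Hl' : 0 <= Cmod l < 1) by (split; [apply Cmod_ge_0|apply Hl]).
    set (K := 6 / ((1 - Cmod l) * (1 - Cmod l))). assert (HK : 0 < K) by (apply Rdiv_lt_0_compat; nra).
    destruct (Hlim (e / K)) as [N HN]; [apply Rdiv_lt_0_compat; lra|]. exists N. intros n Hn.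
    destruct (HP n) as (_ & _ & ->). destruct (Hf n) as (_ & _ & _ & _ & B).
    eapply Rle_trans; [apply (B (Cmod l) l Hl' (Rle_refl _))|]. fold K. specialize (HN n Hn).
    replace e with (K * (e / K)) by (field; lra). apply Rmult_le_compat_l; lra.
  - intros z Hz. pose proof (Cmod_ge_0 z). unfold Edisc in Hz.
    destruct (Hbd ((1 + Cmod z) / 2) ltac:(lra)) as (R1 & HR1 & HB).
    assert (Hp1 : Cmod (phi z) <= R1) by (apply (HphiB ((1 + Cmod z) / 2)); auto; lra).
    assert (Hun : forall n, tcomp q 0 n (u n z) = h z).
    { induction n as [|n IH]; [simpl; rewrite Hu0; auto|].
      simpl. rewrite (HQ n z Hz). auto. }
    apply C_eq_of_small. intros e He.
    set (K := 6 / ((1 - R1) * (1 - R1))). assert (HK : 0 < K) by (apply Rdiv_lt_0_compat; nra).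
    set (L := 2 * 1 / (1 - R1)). assert (HL : 0 < L) by (apply Rdiv_lt_0_compat; lra).
    destruct (Hlim (e / (2 * L * K))) as [N1 HN1]; [apply Rdiv_lt_0_compat; nra|].
    destruct (Hpt z Hz (e / (2 * L))) as [N2 HN2]; [apply Rdiv_lt_0_compat; lra|].
    set (n := (N1 + N2)%nat). specialize (HN1 n ltac:(unfold n; lia)). specialize (HN2 n ltac:(unfold n; lia)).
    destruct (Hf O) as (_ & _ & _ & E & _). rewrite (E n (phi z) (HphiE z Hz)). simpl. rewrite <- (Hun n).
    destruct (tcomp_facts D q a T O n) as (k1 & k2 & k3 & k4).
    destruct (Hf n) as (_ & Bn1 & _ & _ & Bn). specialize (Bn R1 (phi z) HR1 Hp1). specialize (Bn1 (phi z) (HphiE z Hz)).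
    eapply Rle_trans; [apply (lip_bounded_E (tcomp q 0 n) 1 R1); auto|].
    + intros w Hw. apply Rlt_le. apply (k2 w Hw).
    + lra.
    + apply HB. lra.
    + fold L. fold K in Bn. pose proof (Cmod_sub_tri (f n (phi z)) (phi z) (u n z)) as B3.
      rewrite (Cmod_sub_sym (phi z) (u n z)) in B3.
      assert (K * s n <= K * (e / (2 * L * K))) by (apply Rmult_le_compat_l; lra).
      replace (K * (e / (2 * L * K))) with (e / (2 * L)) in H0 by (field; lra).
      replace e with (L * (e / (2 * L) + e / (2 * L))) by (field; lra).
      apply Rmult_le_compat_l; lra.
Qed.

Lemma bounded_cov (D : C -> Prop) (z0 : C) (M : R) : open_C D -> D z0 -> 0 < M ->
  (forall z, D z -> Cmod (z - z0) < M) -> exists f, cov Edisc f D /\ f 0%C = z0.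
Proof.
  intros Ho H0 HM HB.
  assert (HMn : RtoC M <> 0%C) by (intros E; apply RtoC_inj in E; lra).
  set (A := fun w => (z0 + M * w)%C). set (D' := fun w => D (A w)).
  assert (HMm : Cmod M = M) by (rewrite Cmod_R, Rabs_pos_eq; lra).
  destruct (tower_cov D') as (f & Hf & Hf0).
  - intros w Hw. specialize (HB _ Hw). unfold A in HB. unfold Edisc.
    replace (z0 + M * w - z0)%C with (M * w)%C in HB by ring. rewrite Cmod_mult, HMm in HB. nra.
  - unfold D', A. replace (z0 + M * 0)%C with z0 by ring. auto.
  - intros w Hw. destruct (Ho _ Hw) as (e & He & K). exists (e / M). split; [apply Rdiv_lt_0_compat; auto|].
    intros v Hv. apply K. unfold A. replace (z0 + M * v - (z0 + M * w))%C with (M * (v - w))%C by ring.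
    rewrite Cmod_mult, HMm. apply (Rmult_lt_compat_l M) in Hv; auto. replace (M * (e / M)) with e in Hv by (field; lra). auto.
  - exists (fun z => A (f z)). split.
    + apply (cov_comp Edisc f D' A); auto. apply (cov_iso D' D A (fun z => (z - z0) / M)%C).
      * intros z _; unfold A; cdf.
      * intros z _; cdf; auto.
      * auto.
      * intros z Hz. unfold D', A. replace (z0 + M * ((z - z0) / M))%C with z by (field; auto). auto.
      * intros z _. unfold A. field; auto.
      * intros z _. unfold A. field; auto.
    + rewrite Hf0. unfold A. ring.
Qed.

(** * Bloch's theorem *)

(** Near [l] the function [f z - f' l * z] has Lipschitz constant [|f' l| / 2], too small to cancel
    the linear part. *)
Lemma local_inj (f : C -> C) l : holo_on Edisc f -> Edisc l -> C_derive f l <> 0%C ->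
  exists d, 0 < d /\ (forall z, Cmod (z - l) < d -> Edisc z) /\
    forall z w, Cmod (z - l) < d -> Cmod (w - l) < d -> f z = f w -> z = w.
Proof.
  intros Hf Hl Hn. apply Cmod_pos_neq in Hn as Hp. set (m := Cmod (C_derive f l)) in *.
  pose proof (holo_C_derive Edisc f open_Edisc Hf) as Hf'.
  destruct (cdiff_cont _ _ (Hf' l Hl) (m / 2)) as [d [Hd K]]; [lra|].
  destruct (open_Edisc l Hl) as [d' [Hd' K']].
  exists (Rmin d d'). pose proof (Rmin_l d d'). pose proof (Rmin_r d d').
  split; [apply Rmin_pos; auto|]. split; [intros z Hz; apply K'; lra|].
  intros z w Hz Hw E.
  assert (B : Cmod ((f z - C_derive f l * z) - (f w - C_derive f l * w)) <= m / 2 * Cmod (z - w)).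
  { apply (mvi (fun z => f z - C_derive f l * z)%C (fun z => C_derive f z - C_derive f l)%C).
    - intros t Ht. assert (Edisc (w + (z - w) * t)%C).
      { apply K'. eapply Rlt_le_trans; [apply seg_in_ball; eauto|lra]. }
      eapply cder_eq; [cdr; apply (cdiff_C_derive f); auto|]. ring.
    - intros t Ht. assert (Edisc (w + (z - w) * t)%C).
      { apply K'. eapply Rlt_le_trans; [apply seg_in_ball; eauto|lra]. }
      apply cdiff_cont. cdf. apply Hf'; auto.
    - intros t Ht. apply Rlt_le, K. eapply Rlt_le_trans; [apply seg_in_ball; eauto|lra]. }
  rewrite E in B. replace (f w - C_derive f l * z - (f w - C_derive f l * w))%C with (- (C_derive f l * (z - w)))%C in B by ring.
  rewrite Cmod_opp, Cmod_mult in B. fold m in B. pose proof (Cmod_ge_0 (z - w)).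
  apply Csub_eq, Cmod_eq0. nra.
Qed.

(** * Uniqueness of lifts *)

Definition icont (p : R -> C) : Prop :=
  forall t, I01 t -> forall e, 0 < e -> exists d, 0 < d /\ forall s, I01 s -> Rabs (s - t) < d -> Cmod (p s - p t) < e.

(** The set of times up to which the paths agree is closed by continuity, and open because [f] is
    injective near a point with nonzero derivative. *)
Lemma path_unique (f : C -> C) (p1 p2 : R -> C) : holo_on Edisc f ->
  (forall z, Edisc z -> C_derive f z <> 0%C) -> icont p1 -> icont p2 ->
  (forall t, I01 t -> Edisc (p1 t)) -> (forall t, I01 t -> f (p1 t) = f (p2 t)) ->
  p1 0 = p2 0 -> forall t, I01 t -> p1 t = p2 t.
Proof.
  intros Hf Hn C1 C2 HE Heq H0.
  set (S := fun t => I01 t /\ forall s, 0 <= s <= t -> p1 s = p2 s).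
  assert (HS0 : S 0).
  { split; [unfold I01; lra|]. intros s Hs. replace s with 0 by lra. auto. }
  destruct (completeness S) as [T [HT1 HT2]].
  { exists 1. intros t [[_ Ht] _]. auto. }
  { exists 0; auto. }
  assert (HT : I01 T).
  { split; [apply HT1; auto|]. apply HT2. intros t [[_ Ht] _]. auto. }
  assert (Hbelow : forall s, 0 <= s < T -> p1 s = p2 s).
  { intros s Hs. apply NNPP; intros HN. assert (T <= s); [|lra]. apply HT2. intros t [Ht1 Ht2].
    apply Rnot_lt_le; intros Hlt. apply HN, Ht2. lra. }
  assert (HTeq : p1 T = p2 T).
  { destruct (Req_dec T 0) as [->|HT0]; auto. unfold I01 in HT.
    apply C_eq_of_small. intros e He.
    destruct (C1 T HT (e / 2)) as [d1 [Hd1 K1]]; [lra|]. destruct (C2 T HT (e / 2)) as [d2 [Hd2 K2]]; [lra|].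
    set (s := Rmax 0 (T - Rmin d1 d2 / 2)).
    assert (Hs : 0 <= s < T /\ Rabs (s - T) < d1 /\ Rabs (s - T) < d2).
    { assert (0 < Rmin d1 d2) by (apply Rmin_pos; auto). pose proof (Rmin_l d1 d2). pose proof (Rmin_r d1 d2).
      unfold s, Rmax. destruct Rle_dec; rewrite Rabs_left; lra. }
    destruct Hs as (h1 & h2 & h3). specialize (K1 s ltac:(unfold I01; lra) h2). specialize (K2 s ltac:(unfold I01; lra) h3).
    rewrite (Hbelow s h1) in K1. pose proof (Cmod_sub_tri (p1 T) (p2 s) (p2 T)).
    rewrite (Cmod_sub_sym (p1 T) (p2 s)) in H. lra. }
  assert (HT1' : T = 1).
  { apply NNPP; intros HN. assert (HTlt : T < 1) by (unfold I01 in HT; lra).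
    destruct (local_inj f (p1 T) Hf (HE T HT) (Hn _ (HE T HT))) as (d & Hd & _ & Kd).
    destruct (C1 T HT d Hd) as [d1 [Hd1 K1]]. destruct (C2 T HT d Hd) as [d2 [Hd2 K2]].
    set (x := Rmin (1 - T) (Rmin d1 d2 / 2)).
    assert (Hx : 0 < x /\ T + x <= 1 /\ x < d1 /\ x < d2).
    { assert (0 < Rmin d1 d2) by (apply Rmin_pos; auto). pose proof (Rmin_l d1 d2). pose proof (Rmin_r d1 d2).
      unfold x. destruct (Rle_dec (1 - T) (Rmin d1 d2 / 2)) as [h|h].
      - rewrite (Rmin_left (1 - T)) by lra. lra.
      - rewrite (Rmin_right (1 - T)) by lra. lra. }
    destruct Hx as (x1 & x2 & x3 & x4).
    assert (T + x <= T); [|lra]. apply HT1. split; [unfold I01 in *; lra|].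
    intros s Hs. destruct (Rlt_dec s T) as [h|h]; [apply Hbelow; lra|].
    assert (Is : I01 s) by (unfold I01 in *; lra).
    assert (Rabs (s - T) < d1 /\ Rabs (s - T) < d2) as [h1 h2] by (rewrite Rabs_pos_eq; lra).
    apply Kd; auto. rewrite HTeq. auto. }
  intros t Ht. destruct (Req_dec t 1) as [->|]; [rewrite <- HT1'; auto|]. apply Hbelow. unfold I01 in Ht. lra.
Qed.

Lemma icont_ray (phi : C -> C) (z : C) : holo_on Edisc phi -> Edisc z -> icont (fun t => phi (t * z)%C).
Proof.
  intros Hp Hz t Ht e He.
  assert (Htz : Edisc (t * z)%C).
  { unfold Edisc in *. rewrite Cmod_mult, Cmod_R. unfold I01 in Ht. rewrite Rabs_pos_eq by lra. pose proof (Cmod_ge_0 z). nra. }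
  destruct (cdiff_cont _ _ (Hp _ Htz) e He) as [d [Hd K]]. exists d; split; auto.
  intros s _ Hs. apply K. replace (s * z - t * z)%C with (RtoC (s - t) * z)%C by (rewrite RtoC_minus; ring).
  rewrite Cmod_mult, Cmod_R. unfold Edisc in Hz. pose proof (Cmod_ge_0 z). pose proof (Rabs_pos (s - t)). nra.
Qed.

Lemma Edisc_scale t z : 0 <= t <= 1 -> Edisc z -> Edisc (t * z)%C.
Proof.
  intros Ht Hz. unfold Edisc in *. rewrite Cmod_mult, Cmod_R, Rabs_pos_eq by lra. pose proof (Cmod_ge_0 z). nra.
Qed.

Lemma lift_unique (f phi psi : C -> C) : holo_on Edisc f -> (forall z, Edisc z -> C_derive f z <> 0%C) ->
  holo_on Edisc phi -> holo_on Edisc psi -> (forall z, Edisc z -> Edisc (phi z)) ->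
  (forall z, Edisc z -> f (phi z) = f (psi z)) -> phi 0%C = psi 0%C -> forall z, Edisc z -> phi z = psi z.
Proof.
  intros Hf Hn Hp Hq HE Heq H0 z Hz.
  assert (K : forall t, I01 t -> phi (t * z)%C = psi (t * z)%C).
  { apply (path_unique f (fun t => phi (t * z)%C) (fun t => psi (t * z)%C)); auto.
    - apply icont_ray; auto.
    - apply icont_ray; auto.
    - intros t Ht. apply HE, Edisc_scale; auto.
    - intros t Ht. apply Heq, Edisc_scale; auto.
    - replace (0 * z)%C with (RtoC 0) by ring. auto. }
  specialize (K 1 ltac:(unfold I01; lra)). replace (1 * z)%C with z in K by ring. auto.
Qed.

Lemma der_nz_of_lift (f phi : C -> C) (l c e : C) : Edisc l -> holo_on Edisc f -> holo_on Edisc phi -> phi 0%C = l ->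
  e <> 0%C -> (forall z, Edisc z -> f (phi z) = c + e * z)%C -> C_derive f l <> 0%C.
Proof.
  intros Hl Hf Hp H0 He HE E. apply He.
  apply (cder_unique (fun z => c + e * z)%C 0%C).
  - eapply cder_eq; [cdr|ring].
  - apply cder_ext with (fun z => f (phi z)).
    + exists 1; split; [lra|]. intros w Hw. rewrite Csub_0_r in Hw. apply HE; auto.
    + eapply cder_eq; [apply (cder_comp f phi); apply cdiff_C_derive; [rewrite H0; auto|apply Hp, E0]|].
      rewrite H0, E. ring.
Qed.

(** A small affine disc about [f l] lifts, and by the chain rule [f' l] divides its nonzero
    derivative. *)
Lemma cov_der_nz f D : open_C D -> cov Edisc f D -> forall l, Edisc l -> C_derive f l <> 0%C.
Proof.
  intros Ho (Hf & HfD & L) l Hl. destruct (Ho _ (HfD l Hl)) as (e & He & K).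
  destruct (L (fun z => f l + e * z)%C l) as (phi & Hp & HpE & Hp0 & HE); auto.
  - intros z _; cdf.
  - intros z Hz. apply K. replace (f l + e * z - f l)%C with (e * z)%C by ring.
    rewrite Cmod_mult, Cmod_R, Rabs_pos_eq by lra. unfold Edisc in Hz. nra.
  - ring.
  - apply (der_nz_of_lift f phi l (f l) e); auto. intros E. apply RtoC_inj in E. lra.
Qed.

Lemma circ_surj (r : R) (z : C) : Cmod z = r -> 0 < r -> exists t, 0 <= t <= 2 * PI /\ z = circ 0 r t.
Proof.
  intros Hz Hr. pose proof PI_RGT_0.
  assert (Hrn : RtoC r <> 0%C) by (intros E; apply RtoC_inj in E; lra).
  set (u := (z / r)%C).
  assert (Hu : Cmod u = 1) by (unfold u; rewrite Cmod_div, Cmod_R, Rabs_pos_eq by (auto; lra); rewrite Hz; field; lra).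
  assert (Hx : exists t, 0 <= t <= 2 * PI /\ cis t = u).
  { pose proof (Cmod_sqr u) as S. rewrite Hu in S. destruct u as [a b]; simpl in S.
    assert (Ha : -1 <= a <= 1) by nra. pose proof (acos_bound a).
    assert (Hs : sin (acos a) = Rabs b).
    { rewrite sin_acos by auto. rewrite <- (sqrt_Rsqr_abs b). f_equal. unfold Rsqr. lra. }
    destruct (Rle_dec 0 b) as [h|h].
    - exists (acos a). split; [lra|]. unfold cis. rewrite cos_acos, Hs, Rabs_pos_eq; auto.
    - exists (- acos a + 2 * PI). split; [lra|]. unfold cis.
      rewrite cos_plus, sin_plus, cos_2PI, sin_2PI, cos_neg, sin_neg, cos_acos, Hs by auto.
      rewrite Rabs_left by lra. f_equal; ring. }
  destruct Hx as [t [Ht Et]]. exists t; split; auto. unfold circ. rewrite Et. unfold u. field; auto.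
Qed.

Lemma bounded_disc (f : C -> C) r : holo_on Edisc f -> 0 < r < 1 -> exists L, 0 < L /\ forall z, Cmod z <= r -> Cmod (f z) <= L.
Proof.
  intros Hf Hr. set (r1 := (1 + r) / 2).
  destruct (rcont_bounded_period (fun t => f (circ 0 r1 t))) as [L [HL KL]].
  - intros t. apply (rcont_comp f); [|apply rcont_circ]. apply cdiff_cont, Hf, ball_E.
    unfold cball. rewrite Cmod_circ; unfold r1; lra.
  - exists L; split; auto. intros z Hz. apply (max_modulus_E f r1); auto; try (unfold r1; lra).
    intros w Hw. destruct (circ_surj r1 w Hw) as (t & Ht & ->); [unfold r1; lra|]. auto.
Qed.

(* Bloch's theorem in Landau's form: [a] almost maximizes [(r - |z|) |g'(z)|], so that [g'] is
   almost constant near [a]. *)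
Lemma bloch (g : C -> C) : holo_on Edisc g ->
  (forall c, exists w, Cmod (w - c) <= 6 /\ forall z, Edisc z -> g z <> w) ->
  forall z, Edisc z -> Cmod (C_derive g z) * (1 - Cmod z) <= 1920.
Proof.
  intros Hg Hom z Hz. unfold Edisc in Hz. set (r := (1 + Cmod z) / 2). pose proof (Cmod_ge_0 z).
  assert (Hr : 0 < r < 1) by (unfold r; lra).
  pose proof (holo_C_derive Edisc g open_Edisc Hg) as Hg'.
  destruct (bounded_disc (C_derive g) r Hg' Hr) as (L & HL & KL).
  destruct (completeness (fun x => exists v, Cmod v < r /\ x = (r - Cmod v) * Cmod (C_derive g v))) as [M [HM1 HM2]].
  { exists L. intros x [v [Hv ->]]. pose proof (Cmod_ge_0 v). specialize (KL v ltac:(lra)).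
    pose proof (Cmod_ge_0 (C_derive g v)).
    apply Rle_trans with (1 * L); [apply Rmult_le_compat; lra|lra]. }
  { exists ((r - Cmod 0) * Cmod (C_derive g 0%C)), 0%C. rewrite Cmod_0. split; auto; lra. }
  (* Since [r - |z| = (1 - |z|) / 2], the claim follows from [M <= 960]. Otherwise [t d0 > 240]
     below, so that [d0 rho / 2 > 12], twice the radius 6 of the hypothesis. *)
  destruct (Rle_dec M 960) as [HM|HM].
  { assert (B : (r - Cmod z) * Cmod (C_derive g z) <= M) by (apply HM1; exists z; split; [unfold r; lra|auto]).
    replace (r - Cmod z) with ((1 - Cmod z) / 2) in B by (unfold r; lra). lra. }
  exfalso.
  assert (Ha : exists a, Cmod a < r /\ M / 2 < (r - Cmod a) * Cmod (C_derive g a)).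
  { apply NNPP; intros HN. assert (M <= M / 2); [|lra]. apply HM2. intros x [v [Hv ->]].
    apply Rnot_lt_le; intros Hlt. apply HN. eauto. }
  destruct Ha as (a & Har & HaM). set (t := (r - Cmod a) / 2). assert (Ht : 0 < t) by (unfold t; lra).
  set (d0 := Cmod (C_derive g a)) in *. assert (Ed : (r - Cmod a) * d0 = 2 * (t * d0)) by (unfold t; field).
  rewrite Ed in HaM.
  assert (Hd0 : 0 < d0). { assert (0 <= d0) by apply Cmod_ge_0. nra. }
  assert (Hin : forall v, Cmod (v - a) <= t -> Cmod v + t <= r).
  { intros v Hv. pose proof (Cmod_le_sub v a). unfold t in *. lra. }
  (* The weight [r - |v|] is still at least [t] on this disc, and [M < 4 t d0]. *)
  assert (H4 : forall v, Cmod (v - a) <= t -> Cmod (C_derive g v) <= 4 * d0).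
  { intros v Hv. specialize (Hin v Hv).
    assert (B : (r - Cmod v) * Cmod (C_derive g v) <= M) by (apply HM1; exists v; split; [lra|auto]).
    pose proof (Cmod_ge_0 (C_derive g v)).
    assert (t * Cmod (C_derive g v) <= (r - Cmod v) * Cmod (C_derive g v)) by (apply Rmult_le_compat_r; lra).
    assert (t * Cmod (C_derive g v) <= t * (4 * d0)) by lra. apply (Rmult_le_reg_l t); auto. }
  assert (Htn : RtoC t <> 0%C) by (intros E; apply RtoC_inj in E; lra).
  assert (Htm : Cmod t = t) by (rewrite Cmod_R, Rabs_pos_eq; lra).
  assert (Hd5 : (5 * d0)%C <> 0%C) by (rewrite <- RtoC_mult; intros E; apply RtoC_inj in E; lra).
  assert (Hd5m : Cmod (5 * d0) = 5 * d0) by (rewrite <- RtoC_mult, Cmod_R, Rabs_pos_eq; lra).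
  set (rho := t / 10).
  (* Schwarz for [(g' (a + t w) - g' a) / (5 d0)], taken at a tenth of the radius. *)
  assert (Hvar : forall v, Cmod (v - a) <= rho -> Cmod (C_derive g v - C_derive g a) <= d0 / 2).
  { intros v Hv.
    pose proof (schwarz_le (fun w => (C_derive g (a + t * w) - C_derive g a) / (5 * d0))%C ((v - a) / t)%C) as S.
    cbv beta in S. replace (a + t * ((v - a) / t))%C with v in S by (field; auto).
    assert (Hva : Cmod ((v - a) / t) <= / 10).
    { rewrite Cmod_div, Htm by auto. apply (Rmult_le_reg_r t); auto. unfold Rdiv. rewrite Rmult_assoc, Rinv_l by lra. unfold rho in Hv. lra. }
    assert (S' : Cmod ((C_derive g v - C_derive g a) / (5 * d0)) <= Cmod ((v - a) / t)).
    { apply S.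
      - intros w Hw. cdf; auto. apply (cdiff_comp (C_derive g) (fun w => a + t * w)%C); [|cdf].
        apply Hg'. unfold Edisc in *. assert (Cmod (a + t * w) + t <= r); [|lra].
        apply Hin. replace (a + t * w - a)%C with (t * w)%C by ring. rewrite Cmod_mult, Htm. nra.
      - intros w Hw. rewrite Cmod_div, Hd5m by auto. apply (Rmult_le_reg_r (5 * d0)); [lra|].
        unfold Rdiv. rewrite Rmult_assoc, Rinv_l by lra.
        unfold Edisc in Hw.
        assert (B : Cmod (C_derive g (a + t * w)) <= 4 * d0).
        { apply H4. replace (a + t * w - a)%C with (t * w)%C by ring. rewrite Cmod_mult, Htm. nra. }
        unfold Cminus. pose proof (Cmod_triangle (C_derive g (a + t * w)) (- C_derive g a)) as B'. rewrite Cmod_opp in B'. fold d0 in B'. lra.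
      - replace (a + t * 0)%C with a by ring. unfold Cminus, Cdiv. rewrite Cplus_opp_r. ring.
      - unfold Edisc. lra. }
    rewrite Cmod_div, Hd5m in S' by auto.
    assert (S2 : Cmod (C_derive g v - C_derive g a) / (5 * d0) <= / 10) by lra.
    apply (Rmult_le_compat_r (5 * d0)) in S2; [|lra]. unfold Rdiv in S2. rewrite Rmult_assoc, Rinv_l in S2 by lra. lra. }
  assert (Hcirc : forall v, Cmod (v - a) = rho -> d0 * rho / 2 <= Cmod (g v - g a)).
  { intros v Hv.
    assert (B : Cmod ((g v - C_derive g a * v) - (g a - C_derive g a * a)) <= d0 / 2 * Cmod (v - a)).
    { assert (Hs : forall s, 0 <= s <= 1 -> Cmod (a + (v - a) * s - a) <= rho).
      { intros s Hs. apply seg_in_cball_le; auto; [rewrite Cmod_self_sub; unfold rho; lra|lra]. }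
      assert (HsE : forall s, 0 <= s <= 1 -> Edisc (a + (v - a) * s)%C).
      { intros s Hs'. specialize (Hs s Hs'). specialize (Hin _ (Rle_trans _ _ t Hs ltac:(unfold rho; lra))). unfold Edisc; lra. }
      apply (mvi (fun z => g z - C_derive g a * z)%C (fun z => C_derive g z - C_derive g a)%C).
      - intros s Hs'. eapply cder_eq; [cdr; apply (cdiff_C_derive g); auto|]. ring.
      - intros s Hs'. apply cdiff_cont. cdf. apply Hg'; auto.
      - intros s Hs'. apply Hvar; auto. }
    replace (g v - C_derive g a * v - (g a - C_derive g a * a))%C with ((g v - g a) - C_derive g a * (v - a))%C in B by ring.
    pose proof (Cmod_le_sub (C_derive g a * (v - a)) (g v - g a)) as B2. rewrite Cmod_mult in B2. fold d0 in B2.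
    rewrite (Cmod_sub_sym (C_derive g a * (v - a))) in B2. rewrite Hv in *. lra. }
  destruct (Hom (g a)) as (w & Hw & Hwn).
  assert (Hbig : 12 < d0 * rho / 2) by (unfold rho; nra).
  (* At the centre [|g - w| <= 6], on the circle it is at least [d0 rho / 2 - 6 > 6]; so [g] takes
     the omitted value [w]. *)
  destruct (min_modulus (fun v => g v - w)%C a t rho (d0 * rho / 2 - 6) a) as (v & Hv & Ev).
  - intros v Hv. unfold cball in Hv. cdf. apply Hg. specialize (Hin v ltac:(lra)). unfold Edisc; lra.
  - unfold rho; lra.
  - intros v Hv. specialize (Hcirc v Hv). pose proof (Cmod_le_sub (g v - g a) (g v - w)).
    replace (g v - g a - (g v - w))%C with (w - g a)%C in H0 by ring. lra.
  - rewrite Cmod_self_sub. unfold rho; lra.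
  - rewrite Cmod_sub_sym. lra.
  - apply (Hwn v).
    + unfold cball in Hv. specialize (Hin v ltac:(lra)). unfold Edisc; lra.
    + apply Csub_eq; auto.
Qed.

(** * A pull-back whose omitted points form a net *)

Definition ccos (m : C) : C := ((cexp (Ci * m) + cexp (- (Ci * m))) / 2)%C.

(* Covers the twice punctured plane [C \ {0, 1}] by the complement of a net. *)
Definition netmap (m : C) : C := cexp (2 * PI * Ci * ccos m)%C.

Lemma cdiff_ccos m : cdiff ccos m.
Proof.
  unfold ccos. apply (cdiff_div (fun m => cexp (Ci * m) + cexp (- (Ci * m)))%C (fun _ => RtoC 2)).
  - apply C2_nz.
  - apply (cdiff_plus (fun m => cexp (Ci * m)) (fun m => cexp (- (Ci * m))%C)).
    + apply (cdiff_cexp (fun m => Ci * m)%C); cdf.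
    + apply (cdiff_cexp (fun m => - (Ci * m))%C); cdf.
  - cdf.
Qed.

Lemma cdiff_netmap m : cdiff netmap m.
Proof.
  unfold netmap. apply (cdiff_cexp (fun m => 2 * PI * Ci * ccos m)%C).
  apply (cdiff_mult (fun _ => 2 * PI * Ci)%C ccos); [cdf|apply cdiff_ccos].
Qed.

Lemma cexp_2PI_nat (n : nat) : cexp (2 * PI * Ci * RtoC (INR n))%C = 1%C /\ cexp (2 * PI * Ci * - RtoC (INR n))%C = 1%C.
Proof.
  assert (E : (2 * PI * Ci * RtoC (INR n))%C = (0, 2 * INR n * PI)).
  { unfold Ci, RtoC, Cmult; simpl. f_equal; ring. }
  assert (H : cexp (2 * PI * Ci * RtoC (INR n))%C = 1%C).
  { rewrite E. unfold cexp; simpl. rewrite exp_0.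
    replace (2 * INR n * PI) with (0 + 2 * INR n * PI) by ring. rewrite cos_period, sin_period, cos_0, sin_0.
    unfold RtoC. f_equal; ring. }
  split; auto. replace (2 * PI * Ci * - RtoC (INR n))%C with (- (2 * PI * Ci * RtoC (INR n)))%C by ring.
  rewrite cexp_opp, H. field.
Qed.

Lemma exp1_ge_2 : 2 <= exp 1.
Proof. pose proof (exp_ineq1 1 ltac:(lra)). lra. Qed.

(** The equation says [cosh y' = n], and [n] is the first integer above [cosh y]. Then [exp y'] lies
    between [exp y / 2] and [4 exp y], and [exp 2 >= 4] turns this into a distance of at most 2. *)
Lemma arcosh_net (y : R) : 0 <= y -> exists y' n, exp y' + exp (- y') = 2 * INR n /\ Rabs (y' - y) <= 2.
Proof.
  intros Hy. set (c := (exp y + exp (- y)) / 2).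
  pose proof (exp_pos y). pose proof (exp_pos (- y)).
  assert (Hey : 1 <= exp y) by (pose proof (exp_ineq1_le y); lra).
  assert (Heny : exp (- y) <= 1) by (rewrite <- exp_0; destruct (Req_dec y 0) as [->|]; [rewrite Ropp_0; lra|left; apply exp_increasing; lra]).
  assert (Hn : exists n, c < INR n <= c + 1).
  { destruct (archimed c) as [h1 h2]. assert (0 < c) by (unfold c; lra).
    destruct (IZN (up c)) as [n En]; [apply le_IZR; lra|]. exists n. rewrite INR_IZR_INZ, <- En. lra. }
  destruct Hn as [n Hn].
  assert (Hc1 : 1 <= INR n).
  { assert (Hxx : 1 <= c).
    { unfold c. assert (exp y * exp (- y) = 1) by (rewrite <- exp_plus; replace (y + - y) with 0 by ring; apply exp_0).
      pose proof (Rle_0_sqr (exp y - 1)). unfold Rsqr in *. assert (0 < exp y) by lra.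
      apply (Rmult_le_reg_r (exp y)); auto. nra. }
    lra. }
  set (N := INR n) in *. set (s := sqrt (N * N - 1)).
  assert (Hs : 0 <= s <= N).
  { split; [apply sqrt_pos|]. rewrite <- (sqrt_Rsqr N) by lra. apply sqrt_le_1_alt. unfold Rsqr; lra. }
  assert (Hss : s * s = N * N - 1) by (apply sqrt_sqrt; nra).
  set (w := N + s). assert (Hw : 0 < w) by (unfold w; lra).
  exists (ln w), n. fold N. split.
  - rewrite exp_Ropp, exp_ln by auto.
    assert (E : / w = N - s).
    { apply (Rmult_eq_reg_l w); [|lra]. rewrite Rinv_r by lra. unfold w. nra. }
    rewrite E. unfold w. ring.
  - pose proof exp1_ge_2 as He.
    assert (E2 : 4 <= exp 2) by (replace 2 with (1 + 1) by ring; rewrite exp_plus; nra).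
    assert (U : ln w <= y + 2).
    { rewrite <- (ln_exp (y + 2)). assert (Hle : w <= exp (y + 2)).
      { rewrite exp_plus. assert (w <= 4 * exp y) by (unfold w, c in *; lra). nra. }
      destruct (Rle_lt_or_eq_dec _ _ Hle) as [h|h]; [left; apply ln_increasing; auto|rewrite h; lra]. }
    assert (Lw : y - 2 <= ln w).
    { rewrite <- (ln_exp (y - 2)). left. apply ln_increasing; [apply exp_pos|].
      assert (exp (y - 2) * exp 2 = exp y) by (rewrite <- exp_plus; f_equal; ring).
      pose proof (exp_pos (y - 2)).
      assert (exp y / 2 < w) by (unfold w, c in *; lra). nra. }
    unfold Rabs. destruct Rcase_abs; lra.
Qed.

(** At [j PI + i y'] the cosine is [cosh y'] up to sign, an integer. A multiple of [PI] is within
    [PI <= 4] of [x], and [y'] is within 2 of [y]. *)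
Lemma netmap_net (c : C) : exists m, Cmod (m - c) <= 6 /\ netmap m = 1%C.
Proof.
  destruct c as [x y]. pose proof PI_RGT_0. pose proof PI_4.
  destruct (archimed (x / PI)) as [h1 h2]. set (j := up (x / PI)) in *.
  assert (Hj : Rabs (IZR j * PI - x) <= 4).
  { assert (IZR j * PI - x = (IZR j - x / PI) * PI) by (field; lra). rewrite H1.
    rewrite Rabs_mult, !Rabs_pos_eq by lra. nra. }
  assert (Hsin : sin (IZR j * PI) = 0) by (apply sin_eq_0_1; eauto).
  assert (Hcos : cos (IZR j * PI) = 1 \/ cos (IZR j * PI) = -1).
  { pose proof (sin2_cos2 (IZR j * PI)) as S. rewrite Hsin in S. unfold Rsqr in S.
    destruct (Rle_dec 0 (cos (IZR j * PI))); [left|right]; nra. }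
  assert (Hyy : exists y' n, exp y' + exp (- y') = 2 * INR n /\ Rabs (y' - y) <= 2).
  { destruct (Rle_dec 0 y) as [h|h]; [apply arcosh_net; auto|].
    destruct (arcosh_net (- y)) as (y' & n & E & B); [lra|]. exists (- y'), n. split.
    - rewrite Ropp_involutive. lra.
    - rewrite <- Rabs_Ropp. replace (- (- y' - y)) with (y' - - y) by ring. auto. }
  destruct Hyy as (y' & n & En & By).
  exists (IZR j * PI, y'). split.
  - eapply Rle_trans; [apply Cmod_le_parts|]. simpl. unfold Rminus in *. lra.
  - assert (Ec : ccos ((IZR j * PI)%R, y') = (RtoC (cos (IZR j * PI)) * RtoC (INR n))%C).
    { unfold ccos.
      set (x' := IZR j * PI) in *.
      replace (Ci * (x', y'))%C with ((- y', x') : C) by (unfold Ci, Cmult; simpl; f_equal; ring).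
      replace (- (((- y')%R, x') : C))%C with ((y', - x') : C) by (unfold Copp; simpl; f_equal; ring).
      assert (Es : (cexp (((- y')%R, x') : C) + cexp ((y', (- x')%R) : C))%C = (RtoC (cos x') * RtoC (exp y' + exp (- y')))%C).
      { unfold cexp; simpl. rewrite cos_neg, sin_neg, Hsin. unfold RtoC, Cplus, Cmult; simpl. f_equal; ring. }
      rewrite Es, En, RtoC_mult. field. }
    unfold netmap. rewrite Ec. destruct (cexp_2PI_nat n) as [K1 K2].
    destruct Hcos as [-> | ->].
    + replace (1 * RtoC (INR n))%C with (RtoC (INR n)) by ring. auto.
    + replace (RtoC (-1) * RtoC (INR n))%C with (- RtoC (INR n))%C; auto.
      rewrite <- RtoC_mult, <- RtoC_opp. f_equal. ring.
Qed.

Lemma C2PIi_nz : (2 * PI * Ci)%C <> 0%C.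
Proof. apply Cmult_neq_0; [apply C2PI_nz|apply Ci_nz]. Qed.

(** [cos m = k] is solved by [exp (i m) = k + s] with [s^2 = k^2 - 1], because then
    [exp (- i m) = k - s]. *)
Lemma netmap_surj (z : C) : z <> 0%C -> exists m, netmap m = z.
Proof.
  intros Hz. destruct (cexp_surj z Hz) as [L HL]. set (k := (L / (2 * PI * Ci))%C).
  destruct (Csqrt_ex (k * k - 1)%C) as [s Hs].
  assert (Hks : ((k + s) * (k - s) = 1)%C).
  { replace ((k + s) * (k - s))%C with (k * k - s * s)%C by ring. rewrite Hs. ring. }
  assert (Hn : (k + s)%C <> 0%C).
  { intros E. rewrite E in Hks. apply C1_nz. rewrite <- Hks. ring. }
  destruct (cexp_surj _ Hn) as [L2 HL2]. exists (L2 / Ci)%C. unfold netmap, ccos.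
  replace (Ci * (L2 / Ci))%C with L2 by (field; apply Ci_nz).
  rewrite cexp_opp, HL2.
  replace (/ (k + s))%C with (k - s)%C.
  2:{ replace (k - s)%C with ((k + s) * (k - s) * / (k + s))%C by (field; auto). rewrite Hks. ring. }
  replace ((k + s + (k - s)) / 2)%C with k by field.
  unfold k. replace (2 * PI * Ci * (L / (2 * PI * Ci)))%C with L; auto.
  unfold Cdiv. rewrite (Cmult_comm L), Cmult_assoc, Cinv_r by apply C2PIi_nz. ring.
Qed.

(** The formula of [netmap_surj] is inverted along a disc. As [h] omits 0, [k = log h / (2 PI i)]
    exists; as [h] omits 1, [k] avoids [1] and [-1], so [k^2 - 1] has a root [s]; and [k + s] has a
    logarithm because [(k + s) (k - s) = 1]. *)
Lemma netmap_cov (D : C -> Prop) : ~ D 0%C -> ~ D 1%C -> cov (fun m => D (netmap m)) netmap D.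
Proof.
  intros H0 H1. split; [intros m _; apply cdiff_netmap|]. split; [auto|].
  intros h l Hh HhD Hl Hhl.
  destruct (log_E h (2 * PI * Ci * ccos l)%C) as (L & HL & HL0 & HE); auto.
  { intros z Hz E. apply H0. rewrite <- E. auto. }
  set (k := fun z => (L z / (2 * PI * Ci))%C).
  assert (Hkd : holo_on Edisc k) by (intros z Hz; unfold k; cdf; [apply C2PIi_nz|apply HL; auto]).
  assert (Hkn : forall z, (2 * PI * Ci * k z)%C = L z).
  { intros z. unfold k, Cdiv. rewrite (Cmult_comm (L z)), Cmult_assoc, Cinv_r by apply C2PIi_nz. ring. }
  assert (Hk0 : k 0%C = ccos l).
  { unfold k. rewrite HL0. unfold Cdiv. rewrite (Cmult_comm _ (/ _)), Cmult_assoc, Cinv_l by apply C2PIi_nz. ring. }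
  destruct (sqrt_E (fun z => k z * k z - 1)%C ((cexp (Ci * l) - cexp (- (Ci * l))) / 2)%C) as (s & Hs & Hs0 & Hss).
  { intros z Hz. cdf; apply Hkd; auto. }
  { intros z Hz E. apply H1. destruct (cexp_2PI_nat 1) as [K1 K2]. simpl in K1, K2.
    replace (k z * k z - 1)%C with ((k z - 1) * (k z - - (1)))%C in E by ring.
    assert (Ex : k z = 1%C \/ k z = (- (1))%C).
    { destruct (Ceq_dec (k z - 1) 0) as [e|n1]; [left; apply Csub_eq; auto|].
      destruct (Ceq_dec (k z - - (1)) 0) as [e|n2]; [right; apply Csub_eq; auto|].
      exfalso. apply (Cmult_neq_0 _ _ n1 n2). auto. }
    assert (Eh : h z = 1%C).
    { rewrite <- HE, <- Hkn by auto. destruct Ex as [-> | ->]; auto. }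
    rewrite <- Eh; auto. }
  { rewrite Hk0. unfold ccos. pose proof (cexp_nz (Ci * l)). rewrite cexp_opp. field. auto. }
  assert (Hks : forall z, Edisc z -> ((k z + s z) * (k z - s z) = 1)%C).
  { intros z Hz. replace ((k z + s z) * (k z - s z))%C with (k z * k z - s z * s z)%C by ring. rewrite Hss by auto. ring. }
  assert (Hksn : forall z, Edisc z -> (k z + s z)%C <> 0%C).
  { intros z Hz E. specialize (Hks z Hz). rewrite E in Hks. apply C1_nz. rewrite <- Hks. ring. }
  destruct (log_E (fun z => k z + s z)%C (Ci * l)%C) as (L2 & HL2 & HL20 & HE2); auto.
  { intros z Hz. cdf; [apply Hkd|apply Hs]; auto. }
  { rewrite Hk0, Hs0. unfold ccos. field. }
  assert (Hnet : forall z, Edisc z -> netmap (L2 z / Ci)%C = h z).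
  { intros z Hz. unfold netmap, ccos.
    replace (Ci * (L2 z / Ci))%C with (L2 z) by (field; apply Ci_nz).
    rewrite cexp_opp, HE2 by auto.
    replace (/ (k z + s z))%C with (k z - s z)%C.
    2:{ replace (k z - s z)%C with ((k z + s z) * (k z - s z) * / (k z + s z))%C by (field; auto). rewrite Hks by auto. ring. }
    replace ((k z + s z + (k z - s z)) / 2)%C with (k z) by field.
    rewrite Hkn; auto. }
  exists (fun z => L2 z / Ci)%C. repeat split; auto.
  - intros z Hz. cdf; [apply Ci_nz|apply HL2; auto].
  - intros z Hz. rewrite Hnet; auto.
  - rewrite HL20. field. apply Ci_nz.
Qed.

Lemma lip_B (g : C -> C) (B r : R) z w : holo_on Edisc g ->
  (forall v, Edisc v -> Cmod (C_derive g v) * (1 - Cmod v) <= B) -> 0 <= r < 1 ->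
  Cmod z <= r -> Cmod w <= r -> Cmod (g z - g w) <= B / (1 - r) * Cmod (z - w).
Proof.
  intros Hg HB Hr Hz Hw. apply (lip_E g _ r); auto. intros v Hv.
  specialize (HB v ltac:(unfold Edisc; lra)). pose proof (Cmod_ge_0 (C_derive g v)).
  apply (Rmult_le_reg_r (1 - r)); [lra|]. unfold Rdiv. rewrite Rmult_assoc, Rinv_l by lra.
  assert (Cmod (C_derive g v) * (1 - r) <= Cmod (C_derive g v) * (1 - Cmod v)) by (apply Rmult_le_compat_l; lra). lra.
Qed.

(** On the circle of radius [(1 + |w|) / 2] the function [psi z - w] is larger than at [w] itself,
    so [min_modulus] gives a zero. *)
Lemma near_id_surj (psi : C -> C) (w : C) (e : R) : holo_on Edisc psi -> Edisc w ->
  (forall z, Cmod z <= (1 + Cmod w) / 2 -> Cmod (psi z - z) <= e) -> e < (1 - Cmod w) / 4 ->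
  exists z, Edisc z /\ psi z = w.
Proof.
  intros Hp Hw Hn He. unfold Edisc in Hw. pose proof (Cmod_ge_0 w).
  destruct (min_modulus (fun z => psi z - w)%C 0 1 ((1 + Cmod w) / 2) ((1 - Cmod w) / 2 - e) w) as (z & Hz & Ez).
  - intros z Hz. cdf. apply Hp, ball_E; auto.
  - lra.
  - intros z Hz. rewrite Csub_0_r in Hz. specialize (Hn z ltac:(lra)).
    pose proof (Cmod_le_sub z (psi z)). rewrite Cmod_sub_sym in H0.
    pose proof (Cmod_le_sub (psi z) w). lra.
  - rewrite Csub_0_r. lra.
  - specialize (Hn w ltac:(lra)). lra.
  - exists z. split; [apply ball_E; auto|apply Csub_eq; auto].
Qed.

(** Lifts of two dilates agree after rescaling, by uniqueness along rays. So the value at [z] may be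
    taken from the dilate of ratio [(1 + |z|) / 2]. *)
Lemma glue_lifts (f h : C -> C) (l : C) : holo_on Edisc f -> (forall z, Edisc z -> C_derive f z <> 0%C) ->
  (forall r, 0 < r < 1 -> exists phi, holo_on Edisc phi /\ (forall z, Edisc z -> Edisc (phi z)) /\ phi 0%C = l /\
     forall z, Edisc z -> f (phi z) = h (r * z)%C) ->
  exists phi, holo_on Edisc phi /\ (forall z, Edisc z -> Edisc (phi z)) /\ phi 0%C = l /\
     forall z, Edisc z -> f (phi z) = h z.
Proof.
  intros Hf Hn HL.
  assert (HL' : forall r, exists phi, 0 < r < 1 -> holo_on Edisc phi /\ (forall z, Edisc z -> Edisc (phi z)) /\ phi 0%C = l /\
     forall z, Edisc z -> f (phi z) = h (r * z)%C).
  { intros r. destruct (classic (0 < r < 1)) as [H|H]; [destruct (HL r H) as [phi K]; exists phi; auto|exists (fun _ => 0%C); tauto]. }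
  set (ph := fun r => proj1_sig (constructive_indefinite_description _ (HL' r))).
  assert (Hph : forall r, 0 < r < 1 -> holo_on Edisc (ph r) /\ (forall z, Edisc z -> Edisc (ph r z)) /\ ph r 0%C = l /\
     forall z, Edisc z -> f (ph r z) = h (r * z)%C).
  { intros r. unfold ph. destruct constructive_indefinite_description; auto. }
  clearbody ph. clear HL'.
  assert (Hrn : forall r, 0 < r -> RtoC r <> 0%C) by (intros r Hr E; apply RtoC_inj in E; lra).
  assert (Hsc : forall r z, 0 < r -> Cmod z < r -> Edisc (z / r)%C).
  { intros r z Hr Hz. unfold Edisc. rewrite Cmod_div, Cmod_R, Rabs_pos_eq by (auto; lra).
    apply (Rmult_lt_reg_r r); auto. unfold Rdiv. rewrite Rmult_assoc, Rinv_l; lra. }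
  assert (Hagree : forall r r' z, 0 < r < 1 -> 0 < r' < 1 -> Cmod z < r -> Cmod z < r' -> ph r (z / r)%C = ph r' (z / r')%C).
  { intros r r' z Hr Hr' Hz Hz'. destruct (Hph r Hr) as (a1 & a2 & a3 & a4). destruct (Hph r' Hr') as (b1 & b2 & b3 & b4).
    assert (K : forall t, I01 t -> ph r (t * (z / r))%C = ph r' (t * (z / r'))%C).
    { apply (path_unique f (fun t => ph r (t * (z / r))%C) (fun t => ph r' (t * (z / r'))%C)); auto.
      - apply icont_ray; auto. apply Hsc; lra.
      - apply icont_ray; auto. apply Hsc; lra.
      - intros t Ht. apply a2, Edisc_scale; auto. apply Hsc; lra.
      - intros t Ht. rewrite a4, b4 by (apply Edisc_scale; auto; apply Hsc; lra).
        f_equal. field. split; apply Hrn; lra.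
      - replace (0 * (z / r))%C with (RtoC 0) by ring. replace (0 * (z / r'))%C with (RtoC 0) by ring. congruence. }
    specialize (K 1 ltac:(unfold I01; lra)).
    replace (1 * (z / r))%C with (z / r)%C in K by ring. replace (1 * (z / r'))%C with (z / r')%C in K by ring. auto. }
  set (rr := fun z => (1 + Cmod z) / 2).
  assert (Hrr : forall z, Edisc z -> 0 < rr z < 1 /\ Cmod z < rr z).
  { intros z Hz. unfold Edisc in Hz. pose proof (Cmod_ge_0 z). unfold rr. lra. }
  exists (fun z => ph (rr z) (z / rr z)%C). split; [|split; [|split]].
  - intros z Hz. destruct (Hrr z Hz) as [h1 h2]. destruct (Hph _ h1) as (a1 & a2 & a3 & a4).
    eapply cder_cdiff. apply cder_ext with (fun w => ph (rr z) (w / rr z)%C).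
    + exists (rr z - Cmod z). split; [lra|]. intros w Hw. pose proof (Cmod_le_sub w z).
      assert (HwE : Edisc w) by (unfold Edisc; lra). destruct (Hrr w HwE). apply Hagree; auto. lra.
    + apply cdiff_C_derive. apply (cdiff_comp (ph (rr z)) (fun w => w / rr z)%C).
      * apply a1. apply Hsc; lra.
      * cdf. apply Hrn; lra.
  - intros z Hz. destruct (Hrr z Hz) as [h1 h2]. destruct (Hph _ h1) as (a1 & a2 & a3 & a4). apply a2, Hsc; lra.
  - destruct (Hrr 0%C E0) as [h1 h2]. destruct (Hph _ h1) as (a1 & a2 & a3 & a4).
    replace (0 / rr 0%C)%C with (RtoC 0); auto. field. apply Hrn; lra.
  - intros z Hz. destruct (Hrr z Hz) as [h1 h2]. destruct (Hph _ h1) as (a1 & a2 & a3 & a4).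
    rewrite a4 by (apply Hsc; lra). f_equal. field. apply Hrn; lra.
Qed.

(** * Domains omitting two points *)

Lemma cov_normalize f D : open_C D -> cov Edisc f D ->
  exists g c, 0 < c /\ cov Edisc g D /\ g 0%C = f 0%C /\ C_derive g 0%C = RtoC c.
Proof.
  intros Ho Hc. pose proof (cov_der_nz f D Ho Hc 0%C E0) as Hn. apply Cmod_pos_neq in Hn as Hp.
  set (d := C_derive f 0%C) in *. set (u := (Cconj d / Cmod d)%C).
  assert (Hm : RtoC (Cmod d) <> 0%C) by (intros E; apply RtoC_inj in E; lra).
  assert (Hu : Cmod u = 1).
  { unfold u. rewrite Cmod_div, Cmod_conj, Cmod_R, Rabs_pos_eq by (auto; lra). field. lra. }
  exists (fun z => f (u * z)%C), (Cmod d). split; [auto|]. split; [|split].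
  - apply (cov_comp Edisc (fun z => u * z)%C Edisc f); auto. apply cov_rot; auto.
  - replace (u * 0)%C with (RtoC 0) by ring. auto.
  - apply cder_C_derive. eapply cder_eq.
    + apply (cder_comp f (fun z => u * z)%C); [|cdr].
      replace (u * 0)%C with (RtoC 0) by ring. apply cdiff_C_derive, Hc, E0.
    + fold d. unfold u.
      replace (d * (0 * 0 + Cconj d / Cmod d * 1))%C with (Cconj d * d / Cmod d)%C by (unfold Cdiv; ring).
      rewrite Cconj_mult_self, RtoC_mult. field; auto.
Qed.

Lemma choice_nat (A : Type) (P : nat -> A -> Prop) : (forall n, exists x, P n x) -> exists u, forall n, P n (u n).
Proof.
  intros H. exists (fun n => proj1_sig (constructive_indefinite_description _ (H n))).
  intros n. destruct constructive_indefinite_description; auto.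
Qed.

(** [f n] covers the part of [U] within [n + 1] of [m0]. The map [ph n] is the transition from [f n]
    to [f (n + 1)]; [c n] plays the role of the derivative of [f n] at 0, and [s] is a telescoping
    majorant for the deviation of the transitions from the identity. *)
Definition exhausted (U : C -> Prop) (m0 : C) (B : R) (f ph : nat -> C -> C) (c s : nat -> R) : Prop :=
  (forall n, 0 < c n /\ cov Edisc (f n) (fun z => U z /\ Cmod (z - m0) < INR n + 1) /\ f n 0%C = m0 /\
     (forall z, Edisc z -> Cmod (C_derive (f n) z) * (1 - Cmod z) <= B)) /\
  (forall n, holo_on Edisc (ph n) /\ (forall z, Edisc z -> Edisc (ph n z)) /\ ph n 0%C = 0%C /\
     (forall z, Edisc z -> f (S n) (ph n z) = f n z) /\
     C_derive (ph n) 0%C = RtoC (c n / c (S n)) /\ 0 < c n / c (S n) <= 1 /\ 1 - c n / c (S n) <= s n - s (S n)) /\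
  (forall n, 0 <= s n) /\
  (forall e, 0 < e -> exists N, forall n, (N <= n)%nat -> s n <= e).

(** The Schwarz lemma makes the [c n] increase, and the hypothesis at 0 bounds them by [B]. Their
    limit [l] gives [s n = (l - c n) / c 0]. *)
Lemma exhausted_ex (U : C -> Prop) (m0 : C) (B : R) : open_C U -> U m0 ->
  (forall h, holo_on Edisc h -> (forall z, Edisc z -> U (h z)) ->
     forall z, Edisc z -> Cmod (C_derive h z) * (1 - Cmod z) <= B) ->
  exists f ph c s, exhausted U m0 B f ph c s.
Proof.
  intros Ho Hm HB.
  set (V := fun (n : nat) z => U z /\ Cmod (z - m0) < INR n + 1).
  assert (HV : forall n, open_C (V n)).
  { intros n z [Hz1 Hz2]. destruct (Ho z Hz1) as (e & He & K). destruct (open_cball m0 (INR n + 1) z Hz2) as (e' & He' & K').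
    exists (Rmin e e'). split; [apply Rmin_pos; auto|]. intros w Hw. pose proof (Rmin_l e e'). pose proof (Rmin_r e e').
    split; [apply K; lra|apply K'; lra]. }
  destruct (choice_nat ((C -> C) * R) (fun n x => 0 < snd x /\ cov Edisc (fst x) (V n) /\ fst x 0%C = m0 /\ C_derive (fst x) 0%C = RtoC (snd x)))
    as (fc & Hfc).
  { intros n. destruct (bounded_cov (V n) m0 (INR n + 1)) as (f & Hf & Hf0).
    - auto.
    - split; auto. rewrite Cmod_self_sub. pose proof (pos_INR n). lra.
    - pose proof (pos_INR n). lra.
    - intros z [_ Hz]; auto.
    - destruct (cov_normalize f (V n) (HV n) Hf) as (g & c & h1 & h2 & h3 & h4). exists (g, c). simpl.
      rewrite Hf0 in h3. auto. }
  set (f := fun n => fst (fc n)). set (c := fun n => snd (fc n)).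
  assert (Hf : forall n, 0 < c n /\ cov Edisc (f n) (V n) /\ f n 0%C = m0 /\ C_derive (f n) 0%C = RtoC (c n)) by (intros n; apply Hfc).
  clearbody f c. clear Hfc fc.
  destruct (choice_nat (C -> C) (fun n ph => holo_on Edisc ph /\ (forall z, Edisc z -> Edisc (ph z)) /\ ph 0%C = 0%C /\
     (forall z, Edisc z -> f (S n) (ph z) = f n z))) as (ph & Hph).
  { intros n. destruct (Hf n) as (h1 & (k1 & k2 & _) & h3 & h4). destruct (Hf (S n)) as (g1 & (_ & _ & L) & g3 & g4).
    apply (L (f n) 0%C k1); [|apply E0|congruence]. intros z Hz. destruct (k2 z Hz) as [a1 a2]. split; auto.
    rewrite S_INR. lra. }
  assert (HBn : forall n z, Edisc z -> Cmod (C_derive (f n) z) * (1 - Cmod z) <= B).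
  { intros n z Hz. destruct (Hf n) as (h1 & (k1 & k2 & _) & h3 & h4). apply HB; auto. intros w Hw. apply k2; auto. }
  assert (Hder : forall n, (RtoC (c n) = RtoC (c (S n)) * C_derive (ph n) 0)%C).
  { intros n. destruct (Hf n) as (h1 & (k1 & k2 & _) & h3 & h4). destruct (Hf (S n)) as (g1 & (j1 & _) & g3 & g4).
    destruct (Hph n) as (p1 & p2 & p3 & p4). apply (cder_unique (f n) 0%C).
    - rewrite <- h4. apply cdiff_C_derive, k1, E0.
    - apply cder_ext with (fun z => f (S n) (ph n z)).
      + exists 1; split; [lra|]. intros w Hw. rewrite Csub_0_r in Hw. auto.
      + apply (cder_comp (f (S n)) (ph n)); [|apply cdiff_C_derive, p1, E0].
        rewrite p3, <- g4. apply cdiff_C_derive, j1, E0. }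
  assert (Hpd : forall n, C_derive (ph n) 0%C = RtoC (c n / c (S n))).
  { intros n. destruct (Hf (S n)) as (g1 & _). rewrite RtoC_div by lra. rewrite Hder. field.
    intros E. apply RtoC_inj in E. lra. }
  assert (Hcinc : forall n, c n <= c (S n)).
  { intros n. destruct (Hph n) as (p1 & p2 & p3 & p4). destruct (Hf n) as (h1 & _). destruct (Hf (S n)) as (g1 & _).
    pose proof (schwarz_der (ph n) p1 (fun z Hz => Rlt_le _ _ (p2 z Hz)) p3) as SD.
    assert (0 < c n / c (S n)) by (apply Rdiv_lt_0_compat; auto).
    rewrite Hpd, Cmod_R, Rabs_pos_eq in SD by lra. apply (Rmult_le_compat_r (c (S n))) in SD; [|lra].
    unfold Rdiv in SD. rewrite Rmult_assoc, Rinv_l in SD by lra. lra. }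
  assert (Hcinc' : forall n m, (n <= m)%nat -> c n <= c m).
  { intros n m Hnm. induction Hnm; [lra|]. specialize (Hcinc m). lra. }
  destruct (completeness (fun x => exists n, x = c n)) as [l [Hl1 Hl2]].
  { exists B. intros x [n ->]. specialize (HBn n 0%C E0). destruct (Hf n) as (h1 & _ & _ & h4).
    rewrite h4, Cmod_0, Cmod_R, Rabs_pos_eq in HBn by lra. lra. }
  { exists (c O); eauto. }
  assert (Hc0 : 0 < c O) by apply Hf.
  exists f, ph, c, (fun n => (l - c n) / c O). split; [|split; [|split]].
  - intros n. destruct (Hf n) as (h1 & h2 & h3 & h4). auto.
  - intros n. destruct (Hph n) as (p1 & p2 & p3 & p4). destruct (Hf n) as (h1 & _). destruct (Hf (S n)) as (g1 & _).
    specialize (Hcinc n). pose proof (Hcinc' O (S n) ltac:(lia)).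
    do 5 (split; [auto|]). split; [split; [apply Rdiv_lt_0_compat; auto|]|].
    + apply (Rmult_le_reg_r (c (S n))); auto. unfold Rdiv. rewrite Rmult_assoc, Rinv_l by lra. lra.
    + replace (1 - c n / c (S n)) with ((c (S n) - c n) / c (S n)) by (field; lra).
      replace ((l - c n) / c O - (l - c (S n)) / c O) with ((c (S n) - c n) / c O) by (field; lra).
      apply Rmult_le_compat_l; [lra|]. apply Rinv_le_contravar; auto.
  - intros n. assert (c n <= l) by (apply Hl1; eauto). apply Rmult_le_pos; [lra|]. left; apply Rinv_0_lt_compat; auto.
  - intros e He. apply NNPP; intros HN. assert (l <= l - e * c O); [|nra].
    apply Hl2. intros x [n ->]. apply Rnot_lt_le; intros Hlt. apply HN. exists n. intros m Hnm.
    specialize (Hcinc' n m Hnm). apply (Rmult_le_reg_r (c O)); auto. unfold Rdiv. rewrite Rmult_assoc, Rinv_l by lra. lra.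
Qed.

(** The composite [ph_(n+k-1) o ... o ph_n]. New maps act last, opposite to [tcomp], because
    transitions lead to higher levels. *)
Fixpoint pcomp (ph : nat -> C -> C) (n k : nat) (z : C) : C :=
  match k with O => z | S k' => ph (n + k')%nat (pcomp ph n k' z) end.

(** The increments telescope, so the tail [s n] bounds the distance to the limit. The constant [K r]
    may blow up at the unit circle. *)
Lemma unif_cauchy_tele (F : nat -> C -> C) (s : nat -> R) (K : R -> R) : (forall n, 0 <= s n) ->
  (forall e, 0 < e -> exists N, forall n, (N <= n)%nat -> s n <= e) ->
  (forall r, 0 <= r < 1 -> 0 < K r) ->
  (forall r n z, 0 <= r < 1 -> Cmod z <= r -> Cmod (F (S n) z - F n z) <= K r * (s n - s (S n))) ->
  (forall r n k z, 0 <= r < 1 -> Cmod z <= r -> Cmod (F (n + k)%nat z - F n z) <= K r * s n) /\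
  exists f, uconv 0 1 F f /\ (forall z, Edisc z -> clim (fun n => F n z) (f z)) /\
    forall r n z, 0 <= r < 1 -> Cmod z <= r -> Cmod (F n z - f z) <= K r * s n.
Proof.
  intros Hs0 Hlim HK HF.
  assert (G0 : forall r n k z, 0 <= r < 1 -> Cmod z <= r -> Cmod (F (n + k)%nat z - F n z) <= K r * (s n - s (n + k)%nat)).
  { intros r n k z Hr Hz. induction k as [|k IH].
    - rewrite Nat.add_0_r, Cmod_self_sub. lra.
    - rewrite Nat.add_succ_r. specialize (HF r (n + k)%nat z Hr Hz).
      pose proof (Cmod_sub_tri (F (S (n + k)) z) (F (n + k)%nat z) (F n z)). lra. }
  assert (G : forall r n k z, 0 <= r < 1 -> Cmod z <= r -> Cmod (F (n + k)%nat z - F n z) <= K r * s n).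
  { intros r n k z Hr Hz. eapply Rle_trans; [apply (G0 r); auto|]. specialize (HK r Hr).
    apply Rmult_le_compat_l; [lra|]. specialize (Hs0 (n + k)%nat). lra. }
  split; auto.
  destruct (unif_cauchy F) as (f & Hf & Hp).
  { intros r e Hr He. assert (HKr : 0 < K r) by (apply HK; lra).
    destruct (Hlim (e / (2 * K r))) as [N HN]; [apply Rdiv_lt_0_compat; lra|]. exists N.
    assert (G1 : forall m z, (N <= m)%nat -> Cmod z <= r -> Cmod (F m z - F N z) <= e / 2).
    { intros m z Hm Hz. replace m with (N + (m - N))%nat by lia. eapply Rle_trans; [apply (G r); auto; lra|].
      specialize (HN N (le_n _)). replace (e / 2) with (K r * (e / (2 * K r))) by (field; lra). apply Rmult_le_compat_l; lra. }
    intros n m z Hn Hm Hz. pose proof (G1 n z Hn Hz). pose proof (G1 m z Hm Hz).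
    pose proof (Cmod_sub_tri (F n z) (F N z) (F m z)). rewrite (Cmod_sub_sym (F N z) (F m z)) in H1. lra. }
  exists f. split; auto. split; auto. intros r n z Hr Hz.
  apply (clim_Cmod_le (fun k => F n z - F (n + k)%nat z)%C).
  - intros e He. destruct (Hp z ltac:(unfold Edisc; lra) e He) as [N HN]. exists N. intros k Hk.
    specialize (HN (n + k)%nat ltac:(lia)).
    replace (F n z - F (n + k)%nat z - (F n z - f z))%C with (- (F (n + k)%nat z - f z))%C by ring.
    rewrite Cmod_opp. auto.
  - intros k. rewrite Cmod_sub_sym. apply G; auto.
Qed.

(** The maps [psi n] tend to the identity, so every point of [E] is a value of [psi n] for all large
    [n]. A dilate [h (r z)] stays at bounded distance from [m0] by the bound [B]; it lifts through
    some [f n], and [psi n] carries this lift to one through [F]. *)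
Lemma exhausted_cov (U : C -> Prop) (m0 : C) (B : R) f ph c s : open_C U ->
  (forall h, holo_on Edisc h -> (forall z, Edisc z -> U (h z)) ->
     forall z, Edisc z -> Cmod (C_derive h z) * (1 - Cmod z) <= B) -> 0 < B ->
  exhausted U m0 B f ph c s -> exists F, cov Edisc F U /\ F 0%C = m0.
Proof.
  intros Ho HBU HB0 (Hf & Hph & Hs0 & Hlim).
  assert (HphE : forall n z, Edisc z -> Cmod (ph n z) <= Cmod z).
  { intros n z Hz. destruct (Hph n) as (p1 & p2 & p3 & _). apply schwarz_le; auto. intros w Hw. apply Rlt_le, p2; auto. }
  assert (Hnear : forall n r z, 0 <= r < 1 -> Cmod z <= r -> Cmod (ph n z - z) <= 3 / (1 - r) * (s n - s (S n))).
  { intros n r z Hr Hz. destruct (Hph n) as (p1 & p2 & p3 & p4 & p5 & p6 & p7).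
    eapply Rle_trans; [apply (near_id (ph n) (c n / c (S n)) r z); auto|].
    replace (3 * (1 - c n / c (S n)) / (1 - r)) with (3 / (1 - r) * (1 - c n / c (S n))) by (unfold Rdiv; ring).
    apply Rmult_le_compat_l; auto. left; apply Rdiv_lt_0_compat; lra. }
  destruct (unif_cauchy_tele f s (fun r => B / (1 - r) * (3 / (1 - r)))) as (_ & F & HFu & HFp & HFb); auto.
  { intros r Hr. apply Rmult_lt_0_compat; apply Rdiv_lt_0_compat; lra. }
  { intros r n z Hr Hz. assert (Hz' : Edisc z) by (unfold Edisc; lra).
    destruct (Hph n) as (p1 & p2 & p3 & p4 & p5 & p6 & p7). rewrite <- p4 by auto.
    destruct (Hf (S n)) as (_ & (k1 & _) & _ & k4).
    pose proof (HphE n z Hz'). eapply Rle_trans; [apply (lip_B (f (S n)) B r); auto; lra|].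
    rewrite Rmult_assoc. apply Rmult_le_compat_l; [left; apply Rdiv_lt_0_compat; lra|].
    rewrite Cmod_sub_sym. apply Hnear; auto. }
  assert (HFh : holo_on Edisc F).
  { apply (weierstrass_E f); auto. intros n. apply Hf. }
  (* [psi n] is the limit of [ph (n + k - 1) o ... o ph n], so that [F o psi n = f n] *)
  assert (HpcE : forall n k z, Edisc z -> Cmod (pcomp ph n k z) <= Cmod z).
  { intros n k z Hz. induction k as [|k IH]; simpl; [lra|]. eapply Rle_trans; [apply HphE|auto]. unfold Edisc in *; lra. }
  assert (Hpch : forall n k, holo_on Edisc (pcomp ph n k)).
  { intros n k. induction k as [|k IH]; [intros z _; apply cdiff_id|].
    apply (holo_comp Edisc Edisc (ph (n + k)%nat) (pcomp ph n k)); auto; [apply Hph|].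
    intros z Hz. specialize (HpcE n k z Hz). unfold Edisc in *; lra. }
  assert (Hpcf : forall n k z, Edisc z -> f (n + k)%nat (pcomp ph n k z) = f n z).
  { intros n k z Hz. induction k as [|k IH]; [rewrite Nat.add_0_r; auto|].
    rewrite Nat.add_succ_r. simpl. destruct (Hph (n + k)%nat) as (_ & _ & _ & p4 & _). rewrite p4; auto.
    specialize (HpcE n k z Hz). unfold Edisc in *; lra. }
  assert (Hpsi : forall n, exists psi, holo_on Edisc psi /\ (forall z, Edisc z -> Cmod (psi z) <= Cmod z) /\
     (forall r z, 0 <= r < 1 -> Cmod z <= r -> Cmod (psi z - z) <= 3 / (1 - r) * s n) /\
     (forall z, Edisc z -> F (psi z) = f n z)).
  { intros n.
    destruct (unif_cauchy_tele (pcomp ph n) (fun k => s (n + k)%nat) (fun r => 3 / (1 - r))) as (_ & psi & Hu & Hp & Hb); auto.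
    { intros e He. destruct (Hlim e He) as [N HN]. exists N. intros k Hk. apply HN. lia. }
    { intros r Hr. apply Rdiv_lt_0_compat; lra. }
    { intros r k z Hr Hz. rewrite Nat.add_succ_r. simpl. apply Hnear; auto.
      eapply Rle_trans; [apply HpcE; unfold Edisc; lra|auto]. }
    assert (Hle : forall z, Edisc z -> Cmod (psi z) <= Cmod z).
    { intros z Hz. apply (clim_Cmod_le (fun k => pcomp ph n k z)); auto. }
    exists psi. split; [apply (weierstrass_E (pcomp ph n)); auto|]. split; auto. split.
    - intros r z Hr Hz. specialize (Hb r O z Hr Hz). simpl in Hb. rewrite Nat.add_0_r in Hb. rewrite Cmod_sub_sym. auto.
    - intros z Hz. set (r := Cmod z). assert (Hr : 0 <= r < 1) by (split; [apply Cmod_ge_0|exact Hz]).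
      apply C_eq_of_small. intros e He.
      set (K1 := B / (1 - r) * (3 / (1 - r))).
      assert (HK1 : 0 < K1) by (apply Rmult_lt_0_compat; apply Rdiv_lt_0_compat; lra).
      destruct (Hlim (e / (2 * K1))) as [N HN]; [apply Rdiv_lt_0_compat; lra|].
      specialize (HN (n + N)%nat ltac:(lia)).
      rewrite <- (Hpcf n N z Hz).
      assert (Hpr : Cmod (psi z) <= r) by (apply Hle; auto).
      pose proof (HFb r (n + N)%nat (psi z) Hr Hpr) as B1. fold K1 in B1. rewrite Cmod_sub_sym in B1.
      destruct (Hf (n + N)%nat) as (_ & (k1 & _) & _ & k4).
      pose proof (lip_B (f (n + N)%nat) B r (psi z) (pcomp ph n N z) k1 k4 Hr Hpr (HpcE n N z Hz)) as B2.
      pose proof (Hb r N z Hr (Rle_refl _)) as B3. rewrite Cmod_sub_sym in B3.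
      assert (B4 : B / (1 - r) * Cmod (psi z - pcomp ph n N z) <= K1 * s (n + N)%nat).
      { unfold K1. rewrite Rmult_assoc. apply Rmult_le_compat_l; auto. left; apply Rdiv_lt_0_compat; lra. }
      pose proof (Cmod_sub_tri (F (psi z)) (f (n + N)%nat (psi z)) (f (n + N)%nat (pcomp ph n N z))).
      assert (K1 * s (n + N)%nat <= e / 2).
      { replace (e / 2) with (K1 * (e / (2 * K1))) by (field; lra). apply Rmult_le_compat_l; lra. }
      lra. }
  destruct (choice_nat (C -> C) _ Hpsi) as (psi & Hps).
  assert (Hsurj : forall w, Edisc w -> exists N, forall n, (N <= n)%nat -> exists z, Edisc z /\ psi n z = w).
  { intros w Hw. unfold Edisc in Hw. pose proof (Cmod_ge_0 w). set (r := (1 + Cmod w) / 2).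
    assert (Hr : 0 <= r < 1) by (unfold r; lra).
    set (K := 3 / (1 - r)). assert (HK : 0 < K) by (apply Rdiv_lt_0_compat; lra).
    destruct (Hlim ((1 - Cmod w) / 8 / K)) as [N HN]; [apply Rdiv_lt_0_compat; lra|].
    exists N. intros n Hn. destruct (Hps n) as (q1 & q2 & q3 & q4).
    apply (near_id_surj (psi n) w ((1 - Cmod w) / 8)); auto; [|lra].
    intros z Hz. eapply Rle_trans; [apply (q3 r z Hr Hz)|]. fold K. specialize (HN n Hn).
    replace ((1 - Cmod w) / 8) with (K * ((1 - Cmod w) / 8 / K)) by (field; lra). apply Rmult_le_compat_l; lra. }
  assert (HFU : forall z, Edisc z -> U (F z)).
  { intros w Hw. destruct (Hsurj w Hw) as [N HN]. destruct (HN N (le_n _)) as (z & Hz & <-).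
    destruct (Hps N) as (q1 & q2 & q3 & q4). rewrite q4 by auto. destruct (Hf N) as (_ & (_ & k2 & _) & _). apply k2; auto. }
  assert (Hlift : forall h l, holo_on Edisc h -> (forall z, Edisc z -> U (h z)) -> Edisc l -> h 0%C = F l ->
     forall r, 0 < r < 1 -> exists phi, holo_on Edisc phi /\ (forall z, Edisc z -> Edisc (phi z)) /\ phi 0%C = l /\
       forall z, Edisc z -> F (phi z) = h (r * z)%C).
  { intros h l Hh HhU Hl Hhl r Hr.
    destruct (Hsurj l Hl) as [N1 HN1].
    (* From this index on the piece of [U] contains the image of the dilate, whose distance from
       [F l] is at most [B / (1 - r)]. *)
    destruct (INR_unbounded (Cmod (F l - m0) + B / (1 - r))) as [N2 HN2]. apply Rgt_lt in HN2.
    set (n := (N1 + N2)%nat). destruct (HN1 n ltac:(unfold n; lia)) as (zn & Hzn & Ezn).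
    assert (HN2' : INR N2 <= INR n) by (apply le_INR; unfold n; lia).
    destruct (Hps n) as (q1 & q2 & q3 & q4). destruct (Hf n) as (_ & (k1 & k2 & L) & _).
    assert (Hrz : forall z, Edisc z -> Edisc (r * z)%C) by (intros; apply Edisc_scale; auto; lra).
    destruct (L (fun z => h (r * z)%C) zn) as (k & Hk & HkE & Hk0 & HkL).
    - apply (holo_comp Edisc Edisc h (fun z => r * z)%C); auto. intros z _; cdf.
    - intros z Hz. split; [auto|].
      assert (Hrz' : Cmod (r * z) <= r).
      { rewrite Cmod_mult, Cmod_R, Rabs_pos_eq by lra. unfold Edisc in Hz. nra. }
      pose proof (lip_B h B r (r * z)%C 0%C Hh (HBU h Hh HhU) ltac:(lra) Hrz' ltac:(rewrite Cmod_0; lra)) as B1.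
      rewrite Csub_0_r in B1.
      assert (B2 : B / (1 - r) * Cmod (r * z) <= B / (1 - r) * 1).
      { apply Rmult_le_compat_l; [left; apply Rdiv_lt_0_compat; lra|lra]. }
      rewrite Hhl in B1. pose proof (Cmod_sub_tri (h (r * z)%C) (F l) m0). lra.
    - auto.
    - replace (r * 0)%C with (RtoC 0) by ring. rewrite Hhl, <- Ezn, q4 by auto. auto.
    - exists (fun z => psi n (k z)). split; [|split; [|split]].
      + apply (holo_comp Edisc Edisc (psi n) k); auto.
      + intros z Hz. specialize (q2 (k z) (HkE z Hz)). specialize (HkE z Hz). unfold Edisc in *. lra.
      + rewrite Hk0. auto.
      + intros z Hz. rewrite q4 by auto. auto. }
  assert (HFn : forall l, Edisc l -> C_derive F l <> 0%C).
  { intros l Hl. destruct (Ho _ (HFU l Hl)) as (e & He & K).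
    destruct (Hlift (fun z => F l + e * z)%C l) with (r := 1 / 2) as (phi & Hp & HpE & Hp0 & HE); auto.
    - intros z _; cdf.
    - intros z Hz. apply K. replace (F l + e * z - F l)%C with (e * z)%C by ring.
      rewrite Cmod_mult, Cmod_R, Rabs_pos_eq by lra. unfold Edisc in Hz. nra.
    - ring.
    - lra.
    - apply (der_nz_of_lift F phi l (F l) (RtoC (e / 2))); auto.
      + intros E. apply RtoC_inj in E. lra.
      + intros z Hz. rewrite HE by auto. rewrite !RtoC_div by lra. field. }
  exists F. split.
  - split; auto. split; auto. intros h l Hh HhU Hl Hhl. apply glue_lifts; auto.
  - apply (clim_unique (fun n => f n 0%C)); [apply HFp, E0|].
    intros e He. exists O. intros n _. destruct (Hf n) as (_ & _ & -> & _). rewrite Cmod_self_sub; lra.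
Qed.

Theorem hyperbolic_cov (D : C -> Prop) (a b z0 : C) : open_C D -> D z0 -> a <> b -> ~ D a -> ~ D b ->
  exists f, cov Edisc f D /\ f 0%C = z0.
Proof.
  intros Ho H0 Hab Ha Hb.
  assert (Hba : (b - a)%C <> 0%C) by (apply Csub_neq; auto).
  set (A := fun w => (a + (b - a) * w)%C). set (D' := fun w => D (A w)).
  assert (HA0 : ~ D' 0%C) by (unfold D', A; replace (a + (b - a) * 0)%C with a by ring; auto).
  assert (HA1 : ~ D' 1%C) by (unfold D', A; replace (a + (b - a) * 1)%C with b by ring; auto).
  assert (HcA : cov D' A D).
  { apply (cov_iso D' D A (fun z => (z - a) / (b - a))%C).
    - intros z _; unfold A; cdf.
    - intros z _; cdf; auto.
    - auto.
    - intros z Hz. unfold D', A. replace (a + (b - a) * ((z - a) / (b - a)))%C with z by (field; auto). auto.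
    - intros z _. unfold A. field; auto.
    - intros z _. unfold A. field; auto. }
  set (U := fun m => D' (netmap m)).
  set (w0 := ((z0 - a) / (b - a))%C).
  assert (EA : A w0 = z0) by (unfold A, w0; field; auto).
  destruct (netmap_surj w0) as [m0 Hm0].
  { intros E. apply HA0. unfold D'. rewrite <- E, EA. auto. }
  assert (HU0 : U m0) by (unfold U, D'; rewrite Hm0, EA; auto).
  assert (HoU : open_C U).
  { intros m Hm. destruct (Ho _ Hm) as (e & He & K).
    assert (Hc : ccont (fun m => A (netmap m)) m).
    { apply cdiff_cont. apply (cdiff_comp A netmap); [unfold A; cdf|apply cdiff_netmap]. }
    destruct (Hc e He) as (d & Hd & K'). exists d; split; auto. intros v Hv. apply K. apply K'; auto. }
  assert (HBU : forall h, holo_on Edisc h -> (forall z, Edisc z -> U (h z)) ->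
     forall z, Edisc z -> Cmod (C_derive h z) * (1 - Cmod z) <= 1920).
  { intros h Hh HhU. apply bloch; auto. intros c. destruct (netmap_net c) as (m & Hm & Em).
    exists m. split; auto. intros z Hz E. apply HA1. rewrite <- Em, <- E. apply HhU; auto. }
  destruct (exhausted_ex U m0 1920 HoU HU0 HBU) as (f & ph & c & s & HX).
  destruct (exhausted_cov U m0 1920 f ph c s HoU HBU ltac:(lra) HX) as (F & HF & HF0).
  exists (fun z => A (netmap (F z))). split.
  - apply (cov_comp Edisc F U (fun m => A (netmap m))); auto.
    apply (cov_comp U netmap D' A); auto. apply netmap_cov; auto.
  - rewrite HF0, Hm0. auto.
Qed.

(** * Homotopy lifting *)

Definition scont (H : R * R -> C) : Prop :=
  forall p, square p -> forall e, 0 < e -> exists d, 0 < d /\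
    forall p', square p' -> Rabs (fst p' - fst p) < d -> Rabs (snd p' - snd p) < d -> Cmod (H p' - H p) < e.

Lemma icont_filterlim (g : R -> C) :
  (forall t, I01 t -> filterlim g (within I01 (locally t)) (locally (g t))) -> icont g.
Proof.
  intros H t Ht e He. specialize (H t Ht (fun w => Cmod (w - g t) < e)).
  assert (HL : @locally C_UniformSpace (g t) (fun w => Cmod (w - g t) < e)) by (apply locally_Cmod; exists e; auto).
  apply H in HL. apply locally_Rabs in HL. destruct HL as (d & Hd & K). exists d; split; auto.
Qed.

Lemma locally_pair (p : R * R) (P : R * R -> Prop) : locally p P <->
  exists d, 0 < d /\ forall p', Rabs (fst p' - fst p) < d -> Rabs (snd p' - snd p) < d -> P p'.
Proof.
  split.
  - intros [d Hd]. exists d. split; [apply cond_pos|]. intros p' h1 h2. apply Hd. split; auto.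
  - intros [d [Hd H]]. exists (mkposreal d Hd). intros p' [h1 h2]. apply H; auto.
Qed.

Lemma scont_filterlim (H : R * R -> C) :
  (forall p, square p -> filterlim H (within square (locally p)) (locally (H p))) <-> scont H.
Proof.
  split.
  - intros F p Hp e He. specialize (F p Hp (fun w => Cmod (w - H p) < e)).
    assert (HL : @locally C_UniformSpace (H p) (fun w => Cmod (w - H p) < e)) by (apply locally_Cmod; exists e; auto).
    apply F in HL. apply locally_pair in HL. destruct HL as (d & Hd & K). exists d; split; auto.
  - intros F p Hp P HP. apply locally_Cmod in HP. destruct HP as (e & He & K).
    destruct (F p Hp e He) as (d & Hd & K'). apply locally_pair. exists d; split; auto.
Qed.

(** Two Lebesgue numbers, both by quadrisection: a common radius of balls contained in [D], and then
    a modulus of uniform continuity for this radius. *)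
Lemma square_unif (H : R * R -> C) (D : C -> Prop) : scont H -> (forall p, square p -> D (H p)) -> open_C D ->
  exists e, 0 < e /\ (forall p, square p -> forall w, Cmod (w - H p) < e -> D w) /\
  exists d, 0 < d /\ forall p p', square p -> square p' -> Rabs (fst p' - fst p) < d -> Rabs (snd p' - snd p) < d ->
     Cmod (H p' - H p) < e.
Proof.
  intros HC HD Ho.
  assert (He : exists e, 0 < e /\ forall p, inrect 0 1 0 1 p -> forall w, Cmod (w - H p) < e -> D w).
  { apply (rect_cousin (fun a b c d => exists e, 0 < e /\ forall p : C, inrect a b c d p -> forall w, Cmod (w - H p) < e -> D w)); try lra.
    - intros a b c d Hab Hcd (e1 & He1 & K1) (e2 & He2 & K2) (e3 & He3 & K3) (e4 & He4 & K4).
      exists (Rmin (Rmin e1 e2) (Rmin e3 e4)). split; [repeat apply Rmin_pos; auto|].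
      intros p [Hp1 Hp2] w Hw.
      pose proof (Rmin_l (Rmin e1 e2) (Rmin e3 e4)). pose proof (Rmin_r (Rmin e1 e2) (Rmin e3 e4)).
      pose proof (Rmin_l e1 e2). pose proof (Rmin_r e1 e2). pose proof (Rmin_l e3 e4). pose proof (Rmin_r e3 e4).
      destruct (Rle_dec (fst p) ((a + b) / 2)), (Rle_dec (snd p) ((c + d) / 2)).
      + apply (K1 p); [unfold inrect; lra|lra].
      + apply (K3 p); [unfold inrect; lra|lra].
      + apply (K2 p); [unfold inrect; lra|lra].
      + apply (K4 p); [unfold inrect; lra|lra].
    - intros z Hz. assert (Sz : square z) by exact Hz. destruct (Ho _ (HD z Sz)) as (e & He & K).
      destruct (HC z Sz (e / 2)) as (d & Hd & K'); [lra|]. exists d; split; auto.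
      intros a' b' c' d' h1 h2 h3 h4 Hin h5 h6. exists (e / 2). split; [lra|]. intros p Hp w Hw.
      assert (Sp : square p) by (unfold square, I01, inrect in *; lra).
      assert (B : Cmod (H p - H z) < e / 2).
      { apply K'; auto; unfold inrect in *; unfold Rabs; destruct Rcase_abs; lra. }
      apply K. pose proof (Cmod_sub_tri w (H p) (H z)). lra. }
  destruct He as (e & He & Ke). exists e. split; auto. split; [intros p Hp; apply Ke; exact Hp|].
  assert (Hd : exists d, 0 < d /\ forall p : C, inrect 0 1 0 1 p -> forall p', square p' ->
     Rabs (fst p' - fst p) < d -> Rabs (snd p' - snd p) < d -> Cmod (H p' - H p) < e).
  { apply (rect_cousin (fun a b c d => exists d0, 0 < d0 /\ forall p : C, inrect a b c d p -> forall p', square p' ->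
      Rabs (fst p' - fst p) < d0 -> Rabs (snd p' - snd p) < d0 -> Cmod (H p' - H p) < e)); try lra.
    - intros a b c d Hab Hcd (e1 & He1 & K1) (e2 & He2 & K2) (e3 & He3 & K3) (e4 & He4 & K4).
      exists (Rmin (Rmin e1 e2) (Rmin e3 e4)). split; [repeat apply Rmin_pos; auto|].
      intros p [Hp1 Hp2] p' Hp' B1 B2.
      pose proof (Rmin_l (Rmin e1 e2) (Rmin e3 e4)). pose proof (Rmin_r (Rmin e1 e2) (Rmin e3 e4)).
      pose proof (Rmin_l e1 e2). pose proof (Rmin_r e1 e2). pose proof (Rmin_l e3 e4). pose proof (Rmin_r e3 e4).
      destruct (Rle_dec (fst p) ((a + b) / 2)), (Rle_dec (snd p) ((c + d) / 2)).
      + apply (K1 p); auto; try lra. unfold inrect; lra.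
      + apply (K3 p); auto; try lra. unfold inrect; lra.
      + apply (K2 p); auto; try lra. unfold inrect; lra.
      + apply (K4 p); auto; try lra. unfold inrect; lra.
    - intros z Hz. assert (Sz : square z) by exact Hz.
      destruct (HC z Sz (e / 2)) as (d & Hd & K'); [lra|]. exists (d / 2); split; [lra|].
      intros a' b' c' d' h1 h2 h3 h4 Hin h5 h6. exists (d / 2). split; [lra|]. intros p Hp p' Hp' B1 B2.
      assert (Sp : square p) by (unfold square, I01, inrect in *; lra).
      assert (C1 : Rabs (fst p - fst z) < d / 2) by (unfold inrect in *; unfold Rabs; destruct Rcase_abs; lra).
      assert (C2 : Rabs (snd p - snd z) < d / 2) by (unfold inrect in *; unfold Rabs; destruct Rcase_abs; lra).
      assert (B : Cmod (H p - H z) < e / 2) by (apply K'; auto; lra).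
      assert (B' : Cmod (H p' - H z) < e / 2).
      { apply K'; auto.
        - replace (fst p' - fst z) with ((fst p' - fst p) + (fst p - fst z)) by ring.
          eapply Rle_lt_trans; [apply Rabs_triang|]. lra.
        - replace (snd p' - snd z) with ((snd p' - snd p) + (snd p - snd z)) by ring.
          eapply Rle_lt_trans; [apply Rabs_triang|]. lra. }
      pose proof (Cmod_sub_tri (H p') (H z) (H p)). rewrite (Cmod_sub_sym (H z) (H p)) in H0. lra. }
  destruct Hd as (d & Hd & Kd). exists d; split; auto.
Qed.

(** The lift of the affine disc onto the ball, read in the coordinate of the ball, is a section. *)
Lemma cov_section f D : cov Edisc f D -> forall e, 0 < e -> forall l, Edisc l ->
  (forall w, Cmod (w - f l) < e -> D w) ->
  exists S, S (f l) = l /\ forall w, Cmod (w - f l) < e -> Edisc (S w) /\ f (S w) = w /\ ccont S w.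
Proof.
  intros (Hf & HfD & L) e He l Hl HB.
  assert (Hen : RtoC e <> 0%C) by (intros E; apply RtoC_inj in E; lra).
  destruct (L (fun z => f l + e * z)%C l) as (phi & Hp & HpE & Hp0 & HE); auto.
  - intros z _; cdf.
  - intros z Hz. apply HB. replace (f l + e * z - f l)%C with (e * z)%C by ring.
    rewrite Cmod_mult, Cmod_R, Rabs_pos_eq by lra. unfold Edisc in Hz. nra.
  - ring.
  - exists (fun w => phi ((w - f l) / e)%C). split.
    + replace ((f l - f l) / e)%C with (RtoC 0) by (field; auto). auto.
    + intros w Hw. assert (Hw' : Edisc ((w - f l) / e)%C).
      { unfold Edisc. rewrite Cmod_div, Cmod_R, Rabs_pos_eq by (auto; lra).
        apply (Rmult_lt_reg_r e); auto. unfold Rdiv. rewrite Rmult_assoc, Rinv_l; lra. }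
      split; auto. split.
      * rewrite HE by auto. field; auto.
      * apply (ccont_comp phi (fun w => (w - f l) / e)%C); [apply cdiff_cont; auto|]. apply cdiff_cont; cdf; auto.
Qed.

(** Sections are indexed by their base point in [E], since homotopy lifting needs joint continuity
    in base point and argument. For [l'] near [l] the two sections agree at [f l'] by local
    injectivity, and hence along segments by uniqueness of lifts. *)
Lemma cov_local_section f D : open_C D -> cov Edisc f D ->
  forall e, 0 < e -> exists sg : C -> C -> C, forall l, Edisc l -> (forall w, Cmod (w - f l) < e -> D w) ->
    sg l (f l) = l /\ (forall w, Cmod (w - f l) < e -> Edisc (sg l w) /\ f (sg l w) = w) /\
    forall w, Cmod (w - f l) < e -> forall eps, 0 < eps -> exists d, 0 < d /\ forall l' w', Edisc l' ->
      (forall w, Cmod (w - f l') < e -> D w) -> Cmod (l' - l) < d -> Cmod (w' - w) < d -> Cmod (w' - f l') < e ->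
      Cmod (sg l' w' - sg l w) < eps.
Proof.
  intros Ho Hc e He.
  assert (Hx : forall l, exists S : C -> C, Edisc l -> (forall w, Cmod (w - f l) < e -> D w) ->
     S (f l) = l /\ forall w, Cmod (w - f l) < e -> Edisc (S w) /\ f (S w) = w /\ ccont S w).
  { intros l. destruct (classic (Edisc l /\ forall w, Cmod (w - f l) < e -> D w)) as [[h1 h2]|h].
    - destruct (cov_section f D Hc e He l h1 h2) as [S HS]. exists S; auto.
    - exists (fun z => z). intros. exfalso; apply h; auto. }
  set (sg := fun l => proj1_sig (constructive_indefinite_description _ (Hx l))).
  assert (Hsg : forall l, Edisc l -> (forall w, Cmod (w - f l) < e -> D w) ->
     sg l (f l) = l /\ forall w, Cmod (w - f l) < e -> Edisc (sg l w) /\ f (sg l w) = w /\ ccont (sg l) w).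
  { intros l. unfold sg. destruct constructive_indefinite_description; auto. }
  clearbody sg. clear Hx.
  exists sg. intros l Hl HB. destruct (Hsg l Hl HB) as [S1 S2]. split; auto.
  split; [intros w Hw; destruct (S2 w Hw) as (a1 & a2 & _); auto|].
  intros w Hw eps Heps.
  pose proof (cov_der_nz f D Ho Hc) as Hn. destruct Hc as (Hf & HfD & _).
  assert (Hself : Cmod (f l - f l) < e) by (rewrite Cmod_self_sub; auto).
  destruct (local_inj f l Hf Hl (Hn l Hl)) as (d0 & Hd0 & _ & Kinj).
  (* for l' close to l, [sg l (f l') = l'] *)
  destruct (S2 (f l) Hself) as (_ & _ & Sc). destruct (Sc d0 Hd0) as (d1 & Hd1 & K1). rewrite S1 in K1.
  set (d1' := Rmin d1 (e - Cmod (w - f l))).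
  assert (Hd1' : 0 < d1') by (apply Rmin_pos; lra).
  destruct (cdiff_cont f l (Hf l Hl) d1' Hd1') as (d2 & Hd2 & K2).
  destruct (S2 w Hw) as (_ & _ & Scw). destruct (Scw eps Heps) as (d3 & Hd3 & K3).
  set (d := Rmin (Rmin d0 d2) (Rmin d3 (e - Cmod (w - f l)))).
  exists d. split; [unfold d; repeat apply Rmin_pos; auto; lra|].
  intros l' w' Hl' HB' Hll Hww Hwl.
  assert (Hdd : d <= d0 /\ d <= d2 /\ d <= d3 /\ d <= e - Cmod (w - f l)).
  { unfold d. pose proof (Rmin_l (Rmin d0 d2) (Rmin d3 (e - Cmod (w - f l)))). pose proof (Rmin_r (Rmin d0 d2) (Rmin d3 (e - Cmod (w - f l)))).
    pose proof (Rmin_l d0 d2). pose proof (Rmin_r d0 d2). pose proof (Rmin_l d3 (e - Cmod (w - f l))). pose proof (Rmin_r d3 (e - Cmod (w - f l))). lra. }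
  specialize (K2 l' ltac:(lra)). assert (Hfl : Cmod (f l' - f l) < e).
  { assert (d1' <= e - Cmod (w - f l)) by apply Rmin_r. pose proof (Cmod_ge_0 (w - f l)). lra. }
  assert (Hfl1 : Cmod (f l' - f l) < d1) by (assert (d1' <= d1) by apply Rmin_l; lra).
  assert (E1 : sg l (f l') = l').
  { destruct (S2 (f l') Hfl) as (a1 & a2 & _). apply Kinj; auto; lra. }
  assert (Hw'l : Cmod (w' - f l) < e) by (pose proof (Cmod_sub_tri w' w (f l)); lra).
  destruct (Hsg l' Hl' HB') as [T1 T2].
  assert (E2 : sg l' w' = sg l w').
  { assert (HP : forall t, I01 t -> sg l' (f l' + (w' - f l') * t)%C = sg l (f l' + (w' - f l') * t)%C).
    { assert (Hseg1 : forall t, I01 t -> Cmod (f l' + (w' - f l') * t - f l') < e).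
      { intros t Ht. apply seg_in_ball; auto. rewrite Cmod_self_sub; auto. }
      assert (Hseg2 : forall t, I01 t -> Cmod (f l' + (w' - f l') * t - f l) < e).
      { intros t Ht. apply seg_in_ball; auto. }
      assert (Hic : forall S : C -> C, (forall t, I01 t -> ccont S (f l' + (w' - f l') * t)%C) ->
          icont (fun t => S (f l' + (w' - f l') * t)%C)).
      { intros S HS t Ht e0 He0.
        destruct (rcont_comp S (fun t => f l' + (w' - f l') * t)%C t (HS t Ht) (rcont_affine _ _ _) e0 He0) as (dd & Hdd' & Kd).
        exists dd; split; auto. }
      apply (path_unique f (fun t => sg l' (f l' + (w' - f l') * t)%C) (fun t => sg l (f l' + (w' - f l') * t)%C)); auto.
      - apply Hic. intros t Ht. apply T2; auto.
      - apply Hic. intros t Ht. apply S2; auto.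
      - intros t Ht. apply T2; auto.
      - intros t Ht. destruct (T2 _ (Hseg1 t Ht)) as (_ & -> & _). destruct (S2 _ (Hseg2 t Ht)) as (_ & -> & _). auto.
      - replace (f l' + (w' - f l') * 0)%C with (f l') by ring. congruence. }
    specialize (HP 1 ltac:(unfold I01; lra)). replace (f l' + (w' - f l') * 1)%C with w' in HP by ring. auto. }
  rewrite E2. apply K3. lra.
Qed.

Lemma scont_slice_h (H : R * R -> C) s : I01 s -> scont H -> icont (fun t => H (s, t)).
Proof.
  intros Hs HC t Ht e He. destruct (HC (s, t) (conj Hs Ht) e He) as (d & Hd & K). exists d; split; auto.
  intros u Hu Hut. apply K; [split; auto| |auto]. simpl. replace (s - s) with 0 by ring. rewrite Rabs_R0; auto.
Qed.

Lemma scont_slice_v_rev (H : R * R -> C) t : I01 t -> scont H -> icont (fun s => H (1 - s, t)).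
Proof.
  intros Ht HC s Hs e He.
  assert (Hs' : I01 (1 - s)) by (unfold I01 in *; lra).
  destruct (HC (1 - s, t) (conj Hs' Ht) e He) as (d & Hd & K). exists d; split; auto.
  intros u Hu Hut. apply K.
  - split; simpl; auto. unfold I01 in *; lra.
  - simpl. replace (1 - u - (1 - s)) with (- (u - s)) by ring. rewrite Rabs_Ropp; auto.
  - simpl. replace (t - t) with 0 by ring. rewrite Rabs_R0; auto.
Qed.

(** The square is not subdivided but contracted to its corner: [L k] lifts [H] composed with the
    homothety of ratio [k / N]. Passing to [k + 1] moves each value of [H] by less than [e], so the
    section based at [L k p] gives the next lift, and the joint continuity of the sections makes it
    continuous. *)
Lemma homotopy_lift f D H l : open_C D -> cov Edisc f D -> scont H -> (forall p, square p -> D (H p)) ->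
  Edisc l -> f l = H (0, 0) ->
  exists L, scont L /\ (forall p, square p -> Edisc (L p) /\ f (L p) = H p) /\ L (0, 0) = l.
Proof.
  intros Ho Hc HC HD Hl Hl0. destruct (square_unif H D HC HD Ho) as (e & He & Ke & d & Hd & Kd).
  destruct (cov_local_section f D Ho Hc e He) as (sg & Hsg).
  destruct (INR_unbounded (/ d)) as [N0 HN0]. apply Rgt_lt in HN0.
  set (N := INR (S N0)). assert (HN : / d < N) by (unfold N; rewrite S_INR; lra).
  assert (HNp : 0 < N) by (assert (0 < / d) by (apply Rinv_0_lt_compat; auto); lra).
  assert (HNd : / N < d).
  { rewrite <- (Rinv_inv d). apply Rinv_lt_contravar; auto. apply Rmult_lt_0_compat; auto. apply Rinv_0_lt_compat; auto. }
  set (sc := fun (k : nat) (p : R * R) => (INR k / N * fst p, INR k / N * snd p)).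
  assert (Hk01 : forall k, (k <= S N0)%nat -> 0 <= INR k / N <= 1).
  { intros k Hk. split; [apply Rmult_le_pos; [apply pos_INR|left; apply Rinv_0_lt_compat; auto]|].
    apply (Rmult_le_reg_r N); auto. unfold Rdiv. rewrite Rmult_assoc, Rinv_l by lra. rewrite Rmult_1_r, Rmult_1_l. apply le_INR; auto. }
  assert (Hsc : forall k p, (k <= S N0)%nat -> square p -> square (sc k p)).
  { intros k p Hk [h1 h2]. specialize (Hk01 k Hk). unfold square, I01, sc in *; simpl.
    split; split; try apply Rmult_le_pos; try lra; rewrite <- (Rmult_1_r 1); apply Rmult_le_compat; lra. }
  assert (Hsch : forall k p, (S k <= S N0)%nat -> square p -> Cmod (H (sc (S k) p) - H (sc k p)) < e).
  { intros k p Hk Hp. apply Kd; [apply Hsc; auto; lia|apply Hsc; auto| |]; unfold sc; cbn [fst snd]; rewrite S_INR.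
    - replace ((INR k + 1) / N * fst p - INR k / N * fst p) with (/ N * fst p) by (field; lra).
      destruct Hp as [[h1 h2] _]. assert (0 < / N) by (apply Rinv_0_lt_compat; auto).
      rewrite Rabs_pos_eq by nra. nra.
    - replace ((INR k + 1) / N * snd p - INR k / N * snd p) with (/ N * snd p) by (field; lra).
      destruct Hp as [_ [h1 h2]]. assert (0 < / N) by (apply Rinv_0_lt_compat; auto).
      rewrite Rabs_pos_eq by nra. nra. }
  set (L := fix L k p := match k with O => l | S k' => sg (L k' p) (H (sc (S k') p)) end).
  assert (HL : forall k, (k <= S N0)%nat -> scont (L k) /\ forall p, square p -> Edisc (L k p) /\ f (L k p) = H (sc k p)).
  { induction k as [|k IH]; intros Hk.
    - split.
      + intros p Hp e0 He0. exists 1; split; [lra|]. intros. simpl. rewrite Cmod_self_sub; auto.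
      + intros p Hp. split; auto. simpl L. rewrite Hl0. f_equal. unfold sc; simpl INR. unfold Rdiv. f_equal; ring.
    - destruct (IH ltac:(lia)) as [IH1 IH2].
      assert (Hball : forall p, square p -> forall w, Cmod (w - f (L k p)) < e -> D w).
      { intros p Hp w Hw. destruct (IH2 p Hp) as [_ E]. rewrite E in Hw. apply (Ke (sc k p)); auto. apply Hsc; auto; lia. }
      assert (Hin : forall p, square p -> Cmod (H (sc (S k) p) - f (L k p)) < e).
      { intros p Hp. destruct (IH2 p Hp) as [_ E]. rewrite E. auto. }
      split.
      + intros p Hp e0 He0. destruct (IH2 p Hp) as [E1 E2].
        destruct (Hsg (L k p) E1 (Hball p Hp)) as (_ & _ & K). destruct (K _ (Hin p Hp) e0 He0) as (d1 & Hd1 & K1).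
        destruct (IH1 p Hp d1 Hd1) as (d2 & Hd2 & K2).
        destruct (HC (sc (S k) p) (Hsc (S k) p Hk Hp) d1 Hd1) as (d3 & Hd3 & K3).
        exists (Rmin d2 d3). split; [apply Rmin_pos; auto|]. intros p' Hp' B1 B2.
        pose proof (Rmin_l d2 d3). pose proof (Rmin_r d2 d3).
        destruct (IH2 p' Hp') as [F1 F2].
        change (Cmod (sg (L k p') (H (sc (S k) p')) - sg (L k p) (H (sc (S k) p))) < e0).
        apply (K1 (L k p') (H (sc (S k) p')) F1 (Hball p' Hp')); [| |apply Hin; auto].
        * apply K2; auto; lra.
        * specialize (Hk01 (S k) Hk).
          apply K3; auto; unfold sc; cbn [fst snd].
          -- rewrite <- Rmult_minus_distr_l, Rabs_mult, Rabs_pos_eq by lra. pose proof (Rabs_pos (fst p' - fst p)). nra.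
          -- rewrite <- Rmult_minus_distr_l, Rabs_mult, Rabs_pos_eq by lra. pose proof (Rabs_pos (snd p' - snd p)). nra.
      + intros p Hp. destruct (IH2 p Hp) as [E1 E2]. destruct (Hsg (L k p) E1 (Hball p Hp)) as (_ & K & _).
        apply K; auto. }
  assert (HL0 : forall k, (k <= S N0)%nat -> L k (0, 0) = l).
  { induction k as [|k IH]; intros Hk; [reflexivity|].
    change (sg (L k (0, 0)) (H (sc (S k) (0, 0))) = l). rewrite IH by lia.
    assert (S00 : square (0, 0)) by (unfold square, I01; simpl; lra).
    replace (sc (S k) (0, 0)) with (0, 0) by (unfold sc; cbn [fst snd]; rewrite !Rmult_0_r; auto).
    rewrite <- Hl0. apply Hsg; auto. rewrite Hl0. apply Ke; auto. }
  exists (L (S N0)). destruct (HL (S N0) (le_n _)) as [A1 A2]. split; auto. split; [|apply HL0; auto].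
  intros p Hp. destruct (A2 p Hp) as [B1 B2]. split; auto. rewrite B2. f_equal.
  unfold sc. fold N. replace (N / N) with 1 by (field; lra). rewrite !Rmult_1_l. destruct p; auto.
Qed.

(** The image of the segment from [z] to [w] is a loop. In the lift of its contraction the side
    [s = 1] is constant, so the sides [t = 0] and [t = 1], which lie over the same path, have a
    common end and agree down to [s = 0], where they end at [z] and [w]. *)
Lemma simply_connected_cov_inj f D : simply_connected D -> cov Edisc f D ->
  forall z w, Edisc z -> Edisc w -> f z = f w -> z = w.
Proof.
  intros [[Ho _] HS] Hc z w Hz Hw E.
  pose proof (cov_der_nz f D Ho Hc) as Hn. pose proof Hc as (Hf & HfD & _).
  assert (Hseg : forall t, I01 t -> Edisc (z + (w - z) * t)%C).
  { intros t Ht. apply ball_E. apply seg_in_ball; auto; apply E_ball; auto. }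
  assert (Hcont : forall t, I01 t -> rcont (fun t => f (z + (w - z) * t)%C) t).
  { intros t Ht. apply (rcont_comp f (fun t => z + (w - z) * t)%C); [apply cdiff_cont; auto|apply rcont_affine]. }
  destruct (HS (fun t => f (z + (w - z) * t)%C)) as (H & c & H1 & H2 & H3 & H4 & H5).
  - split.
    + intros t Ht P HP. apply locally_Cmod in HP. destruct HP as (e & He & K).
      destruct (Hcont t Ht e He) as (d & Hd & K'). apply locally_Rabs. exists d; split; auto.
    + intros t Ht. auto.
  - replace (z + (w - z) * 0)%C with z by ring. replace (z + (w - z) * 1)%C with w by ring. auto.
  - assert (I0 : I01 0) by (unfold I01; lra). assert (I1 : I01 1) by (unfold I01; lra).
    assert (HC : scont H) by (apply scont_filterlim; auto).
    destruct (homotopy_lift f D H z Ho Hc HC H2 Hz) as (L & L1 & L2 & L3).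
    { rewrite H3 by auto. f_equal. ring. }
    assert (E1 : L (0, 1) = w).
    { assert (K : forall t, I01 t -> L (0, t) = (z + (w - z) * t)%C).
      { apply (path_unique f (fun t => L (0, t)) (fun t => z + (w - z) * t)%C); auto.
        - apply scont_slice_h; auto.
        - intros t Ht e He. destruct (rcont_affine z (w - z) t e He) as (d & Hd & K). exists d; split; auto.
        - intros t Ht. apply L2. split; auto.
        - intros t Ht. destruct (L2 (0, t) (conj I0 Ht)) as [_ ->]. rewrite H3; auto.
        - rewrite L3. ring. }
      rewrite K by auto. ring. }
    assert (E2 : L (1, 1) = L (1, 0)).
    { apply (path_unique f (fun t => L (1, t)) (fun _ => L (1, 0))); auto.
      - apply scont_slice_h; auto.
      - intros t Ht e He. exists 1; split; [lra|]. intros. rewrite Cmod_self_sub; auto.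
      - intros t Ht. apply L2; split; auto.
      - intros t Ht. destruct (L2 (1, t) (conj I1 Ht)) as [_ ->]. destruct (L2 (1, 0) (conj I1 I0)) as [_ ->].
        rewrite !H4; auto. }
    (* The sides are run through from [s = 1], where they agree, to [s = 0]. *)
    assert (E3 : L (1 - 1, 0) = L (1 - 1, 1)).
    { assert (I1s : forall s, I01 s -> I01 (1 - s)) by (unfold I01; intros; lra).
      apply (path_unique f (fun s => L (1 - s, 0)) (fun s => L (1 - s, 1))); auto.
      - apply scont_slice_v_rev; auto.
      - apply scont_slice_v_rev; auto.
      - intros s Hs. apply L2. split; simpl; auto.
      - intros s Hs. destruct (L2 (1 - s, 0) (conj (I1s s Hs) I0)) as [_ ->].
        destruct (L2 (1 - s, 1) (conj (I1s s Hs) I1)) as [_ ->]. auto.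
      - rewrite Rminus_0_r. auto. }
    replace (1 - 1) with 0 in E3 by ring. congruence.
Qed.

(** The image and its complement in [D] are both open, since a ball in [D] centred at an image point
    has a section. *)
Lemma cov_surj f D : open_C D -> connected_C D -> cov Edisc f D -> forall w, D w -> exists z, Edisc z /\ f z = w.
Proof.
  intros Ho Hcn Hc.
  set (U := fun w => D w /\ exists z, Edisc z /\ f z = w).
  set (V := fun w => D w /\ ~ exists z, Edisc z /\ f z = w).
  assert (Hball : forall e l, 0 < e -> Edisc l -> (forall w, Cmod (w - f l) < e -> D w) ->
      forall w, Cmod (w - f l) < e -> exists z, Edisc z /\ f z = w).
  { intros e l He Hl HB w Hw. destruct (cov_section f D Hc e He l Hl HB) as (S & _ & HS).
    destruct (HS w Hw) as (a1 & a2 & _). eauto. }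
  destruct (Hcn U V) as [HU|HV].
  - intros w [Hw [z [Hz E]]]. destruct (Ho w Hw) as (e & He & K). exists e; split; auto.
    intros v Hv. split; auto. subst w. apply (Hball e z); auto.
  - intros w [Hw HN]. destruct (Ho w Hw) as (e & He & K). exists (e / 2); split; [lra|].
    intros v Hv. split; [apply K; lra|]. intros [z [Hz E]]. apply HN. subst v.
    apply (Hball (e / 2) z); auto; [lra| |].
    + intros v Hv'. apply K. pose proof (Cmod_sub_tri v (f z) w). lra.
    + rewrite Cmod_sub_sym. auto.
  - intros w Hw. unfold U, V. tauto.
  - intros w _ [_ h1] [_ h2]. auto.
  - intros w Hw. apply HU; auto.
  - exfalso. destruct Hc as (_ & HfD & _). destruct (HV (f 0%C) (HfD _ E0)) as [_ h]. apply h. exists 0%C; split; auto. apply E0.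
Qed.

(** Local sections show that the inverse of [f] is continuous; the loop is contracted radially in
    [E] and mapped back. *)
Lemma cov_inj_simply_connected f D : cdomain D -> cov Edisc f D ->
  (forall z w, Edisc z -> Edisc w -> f z = f w -> z = w) -> simply_connected D.
Proof.
  intros HD Hc Hinj. split; auto. destruct HD as (Ho & Hcn & _).
  pose proof (cov_surj f D Ho Hcn Hc) as Hs. pose proof Hc as (Hf & HfD & _).
  intros g [Hg1 Hg2] Hg01.
  assert (Hx : forall w, exists z, D w -> Edisc z /\ f z = w).
  { intros w. destruct (classic (D w)) as [h|h]; [destruct (Hs w h) as [z Hz]; exists z; auto|exists 0%C; tauto]. }
  set (inv := fun w => proj1_sig (constructive_indefinite_description _ (Hx w))).
  assert (Hinv : forall w, D w -> Edisc (inv w) /\ f (inv w) = w).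
  { intros w. unfold inv. destruct constructive_indefinite_description; auto. }
  clearbody inv.
  assert (Hci : forall w, D w -> ccont inv w).
  { intros w Hw. destruct (Hinv w Hw) as [h1 h2]. destruct (Ho w Hw) as (e & He & K).
    destruct (cov_section f D Hc e He (inv w) h1) as (S & S1 & S2).
    { rewrite h2. auto. }
    rewrite h2 in S1, S2. apply ccont_ext with S.
    - exists e; split; auto. intros v Hv. destruct (S2 v Hv) as (a1 & a2 & _).
      destruct (Hinv v (K v Hv)) as [b1 b2]. apply Hinj; auto. congruence.
    - apply S2. rewrite Cmod_self_sub; auto. }
  set (k := fun t => inv (g t)).
  assert (Hk : icont k).
  { intros t Ht e He. destruct (Hci (g t) (Hg2 t Ht) e He) as (d & Hd & K).
    destruct (icont_filterlim g Hg1 t Ht d Hd) as (d' & Hd' & K'). exists d'; split; auto.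
    intros s Is Hst. apply K, K'; auto. }
  assert (HkE : forall t, I01 t -> Edisc (k t)) by (intros t Ht; apply Hinv; auto).
  exists (fun p => f (RtoC (1 - fst p) * k (snd p))%C), (f 0%C).
  assert (HsE : forall p, square p -> Edisc (RtoC (1 - fst p) * k (snd p))%C).
  { intros p [h1 h2]. apply Edisc_scale; auto. unfold I01 in h1. lra. }
  split; [|split; [|split; [|split]]].
  - apply scont_filterlim. intros p Hp e He. destruct (cdiff_cont f _ (Hf _ (HsE p Hp)) e He) as (d & Hd & K).
    destruct Hp as [h1 h2]. destruct (Hk (snd p) h2 (d / 2)) as (d' & Hd' & K'); [lra|].
    exists (Rmin (d / 2) d'). split; [apply Rmin_pos; lra|]. intros p' [h1' h2'] B1 B2.
    pose proof (Rmin_l (d / 2) d'). pose proof (Rmin_r (d / 2) d').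
    apply K. specialize (K' (snd p') h2' ltac:(lra)).
    replace (RtoC (1 - fst p') * k (snd p') - RtoC (1 - fst p) * k (snd p))%C with
      (RtoC (1 - fst p') * (k (snd p') - k (snd p)) + RtoC (fst p - fst p') * k (snd p))%C
      by (rewrite !RtoC_minus; ring).
    eapply Rle_lt_trans; [apply Cmod_triangle|]. rewrite !Cmod_mult, !Cmod_R.
    rewrite (Rabs_minus_sym (fst p)). unfold I01 in h1'. rewrite (Rabs_pos_eq (1 - fst p')) by lra.
    pose proof (HkE (snd p) h2) as hk. unfold Edisc in hk. pose proof (Cmod_ge_0 (k (snd p))).
    pose proof (Cmod_ge_0 (k (snd p') - k (snd p))). pose proof (Rabs_pos (fst p' - fst p)). nra.
  - intros p Hp. auto.
  - intros t Ht. simpl. replace (RtoC (1 - 0) * k t)%C with (k t) by (rewrite RtoC_minus; ring). apply Hinv; auto.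
  - intros t Ht. simpl. f_equal. rewrite RtoC_minus. ring.
  - intros s Hs'. simpl. unfold k. rewrite Hg01. auto.
Qed.

Lemma plane_simply_connected D : cdomain D -> (forall z, D z) -> simply_connected D.
Proof.
  intros HD Hall. split; auto. intros g [Hg1 Hg2] Hg01. pose proof (icont_filterlim g Hg1) as Hk.
  exists (fun p => RtoC (1 - fst p) * g (snd p))%C, 0%C.
  split; [|split; [|split; [|split]]].
  - apply scont_filterlim. intros p [h1 h2] e He.
    set (M := Cmod (g (snd p)) + 1). assert (HM : 1 <= M) by (unfold M; pose proof (Cmod_ge_0 (g (snd p))); lra).
    destruct (Hk (snd p) h2 (e / 2)) as (d' & Hd' & K'); [lra|].
    exists (Rmin (e / (2 * M)) d'). split; [apply Rmin_pos; auto; apply Rdiv_lt_0_compat; lra|]. intros p' [h1' h2'] B1 B2.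
    pose proof (Rmin_l (e / (2 * M)) d'). pose proof (Rmin_r (e / (2 * M)) d').
    specialize (K' (snd p') h2' ltac:(lra)).
    replace (RtoC (1 - fst p') * g (snd p') - RtoC (1 - fst p) * g (snd p))%C with
      (RtoC (1 - fst p') * (g (snd p') - g (snd p)) + RtoC (fst p - fst p') * g (snd p))%C
      by (rewrite !RtoC_minus; ring).
    eapply Rle_lt_trans; [apply Cmod_triangle|]. rewrite !Cmod_mult, !Cmod_R.
    rewrite (Rabs_minus_sym (fst p)). unfold I01 in h1'. rewrite (Rabs_pos_eq (1 - fst p')) by lra.
    pose proof (Cmod_ge_0 (g (snd p') - g (snd p))). pose proof (Rabs_pos (fst p' - fst p)).
    assert (Hx : Rabs (fst p' - fst p) * Cmod (g (snd p)) <= e / 2).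
    { pose proof (Cmod_ge_0 (g (snd p))).
      replace (e / 2) with (e / (2 * M) * M) by (field; lra). apply Rmult_le_compat; auto; [lra|unfold M; lra]. }
    nra.
  - auto.
  - intros t Ht. simpl. rewrite RtoC_minus. ring.
  - intros t Ht. simpl. rewrite RtoC_minus. ring.
  - intros s Hs'. simpl. rewrite Hg01. auto.
Qed.

Lemma punctured_plane_biholomorphic D a : ~ D a -> (forall z, z <> a -> D z) -> biholomorphic D Cstar.
Proof.
  intros Ha Hall. exists (fun z => z - a)%C, (fun z => z + a)%C. repeat split.
  - intros z _; cdf.
  - intros z _; cdf.
  - intros z Hz E. apply Ha. apply Csub_eq in E. subst; auto.
  - intros w Hw. apply Hall. intros E. apply Hw. replace w with (w + a - a)%C by ring. rewrite E. ring.
  - intros z _. ring.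
  - intros w _. ring.
Qed.

Lemma domain_trichotomy (D : C -> Prop) : (forall z, D z) \/ (exists a, ~ D a /\ forall z, z <> a -> D z) \/
  exists a b, a <> b /\ ~ D a /\ ~ D b.
Proof.
  destruct (classic (forall z, D z)) as [h|h]; auto. right. apply not_all_ex_not in h. destruct h as [a Ha].
  destruct (classic (forall z, z <> a -> D z)) as [h|h]; [left; eauto|]. right.
  apply not_all_ex_not in h. destruct h as [b Hb]. exists a, b. apply imply_to_and in Hb. destruct Hb. auto.
Qed.

(** * A simply connected factor or a punctured plane *)

(** A Hahn competitor at the same point and for the same vector, whose value exceeds [|a|] by as
    little as wanted. *)
Definition inj_approx (D1 D2 : C -> Prop) : Prop :=
  forall f1 f2 a r, holo_on Edisc f1 -> holo_on Edisc f2 -> (forall z, Edisc z -> D1 (f1 z)) ->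
    (forall z, Edisc z -> D2 (f2 z)) -> Cmod a < r ->
  exists g1 g2 b, holo_on Edisc g1 /\ holo_on Edisc g2 /\ (forall z, Edisc z -> D1 (g1 z)) /\
    (forall z, Edisc z -> D2 (g2 z)) /\
    (forall z w, Edisc z -> Edisc w -> g1 z = g1 w -> g2 z = g2 w -> z = w) /\
    g1 0%C = f1 0%C /\ g2 0%C = f2 0%C /\
    (b * C_derive g1 0 = a * C_derive f1 0)%C /\ (b * C_derive g2 0 = a * C_derive f2 0)%C /\ Cmod b <= r.

Lemma hahn_eq_kob_of_approx D :
  (forall z X r r', D z -> disc_vals false D z X r -> r < r' -> exists r'', r'' <= r' /\ disc_vals true D z X r'') ->
  hahn_eq_kob D.
Proof.
  intros H z X Hz. apply Rbar_le_antisym.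
  - unfold kobayashi. destruct (Glb_Rbar_correct (disc_vals false D z X)) as [_ G]. apply G.
    intros r Hr. destruct (Glb_Rbar_correct (disc_vals true D z X)) as [L _].
    fold (hahn D z X) in L. destruct (hahn D z X) as [x| |] eqn:E; simpl.
    + apply Rnot_lt_le; intros Hlt. destruct (H z X r ((r + x) / 2) Hz Hr ltac:(lra)) as (r'' & h1 & h2).
      specialize (L r'' h2). simpl in L. lra.
    + destruct (H z X r (r + 1) Hz Hr ltac:(lra)) as (r'' & h1 & h2). apply (L r'' h2).
    + auto.
  - unfold hahn. destruct (Glb_Rbar_correct (disc_vals true D z X)) as [_ G]. apply G.
    intros r (f1 & f2 & a & h). destruct (Glb_Rbar_correct (disc_vals false D z X)) as [L _]. apply L.
    exists f1, f2, a. simpl in *. tauto.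
Qed.

Lemma inj_approx_l D1 D2 : inj_approx D1 D2 -> hahn_eq_kob (prodD D1 D2).
Proof.
  intros HA. apply hahn_eq_kob_of_approx.
  intros z X r r' Hz (f1 & f2 & a & h1 & h2 & h3 & _ & h5 & h6 & h7 & h8 & ->) Hlt.
  destruct (HA f1 f2 a r' h1 h2 (fun w Hw => proj1 (h3 w Hw)) (fun w Hw => proj2 (h3 w Hw)) Hlt)
    as (g1 & g2 & b & k1 & k2 & k3 & k4 & k5 & k6 & k7 & k8 & k9 & k10).
  exists (Cmod b). split; auto. exists g1, g2, b. repeat split; auto; try congruence; [apply k3|apply k4|]; auto.
  intros w1 w2 hw1 hw2 E. injection E as E1 E2. auto.
Qed.

Lemma inj_approx_r D1 D2 : inj_approx D1 D2 -> hahn_eq_kob (prodD D2 D1).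
Proof.
  intros HA. apply hahn_eq_kob_of_approx.
  intros z X r r' Hz (f1 & f2 & a & h1 & h2 & h3 & _ & h5 & h6 & h7 & h8 & ->) Hlt.
  destruct (HA f2 f1 a r' h2 h1 (fun w Hw => proj2 (h3 w Hw)) (fun w Hw => proj1 (h3 w Hw)) Hlt)
    as (g1 & g2 & b & k1 & k2 & k3 & k4 & k5 & k6 & k7 & k8 & k9 & k10).
  exists (Cmod b). split; auto. exists g2, g1, b. repeat split; auto; try congruence; [apply k4|apply k3|]; auto.
  intros w1 w2 hw1 hw2 E. injection E as E1 E2. auto.
Qed.

Lemma inj_approx_trivial (D1 D2 : C -> Prop) z1 z2 : open_C D1 -> D1 z1 -> D2 z2 ->
  exists g1 g2, holo_on Edisc g1 /\ holo_on Edisc g2 /\ (forall z, Edisc z -> D1 (g1 z)) /\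
    (forall z, Edisc z -> D2 (g2 z)) /\
    (forall z w, Edisc z -> Edisc w -> g1 z = g1 w -> g2 z = g2 w -> z = w) /\
    g1 0%C = z1 /\ g2 0%C = z2.
Proof.
  intros Ho H1 H2. destruct (Ho z1 H1) as (e & He & K).
  assert (Hen : RtoC e <> 0%C) by (intros E; apply RtoC_inj in E; lra).
  exists (fun z => z1 + e * z)%C, (fun _ => z2). split; [intros z _; cdf|]. split; [intros z _; cdf|].
  split; [|split; [auto|split; [|split; [ring|auto]]]].
  - intros z Hz. apply K. replace (z1 + e * z - z1)%C with (e * z)%C by ring.
    rewrite Cmod_mult, Cmod_R, Rabs_pos_eq by lra. unfold Edisc in Hz. nra.
  - intros z w _ _ E _. replace z with ((z1 + e * z - z1) / e)%C by (field; auto). rewrite E. field; auto.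
Qed.

(** [F] may depend on [f], so that the whole plane, which has no extremal disc, is included. *)
Definition schlicht (D : C -> Prop) : Prop :=
  forall f, holo_on Edisc f -> (forall z, Edisc z -> D (f z)) ->
  exists F, holo_on Edisc F /\ (forall z, Edisc z -> D (F z)) /\
    (forall z w, Edisc z -> Edisc w -> F z = F w -> z = w) /\ F 0%C = f 0%C /\
    C_derive F 0%C <> 0%C /\ Cmod (C_derive f 0%C) <= Cmod (C_derive F 0%C).

Lemma schlicht_plane D : (forall z, D z) -> schlicht D.
Proof.
  intros HD f Hf _. set (M := Cmod (C_derive f 0%C) + 1).
  pose proof (Cmod_ge_0 (C_derive f 0%C)).
  assert (HM : RtoC M <> 0%C) by (intros E; apply RtoC_inj in E; unfold M in E; lra).
  assert (Ed : C_derive (fun z => f 0 + M * z)%C 0%C = RtoC M) by (apply cder_C_derive; eapply cder_eq; [cdr|ring]).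
  exists (fun z => f 0 + M * z)%C. split; [intros z _; cdf|]. split; [auto|]. split; [|split; [ring|]].
  - intros z w _ _ E. replace z with ((f 0 + M * z - f 0) / M)%C by (field; auto). rewrite E. field; auto.
  - rewrite Ed. split; auto. rewrite Cmod_R, Rabs_pos_eq; unfold M; lra.
Qed.

(** [F] is the covering centred at [f 0], injective by homotopy lifting; Schwarz for the lift of [f]
    compares the derivatives. *)
Lemma schlicht_hyperbolic D a b : simply_connected D -> a <> b -> ~ D a -> ~ D b -> schlicht D.
Proof.
  intros HS Hab Ha Hb f Hf HfD. pose proof (proj1 HS) as (Ho & _).
  destruct (hyperbolic_cov D a b (f 0%C) Ho (HfD _ E0) Hab Ha Hb) as (F & HF & HF0).
  pose proof (cov_der_nz F D Ho HF 0%C E0) as Hn.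
  exists F. pose proof HF as (F1 & F2 & F3). split; auto. split; auto. split.
  { apply simply_connected_cov_inj with D; auto. }
  split; auto. split; auto.
  destruct (F3 f 0%C Hf HfD E0) as (phi & p1 & p2 & p3 & p4); auto.
  pose proof (schwarz_der phi p1 (fun z Hz => Rlt_le _ _ (p2 z Hz)) p3) as S.
  assert (Ed : (C_derive f 0 = C_derive F 0 * C_derive phi 0)%C).
  { apply cder_C_derive. apply cder_ext with (fun z => F (phi z)).
    - exists 1; split; [lra|]. intros w Hw. rewrite Csub_0_r in Hw. auto.
    - apply (cder_comp F phi); [rewrite p3|]; apply cdiff_C_derive; [apply F1, E0|apply p1, E0]. }
  rewrite Ed, Cmod_mult. pose proof (Cmod_ge_0 (C_derive F 0%C)). pose proof (Cmod_ge_0 (C_derive phi 0%C)). nra.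
Qed.

Lemma cder_scale (f : C -> C) (t : C) : cdiff f 0%C -> cder (fun z => f (t * z)%C) 0%C (t * C_derive f 0)%C.
Proof.
  intros Hf. eapply cder_eq.
  - apply (cder_comp f (fun z => t * z)%C); [|cdr]. replace (t * 0)%C with (RtoC 0) by ring. apply cdiff_C_derive; auto.
  - ring.
Qed.

Lemma holo_scale (f : C -> C) (t : C) : holo_on Edisc f -> Cmod t < 1 -> holo_on Edisc (fun z => f (t * z)%C).
Proof.
  intros Hf Ht. apply (holo_comp Edisc Edisc f (fun z => t * z)%C); auto; [intros z _; cdf|].
  intros z Hz. unfold Edisc in *. rewrite Cmod_mult. pose proof (Cmod_ge_0 t). pose proof (Cmod_ge_0 z). nra.
Qed.

Lemma Edisc_mult t z : Cmod t <= 1 -> Edisc z -> Edisc (t * z)%C.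
Proof. unfold Edisc. intros. rewrite Cmod_mult. pose proof (Cmod_ge_0 t). pose proof (Cmod_ge_0 z). nra. Qed.

Lemma bounded_scale (f : C -> C) t : holo_on Edisc f -> 0 < t < 1 ->
  exists L, 0 < L /\ forall z, Edisc z -> Cmod (f (t * z)%C - f 0%C) <= L.
Proof.
  intros Hf Ht. destruct (bounded_disc (fun z => f z - f 0)%C t) as (L & HL & K); auto.
  - intros z Hz. cdf. apply Hf; auto.
  - exists L; split; auto. intros z Hz. apply K. rewrite Cmod_mult, Cmod_R, Rabs_pos_eq by lra. unfold Edisc in Hz. nra.
Qed.

(* If [f1'(0) = 0], adding a multiple of [f2] to the coordinate of the first disc corrects its
   derivative without affecting its values on pairs of points identified by [f2]. *)
Lemma schlicht_inj_approx D1 D2 : open_C D1 -> schlicht D1 -> inj_approx D1 D2.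
Proof.
  intros Ho HS f1 f2 a r Hf1 Hf2 H1 H2 Har.
  (* For the zero vector any injective disc through the point works, with [b = 0]. *)
  destruct (classic (a * C_derive f1 0 = 0 /\ a * C_derive f2 0 = 0)%C) as [[Z1 Z2]|HZ].
  { destruct (inj_approx_trivial D1 D2 (f1 0%C) (f2 0%C) Ho (H1 _ E0) (H2 _ E0)) as (g1 & g2 & k1 & k2 & k3 & k4 & k5 & k6 & k7).
    exists g1, g2, 0%C. do 7 (split; [auto|]). rewrite Z1, Z2, Cmod_0. pose proof (Cmod_ge_0 a).
    repeat split; try ring. lra. }
  assert (Ha : a <> 0%C) by (intros ->; apply HZ; split; ring).
  (* Dilation by [t < 1] makes [f2] bounded and replaces [a] by [a / t], of modulus [r]. *)
  apply Cmod_pos_neq in Ha as Hap. set (t := Cmod a / r).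
  assert (Ht : 0 < t < 1).
  { unfold t. split; [apply Rdiv_lt_0_compat; lra|]. apply (Rmult_lt_reg_r r); [lra|]. unfold Rdiv. rewrite Rmult_assoc, Rinv_l; lra. }
  assert (Htn : RtoC t <> 0%C) by (intros E; apply RtoC_inj in E; lra).
  assert (Htm : Cmod t = t) by (rewrite Cmod_R, Rabs_pos_eq; lra).
  assert (Hb : Cmod (a / t) <= r).
  { rewrite Cmod_div, Htm by auto. unfold t. right. field. lra. }
  destruct (HS f1 Hf1 H1) as (F & F1 & F2 & F3 & F4 & F5 & F6). apply Cmod_pos_neq in F5 as F5'.
  assert (g2h : holo_on Edisc (fun z => f2 (t * z)%C)) by (apply holo_scale; auto; lra).
  assert (g2D : forall z, Edisc z -> D2 (f2 (t * z)%C)) by (intros z Hz; apply H2, Edisc_mult; auto; lra).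
  assert (g20 : f2 (t * 0)%C = f2 0%C) by (f_equal; ring).
  assert (g2d : cder (fun z => f2 (t * z)%C) 0%C (t * C_derive f2 0)%C) by (apply cder_scale, Hf2, E0).
  assert (E2 : (a / t * C_derive (fun z => f2 (t * z)%C) 0 = a * C_derive f2 0)%C).
  { rewrite (cder_C_derive _ _ _ g2d). field; auto. }
  destruct (Ceq_dec (C_derive f1 0%C) 0) as [Z1|N1].
  - assert (N2 : C_derive f2 0%C <> 0%C).
    { intros Z2. apply HZ. rewrite Z1, Z2. split; ring. }
    destruct (bounded_scale f2 t Hf2 Ht) as (L & HL & KL).
    set (v := fun z => (z - (f2 (t * z) - f2 0) / (t * C_derive f2 0))%C).
    assert (Nd : (t * C_derive f2 0)%C <> 0%C) by (apply Cmult_neq_0; auto).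
    apply Cmod_pos_neq in Nd as Ndp.
    set (M := 1 + L / Cmod (t * C_derive f2 0)). 
    assert (HM : 1 < M) by (unfold M; assert (0 < L / Cmod (t * C_derive f2 0)) by (apply Rdiv_lt_0_compat; auto); lra).
    assert (HvM : forall z, Edisc z -> Cmod (v z) <= M).
    { intros z Hz. unfold v, Cminus at 1. eapply Rle_trans; [apply Cmod_triangle|]. rewrite Cmod_opp, Cmod_div by auto.
      unfold M. apply Rplus_le_compat; [apply Rlt_le, Hz|]. apply Rmult_le_compat_r; [left; apply Rinv_0_lt_compat; auto|]. auto. }
    set (dl := / (2 * M)).
    assert (Hdl : 0 < dl) by (apply Rinv_0_lt_compat; lra).
    assert (Hdln : RtoC dl <> 0%C) by (intros E; apply RtoC_inj in E; lra).
    assert (HvE : forall z, Edisc z -> Edisc (dl * v z)%C).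
    { intros z Hz. unfold Edisc. rewrite Cmod_mult, Cmod_R, Rabs_pos_eq by lra. specialize (HvM z Hz).
      assert (dl * Cmod (v z) <= dl * M) by (apply Rmult_le_compat_l; lra).
      assert (dl * M = 1 / 2) by (unfold dl; field; lra). lra. }
    assert (Hvh : holo_on Edisc v) by (intros z Hz; unfold v; cdf; auto; apply g2h; auto).
    assert (v0 : v 0%C = 0%C) by (unfold v; rewrite g20; field; auto).
    assert (vd : cder v 0%C 0%C).
    { unfold v. eapply cder_eq; [cdr; [auto|apply g2d]|]. field. auto. }
    exists (fun z => F (dl * v z)%C), (fun z => f2 (t * z)%C), (a / t)%C.
    split. { apply (holo_comp Edisc Edisc F (fun z => dl * v z)%C); auto. intros z Hz. cdf. apply Hvh; auto. }
    split; [auto|]. split; [auto|]. split; [auto|]. split.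
    { intros z w Hz Hw e1 e2. apply F3 in e1; auto.
      assert (ev : v z = v w).
      { replace (v z) with (dl * v z / dl)%C by (field; auto). rewrite e1. field; auto. }
      unfold v in ev. rewrite e2 in ev.
      replace z with (z - (f2 (t * w) - f2 0) / (t * C_derive f2 0) + (f2 (t * w) - f2 0) / (t * C_derive f2 0))%C by ring.
      rewrite ev. ring. }
    split. { rewrite v0. replace (dl * 0)%C with (RtoC 0) by ring. auto. }
    split; [auto|]. split; [|split; auto].
    rewrite Z1. assert (Ed : C_derive (fun z => F (dl * v z)%C) 0%C = 0%C).
    { apply cder_C_derive. eapply cder_eq.
      - apply (cder_comp F (fun z => dl * v z)%C).
        + apply cdiff_C_derive, F1. rewrite v0. replace (dl * 0)%C with (RtoC 0) by ring. apply E0.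
        + apply (cder_mult (fun _ => RtoC dl) v); [apply cder_const|apply vd].
      - ring. }
    rewrite Ed. ring.
  - apply Cmod_pos_neq in N1 as N1p. set (c := (t * C_derive f1 0 / C_derive F 0)%C).
    assert (Hc : c <> 0%C).
    { unfold c, Cdiv. apply Cmult_neq_0; [apply Cmult_neq_0; auto|]. intros E. apply C1_nz. rewrite <- (Cinv_r (C_derive F 0%C)), E by auto. ring. }
    assert (Hc1 : Cmod c < 1).
    { unfold c. rewrite Cmod_div, Cmod_mult, Htm by auto. apply (Rmult_lt_reg_r (Cmod (C_derive F 0%C))); auto.
      unfold Rdiv. rewrite Rmult_assoc, Rinv_l by lra. nra. }
    exists (fun z => F (c * z)%C), (fun z => f2 (t * z)%C), (a / t)%C.
    split; [apply holo_scale; auto|]. split; [auto|]. split; [intros z Hz; apply F2, Edisc_mult; auto; lra|].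
    split; [auto|]. split.
    { intros z w Hz Hw e1 _. apply F3 in e1; [|apply Edisc_mult; auto; lra|apply Edisc_mult; auto; lra].
      replace z with (c * z / c)%C by (field; auto). rewrite e1. field; auto. }
    split. { replace (c * 0)%C with (RtoC 0) by ring. auto. }
    split; [auto|]. split; [|split; auto].
    rewrite (cder_C_derive _ _ _ (cder_scale F c (F1 _ E0))). unfold c. field. auto.
Qed.

Lemma cexp_eq_1_small (x : C) : Cmod x < 1 -> cexp x = 1%C -> x = 0%C.
Proof.
  intros Hx E. destruct x as [a b]. pose proof (im_le_Cmod (a, b)) as Hb. unfold Im in Hb; simpl in Hb.
  assert (Ha : exp a = 1).
  { pose proof (Cmod_cexp (a, b)) as M. rewrite E, Cmod_1 in M. simpl in M. auto. }
  assert (Ha0 : a = 0) by (apply exp_inv; rewrite exp_0; auto).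
  unfold cexp in E; simpl in E. rewrite Ha, !Rmult_1_l in E. injection E as E1 E2.
  assert (Hb0 : b = 0).
  { pose proof PI2_1. destruct (Rtotal_order b 0) as [h|[h|h]]; auto; exfalso.
    - rewrite Rabs_left in Hb by lra. pose proof (sin_lt_0_var b ltac:(lra) h). lra.
    - rewrite Rabs_right in Hb by lra. pose proof (sin_gt_0 b h ltac:(lra)). lra. }
  subst. reflexivity.
Qed.

(** The first disc is written [psi (w1 exp v)]; any [v] with [v 0 = 0] and the right derivative is
    admissible, since [w1 exp v] never vanishes. If [f2' 0 = 0], then [v] is linear, and the second
    disc is replaced by a small one with zero derivative that separates the points identified by the
    exponential. *)
Lemma Cstar_inj_approx D1 D2 : open_C D1 -> open_C D2 -> biholomorphic D1 Cstar -> inj_approx D1 D2.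
Proof.
  intros Ho1 Ho2 (phi & psi & Hphi & Hpsi & P1 & P2 & P3 & P4) f1 f2 a r Hf1 Hf2 H1 H2 Har.
  destruct (classic (a * C_derive f1 0 = 0 /\ a * C_derive f2 0 = 0)%C) as [[Z1 Z2]|HZ].
  { destruct (inj_approx_trivial D1 D2 (f1 0%C) (f2 0%C) Ho1 (H1 _ E0) (H2 _ E0)) as (g1 & g2 & k1 & k2 & k3 & k4 & k5 & k6 & k7).
    exists g1, g2, 0%C. do 7 (split; [auto|]). rewrite Z1, Z2, Cmod_0. pose proof (Cmod_ge_0 a).
    repeat split; try ring. lra. }
  assert (Ha : a <> 0%C) by (intros ->; apply HZ; split; ring).
  apply Cmod_pos_neq in Ha as Hap. set (t := Cmod a / r).
  assert (Ht : 0 < t < 1).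
  { unfold t. split; [apply Rdiv_lt_0_compat; lra|]. apply (Rmult_lt_reg_r r); [lra|]. unfold Rdiv. rewrite Rmult_assoc, Rinv_l; lra. }
  assert (Htn : RtoC t <> 0%C) by (intros E; apply RtoC_inj in E; lra).
  assert (Htm : Cmod t = t) by (rewrite Cmod_R, Rabs_pos_eq; lra).
  assert (Hb : Cmod (a / t) <= r).
  { rewrite Cmod_div, Htm by auto. unfold t. right. field. lra. }
  set (w1 := phi (f1 0%C)). assert (Hw1 : w1 <> 0%C) by (apply P1, H1, E0).
  set (d1 := (C_derive phi (f1 0) * C_derive f1 0)%C).
  assert (Ed1 : (C_derive f1 0 = C_derive psi w1 * d1)%C).
  { apply cder_C_derive. apply cder_ext with (fun z => psi (phi (f1 z))).
    - exists 1; split; [lra|]. intros z Hz. rewrite Csub_0_r in Hz. apply P3, H1, Hz.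
    - apply (cder_comp psi (fun z => phi (f1 z))); [apply cdiff_C_derive, Hpsi, Hw1|].
      apply (cder_comp phi f1); apply cdiff_C_derive; [apply Hphi, H1, E0|apply Hf1, E0]. }
  assert (Hpsi_inj : forall x y : C, x <> 0%C -> y <> 0%C -> psi x = psi y -> x = y).
  { intros x y Hx Hy E. rewrite <- (P4 x Hx), E. apply P4; auto. }
  assert (Hg1 : forall v, holo_on Edisc v -> v 0%C = 0%C -> C_derive v 0%C = (t * d1 / w1)%C ->
     holo_on Edisc (fun z => psi (w1 * cexp (v z))%C) /\ (forall z, Edisc z -> D1 (psi (w1 * cexp (v z))%C)) /\
     psi (w1 * cexp (v 0))%C = f1 0%C /\ (a / t * C_derive (fun z => psi (w1 * cexp (v z))%C) 0 = a * C_derive f1 0)%C).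
  { intros v Hv v0 vd.
    assert (Hnz : forall z, (w1 * cexp (v z))%C <> 0%C) by (intros z; apply Cmult_neq_0; auto; apply cexp_nz).
    assert (Hin : forall z, Edisc z -> cdiff (fun z => w1 * cexp (v z))%C z).
    { intros z Hz. apply (cdiff_mult (fun _ => w1) (fun z => cexp (v z))); [cdf|]. apply cdiff_cexp. apply Hv; auto. }
    split; [|split; [|split]].
    - intros z Hz. apply (cdiff_comp psi (fun z => w1 * cexp (v z))%C); auto. apply Hpsi, Hnz.
    - intros z Hz. apply P2, Hnz.
    - rewrite v0, cexp_0. replace (w1 * 1)%C with w1 by ring. apply P3, H1, E0.
    - assert (Ed : C_derive (fun z => psi (w1 * cexp (v z))%C) 0%C = (t * C_derive f1 0)%C).
      { apply cder_C_derive. eapply cder_eq.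
        - apply (cder_comp psi (fun z => w1 * cexp (v z))%C); [apply cdiff_C_derive, Hpsi, Hnz|].
          apply (cder_mult (fun _ => w1) (fun z => cexp (v z))); [apply cder_const|].
          apply (cder_comp cexp v); [apply cder_cexp|apply cdiff_C_derive, Hv, E0].
        - rewrite v0, cexp_0, vd, Ed1. replace (w1 * 1)%C with w1 by ring. field; auto. }
      rewrite Ed. field; auto. }
  destruct (Ceq_dec (C_derive f2 0%C) 0) as [Z2|N2].
  - assert (N1 : C_derive f1 0%C <> 0%C) by (intros Z1; apply HZ; rewrite Z1, Z2; split; ring).
    assert (Nd1 : d1 <> 0%C) by (intros E; apply N1; rewrite Ed1, E; ring).
    set (c := (t * d1 / w1)%C).
    assert (Hc : c <> 0%C).
    { intros E. apply Nd1. replace d1 with (c * w1 / t)%C by (unfold c; field; auto). rewrite E. field; auto. }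
    destruct (Hg1 (fun z => c * z)%C) as (g1 & g2 & g3 & g4).
    { intros z _; cdf. }
    { ring. }
    { apply cder_C_derive. eapply cder_eq; [cdr|]. fold c. ring. }
    destruct (Ho2 _ (H2 _ E0)) as (e & He & Ke).
    apply Cmod_pos_neq in Hc as Hcp. set (u := fun z => (z - (cexp (c * z) - 1) / c)%C).
    set (M := 1 + (exp (Cmod c) + 1) / Cmod c).
    assert (HM : 1 < M).
    { unfold M. assert (0 < (exp (Cmod c) + 1) / Cmod c); [|lra]. apply Rdiv_lt_0_compat; auto. pose proof (exp_pos (Cmod c)). lra. }
    assert (Hu : forall z, Edisc z -> Cmod (u z) <= M).
    { intros z Hz. unfold u, Cminus at 1. eapply Rle_trans; [apply Cmod_triangle|]. rewrite Cmod_opp, Cmod_div by auto.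
      unfold M. apply Rplus_le_compat; [apply Rlt_le, Hz|]. apply Rmult_le_compat_r; [left; apply Rinv_0_lt_compat; auto|].
      unfold Cminus. eapply Rle_trans; [apply Cmod_triangle|]. rewrite Cmod_opp, Cmod_1. apply Rplus_le_compat_r.
      rewrite Cmod_cexp. assert (B : fst (c * z)%C <= Cmod c).
      { pose proof (re_le_Cmod (c * z)) as B. unfold Re in B. rewrite Cmod_mult in B. unfold Edisc in Hz.
        pose proof (Rle_abs (fst (c * z)%C)). pose proof (Cmod_ge_0 z). nra. }
      destruct (Rle_lt_or_eq_dec _ _ B) as [h|h]; [left; apply exp_increasing; auto|rewrite h; lra]. }
    set (dl := e / (2 * M)). assert (Hdl : 0 < dl) by (apply Rdiv_lt_0_compat; lra).
    assert (Hdln : RtoC dl <> 0%C) by (intros E; apply RtoC_inj in E; lra).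
    assert (Huh : forall z, cdiff u z).
    { intros z. unfold u. cdf; auto. apply (cdiff_cexp (fun z => c * z)%C); cdf. }
    exists (fun z => psi (w1 * cexp (c * z))%C), (fun z => f2 0 + dl * u z)%C, (a / t)%C.
    split; [auto|]. split; [intros z Hz; cdf; apply Huh|]. split; [auto|]. split.
    { intros z Hz. apply Ke. replace (f2 0 + dl * u z - f2 0)%C with (dl * u z)%C by ring.
      rewrite Cmod_mult, Cmod_R, Rabs_pos_eq by lra. specialize (Hu z Hz).
      assert (dl * Cmod (u z) <= dl * M) by (apply Rmult_le_compat_l; lra).
      assert (dl * M = e / 2) by (unfold dl; field; lra). lra. }
    split.
    { intros z w Hz Hw e1 e2. apply Hpsi_inj in e1; try (apply Cmult_neq_0; auto; apply cexp_nz).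
      assert (ex : cexp (c * z) = cexp (c * w)).
      { replace (cexp (c * z)) with (w1 * cexp (c * z) / w1)%C by (field; auto). rewrite e1. field; auto. }
      assert (eu : u z = u w).
      { replace (u z) with ((f2 0 + dl * u z - f2 0) / dl)%C by (field; auto). rewrite e2. field; auto. }
      unfold u in eu. rewrite ex in eu.
      replace z with (z - (cexp (c * w) - 1) / c + (cexp (c * w) - 1) / c)%C by ring. rewrite eu. ring. }
    split; [auto|]. split.
    { unfold u. replace (c * 0)%C with (RtoC 0) by ring. rewrite cexp_0. field; auto. }
    split; [auto|]. split; [|auto].
    assert (Ed : C_derive (fun z => f2 0 + dl * u z)%C 0%C = 0%C).
    { apply cder_C_derive. unfold u. eapply cder_eq.
      - cdr; auto. apply (cder_comp cexp (fun z => c * z)%C); [apply cder_cexp|cdr].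
      - replace (c * 0)%C with (RtoC 0) by ring. rewrite cexp_0. field; auto. }
    rewrite Ed, Z2. ring.
  - set (K := ((t * d1 / w1 - / 2) / (t * C_derive f2 0))%C).
    assert (Nd : (t * C_derive f2 0)%C <> 0%C) by (apply Cmult_neq_0; auto).
    (* On a pair identified by [f2 (t z)] the exponents differ by [(z - w) / 2], of modulus less
       than 1, where the exponential equals 1 only at 0. The constant [K] corrects the
       derivative. *)
    set (v := fun z => (/ 2 * z + K * (f2 (t * z) - f2 0))%C).
    assert (g2h : holo_on Edisc (fun z => f2 (t * z)%C)) by (apply holo_scale; auto; lra).
    assert (g2D : forall z, Edisc z -> D2 (f2 (t * z)%C)) by (intros z Hz; apply H2, Edisc_mult; auto; lra).
    assert (g20 : f2 (t * 0)%C = f2 0%C) by (f_equal; ring).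
    assert (g2d : cder (fun z => f2 (t * z)%C) 0%C (t * C_derive f2 0)%C) by (apply cder_scale, Hf2, E0).
    pose proof C2_nz as HC2.
    destruct (Hg1 v) as (g1 & g2 & g3 & g4).
    { intros z Hz. unfold v. apply (cdiff_plus (fun z => / 2 * z)%C (fun z => K * (f2 (t * z) - f2 0))%C).
      - apply (cdiff_mult (fun _ => / 2)%C (fun z => z)); [apply cdiff_const|apply cdiff_id].
      - cdf. apply g2h; auto. }
    { unfold v. rewrite g20. ring. }
    { apply cder_C_derive. unfold v. eapply cder_eq.
      - apply (cder_plus (fun z => / 2 * z)%C (fun z => K * (f2 (t * z) - f2 0))%C).
        + apply (cder_mult (fun _ => / 2)%C (fun z => z)); [apply cder_const|apply cder_id].
        + cdr. apply g2d.
      - unfold K. field. auto. }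
    exists (fun z => psi (w1 * cexp (v z))%C), (fun z => f2 (t * z)%C), (a / t)%C.
    split; [auto|]. split; [auto|]. split; [auto|]. split; [auto|]. split.
    { intros z w Hz Hw e1 e2. apply Hpsi_inj in e1; try (apply Cmult_neq_0; auto; apply cexp_nz).
      assert (ex : cexp (v z) = cexp (v w)).
      { replace (cexp (v z)) with (w1 * cexp (v z) / w1)%C by (field; auto). rewrite e1. field; auto. }
      assert (ev : (v z + - v w)%C = (/ 2 * (z - w))%C) by (unfold v; rewrite e2; ring).
      assert (e3 : cexp (/ 2 * (z - w)) = 1%C).
      { rewrite <- ev, cexp_plus, cexp_opp, ex. apply Cinv_r, cexp_nz. }
      apply cexp_eq_1_small in e3.
      - apply Csub_eq. replace (z - w)%C with (2 * (/ 2 * (z - w)))%C by (field; auto). rewrite e3. ring.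
      - rewrite Cmod_mult, Cmod_inv, Cmod_R, Rabs_pos_eq by (auto; lra). unfold Edisc in *.
        pose proof (Cmod_triangle z (- w)) as T. rewrite Cmod_opp in T. unfold Cminus. lra. }
    split; [auto|]. split; [auto|]. split; [auto|]. split; [|auto].
    rewrite (cder_C_derive _ _ _ g2d). field; auto.
Qed.

(** The plane with one puncture need not be shown to violate simple connectedness, because
    [Cstar_inj_approx] settles that case as well. *)
Lemma simply_connected_inj_approx D1 D2 : cdomain D1 -> cdomain D2 -> simply_connected D1 -> inj_approx D1 D2.
Proof.
  intros H1 H2 HS. destruct (domain_trichotomy D1) as [h|[(a & h1 & h2)|(a & b & h1 & h2 & h3)]].
  - apply schlicht_inj_approx; [apply H1|]. apply schlicht_plane; auto.
  - apply Cstar_inj_approx; [apply H1|apply H2|]. apply punctured_plane_biholomorphic with a; auto.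
  - apply schlicht_inj_approx; [apply H1|]. apply schlicht_hyperbolic with a b; auto.
Qed.

(** * Deck transformations *)

(** Cauchy's estimate on circles of radius [(R - R1) / 4] puts the derivative within 1/2 of 1; this
    is the origin of the 8. So [phi] shrinks distances at most by the factor 2 on an intermediate
    disc, and preimages exist by [min_modulus]. *)
Lemma near_id_inverse (phi : C -> C) R1 R eta : holo_on Edisc phi -> 0 < R1 < R -> R < 1 ->
  (forall z, Cmod z <= R -> Cmod (phi z - z) <= eta) -> 0 <= eta < (R - R1) / 8 ->
  exists psi, holo_on (cball 0 R1) psi /\ forall x, Cmod x < R1 ->
    Cmod (psi x) <= R /\ phi (psi x) = x /\ Cmod (psi x - x) <= eta.
Proof.
  intros Hp HR1 HR Hn He. set (R2 := (R1 + R) / 2). set (gap := (R - R1) / 2).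
  assert (Hgap : 0 < gap) by (unfold gap; lra).
  assert (Hder : forall v, Cmod v <= R2 -> Cmod (C_derive phi v - 1) <= / 2).
  { intros v Hv.
    assert (Hin : forall z, cball v gap z -> Cmod z <= R).
    { intros z Hz. unfold cball in Hz. pose proof (Cmod_le_sub z v). unfold gap, R2 in *. lra. }
    assert (HvE : Edisc v) by (unfold Edisc, R2 in *; lra).
    pose proof (cauchy_estimate (fun z => phi z - z)%C v gap (gap / 2) eta) as B.
    rewrite (cder_C_derive (fun z => phi z - z)%C v (C_derive phi v - 1)%C) in B.
    - eapply Rle_trans; [apply B|].
      + intros z Hz. specialize (Hin z Hz). cdf. apply Hp. unfold Edisc; lra.
      + lra.
      + intros z Hz. apply Hn, Hin. unfold cball. lra.
      + apply (Rmult_le_reg_r (gap / 2)); [lra|]. unfold Rdiv at 1. rewrite Rmult_assoc, Rinv_l by lra. unfold gap; lra.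
    - cdr. apply (cdiff_C_derive phi). apply Hp; auto. }
  assert (Hexp : forall z w, Cmod z <= R2 -> Cmod w <= R2 -> Cmod (z - w) <= 2 * Cmod (phi z - phi w)).
  { intros z w Hz Hw.
    assert (B : Cmod ((phi z - z) - (phi w - w)) <= / 2 * Cmod (z - w)).
    { assert (Hs : forall t, 0 <= t <= 1 -> Cmod (w + (z - w) * t) <= R2).
      { intros t Ht. rewrite <- (Csub_0_r (w + (z - w) * t)). apply seg_in_cball_le; rewrite ?Csub_0_r; auto. }
      assert (HsE : forall t, 0 <= t <= 1 -> Edisc (w + (z - w) * t)%C).
      { intros t Ht. specialize (Hs t Ht). unfold Edisc, R2 in *. lra. }
      apply (mvi (fun z => phi z - z)%C (fun z => C_derive phi z - 1)%C).
      - intros t Ht. cdr. apply (cdiff_C_derive phi). auto.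
      - intros t Ht. apply cdiff_cont. cdf. apply (holo_C_derive Edisc phi open_Edisc Hp); auto.
      - intros t Ht. auto. }
    replace (phi z - z - (phi w - w))%C with ((phi z - phi w) - (z - w))%C in B by ring.
    pose proof (Cmod_le_sub (z - w) (phi z - phi w)) as B2. rewrite (Cmod_sub_sym (z - w)) in B2. lra. }
  assert (Hex : forall x, exists z, Cmod x < R1 -> Cmod z < R2 /\ phi z = x).
  { intros x. destruct (classic (Cmod x < R1)) as [Hx|Hx]; [|exists 0%C; tauto].
    pose proof (Cmod_ge_0 x).
    destruct (min_modulus (fun z => phi z - x)%C 0 R2 ((R1 + R2) / 2) ((R - R1) / 4 - eta) x) as (z & Hz & Ez).
    - intros z Hz. unfold cball in Hz. rewrite Csub_0_r in Hz. cdf. apply Hp. unfold Edisc, R2 in *. lra.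
    - unfold R2; lra.
    - intros z Hz. rewrite Csub_0_r in Hz. specialize (Hn z ltac:(unfold R2 in *; lra)).
      pose proof (Cmod_le_sub z (phi z)) as b1. rewrite Cmod_sub_sym in b1.
      pose proof (Cmod_le_sub (phi z) x) as b2. unfold R2 in *. lra.
    - rewrite Csub_0_r. unfold R2; lra.
    - specialize (Hn x ltac:(lra)). lra.
    - exists z. intros _. split; [|apply Csub_eq; auto]. unfold cball in Hz. rewrite Csub_0_r in Hz. auto. }
  set (psi := fun x => proj1_sig (constructive_indefinite_description _ (Hex x))).
  assert (Hps : forall x, Cmod x < R1 -> Cmod (psi x) < R2 /\ phi (psi x) = x).
  { intros x. unfold psi. destruct constructive_indefinite_description; auto. }
  clearbody psi. exists psi. split.
  - intros x Hx. unfold cball in Hx. rewrite Csub_0_r in Hx. destruct (Hps x Hx) as [h1 h2].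
    set (d := C_derive phi (psi x)).
    assert (Hd : / 2 <= Cmod d).
    { specialize (Hder (psi x) ltac:(lra)). fold d in Hder. pose proof (Cmod_le_sub 1 d) as b. rewrite Cmod_1 in b.
      rewrite (Cmod_sub_sym 1 d) in b. lra. }
    assert (Hdn : d <> 0%C) by (apply Cmod_pos_neq; lra).
    assert (Hdphi : cder phi (psi x) d) by (apply cdiff_C_derive, Hp; unfold Edisc, R2 in *; lra).
    apply (cder_cdiff psi x (/ d)%C). intros e He0.
    destruct (Hdphi (e / 4)) as (dl & Hdl & K); [lra|].
    exists (Rmin (dl / 2) (R1 - Cmod x)). split; [apply Rmin_pos; lra|]. intros y Hy.
    pose proof (Rmin_l (dl / 2) (R1 - Cmod x)). pose proof (Rmin_r (dl / 2) (R1 - Cmod x)).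
    pose proof (Cmod_le_sub y x) as by1. destruct (Hps y ltac:(lra)) as [k1 k2].
    pose proof (Hexp (psi y) (psi x) ltac:(lra) ltac:(lra)) as B. rewrite h2, k2 in B.
    specialize (K (psi y) ltac:(lra)). rewrite h2, k2 in K.
    replace (psi y - psi x - / d * (y - x))%C with (- ((y - x - d * (psi y - psi x)) / d))%C by (field; auto).
    rewrite Cmod_opp, Cmod_div by auto.
    apply (Rmult_le_reg_r (Cmod d)); [lra|]. unfold Rdiv. rewrite Rmult_assoc, Rinv_l, Rmult_1_r by lra.
    pose proof (Cmod_ge_0 (y - x)). pose proof (Cmod_ge_0 (psi y - psi x)).
    assert (e / 4 * Cmod (psi y - psi x) <= e / 4 * (2 * Cmod (y - x))) by (apply Rmult_le_compat_l; lra).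
    assert (e * Cmod (y - x) * / 2 <= e * Cmod (y - x) * Cmod d) by (apply Rmult_le_compat_l; nra).
    lra.
  - intros x Hx. destruct (Hps x Hx) as [h1 h2]. split; [unfold R2 in *; lra|]. split; auto.
    specialize (Hn (psi x) ltac:(unfold R2 in *; lra)). rewrite h2 in Hn. rewrite Cmod_sub_sym. auto.
Qed.

(* If the lifts [phi1], [phi2] are close to the identity, the system
   [phi1 w = gam1 (phi1 z)], [phi2 w = gam2 (phi2 z)] is a small perturbation of [w = gam1 z = gam2 z],
   whose solution [z = 0] is transversal. *)
Lemma transversal_persist (gam1 gam2 : C -> C) (p : C) :
  holo_on Edisc gam1 -> holo_on Edisc gam2 -> (forall z, Edisc z -> Edisc (gam1 z)) -> (forall z, Edisc z -> Edisc (gam2 z)) ->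
  gam1 0%C = p -> gam2 0%C = p -> p <> 0%C -> C_derive gam1 0%C <> C_derive gam2 0%C ->
  exists R eta, 0 < R < 1 /\ 0 < eta /\ forall phi1 phi2,
    holo_on Edisc phi1 -> holo_on Edisc phi2 -> (forall z, Edisc z -> Edisc (phi1 z)) -> (forall z, Edisc z -> Edisc (phi2 z)) ->
    (forall z, Cmod z <= R -> Cmod (phi1 z - z) <= eta) -> (forall z, Cmod z <= R -> Cmod (phi2 z - z) <= eta) ->
    exists z w, Edisc z /\ Edisc w /\ z <> w /\ phi1 w = gam1 (phi1 z) /\ phi2 w = gam2 (phi2 z).
Proof.
  intros G1 G2 GE1 GE2 Gp1 Gp2 Hp Hd.
  assert (HpE : Edisc p) by (rewrite <- Gp1; apply GE1, E0).
  apply Cmod_pos_neq in Hp. set (q := Cmod p) in *. assert (Hq : q < 1) by exact HpE.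
  set (R1 := (1 + q) / 2). set (R := (3 + q) / 4).
  assert (HRR : q < R1 /\ R1 < R /\ R < 1 /\ 1 / 2 < R1) by (unfold R1, R; lra).
  set (d := (C_derive gam1 0 - C_derive gam2 0)%C).
  assert (Hdn : 0 < Cmod d) by (apply Cmod_pos_neq, Csub_neq; auto).
  destruct (cdiff_cont gam1 0%C (G1 _ E0) (Rmin (R1 - q) (q / 4))) as (d1 & Hd1 & K1); [apply Rmin_pos; lra|].
  assert (DD : cder (fun z => gam1 z - gam2 z)%C 0%C d) by (apply cder_minus; apply cdiff_C_derive; [apply G1|apply G2]; apply E0).
  destruct (DD (Cmod d / 2)) as (d2 & Hd2 & K2); [lra|].
  set (rho0 := Rmin (Rmin d1 d2) (q / 4)).
  assert (Hrho0 : 0 < rho0) by (unfold rho0; repeat apply Rmin_pos; lra).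
  assert (Hr0 : rho0 <= d1 /\ rho0 <= d2 /\ rho0 <= q / 4).
  { unfold rho0. pose proof (Rmin_l (Rmin d1 d2) (q / 4)). pose proof (Rmin_r (Rmin d1 d2) (q / 4)).
    pose proof (Rmin_l d1 d2). pose proof (Rmin_r d1 d2). lra. }
  set (rho := rho0 / 2).
  (* The last bound gives [20 eta < |d| rho / 2]: the error [10 eta] of replacing [gam1 - gam2] by
     [T] occurs both at the centre and on the circle. *)
  set (eta := Rmin (Rmin ((R - R1) / 16) (q / 16)) (Cmod d * rho / 50)).
  assert (Heta : 0 < eta).
  { unfold eta. repeat apply Rmin_pos; try lra. apply Rdiv_lt_0_compat; [|lra]. apply Rmult_lt_0_compat; auto. unfold rho; lra. }
  assert (He : eta <= (R - R1) / 16 /\ eta <= q / 16 /\ eta <= Cmod d * rho / 50).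
  { unfold eta. pose proof (Rmin_l (Rmin ((R - R1) / 16) (q / 16)) (Cmod d * rho / 50)).
    pose proof (Rmin_r (Rmin ((R - R1) / 16) (q / 16)) (Cmod d * rho / 50)).
    pose proof (Rmin_l ((R - R1) / 16) (q / 16)). pose proof (Rmin_r ((R - R1) / 16) (q / 16)). lra. }
  clearbody eta.
  exists R, eta. split; [lra|]. split; auto.
  intros phi1 phi2 P1 P2 PE1 PE2 N1 N2.
  destruct (near_id_inverse phi1 R1 R eta P1 ltac:(lra) ltac:(lra) N1 ltac:(lra)) as (psi & Hpsi & Kpsi).
  assert (Hg1 : forall x, Cmod x < rho0 -> Cmod (gam1 x - p) < q / 4 /\ Cmod (gam1 x) < R1).
  { intros x Hx. specialize (K1 x). rewrite Csub_0_r, Gp1 in K1. specialize (K1 ltac:(lra)).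
    pose proof (Rmin_l (R1 - q) (q / 4)). pose proof (Rmin_r (R1 - q) (q / 4)).
    pose proof (Cmod_le_sub (gam1 x) p). fold q in H1. split; lra. }
  assert (Hx1 : forall x, Cmod x < rho0 -> Cmod x < R1) by (intros; lra).
  assert (HxE : forall x, Cmod x < rho0 -> Edisc x) by (intros; unfold Edisc; lra).
  assert (HpsE : forall x, Cmod x < R1 -> Edisc (psi x)).
  { intros x Hx. destruct (Kpsi x Hx) as (h & _). unfold Edisc; lra. }
  (* With [z = psi x] and [w = psi (gam1 x)] the first equation holds identically; a zero of [T]
     solves the second. *)
  set (T := fun x => (phi2 (psi (gam1 x)) - gam2 (phi2 (psi x)))%C).
  assert (HT : holo_on (cball 0 rho0) T).
  { intros x Hx. unfold cball in Hx. rewrite Csub_0_r in Hx. destruct (Hg1 x Hx) as [h1 h2].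
    unfold T. apply (cdiff_minus (fun x => phi2 (psi (gam1 x))) (fun x => gam2 (phi2 (psi x)))).
    - apply (cdiff_comp phi2 (fun x => psi (gam1 x))); [apply P2, HpsE; auto|].
      apply (cdiff_comp psi gam1); [apply Hpsi; unfold cball; rewrite Csub_0_r; auto|apply G1; auto].
    - apply (cdiff_comp gam2 (fun x => phi2 (psi x))); [apply G2, PE2, HpsE; auto|].
      apply (cdiff_comp phi2 psi); [apply P2, HpsE; auto|]. apply Hpsi; unfold cball; rewrite Csub_0_r; auto. }
  (* The error is [2 eta] for [phi2 o psi] at [gam1 x], plus [4 * 2 eta] from the Lipschitz constant
     4 of [gam2] on the disc of radius 1/2. *)
  assert (Happ : forall x, Cmod x < rho0 -> Cmod (T x - (gam1 x - gam2 x)) <= 10 * eta).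
  { intros x Hx. destruct (Hg1 x Hx) as [h1 h2].
    destruct (Kpsi (gam1 x) h2) as (a1 & a2 & a3). destruct (Kpsi x (Hx1 x Hx)) as (b1 & b2 & b3).
    pose proof (N2 (psi (gam1 x)) a1) as c1. pose proof (N2 (psi x) b1) as c2.
    pose proof (Cmod_sub_tri (phi2 (psi (gam1 x))) (psi (gam1 x)) (gam1 x)) as e1.
    pose proof (Cmod_sub_tri (phi2 (psi x)) (psi x) x) as e2.
    assert (Hhalf : Cmod (phi2 (psi x)) <= / 2) by (pose proof (Cmod_le_sub (phi2 (psi x)) x); lra).
    pose proof (lip_bounded_E gam2 1 (/ 2) (phi2 (psi x)) x G2 (fun z Hz => Rlt_le _ _ (GE2 z Hz)) ltac:(lra) Hhalf ltac:(lra)) as L.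
    replace (2 * 1 / (1 - / 2)) with 4 in L by field.
    unfold T.
    replace (phi2 (psi (gam1 x)) - gam2 (phi2 (psi x)) - (gam1 x - gam2 x))%C with
      ((phi2 (psi (gam1 x)) - gam1 x) + - (gam2 (phi2 (psi x)) - gam2 x))%C by ring.
    eapply Rle_trans; [apply Cmod_triangle|]. rewrite Cmod_opp. lra. }
  destruct (min_modulus T 0 rho0 rho (Cmod d * rho / 2 - 10 * eta) 0%C) as (x & Hx & Ex); auto.
  - unfold rho; lra.
  - intros x Hx. rewrite Csub_0_r in Hx. specialize (Happ x ltac:(unfold rho in *; lra)).
    specialize (K2 x). rewrite Csub_0_r, Gp1, Gp2 in K2. specialize (K2 ltac:(unfold rho in *; lra)).
    replace (gam1 x - gam2 x - (p - p) - d * x)%C with ((gam1 x - gam2 x) - d * x)%C in K2 by ring.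
    pose proof (Cmod_le_sub (d * x) (gam1 x - gam2 x)) as b1. rewrite (Cmod_sub_sym (d * x)), Cmod_mult in b1.
    pose proof (Cmod_le_sub (gam1 x - gam2 x) (T x)) as b2. rewrite (Cmod_sub_sym (gam1 x - gam2 x)) in b2.
    rewrite Hx in *. lra.
  - rewrite Cmod_self_sub. unfold rho; lra.
  - specialize (Happ 0%C ltac:(rewrite Cmod_0; lra)). rewrite Gp1, Gp2 in Happ.
    replace (T 0 - (p - p))%C with (T 0%C) in Happ by ring. lra.
  - unfold cball in Hx. rewrite Csub_0_r in Hx. destruct (Hg1 x Hx) as [h1 h2].
    destruct (Kpsi (gam1 x) h2) as (a1 & a2 & a3). destruct (Kpsi x (Hx1 x Hx)) as (b1 & b2 & b3).
    exists (psi x), (psi (gam1 x)). repeat split; auto.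
    (* [x] is near 0 and [gam1 x] near [p], while [psi] moves both by at most [eta], too little to
       bring them together. *)
    + intros E. rewrite E in b3.
      pose proof (Cmod_sub_tri x (psi (gam1 x)) (gam1 x)) as t1. rewrite (Cmod_sub_sym x (psi (gam1 x))) in t1.
      pose proof (Cmod_sub_tri x (gam1 x) p) as t2. pose proof (Cmod_le_sub p x) as t3. rewrite (Cmod_sub_sym p x) in t3. fold q in t3. lra.
    + rewrite b2. auto.
    + apply Csub_eq. exact Ex.
Qed.

(** A competitor has a single [a] for both components, so both lifts have the derivative [1 / a] at
    0. Therefore one rotation [om] brings both near the identity, which is the situation of
    [transversal_persist]. *)
Lemma hahn_neq_kob_of_deck D1 D2 f1 f2 gam1 gam2 p : open_C D1 -> open_C D2 -> cov Edisc f1 D1 -> cov Edisc f2 D2 ->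
  holo_on Edisc gam1 -> holo_on Edisc gam2 -> (forall z, Edisc z -> Edisc (gam1 z)) -> (forall z, Edisc z -> Edisc (gam2 z)) ->
  (forall z, Edisc z -> f1 (gam1 z) = f1 z) -> (forall z, Edisc z -> f2 (gam2 z) = f2 z) ->
  gam1 0%C = p -> gam2 0%C = p -> p <> 0%C -> C_derive gam1 0%C <> C_derive gam2 0%C ->
  ~ hahn_eq_kob (prodD D1 D2).
Proof.
  intros Ho1 Ho2 C1 C2 G1 G2 GE1 GE2 GF1 GF2 Gp1 Gp2 Hp Hd Heq.
  destruct (transversal_persist gam1 gam2 p G1 G2 GE1 GE2 Gp1 Gp2 Hp Hd) as (R & eta & HR & Heta & K).
  pose proof (cov_der_nz f1 D1 Ho1 C1 0%C E0) as Hn1. pose proof (cov_der_nz f2 D2 Ho2 C2 0%C E0) as Hn2.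
  pose proof C1 as (F1 & FD1 & L1). pose proof C2 as (F2 & FD2 & L2).
  set (z := (f1 0%C, f2 0%C)). set (X := (C_derive f1 0%C, C_derive f2 0%C)).
  assert (Hz : prodD D1 D2 z) by (split; [apply FD1, E0|apply FD2, E0]).
  specialize (Heq z X Hz).
  (* [near_id] turns [1 - c <= e] into a distance of at most [eta] on [|z| <= R]. *)
  set (e := eta * (1 - R) / 3). assert (He : 0 < e) by (unfold e; apply Rdiv_lt_0_compat; nra).
  assert (Hex : exists r, r < 1 + e /\ disc_vals true (prodD D1 D2) z X r).
  { apply NNPP; intros HN.
    destruct (Glb_Rbar_correct (disc_vals true (prodD D1 D2) z X)) as [_ G].
    assert (B : Rbar_le (1 + e) (hahn (prodD D1 D2) z X)).
    { apply G. intros r Hr. simpl. apply Rnot_lt_le; intros Hlt. apply HN; eauto. }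
    destruct (Glb_Rbar_correct (disc_vals false (prodD D1 D2) z X)) as [L _].
    assert (B2 : Rbar_le (kobayashi (prodD D1 D2) z X) 1).
    { apply L. exists f1, f2, 1%C. split; [auto|]. split; [auto|]. split; [intros w Hw; split; [apply FD1; auto|apply FD2; auto]|].
      split; [exact I|]. split; [auto|]. split; [auto|]. split; [apply Cmult_1_l|]. split; [apply Cmult_1_l|].
      symmetry. apply Cmod_1. }
    rewrite Heq in B. pose proof (Rbar_le_trans _ _ _ B B2) as B3. simpl in B3. lra. }
  destruct Hex as (r & Hr & g1 & g2 & a & g1h & g2h & gD & gI & g10 & g20 & ga1 & ga2 & Er). simpl in g10, g20, ga1, ga2.
  assert (Ha : a <> 0%C).
  { intros E. apply Hn1. rewrite <- ga1, E. ring. }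
  destruct (L1 g1 0%C g1h (fun w Hw => proj1 (gD w Hw)) E0 g10) as (phi1 & p1 & p1E & p10 & p1f).
  destruct (L2 g2 0%C g2h (fun w Hw => proj2 (gD w Hw)) E0 g20) as (phi2 & p2 & p2E & p20 & p2f).
  assert (Hder : forall f phi g, cdiff f 0%C -> holo_on Edisc phi -> phi 0%C = 0%C -> C_derive f 0%C <> 0%C ->
     (forall z, Edisc z -> f (phi z) = g z) -> (a * C_derive g 0 = C_derive f 0)%C -> C_derive phi 0%C = (/ a)%C).
  { intros f phi g Hf Hphi Hphi0 Hnf Hfg Hag.
    assert (E : (C_derive g 0 = C_derive f 0 * C_derive phi 0)%C).
    { apply cder_C_derive. apply cder_ext with (fun z => f (phi z)).
      - exists 1; split; [lra|]. intros w Hw. rewrite Csub_0_r in Hw. auto.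
      - apply (cder_comp f phi); [rewrite Hphi0|]; apply cdiff_C_derive; auto. apply Hphi, E0. }
    rewrite E in Hag. replace (C_derive phi 0%C) with ((a * (C_derive f 0 * C_derive phi 0)) / (a * C_derive f 0))%C by (field; auto).
    rewrite Hag. field; auto. }
  pose proof (Hder f1 phi1 g1 (F1 _ E0) p1 p10 Hn1 p1f ga1) as d1.
  pose proof (Hder f2 phi2 g2 (F2 _ E0) p2 p20 Hn2 p2f ga2) as d2.
  apply Cmod_pos_neq in Ha as Hap.
  set (om := (a / Cmod a)%C). assert (Hma : RtoC (Cmod a) <> 0%C) by (intros E; apply RtoC_inj in E; lra).
  assert (Hom : Cmod om = 1) by (unfold om; rewrite Cmod_div, Cmod_R, Rabs_pos_eq by (auto; lra); field; lra).
  set (c := / Cmod a).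
  assert (Hc0 : 0 < c) by (apply Rinv_0_lt_compat; auto).
  assert (Hc1 : c <= 1).
  { pose proof (schwarz_der phi1 p1 (fun z Hz => Rlt_le _ _ (p1E z Hz)) p10) as S.
    rewrite d1, Cmod_inv in S by auto. exact S. }
  assert (Hc2 : 1 - c <= e).
  { assert (Hx : / (1 + e) <= c) by (apply Rinv_le_contravar; lra).
    assert (1 - e <= / (1 + e)).
    { apply (Rmult_le_reg_r (1 + e)); [lra|]. rewrite Rinv_l by lra. nra. }
    lra. }
  assert (Homz : forall z, Edisc z -> Edisc (om * z)%C) by (intros; apply Edisc_mult; auto; lra).
  assert (Hrot : forall phi, holo_on Edisc phi -> (forall z, Edisc z -> Edisc (phi z)) -> phi 0%C = 0%C -> C_derive phi 0%C = (/ a)%C ->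
     holo_on Edisc (fun z => phi (om * z)%C) /\ (forall z, Edisc z -> Edisc (phi (om * z)%C)) /\
     forall z, Cmod z <= R -> Cmod (phi (om * z)%C - z) <= eta).
  { intros phi Hphi HphiE Hphi0 Hphid.
    assert (Hh : holo_on Edisc (fun z => phi (om * z)%C)).
    { apply (holo_comp Edisc Edisc phi (fun z => om * z)%C); auto. intros w _; cdf. }
    split; [auto|]. split; [auto|]. intros w Hw.
    pose proof (near_id (fun z => phi (om * z)%C) c R w Hh (fun z Hz => HphiE _ (Homz z Hz))) as B. cbv beta in B.
    eapply Rle_trans; [apply B; auto; try lra|].
    - replace (om * 0)%C with (RtoC 0) by ring. auto.
    - rewrite (cder_C_derive _ _ _ (cder_scale phi om (Hphi _ E0))), Hphid. unfold om, c. rewrite RtoC_inv by lra. field; auto.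
    - apply (Rmult_le_reg_r (1 - R)); [lra|]. unfold Rdiv. rewrite Rmult_assoc, Rinv_l by lra. unfold e in Hc2. lra. }
  destruct (Hrot phi1 p1 p1E p10 d1) as (q1 & q1E & q1n). destruct (Hrot phi2 p2 p2E p20 d2) as (q2 & q2E & q2n).
  destruct (K _ _ q1 q2 q1E q2E q1n q2n) as (x & y & Hx & Hy & Hxy & E1 & E2).
  apply Hxy. assert (Eo : (om * y)%C = (om * x)%C).
  { apply gI; auto.
    assert (A1 : g1 (om * y)%C = g1 (om * x)%C) by (rewrite <- !p1f by auto; rewrite E1; apply GF1; auto).
    assert (A2 : g2 (om * y)%C = g2 (om * x)%C) by (rewrite <- !p2f by auto; rewrite E2; apply GF2; auto).
    congruence. }
  assert (Homn : om <> 0%C) by (apply Cmod_pos_neq; lra).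
  replace x with (om * x / om)%C by (field; auto). rewrite <- Eo. field; auto.
Qed.

(** * Deck transformations as elements of SU(1,1) *)

Definition su11 (s t z : C) : C := ((s * z + t) / (Cconj t * z + Cconj s))%C.

Lemma su11_den (s t z : C) : Cmod s * Cmod s - Cmod t * Cmod t = 1 -> Edisc z ->
  (Cconj t * z + Cconj s)%C <> 0%C.
Proof.
  intros Hst Hz E. unfold Edisc in Hz.
  assert (H : Cmod (Cconj t * z) = Cmod (Cconj s)).
  { replace (Cconj t * z)%C with (- Cconj s)%C; [apply Cmod_opp|].
    symmetry. apply Csub_eq. rewrite <- E. ring. }
  rewrite Cmod_mult, !Cmod_conj in H. pose proof (Cmod_ge_0 t). pose proof (Cmod_ge_0 z).
  rewrite <- H in Hst. assert (0 <= Cmod t * Cmod t) by nra. assert (Cmod z * Cmod z <= 1) by nra. nra.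
Qed.

Lemma su11_s_nz (s t : C) : Cmod s * Cmod s - Cmod t * Cmod t = 1 -> s <> 0%C.
Proof. intros H E. subst. rewrite Cmod_0 in H. pose proof (Cmod_ge_0 t). nra. Qed.

Lemma su11_E (s t z : C) : Cmod s * Cmod s - Cmod t * Cmod t = 1 -> Edisc z -> Edisc (su11 s t z).
Proof.
  intros H Hz. pose proof (su11_den s t z H Hz) as Hn. unfold su11, Edisc. rewrite Cmod_div by auto.
  apply Cmod_pos_neq in Hn. apply (Rmult_lt_reg_r (Cmod (Cconj t * z + Cconj s))); auto.
  unfold Rdiv. rewrite Rmult_assoc, Rinv_l, Rmult_1_l, Rmult_1_r by lra.
  (* The matrix preserves the form [|y|^2 - |x|^2], here evaluated at the vector [(z, 1)]. *)
  assert (I : Cmod (Cconj t * z + Cconj s) * Cmod (Cconj t * z + Cconj s) - Cmod (s * z + t) * Cmod (s * z + t)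
     = (Cmod s * Cmod s - Cmod t * Cmod t) * (1 - Cmod z * Cmod z)).
  { rewrite !Cmod_sqr. destruct s, t, z; simpl. ring. }
  rewrite H in I. unfold Edisc in Hz. pose proof (Cmod_ge_0 z). pose proof (Cmod_ge_0 (s * z + t)). nra.
Qed.

Lemma su11_cder0 (s t : C) : Cmod s * Cmod s - Cmod t * Cmod t = 1 -> cder (su11 s t) 0%C (/ (Cconj s * Cconj s))%C.
Proof.
  intros H. pose proof (su11_s_nz s t H) as Hs.
  assert (Hcs : Cconj s <> 0%C) by (apply Cmod_pos_neq; rewrite Cmod_conj; apply Cmod_pos_neq; auto).
  unfold su11. eapply cder_eq; [cdr; apply (su11_den s t 0 H E0)|].
  assert (E : (s * Cconj s - t * Cconj t = 1)%C).
  { replace (s * Cconj s)%C with (Cconj s * s)%C by ring. replace (t * Cconj t)%C with (Cconj t * t)%C by ring.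
    rewrite !Cconj_mult_self, <- RtoC_minus. f_equal. auto. }
  replace (Cconj t * 0 + Cconj s)%C with (Cconj s) by ring. replace (s * 0 + t)%C with t by ring.
  replace ((0 * 0 + s * 1 + 0) * Cconj s - t * (0 * 0 + Cconj t * 1 + 0))%C with (s * Cconj s - t * Cconj t)%C by ring.
  rewrite E. field; auto.
Qed.

Lemma holo_su11 (s t : C) : Cmod s * Cmod s - Cmod t * Cmod t = 1 -> holo_on Edisc (su11 s t).
Proof. intros H z Hz. unfold su11. cdf. apply su11_den; auto. Qed.

(** [s] and [t] are matrix entries of determinant 1. Entries are kept instead of a map, because
    [Re s] is the conjugation invariant and [s] alone determines the derivative at 0. *)
Definition deck (D : C -> Prop) (f : C -> C) (s t : C) : Prop :=
  cov Edisc f D /\ Cmod s * Cmod s - Cmod t * Cmod t = 1 /\ forall z, Edisc z -> f (su11 s t z) = f z.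

Lemma cov_recenter f D a : cov Edisc f D -> Edisc a -> cov Edisc (fun z => f (mob a z)) D.
Proof. intros Hc Ha. apply (cov_comp Edisc (mob a) Edisc f); auto. apply cov_mob; auto. Qed.

(** [gam o mob x] and [mob x] lift the same disc and agree at 0. *)
Lemma deck_free f D gam : open_C D -> cov Edisc f D -> holo_on Edisc gam -> (forall z, Edisc z -> Edisc (gam z)) ->
  (forall z, Edisc z -> f (gam z) = f z) -> forall x, Edisc x -> gam x = x -> forall z, Edisc z -> gam z = z.
Proof.
  intros Ho Hc G GE GF x Hx Ex z Hz.
  assert (K : forall w, Edisc w -> gam (mob x w) = mob x w).
  { apply (lift_unique f (fun w => gam (mob x w)) (mob x)).
    - apply Hc.
    - apply cov_der_nz with D; auto.
    - apply (holo_comp Edisc Edisc gam (mob x)); auto; [apply holo_mob; auto|intros; apply mob_E; auto].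
    - apply holo_mob; auto.
    - intros w Hw. apply GE, mob_E; auto.
    - intros w Hw. apply GF, mob_E; auto.
    - rewrite mob_0. auto. }
  rewrite <- (mob_inv' x z Hx Hz). apply K, mob_E; auto. apply Edisc_opp; auto.
Qed.

(** The right side of [schwarz_near] vanishes. *)
Lemma rotation_of_unimodular_der (k : C -> C) : holo_on Edisc k -> (forall z, Edisc z -> Edisc (k z)) -> k 0%C = 0%C ->
  Cmod (C_derive k 0%C) = 1 -> forall z, Edisc z -> k z = (C_derive k 0 * z)%C.
Proof.
  intros Hk HE H0 H1 z Hz. pose proof (schwarz_near k z Hk (fun z Hz => Rlt_le _ _ (HE z Hz)) H0 Hz) as S.
  rewrite H1 in S. unfold Edisc in Hz. apply Csub_eq, Cmod_eq0.
  set (A := Cmod (k z - C_derive k 0 * z)) in *. nra.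
Qed.

(** Two points of a fibre are moved to 0 and [mu]. The lift [gam] of the covering [g] that starts at
    [mu] is an automorphism: lifting the covering recentred at [mu] back to 0 gives [k] with
    [gam o k = mob mu], and the Schwarz lemma for [mob (- mu) o gam] and for [k] makes the former a
    rotation. *)
Lemma deck_exists f D : open_C D -> cov Edisc f D -> ~ (forall z w, Edisc z -> Edisc w -> f z = f w -> z = w) ->
  exists g s t, deck D g s t /\ t <> 0%C /\ fst s <> 0.
Proof.
  intros Ho Hc Hni.
  assert (Hzw : exists z w, Edisc z /\ Edisc w /\ f z = f w /\ z <> w).
  { apply NNPP; intros HN. apply Hni. intros z w Hz Hw E. apply NNPP; intros Hne. apply HN. exists z, w; auto. }
  destruct Hzw as (z0 & w0 & Hz0 & Hw0 & E0' & Hne).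
  set (g := fun z => f (mob z0 z)). assert (Hg : cov Edisc g D) by (apply cov_recenter; auto).
  set (mu := mob (- z0) w0). assert (Hmu : Edisc mu) by (apply mob_E; auto; apply Edisc_opp; auto).
  assert (Hgmu : g mu = g 0%C).
  { unfold g, mu. rewrite mob_inv', mob_0 by auto. auto. }
  assert (Hmun : mu <> 0%C).
  { intros E. apply Hne. rewrite <- (mob_inv' z0 w0) by auto. fold mu. rewrite E, mob_0. auto. }
  pose proof (cov_der_nz g D Ho Hg) as Hn. pose proof Hg as (g1 & g2 & g3).
  destruct (g3 g mu g1 g2 Hmu) as (gam & a1 & a2 & a3 & a4); [auto|].
  destruct (cov_recenter g D mu Hg Hmu) as (r1 & r2 & _).
  destruct (g3 _ 0%C r1 r2 E0) as (k & b1 & b2 & b3 & b4).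
  { rewrite mob_0; auto. }
  assert (Hgk : forall z, Edisc z -> gam (k z) = mob mu z).
  { apply (lift_unique g (fun z => gam (k z)) (mob mu)); auto.
    - apply (holo_comp Edisc Edisc gam k); auto.
    - apply holo_mob; auto.
    - intros z Hz. rewrite a4 by auto. apply b4; auto.
    - rewrite b3, a3, mob_0. auto. }
  pose proof (Edisc_opp mu Hmu) as Hmo.
  set (kap := fun z => mob (- mu) (gam z)).
  assert (Hkap : holo_on Edisc kap) by (apply (holo_comp Edisc Edisc (mob (- mu)) gam); auto; apply holo_mob; auto).
  assert (HkapE : forall z, Edisc z -> Edisc (kap z)) by (intros; apply mob_E; auto).
  assert (Hkap0 : kap 0%C = 0%C).
  { unfold kap. rewrite a3. rewrite <- (mob_0 mu) at 2. apply mob_inv; auto. apply E0. }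
  assert (Hkk : forall z, Edisc z -> kap (k z) = z).
  { intros z Hz. unfold kap. rewrite Hgk by auto. apply mob_inv; auto. }
  assert (Hdd : (C_derive kap 0 * C_derive k 0 = 1)%C).
  { apply (cder_unique (fun z => z) 0%C); [|apply cder_id].
    apply cder_ext with (fun z => kap (k z)).
    - exists 1; split; [lra|]. intros w Hw. rewrite Csub_0_r in Hw. auto.
    - apply (cder_comp kap k); [rewrite b3|]; apply cdiff_C_derive; [apply Hkap, E0|apply b1, E0]. }
  set (u := C_derive kap 0%C) in *.
  assert (Hu : Cmod u = 1).
  { pose proof (schwarz_der kap Hkap (fun z Hz => Rlt_le _ _ (HkapE z Hz)) Hkap0) as S1.
    pose proof (schwarz_der k b1 (fun z Hz => Rlt_le _ _ (b2 z Hz)) b3) as S2. fold u in S1.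
    apply (f_equal Cmod) in Hdd. rewrite Cmod_mult, Cmod_1 in Hdd.
    pose proof (Cmod_ge_0 u). pose proof (Cmod_ge_0 (C_derive k 0%C)). nra. }
  assert (Hgam : forall z, Edisc z -> gam z = mob mu (u * z)%C).
  { intros z Hz. rewrite <- (mob_inv' mu (gam z)) by auto. f_equal. apply (rotation_of_unimodular_der kap); auto. }
  (* [gam z = mob mu (v^2 z)]; dividing numerator and denominator by [v] and scaling by [k0] gives
     entries of determinant 1. *)
  destruct (cis_sqrt u Hu) as (v & Hv & Hvm).
  set (m2 := Cmod mu * Cmod mu). assert (Hm2 : 0 < 1 - m2).
  { unfold m2. unfold Edisc in Hmu. pose proof (Cmod_ge_0 mu). nra. }
  set (k0 := / sqrt (1 - m2)).
  assert (Hsq : 0 < sqrt (1 - m2)) by (apply sqrt_lt_R0; auto).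
  assert (Hk0 : 0 < k0) by (apply Rinv_0_lt_compat; auto).
  assert (Hk02 : k0 * k0 * (1 - m2) = 1).
  { unfold k0. rewrite <- (sqrt_sqrt (1 - m2)) at 3 by lra. field. lra. }
  assert (Hk0n : RtoC k0 <> 0%C) by (intros E; apply RtoC_inj in E; lra).
  assert (Hvn : v <> 0%C) by (apply Cmod_pos_neq; lra).
  assert (Hvv : (Cconj v * v = 1)%C) by (rewrite Cconj_mult_self, Hvm; f_equal; ring).
  set (s := (k0 * v)%C). set (t := (k0 * (mu * Cconj v))%C).
  assert (Hck0 : Cconj k0 = RtoC k0) by (unfold Cconj, RtoC; simpl; f_equal; ring).
  assert (Hst : Cmod s * Cmod s - Cmod t * Cmod t = 1).
  { unfold s, t. rewrite !Cmod_mult, Cmod_conj, Hvm, Cmod_R, Rabs_pos_eq by lra. unfold m2 in Hk02. lra. }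
  assert (Hsu : forall z, Edisc z -> su11 s t z = gam z).
  { intros z Hz. rewrite Hgam by auto. unfold su11, mob.
    assert (Huz : Edisc (u * z)%C) by (apply Edisc_mult; auto; lra).
    pose proof (su11_den s t z Hst Hz) as N1. pose proof (mob_den_E mu (u * z)%C Hmu Huz) as N2.
    unfold s, t in *. rewrite !Cmult_conj, Cconj_conj, Hck0 in *. rewrite <- Hv in *.
    assert (Ev : Cconj v = (/ v)%C).
    { replace (Cconj v) with (Cconj v * v * / v)%C by (field; auto). rewrite Hvv. ring. }
    rewrite Ev in *. field. repeat split; auto.
    intros E. apply (Cmult_neq_0 _ _ Hk0n N2). rewrite <- E. ring. }
  exists g, s, t. split; [|split].
  - split; auto. split; auto. intros z Hz. rewrite Hsu by auto. auto.
  - assert (Hcvn : Cconj v <> 0%C) by (apply Cmod_pos_neq; rewrite Cmod_conj; lra).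
    exact (Cmult_neq_0 _ _ Hk0n (Cmult_neq_0 _ _ Hmun Hcvn)).
  - intros Es. (* u = -1: gam is an elliptic involution with a fixed point in the disc *)
    assert (Hv0 : fst v = 0).
    { unfold s in Es. destruct v as [v1 v2]. simpl in *. nra. }
    assert (Hu1 : u = (- (1))%C).
    { pose proof (Cmod_sqr v) as Q. rewrite Hvm in Q. rewrite <- Hv. destruct v as [v1 v2]. simpl in *. subst v1.
      unfold Cmult, Copp, RtoC; simpl. f_equal; lra. }
    (* The hyperbolic midpoint of 0 and [mu], which the involution exchanges. *)
    set (x := (mu / RtoC (1 + sqrt (1 - m2)))%C).
    assert (Hden : RtoC (1 + sqrt (1 - m2)) <> 0%C) by (intros E; apply RtoC_inj in E; lra).
    assert (HxE : Edisc x).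
    { unfold x, Edisc. rewrite Cmod_div, Cmod_R, Rabs_pos_eq by (auto; lra). unfold Edisc in Hmu. pose proof (Cmod_ge_0 mu).
      apply (Rmult_lt_reg_r (1 + sqrt (1 - m2))); [lra|]. unfold Rdiv. rewrite Rmult_assoc, Rinv_l by lra. lra. }
    assert (Hfix : gam x = x).
    { rewrite Hgam by auto. rewrite Hu1. unfold mob.
      assert (Hmx : Edisc (- (1) * x)%C) by (replace (- (1) * x)%C with (- x)%C by ring; apply Edisc_opp; auto).
      pose proof (mob_den_E mu _ Hmu Hmx) as N.
      assert (Eq : (- (1) * x + mu = x * (1 + Cconj mu * (- (1) * x)))%C).
      { set (q := sqrt (1 - m2)) in *.
        assert (Hq2 : (Cconj mu * mu)%C = (1 - q * q)%C).
        { rewrite Cconj_mult_self, <- RtoC_mult, <- RtoC_minus. f_equal. fold m2. unfold q. rewrite sqrt_sqrt by lra. ring. }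
        unfold x. rewrite RtoC_plus in *.
        replace (- (1) * (mu / (1 + q)) + mu)%C with (mu / (1 + q) * q)%C by (field; auto).
        replace (mu / (1 + q) * (1 + Cconj mu * (- (1) * (mu / (1 + q)))))%C
          with (mu / (1 + q) * (1 - (Cconj mu * mu) / (1 + q)))%C by (field; auto).
        rewrite Hq2. field; auto. }
      rewrite Eq. unfold Cdiv. rewrite <- Cmult_assoc, Cinv_r by exact N. ring. }
    apply Hmun. rewrite <- a3. apply (deck_free g D gam Ho Hg a1 a2 a4 x HxE Hfix). apply E0.
Qed.

(** These are the entries of the inverse matrix; [Im s] changes its sign. *)
Lemma deck_inverse D f s t : deck D f s t -> deck D f (Cconj s) (- t)%C.
Proof.
  intros (Hc & Hst & Hf). assert (Hst' : Cmod (Cconj s) * Cmod (Cconj s) - Cmod (- t) * Cmod (- t) = 1) by (rewrite Cmod_conj, Cmod_opp; auto).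
  split; auto. split; auto. intros z Hz. pose proof (su11_E _ _ z Hst' Hz) as HE. rewrite <- (Hf _ HE). f_equal.
  pose proof (su11_den _ _ z Hst' Hz) as N1. pose proof (su11_den _ _ _ Hst HE) as N2.
  unfold su11 in *. rewrite Copp_conj, Cconj_conj in *.
  assert (E : (s * Cconj s - t * Cconj t = 1)%C).
  { replace (s * Cconj s)%C with (Cconj s * s)%C by ring. replace (t * Cconj t)%C with (Cconj t * t)%C by ring.
    rewrite !Cconj_mult_self, <- RtoC_minus. f_equal. auto. }
  apply Csub_eq.
  set (d := (- Cconj t * z + s)%C) in *. set (n := (Cconj s * z + - t)%C) in *.
  replace (s * (n / d) + t)%C with (((s * Cconj s - t * Cconj t) * z) / d)%C by (unfold n; field_simplify_eq; [unfold d; ring|auto]).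
  replace (Cconj t * (n / d) + Cconj s)%C with ((s * Cconj s - t * Cconj t) / d)%C by (unfold n; field_simplify_eq; [unfold d; ring|auto]).
  rewrite E. field. repeat split; auto. 
Qed.

Lemma deck_rotate D f s t u : deck D f s t -> Cmod u = 1 -> deck D (fun z => f (u * z)%C) s (/ u * t)%C.
Proof.
  intros (Hc & Hst & Hf) Hu. assert (Hun : u <> 0%C) by (apply Cmod_pos_neq; lra).
  assert (Hst' : Cmod s * Cmod s - Cmod (/ u * t) * Cmod (/ u * t) = 1).
  { rewrite Cmod_mult, Cmod_inv, Hu, Rinv_1, Rmult_1_l by auto. auto. }
  split; [|split; auto].
  - apply (cov_comp Edisc (fun z => u * z)%C Edisc f); auto. apply cov_rot; auto.
  - intros z Hz. assert (Huz : Edisc (u * z)%C) by (apply Edisc_mult; auto; lra).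
    rewrite <- (Hf _ Huz). f_equal.
    pose proof (su11_den _ _ z Hst' Hz) as N1. pose proof (su11_den _ _ _ Hst Huz) as N2.
    unfold su11. rewrite Cmult_conj in *.
    assert (Ec : Cconj (/ u) = u).
    { rewrite Cinv_conj by auto. assert (Euu : (Cconj u * u = 1)%C) by (rewrite Cconj_mult_self, Hu; f_equal; ring).
      assert (Hcn : Cconj u <> 0%C) by (apply Cmod_pos_neq; rewrite Cmod_conj; lra).
      replace u with (Cconj u * u / Cconj u)%C at 2 by (field; auto). rewrite Euu. field; auto. }
    rewrite Ec in *. field. split; auto.
Qed.

(* With [t = i T] and [x = rho] real, conjugation by [mob rho] acts on [(Im s, T)] as a
   hyperbolic rotation and fixes [Re s]. *)
Lemma deck_boost D f (sg m T m' : R) : deck D f (sg, m) (0, T) -> 0 < T -> 0 <= m < m' ->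
  exists g, deck D g (sg, m') (0, sqrt (T * T + m' * m' - m * m)).
Proof.
  intros (Hc & Hst & Hf) HT Hm. set (T' := sqrt (T * T + m' * m' - m * m)).
  assert (HT2 : T' * T' = T * T + m' * m' - m * m) by (apply sqrt_sqrt; nra).
  assert (HT' : 0 <= T') by apply sqrt_pos.
  assert (HTT : T < T') by nra.
  assert (Hst2 : sg * sg + m * m - T * T = 1) by (rewrite !Cmod_sqr in Hst; simpl in Hst; lra).
  (* Solves both [rho (m + m') = T' - T] and [rho (T + T') = m' - m], which agree because
     [T'^2 - m'^2 = T^2 - m^2]. *)
  set (rho := (T' - T) / (m + m')).
  assert (Hrho : 0 < rho < 1).
  { unfold rho. split; [apply Rdiv_lt_0_compat; lra|]. apply (Rmult_lt_reg_r (m + m')); [lra|].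
    unfold Rdiv. rewrite Rmult_assoc, Rinv_l by lra. nra. }
  assert (Er : rho * (m + m') = T' - T) by (unfold rho; field; lra).
  assert (Er2 : rho * (T + T') = m' - m).
  { apply (Rmult_eq_reg_r (m + m')); [|lra]. replace (rho * (T + T') * (m + m')) with (rho * (m + m') * (T + T')) by ring.
    rewrite Er. nra. }
  assert (HrE : Edisc (RtoC rho)) by (unfold Edisc; rewrite Cmod_R, Rabs_pos_eq; lra).
  assert (Hst' : Cmod (sg, m') * Cmod (sg, m') - Cmod (0, T') * Cmod (0, T') = 1).
  { rewrite !Cmod_sqr; simpl. lra. }
  exists (fun z => f (mob rho z)). split; [apply cov_recenter; auto|]. split; auto.
  intros z Hz. pose proof (mob_E rho z HrE Hz) as Hmz. rewrite <- (Hf _ Hmz). f_equal.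
  pose proof (su11_den _ _ z Hst' Hz) as N1. pose proof (su11_den _ _ _ Hst Hmz) as N2.
  pose proof (su11_E _ _ z Hst' Hz) as HE'.
  pose proof (mob_den_E rho _ HrE HE') as N3. pose proof (mob_den_E rho z HrE Hz) as N4.
  unfold mob, su11 in *.
  assert (Ecr : Cconj rho = RtoC rho) by (unfold Cconj, RtoC; simpl; f_equal; ring).
  rewrite Ecr in *.
  set (s := ((sg, m) : C)) in *. set (t := ((0, T) : C)) in *. set (s' := ((sg, m') : C)) in *. set (t' := ((0, T') : C)) in *.
  (* The four relations are the entries of one matrix identity: the matrix of [mob rho] intertwines
     the new and the old deck transformation. *)
  assert (A1 : (s' + rho * Cconj t' = s + rho * t)%C).
  { unfold s, t, s', t', Cconj, RtoC, Cmult, Cplus; simpl. f_equal; lra. }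
  assert (A2 : (t' + rho * Cconj s' = t + rho * s)%C).
  { unfold s, t, s', t', Cconj, RtoC, Cmult, Cplus; simpl. f_equal; lra. }
  assert (A3 : (Cconj t' + rho * s' = Cconj t + rho * Cconj s)%C).
  { unfold s, t, s', t', Cconj, RtoC, Cmult, Cplus; simpl. f_equal; lra. }
  assert (A4 : (Cconj s' + rho * t' = Cconj s + rho * Cconj t)%C).
  { unfold s, t, s', t', Cconj, RtoC, Cmult, Cplus; simpl. f_equal; lra. }
  set (n' := (s' * z + t')%C) in *. set (d' := (Cconj t' * z + Cconj s')%C) in *.
  assert (B1 : (n' + rho * d' = s * (z + rho) + t * (1 + rho * z))%C).
  { unfold n', d'. replace (s' * z + t' + rho * (Cconj t' * z + Cconj s'))%C with
      ((s' + rho * Cconj t') * z + (t' + rho * Cconj s'))%C by ring. rewrite A1, A2. ring. }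
  assert (B2 : (d' + rho * n' = Cconj t * (z + rho) + Cconj s * (1 + rho * z))%C).
  { unfold n', d'. replace (Cconj t' * z + Cconj s' + rho * (s' * z + t'))%C with
      ((Cconj t' + rho * s') * z + (Cconj s' + rho * t'))%C by ring. rewrite A3, A4. ring. }
  assert (N5 : (d' + rho * n')%C <> 0%C).
  { intros E. apply N3. replace (1 + rho * (n' / d'))%C with ((d' + rho * n') / d')%C by (field; auto). rewrite E. field; auto. }
  transitivity ((n' + rho * d') / (d' + rho * n'))%C.
  - field. split; auto.
  - rewrite B1, B2. rewrite B2 in N5. field. split; auto.
Qed.

(** A rotation brings [t] to the positive imaginary axis, as [deck_boost] wants; the boost raises
    [|Im s|], and the inverse supplies its sign. [Re s] is kept throughout. *)
Lemma deck_normal D f s t : deck D f s t -> t <> 0%C -> forall m' (neg : bool), Rabs (snd s) < m' ->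
  exists g T, 0 < T /\ deck D g (fst s, if neg then - m' else m') (0, T).
Proof.
  assert (Hrot : forall D f s t, deck D f s t -> t <> 0%C -> exists g T, 0 < T /\ deck D g s (0, T)).
  { clear. intros D f s t Hd Ht. apply Cmod_pos_neq in Ht as Htp.
    assert (Hmn : RtoC (Cmod t) <> 0%C) by (intros E; apply RtoC_inj in E; lra).
    set (u := (t / (Ci * Cmod t))%C).
    assert (Hcn : (Ci * Cmod t)%C <> 0%C) by (apply Cmult_neq_0; auto; apply Ci_nz).
    assert (Hu : Cmod u = 1).
    { unfold u. rewrite Cmod_div, Cmod_mult, Cmod_Ci, Cmod_R, Rabs_pos_eq by (auto; lra). field. lra. }
    exists (fun z => f (u * z)%C), (Cmod t). split; auto.
    replace ((0, Cmod t) : C) with (/ u * t)%C; [apply deck_rotate; auto|].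
    replace ((0, Cmod t) : C) with (Ci * Cmod t)%C by (unfold Ci, RtoC, Cmult; simpl; f_equal; ring).
    unfold u. field. repeat split; auto using Ci_nz. }
  assert (Hpos : forall D f s t, deck D f s t -> t <> 0%C -> forall m', Rabs (snd s) < m' ->
     exists g T, 0 < T /\ deck D g (fst s, m') (0, T)).
  { intros D0 f0 s0 t0 Hd Ht m' Hm'.
    assert (Hs : exists f1 t1 m, 0 <= m < m' /\ deck D0 f1 (fst s0, m) t1 /\ t1 <> 0%C).
    { destruct (Rle_dec 0 (snd s0)) as [h|h].
      - exists f0, t0, (snd s0). rewrite Rabs_pos_eq in Hm' by auto. split; [lra|]. split; [|exact Ht]. rewrite <- surjective_pairing. exact Hd.
      - exists f0, (- t0)%C, (- snd s0). rewrite Rabs_left in Hm' by lra. split; [lra|]. split.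
        + apply deck_inverse in Hd. destruct s0; auto.
        + intros E. apply Ht. replace t0 with (- - t0)%C by ring. rewrite E. ring. }
    destruct Hs as (f1 & t1 & m & Hm & Hd1 & Ht1). destruct (Hrot _ _ _ _ Hd1 Ht1) as (f2 & T & HT & Hd2).
    destruct (deck_boost _ _ _ _ _ m' Hd2 HT Hm) as (g & Hg). exists g, (sqrt (T * T + m' * m' - m * m)). split; auto.
    apply sqrt_lt_R0. nra. }
  intros Hd Ht m' neg Hm'. destruct (Hpos D f s t Hd Ht m' Hm') as (g & T & HT & Hg). destruct neg; [|eauto].
  apply deck_inverse in Hg.
  destruct (Hrot D g _ _ Hg) as (g' & T' & HT' & Hg').
  { intros E. injection E as E1 E2. lra. }
  exists g', T'. split; auto.
Qed.

Lemma hahn_neq_kob D1 D2 : cdomain D1 -> cdomain D2 -> ~ simply_connected D1 -> ~ simply_connected D2 ->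
  ~ biholomorphic D1 Cstar -> ~ biholomorphic D2 Cstar -> ~ hahn_eq_kob (prodD D1 D2).
Proof.
  assert (Hdeck : forall D, cdomain D -> ~ simply_connected D -> ~ biholomorphic D Cstar ->
     exists f s t, deck D f s t /\ t <> 0%C /\ fst s <> 0).
  { clear. intros D HD Hs Hb. destruct (domain_trichotomy D) as [h|[(a & h1 & h2)|(a & b & h1 & h2 & h3)]].
    - exfalso. apply Hs, plane_simply_connected; auto.
    - exfalso. apply Hb, punctured_plane_biholomorphic with a; auto.
    - destruct HD as (Ho & Hcn & z0 & Hz0). destruct (hyperbolic_cov D a b z0 Ho Hz0 h1 h2 h3) as (f & Hf & _).
      apply (deck_exists f D Ho Hf). intros Hinj. apply Hs. apply cov_inj_simply_connected with f; auto.
      split; auto. split; eauto. }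
  intros H1 H2 S1 S2 B1 B2.
  destruct (Hdeck D1 H1 S1 B1) as (f1 & s1 & t1 & d1 & t1n & r1). destruct (Hdeck D2 H2 S2 B2) as (f2 & s2 & t2 & d2 & t2n & r2).
  set (a1 := fst s1) in *. set (a2 := fst s2) in *.
  (* The common value to which both [|s|^2] are raised. It exceeds each of them, since a boost can
     only raise. *)
  set (N := 1 + a1 * a1 + a2 * a2 + snd s1 * snd s1 + snd s2 * snd s2).
  set (m1 := sqrt (N - a1 * a1)). set (m2 := sqrt (N - a2 * a2)).
  assert (Hm : forall a b X, X = N - a * a -> b * b < X -> sqrt X * sqrt X = X /\ Rabs b < sqrt X).
  { intros a b X _ Hb. assert (0 <= X) by nra. split; [apply sqrt_sqrt; auto|].
    rewrite <- sqrt_Rsqr_abs. apply sqrt_lt_1; auto. apply Rle_0_sqr. }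
  destruct (Hm a1 (snd s1) (N - a1 * a1) eq_refl ltac:(unfold N; nra)) as [E1 L1]. fold m1 in E1, L1.
  destruct (Hm a2 (snd s2) (N - a2 * a2) eq_refl ltac:(unfold N; nra)) as [E2 L2]. fold m2 in E2, L2.
  assert (Hm1 : 0 < m1) by (pose proof (Rabs_pos (snd s1)); lra). assert (Hm2 : 0 < m2) by (pose proof (Rabs_pos (snd s2)); lra).
  destruct (deck_normal D1 f1 s1 t1 d1 t1n m1 false L1) as (g1 & T1 & HT1 & k1). fold a1 in k1.
  (* With equal real parts, opposite imaginary parts exclude [q1 = q2], and [a1 <> 0] excludes
     [q1 = - q2]. With distinct real parts, imaginary parts of equal sign exclude both. *)
  set (neg := if Req_dec_T a1 a2 then true else false).
  destruct (deck_normal D2 f2 s2 t2 d2 t2n m2 neg L2) as (g2 & T2 & HT2 & k2). fold a2 in k2.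
  set (q1 := ((a1, m1) : C)) in *. set (q2 := ((a2, if neg then - m2 else m2) : C)) in *.
  assert (M1 : Cmod q1 * Cmod q1 = N) by (rewrite Cmod_sqr; unfold q1; simpl; lra).
  assert (M2 : Cmod q2 * Cmod q2 = N) by (rewrite Cmod_sqr; unfold q2; simpl; destruct neg; lra).
  assert (ET : T1 = T2).
  { destruct k1 as (_ & i1 & _). destruct k2 as (_ & i2 & _). rewrite M1, Cmod_sqr in i1. rewrite M2, Cmod_sqr in i2. simpl in i1, i2. nra. }
  subst T2. set (iT := ((0, T1) : C)) in *.
  assert (Hq1 : q1 <> 0%C) by (apply (su11_s_nz q1 iT); apply k1). assert (Hq2 : q2 <> 0%C) by (apply (su11_s_nz q2 iT); apply k2).
  assert (Hcn : forall q : C, q <> 0%C -> Cconj q <> 0%C) by (intros q Hq; apply Cmod_pos_neq; rewrite Cmod_conj; apply Cmod_pos_neq; auto).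
  (* Rotating the second covering by [u] divides its [t] by [u], which makes [t / conj s] the same
     for both. *)
  set (u := (Cconj q1 / Cconj q2)%C).
  assert (Hmm : Cmod q1 = Cmod q2) by (pose proof (Cmod_ge_0 q1); pose proof (Cmod_ge_0 q2); nra).
  assert (Hu : Cmod u = 1).
  { unfold u. rewrite Cmod_div, !Cmod_conj, Hmm by auto. field. apply Cmod_pos_neq in Hq2. lra. }
  assert (Hun : u <> 0%C) by (apply Cmod_pos_neq; lra).
  pose proof (deck_rotate D2 g2 q2 iT u k2 Hu) as k3.
  destruct k1 as (c1 & i1 & j1). destruct k3 as (c3 & i3 & j3).
  assert (HiT : iT <> 0%C) by (intros E; injection E as E'; lra).
  apply (hahn_neq_kob_of_deck D1 D2 g1 (fun z => g2 (u * z)%C) (su11 q1 iT) (su11 q2 (/ u * iT)) (iT / Cconj q1)%C); auto.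
  - apply H1.
  - apply H2.
  - apply holo_su11; auto.
  - apply holo_su11; auto.
  - intros; apply su11_E; auto.
  - intros; apply su11_E; auto.
  - unfold su11. replace (q1 * 0 + iT)%C with iT by ring. f_equal. ring.
  - unfold su11. replace (Cconj (/ u * iT) * 0 + Cconj q2)%C with (Cconj q2) by ring. unfold u. field. auto.
  - unfold Cdiv. apply Cmult_neq_0; auto. intros E. apply C1_nz. rewrite <- (Cinv_r (Cconj q1)), E by auto. ring.
  - rewrite (cder_C_derive _ _ _ (su11_cder0 q1 iT i1)), (cder_C_derive _ _ _ (su11_cder0 q2 _ i3)). intros E.
    assert (Ec : (Cconj q1 * Cconj q1 = Cconj q2 * Cconj q2)%C).
    { pose proof (Hcn _ Hq1). pose proof (Hcn _ Hq2).
      replace (Cconj q1 * Cconj q1)%C with (/ / (Cconj q1 * Cconj q1))%C by (field; auto). rewrite E. field; auto. }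
    assert (Ep : ((Cconj q1 - Cconj q2) * (Cconj q1 + Cconj q2) = 0)%C).
    { replace ((Cconj q1 - Cconj q2) * (Cconj q1 + Cconj q2))%C with (Cconj q1 * Cconj q1 - Cconj q2 * Cconj q2)%C by ring. rewrite Ec. ring. }
    assert (Ed : Cconj q1 = Cconj q2 \/ Cconj q1 = (- Cconj q2)%C).
    { destruct (Ceq_dec (Cconj q1 - Cconj q2) 0) as [e|n1]; [left; apply Csub_eq; auto|].
      destruct (Ceq_dec (Cconj q1 + Cconj q2) 0) as [e|n2].
      - right. apply Csub_eq. rewrite <- e. ring.
      - exfalso. apply (Cmult_neq_0 _ _ n1 n2). auto. }
    unfold q1, q2, neg, Cconj, Copp in Ed. simpl in Ed.
    destruct (Req_dec_T a1 a2) as [ea|na]; destruct Ed as [Ed|Ed]; injection Ed as Ed1 Ed2; lra.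
Qed.

Theorem theorem1 (D1 D2 : C -> Prop) :
  cdomain D1 -> cdomain D2 ->
  ((simply_connected D1 \/ simply_connected D2) -> hahn_eq_kob (prodD D1 D2)) /\
  ((biholomorphic D1 Cstar \/ biholomorphic D2 Cstar) -> hahn_eq_kob (prodD D1 D2)) /\
  (~ simply_connected D1 -> ~ simply_connected D2 ->
   ~ biholomorphic D1 Cstar -> ~ biholomorphic D2 Cstar ->
   ~ hahn_eq_kob (prodD D1 D2)) /\
  (hahn_eq_kob (prodD D1 D2) <->
   (simply_connected D1 \/ biholomorphic D1 Cstar \/
    simply_connected D2 \/ biholomorphic D2 Cstar)).
Proof.
  intros H1 H2.
  assert (P1 : simply_connected D1 \/ simply_connected D2 -> hahn_eq_kob (prodD D1 D2)).
  { intros [HS|HS].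
    - apply inj_approx_l, simply_connected_inj_approx; auto.
    - apply inj_approx_r, simply_connected_inj_approx; auto. }
  assert (P2 : biholomorphic D1 Cstar \/ biholomorphic D2 Cstar -> hahn_eq_kob (prodD D1 D2)).
  { intros [HB|HB].
    - apply inj_approx_l, Cstar_inj_approx; auto; [apply H1|apply H2].
    - apply inj_approx_r, Cstar_inj_approx; auto; [apply H2|apply H1]. }
  pose proof (hahn_neq_kob D1 D2 H1 H2) as P3.
  split; [exact P1|]. split; [exact P2|]. split; [exact P3|].
  split; [|tauto]. intros Heq. apply NNPP. intros HN. apply P3; tauto.
Qed.
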